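(* Every planar trivalent graph, when seen as a surface with defects $(\mathbb{S}^2,\Gamma)\in\mathrm{Mor}(\mathrm{Bord}_2^{\mathrm{def}}(\mathcal{D}_+^{\mathbf 3}))$, can be written as a composite $\rho_{i_1}\circ\cdots\circ\rho_{i_m}$ where each $\rho_{i_j}$ is one of the four patterns $I,\mu_i,\beta_i,\gamma_i$.
   Context: A planar trivalent graph is an undirected finite graph with all vertices of valency $3$, embedded in $\mathbb{S}^2$. The morphisms of $\mathrm{Bord}_2^{\mathrm{def}}(\mathcal{D}_+^{\mathbf 3})$ are compact oriented surfaces with embedded undirected trivalent graphs (edges may end transversally at marked points of the boundary circles), taken up to isomorphism, i.e. orientation-preserving diffeomorphism (fixing the boundary) carrying graph to graph; composition is gluing along boundary circles with marked points. The four patterns are cylinders with embedded graphs, each having a strip joining its two boundary circles free of defects (it contains the distinguished points of the boundary circles), so that it is described by the graph in the complementary rectangle, whose bottom side is part of the in-boundary and top side part of the out-boundary. With marked points numbered left to right: - $I$: $n$ vertical strands ($n$ marked points to $n$ marked points); - $\mu_i$: from $n$ to $n-1$ marked points: strands $i$ and $i+1$ merge at a single trivalent vertex, from which one strand continues upward; all other strands are vertical; - $\beta_i$: from $n$ to $n-2$ marked points: the marked points $i$ and $i+1$ of the bottom are joined to each other by an arc (a cap); all other strands are vertical; - $\gamma_i$: from $n-2$ to $n$ marked points: the marked points $i$ and $i+1$ of the top are joined to each other by an arc (a cup); all other strands are vertical. Here $n\geq2$ may equal $2$, in which case $i=1$, $i+1=2$. The part of the sphere outside the rectangles, including the two defect-free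 discs closing off the first and last cylinder, contains no part of $\Gamma$ and is suppressed from the notation. *)

(* Defs.v *)
From HB Require Import structures.
From mathcomp Require Import all_boot all_order all_algebra.
From mathcomp Require Import all_classical all_reals all_analysis.
Set Implicit Arguments.
Unset Strict Implicit.
Unset Printing Implicit Defensive.
Import Order.TTheory GRing.Theory Num.Theory.
Import numFieldNormedType.Exports.
Local Open Scope classical_set_scope.
Local Open Scope ring_scope.

(** * Smooth maps *)

(* In finite dimension, f is C^k on the open set U iff its iterated directional
   derivatives up to order k exist and are continuous on U. *)
Fixpoint is_Ck (R : realType) (V W : normedModType R) (k : nat) (U : set V)
    (f : V -> W) : Prop :=
  match k with
  | 0%N => forall x, U x -> {for x, continuous f}
  | k'.+1 => [/\ forall x, U x -> {for x, continuous f},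
                 forall v x, U x -> derivable f x v
               & forall v, is_Ck k' U ('D_v f)]
  end.

(* Smooth (up to the boundary, if any) on A: as f is total, this only asks that
   f be C^oo on a neighbourhood of A. *)
Definition smooth_on (R : realType) (V W : normedModType R) (A : set V)
    (f : V -> W) : Prop :=
  exists U : set V, [/\ open U, A `<=` U & forall k, is_Ck k U f].

(** * The sphere and its regular parametrisations *)

Definition sphere (R : realType) : set 'rV[R]_3 :=
  [set p | \sum_(i < 3) p 0 i ^+ 2 = 1].
Arguments sphere R : clear implicits.

Definition det3 (R : realType) (u v w : 'rV[R]_3) : R :=
  \det (col_mx u (col_mx v w) : 'M[R]_3).

(* f restricted to A is an orientation preserving immersion into the sphere:
   the plane has its standard orientation, and the sphere is oriented as the
   boundary of the ball (outward normal first). *)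
Definition oriented_immersion (R : realType) (A : set (R * R))
    (f : R * R -> 'rV[R]_3) : Prop :=
  [/\ smooth_on A f,
      forall z, A z -> sphere R (f z)
    & forall z, A z -> 0 < det3 (f z) ('D_(1, 0) f z) ('D_(0, 1) f z)].

(** * Planar trivalent graphs *)

(* A finite undirected multigraph, loops and multiple edges being allowed; the
   two ends of an edge are told apart by a boolean only to name them. *)
Record graph := Graph {
  vertex : finType;
  edge : finType;
  end_of : edge -> bool -> vertex
}.

(* A loop contributes two half-edges at its vertex. *)
Definition valency (G : graph) (v : vertex G) : nat :=
  #|[pred h : edge G * bool | end_of h.1 h.2 == v]|.

(* The model of a trivalent vertex in the plane. Any three rays from the origin
   that do not lie in a closed half-plane are linearly equivalent to these. *)
Definition tripod (R : realType) : set (R * R) :=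
  [set z | (z.1 = 0 /\ 0 <= z.2) \/ (z.2 <= 0 /\ `|z.1| = - z.2)].
Arguments tripod R : clear implicits.

Definition disc (R : realType) : set (R * R) :=
  [set z | z.1 ^+ 2 + z.2 ^+ 2 <= 1].
Arguments disc R : clear implicits.

Definition open_disc (R : realType) : set (R * R) :=
  [set z | z.1 ^+ 2 + z.2 ^+ 2 < 1].
Arguments open_disc R : clear implicits.

Section Embedding.
Variables (R : realType) (G : graph).
Variables (pos : vertex G -> 'rV[R]_3) (arc : edge G -> R -> 'rV[R]_3).

Definition drawing : set 'rV[R]_3 :=
  range pos `|` \bigcup_(e in [set: edge G]) (arc e @` `[0, 1]%classic).

(* As for every surface with defects, the defect lines are smooth, and near a
   junction the pair (surface, defect graph) is diffeomorphic to the standard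
   star. *)
Record is_embedding : Prop := IsEmbedding {
  pos_sphere : forall v, sphere R (pos v);
  pos_inj : injective pos;
  arc_sphere : forall e (t : R), 0 <= t <= 1 -> sphere R (arc e t);
  arc_smooth : forall e, smooth_on (`[0, 1]%classic : set R) (arc e);
  arc_regular : forall e (t : R), 0 <= t <= 1 -> 'D_1 (arc e) t != 0;
  arc_start : forall e, arc e 0 = pos (end_of e false);
  arc_finish : forall e, arc e 1 = pos (end_of e true);
  arc_disjoint : forall e e' (s t : R), 0 < s < 1 -> 0 < t < 1 ->
    arc e s = arc e' t -> e = e' /\ s = t;
  arc_avoid : forall e (t : R) v, 0 < t < 1 -> arc e t <> pos v;
  vertex_chart : forall v, exists psi : R * R -> 'rV[R]_3,
    [/\ oriented_immersion (open_disc R) psi,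
        set_inj (open_disc R) psi,
        psi (0, 0) = pos v
      & forall z, open_disc R z -> (drawing (psi z) <-> tripod R z)]
}.

End Embedding.

Record planar_trivalent_graph (R : realType) := PlanarTrivalentGraph {
  ptg_graph : graph;
  ptg_pos : vertex ptg_graph -> 'rV[R]_3;
  ptg_arc : edge ptg_graph -> R -> 'rV[R]_3;
  ptg_trivalent : forall v : vertex ptg_graph, valency v = 3%N;
  ptg_embedding : is_embedding ptg_pos ptg_arc
}.

Definition graph_locus (R : realType) (Gamma : planar_trivalent_graph R) :
    set 'rV[R]_3 :=
  drawing (@ptg_pos R Gamma) (@ptg_arc R Gamma).

(** * The four patterns *)

(* The index i counts from 0, so that the strands involved are the ones at
   X`_i and X`_i.+1 below. *)
Inductive shape := Strands | Merge of nat | Cap of nat | Cup of nat.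

(* The cylinder is (R/Z) x [0, 1], with the distinguished points of the boundary
   circles at 0 in R/Z; the rectangle of a pattern lies in ]0, 1[ x [0, 1].
   The marked points are allowed any positions in ]0, 1[, so that strands can be
   vertical in the strict sense; ptn_pos lists, from left to right, the marked
   points of the bottom (for Cup: of the top). *)
Record pattern (R : realType) := Pattern {
  ptn_shape : shape;
  ptn_pos : seq R
}.

Section Patterns.
Variable R : realType.
Implicit Types (X : seq R) (i : nat) (P : pattern R).

Definition others X i : seq R := take i X ++ drop i.+2 X.
Definition midpoint X i : R := (X`_i + X`_i.+1) / 2.
Definition half_gap X i : R := (X`_i.+1 - X`_i) / 2.

Definition pattern_wf P : bool :=
  let X := ptn_pos P in
  [&& sorted <%R X, all (fun x : R => 0 < x < 1) X
    & match ptn_shape P with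
      | Strands => true
      | Merge i | Cap i | Cup i => (i.+1 < size X)%N
      end].

Definition source P : seq R :=
  match ptn_shape P with
  | Strands | Merge _ | Cap _ => ptn_pos P
  | Cup i => others (ptn_pos P) i
  end.

Definition target P : seq R :=
  let X := ptn_pos P in
  match ptn_shape P with
  | Strands | Cup _ => X
  | Merge i => take i X ++ midpoint X i :: drop i.+2 X
  | Cap i => others X i
  end.

(* The part of the pattern in [0, 1] x [0, 1]: Merge is a straight Y with vertex
   (midpoint, 1/2), and Cap and Cup are half-ellipses of height 1/2. *)
Definition pattern_graph P (x t : R) : Prop :=
  let X := ptn_pos P in
  match ptn_shape P with
  | Strands => x \in X
  | Merge i => [\/ x \in others X i,
                   t <= 1 / 2 /\ `|x - midpoint X i| = half_gap X i * (1 - 2 * t)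
                 | 1 / 2 <= t /\ x = midpoint X i]
  | Cap i => x \in others X i \/
             ((x - midpoint X i) / half_gap X i) ^+ 2 + (2 * t) ^+ 2 = 1
  | Cup i => x \in others X i \/
             ((x - midpoint X i) / half_gap X i) ^+ 2 + (2 * (1 - t)) ^+ 2 = 1
  end.

End Patterns.

(** * Composites *)

Section Composite.
Variable R : realType.

(* A parametrised cylinder in the sphere, smooth up to its boundary; the first
   coordinate runs through R/Z, the second goes from the in-boundary (0) to the
   out-boundary (1). *)
Definition cylinder (Phi : R * R -> 'rV[R]_3) : Prop :=
  [/\ oriented_immersion [set z | 0 <= z.2 <= 1] Phi,
      forall x t, Phi (x + 1, t) = Phi (x, t)
    & set_inj [set z | 0 <= z.1 < 1 /\ 0 <= z.2 <= 1] Phi].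

Definition parametrised_disc (delta : R * R -> 'rV[R]_3) : Prop :=
  oriented_immersion (disc R) delta /\ set_inj (disc R) delta.

(* s = [:: rho_1; ...; rho_m] stands for rho_1 \o ... \o rho_m, so that the
   first item is on top. *)
Definition composable (s : seq (pattern R)) : Prop :=
  forall j, (j.+1 < size s)%N ->
    source (nth (Pattern Strands [::]) s j)
    = target (nth (Pattern Strands [::]) s j.+1).

(* (S^2, Gamma) is the result of gluing, along parametrised boundary circles,
   cylinders isomorphic to the patterns in s, the first and the last of them
   being closed off by defect-free discs. Gluing determines the result up to
   isomorphism, so this is stated by cutting the sphere into such pieces;
   the smooth structure of the sphere is compatible with that of each piece. *)
Definition is_composite (s : seq (pattern R)) (Gamma : set 'rV[R]_3) : Prop :=
  let m := size s in
  let rho := nth (Pattern Strands [::]) s in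
  [/\ (0 < m)%N, (forall j, (j < m)%N -> pattern_wf (rho j)), composable s,
      source (rho m.-1) = [::] /\ target (rho 0%N) = [::]
    & exists (Phi : nat -> R * R -> 'rV[R]_3)
             (bottom top : R * R -> 'rV[R]_3),
      [/\ (* the pieces *)
          [/\ forall j, (j < m)%N -> cylinder (Phi j),
              parametrised_disc bottom & parametrised_disc top],
          (* their boundary circles are identified; the circle bounding the
             bottom disc runs clockwise, since seen from that disc the upward
             direction is the outward one *)
          [/\ forall j x, (j.+1 < m)%N -> Phi j.+1 (x, 1) = Phi j (x, 0),
              forall x, Phi m.-1 (x, 0)
                = bottom (cos (2 * pi * x), - sin (2 * pi * x))
            & forall x, Phi 0%N (x, 1)
                = top (cos (2 * pi * x), sin (2 * pi * x))],
          (* they make up the sphere, each point being obtained once *)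
          [/\ forall p, sphere R p ->
                [\/ (bottom @` disc R) p, (top @` open_disc R) p
                  | exists2 j, (j < m)%N
                    & (Phi j @` [set z | 0 < z.2 <= 1]) p],
              (bottom @` disc R) `&` (top @` open_disc R) = set0,
              forall j, (j < m)%N ->
                (bottom @` disc R `|` top @` open_disc R)
                `&` (Phi j @` [set z | 0 < z.2 <= 1]) = set0
            & forall j k, (j < k < m)%N ->
                (Phi j @` [set z | 0 < z.2 <= 1])
                `&` (Phi k @` [set z | 0 < z.2 <= 1]) = set0]
        & (* they carry the prescribed defects *)
          [/\ forall j (x t : R), (j < m)%N -> 0 <= x <= 1 -> 0 <= t <= 1 ->
                (Gamma (Phi j (x, t)) <-> pattern_graph (rho j) x t),
              Gamma `&` (bottom @` disc R) = set0
            & Gamma `&` (top @` disc R) = set0]]].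

End Composite.

(* Main.v *)
Require Import Defs.
From mathcomp Require Import all_boot all_order all_algebra.
From mathcomp Require Import all_classical all_reals all_analysis.
From mathcomp Require Import ring lra zify.
Set Implicit Arguments.
Unset Strict Implicit.
Unset Printing Implicit Defensive.
Import Order.TTheory GRing.Theory Num.Theory.
Import numFieldNormedType.Exports.
Local Open Scope classical_set_scope.
Local Open Scope ring_scope.

(* A point off the graph is pushed by a conformal map (a Lorentz boost of the
   sphere) until the graph lies in a small disc on the opposite side, away from
   the poles; longitude and latitude then turn the graph into a drawing in the
   plane. An ambient diffeomorphism, composed of compactly supported shears,
   puts this drawing in general position: the vertices become straight Y's and
   the arcs transverse to the horizontal levels except at finitely many parabolic
   maxima and minima, all these events being at distinct levels. Sweeping the
   levels from bottom to top cuts the plane into bands whose parametrisations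
   straighten the strands, each band being one of the four patterns; real
   induction on the level glues them. Carried back to the sphere, the bands are
   the cylinders, and the two polar caps are the closing discs. *)

(** * Smooth functions *)

(** A composite must carry each pattern exactly: vertical strands, straight Y's, half-ellipses.
    Hence events are brought to two rigid normal forms, a parabola and a linear Y, and levels are
    reparametrised freely: marked points may sit anywhere, so the same ones can be kept along a
    whole run of strands. The obstacle is general position, as the height along an arc may be
    critical on any closed set. No generic perturbation is made: a stretch that is nowhere vertical
    is a graph over the horizontal axis, its height is replaced by a uniformly close zigzag whose
    turns are parabolas at chosen levels, and a shear carries one graph to the other. Vertices are
    straightened before, so that arcs are steep near their ends and flat points stay inside.
    Compactness is mostly used as real induction: over levels, across one level, along a graph,
    along an arc. The closing discs are fixed as the zones of height beyond 4/5 and -4/5, and the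
    defect-free strip surrounds longitude 0; this is why the graph is first squeezed around the
    opposite point. *)

Section CkBasics.
Context {R : realType} {V W : normedModType R}.
Implicit Types (U : set V) (f g : V -> W).

Lemma Ck_sub k U U' f : U' `<=` U -> is_Ck k U f -> is_Ck k U' f.
Proof.
move=> sUU'; elim: k f => [|k IH] f /=; first by move=> Hf x /sUU'; exact: Hf.
case=> H1 H2 H3; split; [by move=> x /sUU'; exact: H1|by move=> v x /sUU'; exact: H2|].
by move=> v; apply: IH.
Qed.

Lemma Ck_cont k U f x : is_Ck k U f -> U x -> {for x, continuous f}.
Proof. by case: k => [|k] /= H Ux; [exact: H|case: H => H _ _; exact: H]. Qed.

Lemma Ck_down k U f : is_Ck k.+1 U f -> is_Ck k U f.
Proof.
elim: k f => [|k IH] f; first by case.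
by move=> /= -[H1 H2 H3]; split=> // v; apply: IH; exact: H3.
Qed.

(** Openness makes the two functions agree near each point, hence have the same directional
    derivatives there. *)
Lemma Ck_ext k U f g : open U -> (forall x, U x -> f x = g x) ->
  is_Ck k U f -> is_Ck k U g.
Proof.
move=> oU; elim: k f g => [|k IH] f g fg /=.
  move=> Hf x Ux.
  have nfg : {near x, f =1 g} by near=> y; apply: fg; near: y; exact: open_nbhs_nbhs.
  rewrite /prop_for /continuous_at -(fg _ Ux).
  apply: cvg_trans (Hf _ Ux); apply: near_eq_cvg; exact: nfg.
have nfg x : U x -> {near x, f =1 g}.
  by move=> Ux; near=> y; apply: fg; near: y; exact: open_nbhs_nbhs.
case=> H1 H2 H3; split.
- move=> x Ux; rewrite /prop_for /continuous_at -(fg _ Ux).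
  by apply: cvg_trans (H1 _ Ux); apply: near_eq_cvg; exact: nfg.
- by move=> v x Ux; apply: near_eq_derivable (H2 v x Ux); exact: nfg.
- move=> v; apply: IH (H3 v) => x Ux; apply: near_eq_derive; exact: nfg.
Unshelve. all: by end_near. Qed.

(** Each clause of [is_Ck] is a condition on the total function [f] at one point of the set, so any
    cover will do. *)
Lemma Ck_union k U f : (forall x, U x -> exists2 U', U' x & is_Ck k U' f) ->
  is_Ck k U f.
Proof.
elim: k f => [|k IH] f /=.
  by move=> H x /H[U' U'x]; exact.
move=> H; split.
- by move=> x /H[U' U'x [H1 _ _]]; exact: H1.
- by move=> v x /H[U' U'x [_ H1 _]]; exact: H1.
- by move=> v; apply: IH => x /H[U' U'x [_ _ H1]]; exists U'.
Qed.

Lemma Ck_cst k U (c : W) : is_Ck k U (fun=> c).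
Proof.
elim: k U c => [|k IH] U c /=; first by move=> x _; exact: cvg_cst.
split; [by move=> x _; exact: cvg_cst|by move=> v x _; exact: derivable_cst|].
move=> v; rewrite (_ : 'D_v _ = fun=> 0); first exact: IH.
by apply/funext => x; exact: derive_cst.
Qed.

Lemma CkD k U f g : open U -> is_Ck k U f -> is_Ck k U g -> is_Ck k U (fun x => f x + g x).
Proof.
move=> oU; elim: k f g => [|k IH] f g /=.
  by move=> Hf Hg x Ux; apply: cvgD; [exact: Hf|exact: Hg].
case=> f1 f2 f3 [g1 g2 g3]; split.
- by move=> x Ux; apply: cvgD; [exact: f1|exact: g1].
- by move=> v x Ux; apply: derivableD; [exact: f2|exact: g2].
- move=> v; apply: (Ck_ext oU) (IH _ _ (f3 v) (g3 v)) => x Ux.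
  by rewrite -deriveD; [|exact: f2|exact: g2].
Qed.

Definition smooth U f := forall k, is_Ck k U f.

Lemma smooth_sub U U' f : U' `<=` U -> smooth U f -> smooth U' f.
Proof. by move=> s H k; exact: Ck_sub s (H k). Qed.
Lemma smooth_ext U f g : open U -> (forall x, U x -> f x = g x) -> smooth U f -> smooth U g.
Proof. by move=> oU fg H k; exact: Ck_ext oU fg (H k). Qed.
Lemma smooth_union U f : (forall x, U x -> exists2 U', U' x & smooth U' f) -> smooth U f.
Proof. by move=> H k; apply: Ck_union => x /H[U' U'x H']; exists U'. Qed.
Lemma smooth_cst U (c : W) : smooth U (fun=> c).
Proof. by move=> k; exact: Ck_cst. Qed.
Lemma smoothD U f g : open U -> smooth U f -> smooth U g -> smooth U (fun x => f x + g x).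
Proof. by move=> oU Hf Hg k; exact: CkD. Qed.
Lemma smooth_derive U f v : smooth U f -> smooth U ('D_v f).
Proof. by move=> H k; have [_ _] := H k.+1; apply. Qed.
Lemma smooth_derivable U f v x : smooth U f -> U x -> derivable f x v.
Proof. by move=> H Ux; case: (H 1%N) => _ H' _; exact: H'. Qed.
Lemma smooth_cont U f x : smooth U f -> U x -> {for x, continuous f}.
Proof. by move=> H; exact: Ck_cont (H 0%N). Qed.
End CkBasics.
Arguments smooth {R V W} U f%_function_scope.

(** * Sums and products of smooth real functions *)

Section CkReal.
Context {R : realType} {V : normedModType R}.
Implicit Types (U : set V) (f g : V -> R).

Lemma CkM k U f g : open U -> is_Ck k U f -> is_Ck k U g -> is_Ck k U (fun x => f x * g x).
Proof.
move=> oU; elim: k f g => [|k IH] f g.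
  by move=> Hf Hg x Ux; apply: cvgM; [exact: Hf|exact: Hg].
move=> Hf Hg; have := Ck_down Hf; have := Ck_down Hg; move=> gk fk.
case: Hf => f1 f2 f3; case: Hg => g1 g2 g3; split.
- by move=> x Ux; apply: cvgM; [exact: f1|exact: g1].
- by move=> v x Ux; apply: derivableM; [exact: f2|exact: g2].
- move=> v; have HD := CkD oU (IH _ _ fk (g3 v)) (IH _ _ gk (f3 v)).
  apply: (Ck_ext oU _ HD) => x Ux.
  by rewrite [RHS](@deriveM _ _ f g); [|exact: f2|exact: g2].
Qed.

Lemma CkN k U f : open U -> is_Ck k U f -> is_Ck k U (fun x => - f x).
Proof.
move=> oU H; have HM := CkM oU (Ck_cst k U (-1 : R)) H.
apply: (Ck_ext oU _ HM) => x _.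
by rewrite mulN1r.
Qed.

Lemma smoothM U f g : open U -> smooth U f -> smooth U g -> smooth U (fun x => f x * g x).
Proof. by move=> oU Hf Hg k; exact: CkM. Qed.
Lemma smoothN U f : open U -> smooth U f -> smooth U (fun x => - f x).
Proof. by move=> oU Hf k; exact: CkN. Qed.
Lemma smoothB U f g : open U -> smooth U f -> smooth U g -> smooth U (fun x => f x - g x).
Proof. by move=> oU Hf Hg; apply: smoothD => //; exact: smoothN. Qed.
Lemma smoothX U f n : open U -> smooth U f -> smooth U (fun x => f x ^+ n).
Proof.
move=> oU Hf; elim: n => [|n IH].
  by apply: (smooth_ext oU _ (smooth_cst U (1 : R))) => x _; rewrite expr0.
by apply: (smooth_ext oU _ (smoothM oU Hf IH)) => x _; rewrite exprS.
Qed.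
Lemma smooth_sum U (I : Type) (s : seq I) (F : I -> V -> R) : open U ->
  (forall i, smooth U (F i)) -> smooth U (fun x => \sum_(i <- s) F i x).
Proof.
move=> oU H; elim: s => [|i s IH].
  by apply: (smooth_ext oU _ (smooth_cst U (0 : R))) => x _; rewrite big_nil.
by apply: (smooth_ext oU _ (smoothD oU (H i) IH)) => x _; rewrite big_cons.
Qed.

End CkReal.

(** * Difference quotients in one and two variables *)

Section Caratheodory.
Context {R : realType}.

(** Carathéodory's form of the derivative: the increment is exactly [slope] times the displacement,
    and [slope] is continuous at [a]. The chain rule then avoids dividing by an increment of the
    inner function, which may vanish. *)
Definition slope (g : R -> R) (a x : R) : R :=
  if x == a then 'D_1 g a else (g x - g a) / (x - a).

Lemma slopeE g a x : g x - g a = slope g a x * (x - a).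
Proof.
rewrite /slope; case: eqP => [->|/eqP xa]; first by rewrite !subrr mulr0.
by rewrite divfK // subr_eq0.
Qed.

Lemma MVTe (g : R -> R) (a b : R) :
  (forall z : R, Num.min a b <= z <= Num.max a b -> derivable g z 1) ->
  exists2 z, Num.min a b <= z <= Num.max a b & g b - g a = 'D_1 g z * (b - a).
Proof.
have main c d : c <= d -> (forall z : R, c <= z <= d -> derivable g z 1) ->
  exists2 z, c <= z <= d & g d - g c = 'D_1 g z * (d - c).
  move=> cd H; have [||z] := @MVT_segment R g ('D_1 g) c d cd.
  - by move=> x; rewrite in_itv /= => /andP[xc xd]; apply: derivableP; apply: H; rewrite !ltW.
  - apply: derivable_within_continuous => x; rewrite in_itv /=; exact: H.
  - by rewrite in_itv /= => zi ->; exists z.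
case: (leP a b) => ab; first exact: main.
move=> /(main _ _ (ltW ab))[z zi E]; exists z => //.
by rewrite -opprB E; ring.
Qed.

Lemma slope_cvg (g : R -> R) a : derivable g a 1 -> slope g a x @[x --> a] --> 'D_1 g a.
Proof.
move=> dg; have Ea : slope g a a = 'D_1 g a by rewrite /slope eqxx.
rewrite -[X in _ --> X]Ea; apply/continuous_withinNshiftx.
rewrite Ea /=.
apply: cvg_trans dg; apply: near_eq_cvg; near=> h.
have h0 : h != 0 by near: h; exact: nbhs_dnbhs_neq.
rewrite /slope /= ifF; last by apply/negP => /eqP /(congr1 (fun z => z - a)); rewrite addrK subrr => /eqP; apply/negP.
by rewrite addrK scaler1 mulrC.
Unshelve. all: by end_near. Qed.

(** Increments from [p] to [q] are split at the corner [(p.1, q.2)]: the vertical side, then the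
    horizontal one. The segment of [slope1] lies at height [q.2], not on a line through [p], which
    is why its limit calls for a continuous partial derivative. *)
Definition slope1 (g : R * R -> R) (p q : R * R) : R :=
  if q.1 == p.1 then 'D_(1, 0) g p else (g q - g (p.1, q.2)) / (q.1 - p.1).
Definition slope2 (g : R * R -> R) (p q : R * R) : R :=
  if q.2 == p.2 then 'D_(0, 1) g p else (g (p.1, q.2) - g p) / (q.2 - p.2).

Lemma slope12E g p q :
  g q - g p = slope1 g p q * (q.1 - p.1) + slope2 g p q * (q.2 - p.2).
Proof.
have -> : g q - g p = (g q - g (p.1, q.2)) + (g (p.1, q.2) - g p) by ring.
congr (_ + _); rewrite /slope1 /slope2; case: eqP => [e|/eqP xa].
- by rewrite e subrr mulr0 -{1}e -surjective_pairing subrr.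
- by rewrite divfK // subr_eq0.
- by rewrite e subrr mulr0 -surjective_pairing subrr.
- by rewrite divfK // subr_eq0.
Qed.

Lemma D10E (g : R * R -> R) (x y : R) : 'D_(1, 0) g (x, y) = 'D_1 (fun s => g (s, y)) x.
Proof.
rewrite /derive; f_equal; f_equal; apply/funext => h /=.
by congr (_ *: (g _ - _)); congr pair => /=; rewrite ?scaler0 ?add0r.
Qed.
Lemma D01E (g : R * R -> R) (x y : R) : 'D_(0, 1) g (x, y) = 'D_1 (fun s => g (x, s)) y.
Proof.
rewrite /derive; f_equal; f_equal; apply/funext => h /=.
by congr (_ *: (g _ - _)); congr pair => /=; rewrite ?scaler0 ?add0r.
Qed.
Lemma derivable10E (g : R * R -> R) (x y : R) : derivable g (x, y) (1, 0) = derivable (fun s => g (s, y)) x 1.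
Proof.
have E : (fun h : R => h^-1 *: ((g \o shift (x, y)) (h *: (1, 0)) - g (x, y))) =
  (fun h : R => h^-1 *: (((fun s => g (s, y)) \o shift x) (h *: 1) - g (x, y))).
  apply/funext => h /=.
  by congr (_ *: (g _ - _)); congr pair => /=; rewrite ?scaler0 ?add0r.
by rewrite /derivable E.
Qed.
Lemma derivable01E (g : R * R -> R) (x y : R) : derivable g (x, y) (0, 1) = derivable (fun s => g (x, s)) y 1.
Proof.
have E : (fun h : R => h^-1 *: ((g \o shift (x, y)) (h *: (0, 1)) - g (x, y))) =
  (fun h : R => h^-1 *: (((fun s => g (x, s)) \o shift y) (h *: 1) - g (x, y))).
  apply/funext => h /=.
  by congr (_ *: (g _ - _)); congr pair => /=; rewrite ?scaler0 ?add0r.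
by rewrite /derivable E.
Qed.

Lemma nbhs2P (p : R * R) (A : set (R * R)) : nbhs p A <->
  exists2 e : R, 0 < e & forall x y, `|x - p.1| < e -> `|y - p.2| < e -> A (x, y).
Proof.
split.
  move=> /nbhs_ballP[e /= e0 H]; exists e => // x y hx hy; apply: H.
  by split; rewrite /= -ball_normE /ball_ /= distrC.
case=> e e0 H; apply/nbhs_ballP; exists e => // -[x y] [].
by rewrite /= -!ball_normE /ball_ /= => hx hy; apply: H; rewrite distrC.
Qed.

Lemma minmax_dist (a b z e : R) : Num.min a b <= z <= Num.max a b -> `|b - a| < e -> `|z - a| < e.
Proof.
rewrite ltr_norml ge_min le_max => /andP[]/orP[]h1/orP[]h2 /andP[h3 h4]; rewrite ltr_norml; apply/andP; split; lra.
Qed.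

(** The mean value theorem turns [slope1] into the partial derivative at a point of the segment, and
    this point tends to [p] with [q]. *)
Lemma slope1_cvg (g : R * R -> R) (p : R * R) U : open U -> U p -> (forall q, U q -> derivable g q (1, 0)) ->
  {for p, continuous ('D_(1, 0) g)} -> slope1 g p q @[q --> p] --> 'D_(1, 0) g p.
Proof.
move=> oU Up dg cg; apply/cvgrPdist_lt => e e0.
have /nbhs2P[d1 d10 H1] : nbhs p U by exact: open_nbhs_nbhs.
have /cvgrPdist_lt/(_ _ e0)/nbhs2P[d2 d20 H2] := cg.
apply/nbhs2P; exists (Num.min d1 d2); first by rewrite lt_min d10 d20.
move=> x y; rewrite !lt_min => /andP[x1 x2] /andP[y1 y2]; rewrite /slope1 /=.
case: eqP => [_|/eqP xp]; first by rewrite subrr normr0.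
have [z zi E] := @MVTe (fun s => g (s, y)) p.1 x (fun z zi => ltac:(rewrite -derivable10E; apply/dg/H1 => //; exact: minmax_dist zi x1)).
rewrite E mulfK ?subr_eq0// -D10E; apply: H2 => //; exact: minmax_dist zi x2.
Qed.

Lemma slope2_cvg (g : R * R -> R) (p : R * R) U : open U -> U p -> (forall q, U q -> derivable g q (0, 1)) ->
  {for p, continuous ('D_(0, 1) g)} -> slope2 g p q @[q --> p] --> 'D_(0, 1) g p.
Proof.
move=> oU Up dg cg; apply/cvgrPdist_lt => e e0.
have /nbhs2P[d1 d10 H1] : nbhs p U by exact: open_nbhs_nbhs.
have /cvgrPdist_lt/(_ _ e0)/nbhs2P[d2 d20 H2] := cg.
apply/nbhs2P; exists (Num.min d1 d2); first by rewrite lt_min d10 d20.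
move=> x y; rewrite !lt_min => /andP[x1 x2] /andP[y1 y2]; rewrite /slope2 /=.
case: eqP => [_|/eqP xp]; first by rewrite subrr normr0.
have [z zi E] := @MVTe (fun s => g (p.1, s)) p.2 y (fun z zi => ltac:(rewrite -derivable01E; apply/dg/H1 => //=; rewrite ?subrr ?normr0 //; exact: minmax_dist zi y1)).
rewrite (_ : g p = g (p.1, p.2)); last by rewrite -surjective_pairing.
rewrite E mulfK ?subr_eq0// -D01E; apply: H2 => //=; rewrite ?subrr ?normr0 //; exact: minmax_dist zi y2.
Qed.

End Caratheodory.

(** * Chain rule *)

Section Chain.
Context {R : realType} {V : normedModType R}.
Implicit Types (f : V -> R).

Lemma cvg_pair2 (T : Type) (F : set_system T) {FF : Filter F} (f1 f2 : T -> R) (a b : R) :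
  f1 x @[x --> F] --> a -> f2 x @[x --> F] --> b -> (f1 x, f2 x) @[x --> F] --> (a, b).
Proof.
move=> H1 H2 A /nbhs2P[e e0 H] /=; rewrite /nbhs /=.
move/cvgrPdist_lt: H1 => /(_ _ e0) H1; move/cvgrPdist_lt: H2 => /(_ _ e0) H2.
apply: filterS2 H1 H2 => x h1 h2; apply: H => /=; by rewrite distrC.
Qed.

Lemma line_cvg (f : V -> R) x v : {for x, continuous f} -> f (h *: v + x) @[h --> 0^'] --> f x.
Proof.
move=> cf; apply: (@cvg_comp _ _ _ (fun h : R => h *: v + x) f _ (nbhs x)) => //.
have H : h *: v + x @[h --> (0 : R)^'] --> 0 *: v + x.
  by apply: cvgD; [apply: cvgZr_tmp; exact: nbhs_dnbhs|exact: cvg_cst].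
by rewrite scale0r add0r in H.
Qed.

Lemma is_derive_comp1 (g : R -> R) f x v df : {for x, continuous f} ->
  derivable g (f x) 1 -> is_derive x v f df ->
  is_derive x v (fun y => g (f y)) ('D_1 g (f x) * df).
Proof.
move=> cf dg [df1 df2].
suff H : h^-1 *: (((fun y => g (f y)) \o shift x) (h *: v) - g (f x)) @[h --> 0^'] --> 'D_1 g (f x) * df.
  by split; [apply/cvg_ex; exists ('D_1 g (f x) * df)|apply/cvg_lim].
have -> : (fun h : R => h^-1 *: (((fun y => g (f y)) \o shift x) (h *: v) - g (f x)))
  = (fun h : R => slope g (f x) (f (h *: v + x)) * (h^-1 *: ((f \o shift x) (h *: v) - f x))).
  by apply/funext => h /=; rewrite slopeE; rewrite !/(_ *: _) /=; ring.
apply: cvgM; last by rewrite -df2; exact: df1.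
exact: cvg_comp (line_cvg _ cf) (slope_cvg dg).
Qed.

(** The increment of [g] is a combination of the increments of [f1] and [f2], whose coefficients,
    the two slopes, tend to the partial derivatives. *)
Lemma is_derive_comp2 (g : R * R -> R) U f1 f2 x v d1 d2 :
  open U -> U (f1 x, f2 x) -> smooth U g ->
  {for x, continuous f1} -> {for x, continuous f2} ->
  is_derive x v f1 d1 -> is_derive x v f2 d2 ->
  is_derive x v (fun y => g (f1 y, f2 y))
    ('D_(1, 0) g (f1 x, f2 x) * d1 + 'D_(0, 1) g (f1 x, f2 x) * d2).
Proof.
move=> oU Ux sg c1 c2 [d11 d12] [d21 d22]; set p := (f1 x, f2 x).
suff H : h^-1 *: (((fun y => g (f1 y, f2 y)) \o shift x) (h *: v) - g p) @[h --> 0^'] -->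
   'D_(1, 0) g p * d1 + 'D_(0, 1) g p * d2.
  by split; [apply/cvg_ex; eexists; exact: H|apply/cvg_lim].
have -> : (fun h : R => h^-1 *: (((fun y => g (f1 y, f2 y)) \o shift x) (h *: v) - g p))
  = (fun h : R => slope1 g p (f1 (h *: v + x), f2 (h *: v + x)) * (h^-1 *: ((f1 \o shift x) (h *: v) - f1 x))
     + slope2 g p (f1 (h *: v + x), f2 (h *: v + x)) * (h^-1 *: ((f2 \o shift x) (h *: v) - f2 x))).
  by apply/funext => h /=; rewrite slope12E; rewrite !/(_ *: _) /=; ring.
have cp : (f1 (h *: v + x), f2 (h *: v + x)) @[h --> 0^'] --> p.
  by apply: cvg_pair2; exact: line_cvg.
rewrite -d12 -d22; apply: cvgD; apply: cvgM; [|exact: d11| |exact: d21].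
- apply: cvg_comp cp _; apply: (slope1_cvg oU Ux).
    by move=> q Uq; exact: smooth_derivable sg Uq.
  exact: smooth_cont (smooth_derive _ sg) Ux.
- apply: cvg_comp cp _; apply: (slope2_cvg oU Ux).
    by move=> q Uq; exact: smooth_derivable sg Uq.
  exact: smooth_cont (smooth_derive _ sg) Ux.
Qed.

(** The induction lets [g] vary: the derivative of the composite contains ['D_1 g] composed with
    [f], where [f] enters to the lower order. *)
Lemma Ck_comp1 k (W : set R) (U : set V) (g : R -> R) f : open U ->
  (forall x, U x -> W (f x)) ->
  smooth W g -> is_Ck k U f -> is_Ck k U (fun x => g (f x)).
Proof.
move=> oU UW; elim: k g => [|k IH] g sg.
  move=> cf x Ux; apply: (@continuous_comp _ _ _ f g); first exact: cf.
  by apply: smooth_cont sg _; exact: UW.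
move=> Hf; have fk := Ck_down Hf; case: (Hf) => f1 f2 f3; split.
- move=> x Ux; apply: (@continuous_comp _ _ _ f g); first exact: f1.
  by apply: smooth_cont sg _; exact: UW.
- move=> v x Ux; apply: ex_derive; apply: is_derive_comp1; first exact: f1.
    by apply: smooth_derivable sg _; exact: UW.
  by apply: derivableP; exact: f2.
- move=> v; have HM := CkM oU (IH _ (smooth_derive (1 : R) sg) fk) (f3 v).
  apply: (Ck_ext oU _ HM) => x Ux; apply/esym/derive_val.
  apply: is_derive_comp1; first exact: f1.
    by apply: smooth_derivable sg _; exact: UW.
  by apply: derivableP; exact: f2.
Qed.

Lemma Ck_comp2 k (W : set (R * R)) (U : set V) (g : R * R -> R) f1 f2 : open U -> open W ->
  (forall x, U x -> W (f1 x, f2 x)) ->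
  smooth W g -> is_Ck k U f1 -> is_Ck k U f2 -> is_Ck k U (fun x => g (f1 x, f2 x)).
Proof.
move=> oU oW UW; elim: k g => [|k IH] g sg.
  move=> cf1 cf2 x Ux; apply: (@continuous_comp _ _ _ (fun x => (f1 x, f2 x)) g).
    by apply: cvg_pair2; [exact: cf1|exact: cf2].
  by apply: smooth_cont sg _; exact: UW.
move=> Hf Hh; have fk := Ck_down Hf; have hk := Ck_down Hh.
case: (Hf) => a1 a2 a3; case: (Hh) => b1 b2 b3.
have D v x : U x -> is_derive x v (fun y => g (f1 y, f2 y))
    ('D_(1, 0) g (f1 x, f2 x) * 'D_v f1 x + 'D_(0, 1) g (f1 x, f2 x) * 'D_v f2 x).
  move=> Ux; apply: (is_derive_comp2 oW (UW _ Ux) sg); [exact: a1|exact: b1| |].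
    by apply: derivableP; exact: a2.
  by apply: derivableP; exact: b2.
split.
- move=> x Ux; apply: (@continuous_comp _ _ _ (fun x => (f1 x, f2 x)) g).
    by apply: cvg_pair2; [exact: a1|exact: b1].
  by apply: smooth_cont sg _; exact: UW.
- by move=> v x /(D v)[].
- move=> v.
  have HM := CkD oU (CkM oU (IH _ (smooth_derive ((1, 0) : R * R) sg) fk hk) (a3 v)) (CkM oU (IH _ (smooth_derive ((0, 1) : R * R) sg) fk hk) (b3 v)).
  by apply: (Ck_ext oU _ HM) => x /(D v)[].
Qed.

Lemma smooth_comp1 (W : set R) (U : set V) (g : R -> R) f : open U ->
  (forall x, U x -> W (f x)) ->
  smooth W g -> smooth U f -> smooth U (fun x => g (f x)).
Proof. by move=> oU UW sg sf k; exact: (Ck_comp1 oU UW sg (sf k)). Qed.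

Lemma smooth_comp2 (W : set (R * R)) (U : set V) (g : R * R -> R) f1 f2 : open U -> open W ->
  (forall x, U x -> W (f1 x, f2 x)) ->
  smooth W g -> smooth U f1 -> smooth U f2 -> smooth U (fun x => g (f1 x, f2 x)).
Proof. by move=> oU oW UW sg s1 s2 k; exact: (Ck_comp2 oU oW UW sg (s1 k) (s2 k)). Qed.

End Chain.

(** * Elementary functions *)

Section Elementary.
Context {R : realType}.

Lemma smooth_linear (V : normedModType R) (U : set V) (f : V -> R) (l : V -> R) :
  continuous f -> (forall x v, is_derive x v f (l v)) -> smooth U f.
Proof.
move=> cf df [|k] /=; first by move=> x _; exact: cf.
split; [by move=> x _; exact: cf|by move=> v x _; case: (df x v)|].
move=> v; rewrite (_ : 'D_v f = fun=> l v); first exact: Ck_cst.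
by apply/funext => x; case: (df x v).
Qed.

Lemma smooth_id (U : set R) : smooth U (fun x : R => x).
Proof. by apply: (@smooth_linear _ _ _ id) => // x; exact: cvg_id. Qed.

Lemma is_derive_fst (x v : R * R) : is_derive x v (fun z : R * R => z.1) v.1.
Proof.
suff H : h^-1 *: (((fun z : R * R => z.1) \o shift x) (h *: v) - x.1) @[h --> 0^'] --> v.1.
  by split; [apply/cvg_ex; eexists; exact: H|apply/cvg_lim].
apply: cvg_near_cst; near=> h.
have h0 : h != 0 by near: h; exact: nbhs_dnbhs_neq.
by rewrite /= addrK; rewrite !/(_ *: _) /= mulKf.
Unshelve. all: by end_near. Qed.

Lemma is_derive_snd (x v : R * R) : is_derive x v (fun z : R * R => z.2) v.2.
Proof.
suff H : h^-1 *: (((fun z : R * R => z.2) \o shift x) (h *: v) - x.2) @[h --> 0^'] --> v.2.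
  by split; [apply/cvg_ex; eexists; exact: H|apply/cvg_lim].
apply: cvg_near_cst; near=> h.
have h0 : h != 0 by near: h; exact: nbhs_dnbhs_neq.
by rewrite /= addrK; rewrite !/(_ *: _) /= mulKf.
Unshelve. all: by end_near. Qed.

Lemma smooth_fst (U : set (R * R)) : smooth U (fun z => z.1).
Proof. by apply: (@smooth_linear _ _ _ fst) => [x|x v]; [exact: cvg_fst|exact: is_derive_fst]. Qed.
Lemma smooth_snd (U : set (R * R)) : smooth U (fun z => z.2).
Proof. by apply: (@smooth_linear _ _ _ snd) => [x|x v]; [exact: cvg_snd|exact: is_derive_snd]. Qed.

Lemma derive_scale (f : R -> R) x v : derivable f x 1 -> is_derive x v f (v * 'D_1 f x).
Proof.
move=> df; have dd : differentiable f x by apply/derivable1_diffP.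
split; first exact: diff_derivable.
rewrite !deriveE // -[X in 'd f x X]mulr1 -[X in 'd f x X]/(v *: 1).
by rewrite linearZ.
Qed.

(** Bootstrapping: when the derivatives of a family are as regular as the family itself, regularity
    climbs one order at a time. This serves for sine and cosine, inverse, arctangent, square root,
    flat functions and inverse functions. *)
Lemma smooth_ode (U : set R) (f : R -> R) (F : set (R -> R)) : open U ->
  (forall f, F f -> (forall x, U x -> derivable f x 1) /\
     forall k, (forall g, F g -> is_Ck k U g) -> is_Ck k U ('D_1 f)) ->
  F f -> smooth U f.
Proof.
move=> oU H Ff k; elim: k f Ff => [|k IH] f Ff.
  move=> x Ux; apply: differentiable_continuous; apply/derivable1_diffP.
  by have [df _] := H _ Ff; exact: df.
have [df Hk] := H _ Ff; split.
- by move=> x Ux; apply: differentiable_continuous; apply/derivable1_diffP; exact: df.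
- by move=> v x Ux; case: (derive_scale v (df _ Ux)).
- move=> v; have HM := CkM oU (Ck_cst k U v) (Hk _ IH).
  by apply: (Ck_ext oU _ HM) => x Ux; case: (derive_scale v (df _ Ux)).
Qed.

Lemma smooth_sincos (U : set R) : open U -> smooth U sin /\ smooth U cos.
Proof.
move=> oU; suff H (f : R -> R) : [set sin; cos] f -> smooth U f by split; apply: H; [left|right].
move=> Ff; apply: (@smooth_ode _ _ [set sin; cos]) Ff => // _ [->|->]; split.
- by move=> x _; exact: derivable_sin.
- move=> k H; apply: (Ck_ext oU _ (H cos (or_intror erefl))) => x _.
  by apply/esym/derive_val; exact: is_derive_sin.
- by move=> x _; exact: derivable_cos.
- move=> k H; apply: (Ck_ext oU _ (CkN oU (H sin (or_introl erefl)))) => x _.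
  by apply/esym/derive_val; exact: is_derive_cos.
Qed.

Lemma smooth_sin (U : set R) : open U -> smooth U sin.
Proof. by move=> /smooth_sincos[]. Qed.
Lemma smooth_cos (U : set R) : open U -> smooth U cos.
Proof. by move=> /smooth_sincos[]. Qed.

Lemma open_neq0 : open [set x : R | x != 0].
Proof. exact: open_neq. Qed.

Lemma smooth_inv : smooth [set x : R | x != 0] (fun x => x^-1).
Proof.
have oU := open_neq0.
apply: (@smooth_ode _ _ [set (fun x : R => x^-1)]) => // _ ->.
have D (x : R) : x != 0 -> is_derive x 1 (fun y : R => y^-1) (- (x^-1 * x^-1)).
  move=> x0; apply: is_derive_eq; first exact: is_deriveV.
  by rewrite scaler1 expr2 invfM.
split=> [x x0|k H]; first by case: (D x x0).
apply: (Ck_ext oU _ (CkN oU (CkM oU (H _ erefl) (H _ erefl)))) => x x0.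
by apply/esym/derive_val; exact: D.
Qed.

Lemma smoothV (V : normedModType R) (U : set V) (f : V -> R) : open U ->
  (forall x, U x -> f x != 0) -> smooth U f -> smooth U (fun x => (f x)^-1).
Proof. by move=> oU f0 sf; exact: (smooth_comp1 oU f0 smooth_inv sf). Qed.

Lemma smooth_atan (U : set R) : open U -> smooth U atan.
Proof.
move=> oU; apply: (@smooth_ode _ _ [set atan]) => // _ ->; split => [x _|k H].
  by apply: ex_derive; exact: is_derive1_atan.
have sm : smooth U (fun x : R => (1 + x ^+ 2)^-1).
  apply: smoothV => //; first by move=> x _; rewrite gt_eqF // ltr_pwDl // sqr_ge0.
  by apply: smoothD => //; [exact: smooth_cst|apply: smoothX => //; exact: smooth_id].
by apply: (Ck_ext oU _ (sm k)) => x _; apply/esym/derive_val; exact: is_derive1_atan.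
Qed.

Lemma smooth_sqrt : smooth [set x : R | 0 < x] (fun x => Num.sqrt x).
Proof.
have oU : open [set x : R | 0 < x] by exact: open_gt.
apply: (@smooth_ode _ _ [set (fun x : R => Num.sqrt x)]) => // _ ->; split => [x x0|k H].
  by apply: ex_derive; exact: is_derive1_sqrt.
have Ci : is_Ck k [set x : R | 0 < x] (fun x => (2 * Num.sqrt x)^-1).
  apply: (Ck_comp1 oU _ smooth_inv); last by apply: CkM => //; [exact: Ck_cst|exact: H].
  by move=> x x0 /=; rewrite mulf_neq0 ?pnatr_eq0 // gt_eqF // sqrtr_gt0.
by apply: (Ck_ext oU _ Ci) => x x0; apply/esym/derive_val; exact: is_derive1_sqrt.
Qed.

End Elementary.

(** * Real induction, derivation rules and cut-off functions *)

Section OneDim.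
Context {R : realType}.
Implicit Types (f g : R -> R) (x y a b c : R).

Lemma open_itvoo a b : open [set x : R | a < x < b].
Proof.
rewrite (_ : mkset _ = [set x | a < x] `&` [set x | x < b]); first by apply: openI; [exact: open_gt|exact: open_lt].
by apply/seteqP; split=> x /= => [/andP[]|[-> ->]].
Qed.

(** Let [c] be the supremum of the points up to which [P] holds at every good point. All other
    points near [c] are good, so a good point on the left transmits [P] across [c], and [c] cannot
    be below [b]. [P] is never asked at a bad point: this is how critical levels are crossed. *)
Lemma real_ind (P good : R -> Prop) a b : a <= b ->
  (forall c, a <= c <= b -> exists2 d : R, 0 < d &
    (forall x, `|x - c| < d -> x <> c -> a <= x <= b -> good x) /\
    (forall x y, `|x - c| < d -> `|y - c| < d -> a <= x -> x < y -> y <= b ->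
       good x -> good y -> P x -> P y)) ->
  good a -> good b -> P a -> P b.
Proof.
move=> ab loc ga gb Pa.
pose S := [set z | a <= z <= b /\ forall y, a <= y <= z -> good y -> P y].
have Sa : S a by split; [rewrite lexx ab|move=> y yi; have -> : y = a by apply/eqP; rewrite eq_le andbC].
have hS : has_sup S by split; [exists a|exists b => z [/andP[]]].
pose c := sup S.
have ac : a <= c by apply: sup_upper_bound.
have cb : c <= b by apply: ge_sup; [exists a|move=> z [/andP[]]].
have [|d d0 [dg dP]] := loc c; first by rewrite ac.
have below y : a <= y -> y < c -> good y -> P y.
  move=> ay yc gy; have [|z [zi Hz]] := @sup_adherent R S (c - y) _ hS; first by rewrite subr_gt0.
  by rewrite subKr => yz; apply: Hz; rewrite // ay ltW.
(* a good point from which c can be crossed *)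
have [x0 [x0a x0d gx0 Px0 x0c]] : exists x0, [/\ a <= x0, `|x0 - c| < d, good x0, P x0 & x0 <= c /\ (x0 = c -> c = a)].
  have [ca|ca] := eqVneq c a; first by exists a; rewrite ca subrr normr0; split.
  have {}ca : a < c by rewrite lt_neqAle eq_sym ca.
  have [m [am mc md]] : exists m, [/\ a <= m, m < c & c - d < m].
    have [h|h] := lerP a (c - d / 2); [exists (c - d / 2)|exists a]; split; clear -h d0 ca; lra.
  exists m; have gm : good m.
    apply: dg; rewrite ?ltr0_norm ?subr_lt0 //; [clear -md; lra|by apply/eqP; rewrite lt_eqF|clear -am mc cb; lra].
  split=> //; [by rewrite ltr0_norm ?subr_lt0 //; clear -md; lra|exact: below|].
  by split; [exact: ltW|move=> E1; move: mc; rewrite E1 ltxx].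
have cross y : x0 <= y -> y <= b -> `|y - c| < d -> good y -> P y.
  rewrite le_eqVlt => /orP[/eqP <- //|xy] yb yd gy; exact: (dP x0 y).
have [cb'|] := ltrP c b; last first.
  move=> bc; have cbE : c = b by apply/eqP; rewrite eq_le cb.
  by apply: cross => //; [case: x0c; rewrite cbE|rewrite cbE subrr normr0].
have [e [ce eb ed]] : exists e, [/\ c < e, e <= b & e < c + d].
  have [h|h] := lerP (c + d / 2) b; [exists (c + d / 2)|exists b]; split; clear -h d0 cb'; lra.
suff Se : S e by have := sup_upper_bound hS Se; rewrite leNgt ce.
split=> [|y /andP[ay ye] gy]; first by rewrite eb (le_trans ac (ltW ce)).
have [xy|yx] := lerP x0 y.
  have [yc|cy] := ltrP y c; first exact: below.
  by apply: cross => //; [exact: le_trans eb|rewrite ger0_norm ?subr_ge0 //; clear -ye ed; lra].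
by apply: below => //; apply: lt_le_trans yx _; case: x0c.
Qed.

Section Rules.
Context {V : normedModType R} (x v : V).
Implicit Types F G : V -> R.

(** The rules are restated for pointwise expressions, so that the derivative of a formula is
    assembled as a term and its value read off by [derive_val]. *)
Lemma dD F G a b : is_derive x v F a -> is_derive x v G b -> is_derive x v (fun z => F z + G z) (a + b).
Proof. exact: is_deriveD. Qed.
Lemma dM F G a b : is_derive x v F a -> is_derive x v G b -> is_derive x v (fun z => F z * G z) (a * G x + F x * b).
Proof.
move=> DF DG; apply: (is_derive_eq (@is_deriveM _ _ F G x v a b DF DG)).
by rewrite /(_ *: _) /= [RHS]addrC [a * _]mulrC.
Qed.
Lemma dN F a : is_derive x v F a -> is_derive x v (fun z => - F z) (- a).
Proof. exact: is_deriveN. Qed.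
Lemma dB F G a b : is_derive x v F a -> is_derive x v G b -> is_derive x v (fun z => F z - G z) (a - b).
Proof. by move=> DF DG; apply: dD => //; exact: dN. Qed.
Lemma dC (k : R) : is_derive x v (fun _ => k) 0.
Proof. exact: is_derive_cst. Qed.
Lemma dZ k F a : is_derive x v F a -> is_derive x v (fun z => k * F z) (k * a).
Proof. by move=> DF; apply: (is_derive_eq (dM (dC k) DF)); rewrite mul0r add0r. Qed.
Lemma dX2 F a : is_derive x v F a -> is_derive x v (fun z => F z ^+ 2) (2 * F x * a).
Proof.
move=> DF; have -> : (fun z => F z ^+ 2) = (fun z => F z * F z) by apply/funext => z; rewrite expr2.
by apply: (is_derive_eq (dM DF DF)); ring.
Qed.
Lemma dXn F a n : is_derive x v F a -> is_derive x v (fun z => F z ^+ n) (n%:R * F x ^+ n.-1 * a).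
Proof.
move=> DF; elim: n => [|n IH]; first by apply: (is_derive_eq (dC 1)); rewrite !mul0r.
have -> : (fun z => F z ^+ n.+1) = (fun z => F z * F z ^+ n) by apply/funext => z; rewrite exprS.
apply: (is_derive_eq (dM DF IH)); case: n {IH} => [|n] /=; first by rewrite expr0; ring.
by rewrite -[n.+2%:R]natr1 exprS; ring.
Qed.
Lemma d_sum (I : Type) (s : seq I) (F : I -> V -> R) (dF : I -> R) :
  (forall i, is_derive x v (F i) (dF i)) -> is_derive x v (fun z => \sum_(i <- s) F i z) (\sum_(i <- s) dF i).
Proof.
move=> DF; elim: s => [|i s IH].
  rewrite big_nil (_ : (fun z => _) = (fun=> 0)); first exact: dC.
  by apply/funext => z; rewrite big_nil.
rewrite big_cons (_ : (fun z => _) = (fun z => F i z + \sum_(j <- s) F j z)); first exact: dD.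
by apply/funext => z; rewrite big_cons.
Qed.
End Rules.

Lemma dI x : is_derive x 1 (fun y : R => y) 1.
Proof. exact: is_derive_id. Qed.
Lemma d1comp f (V : normedModType R) (F : V -> R) (z v : V) a : {for z, continuous F} -> derivable f (F z) 1 -> is_derive z v F a ->
  is_derive z v (fun t => f (F t)) ('D_1 f (F z) * a).
Proof. exact: is_derive_comp1. Qed.

Lemma incr_lt f a b : (forall z, a <= z <= b -> derivable f z 1) ->
  (forall z, a <= z <= b -> 0 < 'D_1 f z) -> forall x y, a <= x -> x < y -> y <= b -> f x < f y.
Proof.
move=> df pf x y ax xy yb.
have sub z : Num.min x y <= z <= Num.max x y -> a <= z <= b by rewrite (min_l (ltW xy)) (max_r (ltW xy)) => zi; clear -zi ax yb; lra.
have [z zi E1] := @MVTe R f x y (fun z zi => df z (sub z zi)).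
by rewrite -subr_gt0 E1 mulr_gt0 ?subr_gt0 // pf // sub.
Qed.

Lemma nondecr_le f a b : (forall z, a <= z <= b -> derivable f z 1) ->
  (forall z, a <= z <= b -> 0 <= 'D_1 f z) -> forall x y, a <= x -> x <= y -> y <= b -> f x <= f y.
Proof.
move=> df pf x y ax xy yb.
have sub z : Num.min x y <= z <= Num.max x y -> a <= z <= b by rewrite (min_l xy) (max_r xy) => zi; clear -zi ax yb; lra.
have [z zi E1] := @MVTe R f x y (fun z zi => df z (sub z zi)).
by rewrite -subr_ge0 E1 mulr_ge0 ?subr_ge0 // pf // sub.
Qed.

(** The parameter [n] makes the family closed under derivation up to linear combinations, so that
    all its members are smooth by bootstrapping. *)
Definition flat (n : nat) (x : R) : R := if 0 < x then x^-1 ^+ n * expR (- x^-1) else 0.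

(** The exponential at [x^-1] dominates its term of order n + 2. A quadratic bound is what makes the
    derivative at the origin vanish. *)
Lemma flat_bound n : exists2 C : R, 0 < C & forall x, `|flat n x| <= C * x ^+ 2.
Proof.
exists (n.+2)`!%:R; first by rewrite ltr0n fact_gt0.
move=> x; rewrite /flat; case: ifPn => [x0|_]; last by rewrite normr0 mulr_ge0 // sqr_ge0.
have y0 : 0 < x^-1 by rewrite invr_gt0.
have E1 := expR_ge1Dxn n.+1 (ltW y0); rewrite expRN.
have f0 : 0 < (n.+2)`!%:R :> R by rewrite ltr0n fact_gt0.
have E2 : x^-1 ^+ n.+2 <= (n.+2)`!%:R * expR x^-1.
  by rewrite mulrC -ler_pdivrMr //; apply: le_trans E1; rewrite lerDr.
have e0 := @expR_gt0 R x^-1; rewrite ger0_norm; last by rewrite mulr_ge0 ?exprn_ge0 ?invr_ge0 ?ltW.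
have -> : x ^+ 2 = (x^-1 ^+ 2)^-1 by rewrite exprVn invrK.
by rewrite ler_pdivrMr // mulrAC ler_pdivlMr ?exprn_gt0 // -exprD addn2.
Qed.

Lemma is_derive_flat n x : is_derive x 1 (flat n) (flat n.+2 x - n%:R * flat n.+1 x).
Proof.
case: (ltgtP x 0) => [x0|x0|->].
- have -> : flat n.+2 x - n%:R * flat n.+1 x = 0 by rewrite /flat ltNge (ltW x0) /= mulr0 subrr.
  apply: near_eq_is_derive (is_derive_cst (0 : R) x 1).
  near=> y; rewrite /flat ifF //; apply/negbTE; rewrite -leNgt ltW //.
  by near: y; apply: open_nbhs_nbhs; split; [exact: open_lt|].
- have xn : x != 0 by rewrite gt_eqF.
  have D1 : is_derive x 1 (fun t : R => t^-1) (- (x^-1 * x^-1)).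
    by apply: is_derive_eq; [exact: is_deriveV|rewrite scaler1 expr2 invfM].
  have D2 : is_derive x 1 (fun t : R => t^-1 ^+ n) (- n%:R * x^-1 ^+ n.+1).
    apply: (is_derive_eq (dXn n D1)); case: (n) => [|m] /=; first by rewrite mul0r oppr0 !mul0r.
    by rewrite !exprS; ring.
  have D3 : is_derive x 1 (fun t : R => expR (- t^-1)) (expR (- x^-1) * (x^-1 * x^-1)).
    have c1 : {for x, continuous (fun t : R => - t^-1)} by apply: cvgN; apply: cvgV => //; exact: cvg_id.
    have d1 : derivable expR (- x^-1) 1 by exact: derivable_expR.
    apply: (is_derive_eq (d1comp (f := expR) (F := fun t : R => - t^-1) c1 d1 (dN D1))).
    have -> : 'D_1 expR (- x^-1) = expR (- x^-1) by exact: (congr1 (fun f : R -> R => f (- x^-1)) (derive_expR R)).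
    by rewrite opprK.
  have D := dM D2 D3.
  have -> : flat n.+2 x - n%:R * flat n.+1 x = - n%:R * x^-1 ^+ n.+1 * expR (- x^-1) + x^-1 ^+ n * (expR (- x^-1) * (x^-1 * x^-1)).
    by rewrite /flat x0 !exprS; ring.
  apply: near_eq_is_derive D; near=> y; rewrite /flat ifT //.
  by near: y; apply: open_nbhs_nbhs; split; [exact: open_gt|].
- have -> : flat n.+2 0 - n%:R * flat n.+1 0 = 0 :> R by rewrite /flat !ltxx mulr0 subrr.
  have [C C0 HC] := flat_bound n; have f0 : flat n 0 = 0 by rewrite /flat ltxx.
  suff Hc : h^-1 *: ((flat n \o shift 0) (h *: 1) - flat n 0) @[h --> 0^'] --> (0 : R).
    by split; [apply/cvg_ex; eexists; exact: Hc|apply/cvg_lim].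
  apply: (@cvg_to_0_linear R _ C 1) => // h /andP[h0 _].
  rewrite /= f0 addr0 subr0 /(_ *: _) /= /(_ *: _) /= mulr1 normrM normfV ler_pdivrMl //.
  apply: le_trans (HC h) _; rewrite -[X in _ * X <= _]ger0_norm ?sqr_ge0 // normrX expr2.
  by rewrite le_eqVlt; apply/orP; left; apply/eqP; ring.
Unshelve. all: by end_near.
Qed.

Lemma smooth_flat n : smooth [set: R] (flat n).
Proof.
apply: (@smooth_ode R _ _ (range flat)); [exact: openT| |by exists n].
move=> _ [m _ <-]; split=> [x _|k H]; first by apply: ex_derive; exact: is_derive_flat.
have HM := CkD (@openT R) (H _ (imageT flat m.+2)) (CkN (@openT R) (CkM (@openT R) (Ck_cst k setT (m%:R : R)) (H _ (imageT flat m.+1)))).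
apply: (Ck_ext (@openT R) _ HM) => x _; apply/esym/derive_val; exact: is_derive_flat.
Qed.

Lemma flat0_ge0 x : 0 <= flat 0 x.
Proof. by rewrite /flat; case: ifP => // x0; rewrite mulr_ge0 ?exprn_ge0 ?invr_ge0 ?expR_ge0 // ltW. Qed.
Lemma flat2_ge0 x : 0 <= flat 2 x.
Proof. by rewrite /flat; case: ifP => // x0; rewrite mulr_ge0 ?exprn_ge0 ?invr_ge0 ?expR_ge0 // ltW. Qed.
Lemma flat0_gt0 x : 0 < x -> 0 < flat 0 x.
Proof. by move=> x0; rewrite /flat x0 mulr_gt0 ?exprn_gt0 ?invr_gt0 ?expR_gt0. Qed.
Lemma flat_le0 n x : x <= 0 -> flat n x = 0.
Proof. by move=> x0; rewrite /flat ltNge x0. Qed.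

Lemma flat_den x : 0 < flat 0 x + flat 0 (1 - x).
Proof.
have [x0|x0] := ltP 0 x; first by rewrite ltr_pwDl ?flat0_gt0 ?flat0_ge0.
by rewrite ltr_wpDl ?flat0_ge0 // flat0_gt0 //; lra.
Qed.

Definition step (x : R) : R := flat 0 x / (flat 0 x + flat 0 (1 - x)).

Lemma smooth_step (V : normedModType R) (U : set V) (f : V -> R) : open U -> smooth U f -> smooth U (fun z => step (f z)).
Proof.
move=> oU sf; apply: (@smooth_comp1 _ _ setT _ step) => //.
have s1 : smooth [set: R] (fun x : R => flat 0 (1 - x)).
  apply: (@smooth_comp1 _ _ setT _ (flat 0) (fun x : R => 1 - x) (@openT R)) => //; first exact: smooth_flat.
  by apply: smoothB; [exact: openT|exact: smooth_cst|exact: smooth_id].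
apply: smoothM; [exact: openT|exact: smooth_flat|].
apply: smoothV; [exact: openT|by move=> x _; rewrite gt_eqF // flat_den|].
by apply: smoothD => //; [exact: openT|exact: smooth_flat].
Qed.

Lemma step0 x : x <= 0 -> step x = 0.
Proof. by move=> x0; rewrite /step flat_le0 // mul0r. Qed.
Lemma step1 x : 1 <= x -> step x = 1.
Proof.
move=> x1; rewrite /step (@flat_le0 0 (1 - x)) ?subr_le0 // addr0 divff // gt_eqF //.
by apply: flat0_gt0; lra.
Qed.
Lemma step_ge0 x : 0 <= step x.
Proof. by rewrite /step divr_ge0 ?flat0_ge0 // ltW // flat_den. Qed.
Lemma step_le1 x : step x <= 1.
Proof. by rewrite /step ler_pdivrMr ?flat_den // mul1r lerDl flat0_ge0. Qed.
Lemma derivable_step x : derivable step x 1.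
Proof. exact: (smooth_derivable (smooth_step (@openT R) (@smooth_id R setT)) Logic.I). Qed.

Lemma step_incr x : 0 <= 'D_1 step x.
Proof.
have D1 : is_derive x 1 (flat 0) (flat 2 x).
  by apply: (is_derive_eq (is_derive_flat 0 x)); rewrite mul0r subr0.
have D2 : is_derive x 1 (fun t : R => flat 0 (1 - t)) (- flat 2 (1 - x)).
  have c1 : {for x, continuous (fun t : R => 1 - t)} by apply: cvgB; [exact: cvg_cst|exact: cvg_id].
  have [d1 e1] := is_derive_flat 0 (1 - x).
  apply: (is_derive_eq (d1comp c1 d1 (dB (dC x 1 1) (dI x)))).
  by rewrite e1 mul0r subr0 sub0r mulrN1.
have DD := dD D1 D2.
have n0 : flat 0 x + flat 0 (1 - x) != 0 by rewrite gt_eqF // flat_den.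
have DV := @is_deriveV _ (fun t => flat 0 t + flat 0 (1 - t)) x _ 1 n0 DD.
have D := dM D1 DV.
rewrite (derive_val (is_derive := D : is_derive x 1 step _)) /=.
move: n0 (flat0_ge0 x) (flat0_ge0 (1 - x)) (flat2_ge0 x) (flat2_ge0 (1 - x)) => /=.
move: (flat 0 x) (flat 0 (1 - x)) (flat 2 x) (flat 2 (1 - x)) => A B C D' n0 A0 B0 C0 D0.
have -> : C / (A + B) + A * (- (A + B) ^- 2 *: (C - D')) = (C * B + A * D') / (A + B) ^+ 2.
  by rewrite /(_ *: _) /=; field.
by rewrite divr_ge0 ?sqr_ge0 // addr_ge0 // mulr_ge0.
Qed.

Definition plateau (x : R) : R := step (2 - x) * step (2 + x).

Lemma smooth_plateau (V : normedModType R) (U : set V) (f : V -> R) : open U -> smooth U f -> smooth U (fun z => plateau (f z)).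
Proof.
move=> oU sf; apply: smoothM => //; apply: smooth_step => //.
  by apply: smoothB => //; exact: smooth_cst.
by apply: smoothD => //; exact: smooth_cst.
Qed.

Lemma plateau1 x : `|x| <= 1 -> plateau x = 1.
Proof. by rewrite ler_norml => /andP[h1 h2]; rewrite /plateau !step1 ?mul1r //; lra. Qed.
Lemma plateau0 x : 2 <= `|x| -> plateau x = 0.
Proof.
rewrite /plateau ler_normr => /orP[h|h]; first by rewrite step0 ?mul0r //; lra.
by rewrite [X in _ * X]step0 ?mulr0 //; lra.
Qed.
Lemma plateau_ge0 x : 0 <= plateau x.
Proof. by rewrite mulr_ge0 ?step_ge0. Qed.
Lemma plateau_le1 x : plateau x <= 1.
Proof. by rewrite /plateau mulr_ile1 ?step_ge0 ?step_le1. Qed.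
Lemma derivable_plateau x : derivable plateau x 1.
Proof. exact: (smooth_derivable (smooth_plateau (@openT R) (@smooth_id R setT)) Logic.I). Qed.

Lemma derive_plateau x : 'D_1 plateau x = - 'D_1 step (2 - x) * step (2 + x) + step (2 - x) * 'D_1 step (2 + x).
Proof.
have D1 : is_derive x 1 (fun t : R => step (2 - t)) (- 'D_1 step (2 - x)).
  rewrite [- 'D_1 step _](_ : _ = 'D_1 step (2 - x) * (0 - 1)); last by rewrite sub0r mulrN1.
  apply: (d1comp _ _ (dB (dC x 1 2) (dI x))); last exact: derivable_step.
  by apply: cvgB; [exact: cvg_cst|exact: cvg_id].
have D2 : is_derive x 1 (fun t : R => step (2 + t)) ('D_1 step (2 + x)).
  rewrite -[X in is_derive _ _ _ X]mulr1 -[X in _ * X]add0r; apply: (d1comp _ _ (dD (dC x 1 2) (dI x))); last exact: derivable_step.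
  by apply: cvgD; [exact: cvg_cst|exact: cvg_id].
exact: (derive_val (is_derive := dM D1 D2)).
Qed.

Lemma step_const0 x : x < 0 -> 'D_1 step x = 0.
Proof.
move=> x0; rewrite (@near_eq_derive _ _ _ step (fun=> 0)) ?derive_cst //.
near=> y; apply: step0; apply: ltW; near: y.
by apply: open_nbhs_nbhs; split; [exact: open_lt|].
Unshelve. all: by end_near.
Qed.
Lemma step_const1 x : 1 < x -> 'D_1 step x = 0.
Proof.
move=> x0; rewrite (@near_eq_derive _ _ _ step (fun=> 1)) ?derive_cst //.
near=> y; apply: step1; apply: ltW; near: y.
by apply: open_nbhs_nbhs; split; [exact: open_gt|].
Unshelve. all: by end_near.
Qed.

(** On each side of 0 only one of the two steps varies. With [plateau_le1] this bounds the
    derivative of [x * plateau x] by 1, which keeps a contraction cut off by [plateau]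
    increasing. *)
Lemma plateau_sign x : x * 'D_1 plateau x <= 0.
Proof.
have a0 := step_incr (2 - x); have b0 := step_incr (2 + x); have c0 := step_ge0 (2 - x); have d0 := step_ge0 (2 + x).
have neg : x <= 0 -> 'D_1 step (2 - x) = 0 by clear => h; apply: step_const1; lra.
have pos : 0 < x -> 'D_1 step (2 + x) = 0 by clear => h; apply: step_const1; lra.
rewrite derive_plateau; move: a0 b0 c0 d0 neg pos.
move: ('D_1 step (2 - x)) ('D_1 step (2 + x)) (step (2 - x)) (step (2 + x)) => A B C D a0 b0 c0 d0 neg pos.
have [x0|x0] := ltP 0 x.
  by rewrite pos // mulr0 addr0 mulNr mulrN oppr_le0 mulr_ge0 ?mulr_ge0 // ltW.
by rewrite neg // oppr0 mul0r add0r mulr_le0_ge0 // mulr_ge0.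
Qed.

Lemma plateau_bound : exists2 C : R, 0 < C & forall x, `|'D_1 plateau x| <= C.
Proof.
have sp : smooth [set: R] plateau by exact: (smooth_plateau (@openT R) (@smooth_id R setT)).
have cD : continuous ('D_1 plateau) by move=> x; exact: (smooth_cont (smooth_derive (1 : R) sp) Logic.I).
have cn : {within `[-2, 2 : R], continuous (fun x => `|'D_1 plateau x|)}.
  by apply: continuous_subspaceT => x; apply: cvg_norm; exact: cD.
have [|c _ Hc] := @EVT_max R (fun x => `|'D_1 plateau x|) (-2) 2 _ cn; first by lra.
exists (`|'D_1 plateau c| + 1); first by rewrite ltr_wpDl.
move=> x; have [xi|] := boolP (x \in `[-2, 2 : R]); first by apply: le_trans (Hc x xi) _; rewrite lerDl.
rewrite in_itv /= negb_and -!ltNge derive_plateau => /orP[h|h].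
  by rewrite (@step_const1 (2 - x)) ?(@step_const0 (2 + x)) ?oppr0 ?mul0r ?mulr0 ?addr0 ?normr0 ?addr_ge0 //; lra.
by rewrite (@step_const0 (2 - x)) ?(@step_const1 (2 + x)) ?oppr0 ?mul0r ?mulr0 ?addr0 ?normr0 ?addr_ge0 //; lra.
Qed.

End OneDim.
Arguments step {R} x.
Arguments plateau {R} x.

(** * Inverses and shears *)

Section Inverse.
Context {R : realType}.

Lemma derivable_cont (f : R -> R) (x : R) : derivable f x 1 -> {for x, continuous f}.
Proof. by move=> /derivable1_diffP/differentiable_continuous. Qed.

Lemma nbhs1P (x : R) (A : set R) : nbhs x A <->
  exists2 e : R, 0 < e & forall y, `|y - x| < e -> A y.
Proof.
split.
  move=> /nbhs_ballP[e /= e0 H]; exists e => // y hy; apply: H.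
  by rewrite -ball_normE /ball_ /= distrC.
case=> e e0 H; apply/nbhs_ballP; exists e => // y.
by rewrite /= -ball_normE /ball_ /= => hy; apply: H; rewrite distrC.
Qed.

Lemma openR (A : set R) : (forall x, A x -> exists2 e : R, 0 < e & forall y, `|y - x| < e -> A y) -> open A.
Proof. by move=> H; rewrite openE => x /H He; apply/nbhs1P. Qed.

Lemma openR2 (A : set (R * R)) : (forall p, A p -> exists2 e : R, 0 < e & forall x y, `|x - p.1| < e -> `|y - p.2| < e -> A (x, y)) -> open A.
Proof. by move=> H; rewrite openE => x /H He; apply/nbhs2P. Qed.

Lemma cont1P (f : R -> R) (x : R) : {for x, continuous f} <->
  forall e : R, 0 < e -> exists2 d : R, 0 < d & forall y, `|y - x| < d -> `|f y - f x| < e.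
Proof.
split.
  move=> /cvgrPdist_lt cf e /cf /nbhs1P[d d0 H]; exists d => // y /H.
  by rewrite distrC.
move=> H; apply/cvgrPdist_lt => e /H[d d0 H']; apply/nbhs1P; exists d => // y /H'.
by rewrite distrC.
Qed.

Lemma cont2P (f : R * R -> R) (p : R * R) : {for p, continuous f} <->
  forall e : R, 0 < e -> exists2 d : R, 0 < d & forall x y, `|x - p.1| < d -> `|y - p.2| < d -> `|f (x, y) - f p| < e.
Proof.
split.
  move=> /cvgrPdist_lt cf e /cf /nbhs2P[d d0 H]; exists d => // x y hx hy.
  by rewrite distrC; exact: H.
move=> H; apply/cvgrPdist_lt => e /H[d d0 H']; apply/nbhs2P; exists d => // x y hx hy.
by rewrite distrC; exact: H'.
Qed.

Lemma IVT_incr (f : R -> R) (a b v : R) : a <= b -> (forall z, a <= z <= b -> {for z, continuous f}) ->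
  f a <= v <= f b -> exists2 c, a <= c <= b & f c = v.
Proof.
move=> ab cf /andP[v1 v2]; have [||c] := @IVT R f a b v ab.
- by apply: continuous_in_subspaceT => z; rewrite inE /= in_itv /=; exact: cf.
- by rewrite ge_min v1 le_max v2 orbT.
- by rewrite in_itv /= => ci fc; exists c.
Qed.

(** The inverse solves k' = 1 / h'(k), hence is smooth by bootstrapping on the family reduced to
    [k]. *)
Lemma inverse_pos (h : R -> R) (a b : R) : smooth [set t : R | a < t < b] h ->
  (forall t, a < t < b -> 0 < 'D_1 h t) ->
  exists2 k : R -> R, forall t, a < t < b -> k (h t) = t &
    open (h @` [set t : R | a < t < b]) /\ smooth (h @` [set t : R | a < t < b]) k.
Proof.
move=> sh ph; set I := [set t : R | a < t < b]; set W := h @` I.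
have dh t : I t -> derivable h t 1 by exact: smooth_derivable.
have mono x y : I x -> I y -> x < y -> h x < h y.
  move=> /= /andP[ax xb] /andP[ay yb] xy.
  apply: (@incr_lt _ h x y) => //; move=> z /andP[z1 z2]; [apply: dh|apply: ph]; rewrite /I /=; lra.
have inj x y : I x -> I y -> h x = h y -> x = y.
  by move=> Ix Iy e; case: (ltgtP x y) => // xy; have := mono _ _ _ _ xy => /(_ ltac:(assumption) ltac:(assumption)); rewrite e ltxx.
pose k y := get [set t | I t /\ h t = y].
have kh t : I t -> k (h t) = t.
  move=> It; have : [set t' | I t' /\ h t' = h t] !=set0 by exists t.
  by move=> /getPex[It' e]; apply: inj.
have oW : open W.
  apply: openR => _ [t It <-].
  have [/andP[t1 t2]] := (It).
  pose e := Num.min (t - a) (b - t) / 2.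
  have [e0 ea eb] : [/\ 0 < e, a < t - e & t + e < b].
    by rewrite /e; case: (leP (t - a) (b - t)) => ?; split; lra.
  have I1 : I (t - e) by rewrite /I /=; lra.
  have I2 : I (t + e) by rewrite /I /=; lra.
  have h1 : h (t - e) < h t by apply: mono => //; lra.
  have h2 : h t < h (t + e) by apply: mono => //; lra.
  exists (Num.min (h t - h (t - e)) (h (t + e) - h t)); first by rewrite lt_min !subr_gt0 h1 h2.
  move=> y; rewrite lt_min !ltr_norml => /andP[/andP[y1 y2] /andP[y3 y4]].
  have [|||z zi <-] := @IVT_incr h (t - e) (t + e) y; [lra| |lra|].
  - by move=> z zi; apply: smooth_cont sh _; rewrite /=; lra.
  - by exists z => //; rewrite /I /=; lra.
exists k => //; split => //.
have Dk y : W y -> is_derive y 1 k ('D_1 h (k y))^-1.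
  case=> t It <-; rewrite kh //; apply: (@is_derive_inverse R h k).
  - near=> s; apply: kh; near: s; apply: open_nbhs_nbhs; split=> //; exact: open_itvoo.
  - near=> s; apply: (smooth_cont sh); near: s; apply: open_nbhs_nbhs; split=> //; exact: open_itvoo.
  - by apply: derivableP; exact: dh.
  - by rewrite gt_eqF // ph.
apply: (@smooth_ode _ _ _ [set k] oW) => // _ ->; split => [y /Dk[]//|n H].
have Wk y : W y -> I (k y) by case=> t It <-; rewrite kh.
have C1 := Ck_comp1 oW Wk (smooth_derive (1 : R) sh) (H _ erefl).
have C2 : is_Ck n W (fun y => ('D_1 h (k y))^-1).
  apply: (Ck_comp1 oW _ smooth_inv C1) => y Wy /=; rewrite gt_eqF //; exact/ph/Wk.
by apply: (Ck_ext oW _ C2) => y Wy; apply/esym/derive_val; exact: Dk.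
Unshelve. all: by end_near. Qed.

Lemma sign_const (f : R -> R) (a b : R) : (forall t, a < t < b -> {for t, continuous f}) ->
  (forall t, a < t < b -> f t != 0) ->
  (forall t, a < t < b -> 0 < f t) \/ (forall t, a < t < b -> f t < 0).
Proof.
move=> cf f0; case: (pselect (exists2 t, a < t < b & 0 < f t)) => [[t ti ft]|H]; last first.
  right=> t ti; rewrite ltNge le_eqVlt eq_sym (negbTE (f0 t ti)) /=; apply/negP => ft.
  by apply: H; exists t.
left=> s si; rewrite ltNge le_eqVlt (negbTE (f0 s si)) /=; apply/negP => fs.
have cf' : forall z, Num.min s t <= z <= Num.max s t -> a < z < b.
  by move=> z; case: (leP s t) => ? ?; lra.
have [|||c] := @IVT R f (Num.min s t) (Num.max s t) 0.
- by case: (leP s t) => ?; lra.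
- by apply: continuous_in_subspaceT => z; rewrite inE /= in_itv /= => /cf'; exact: cf.
- by case: (leP s t) => st; case: (leP (f _) (f _)) => ?; lra.
- by rewrite in_itv /= => /cf' /f0 /eqP.
Qed.

Lemma inverse_ne0 (h : R -> R) (a b : R) : smooth [set t : R | a < t < b] h ->
  (forall t, a < t < b -> 'D_1 h t != 0) ->
  exists2 k : R -> R, forall t, a < t < b -> k (h t) = t &
    open (h @` [set t : R | a < t < b]) /\ smooth (h @` [set t : R | a < t < b]) k.
Proof.
move=> sh nh; have oI := @open_itvoo R a b.
have ch t : a < t < b -> {for t, continuous ('D_1 h)} by move=> ti; apply: smooth_cont (smooth_derive _ sh) _.
case: (sign_const ch nh) => ph; first exact: inverse_pos.
have D t : a < t < b -> 'D_1 (fun t => - h t) t = - 'D_1 h t.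
  by move=> ti; apply: derive_val; apply: dN; apply: derivableP; exact: smooth_derivable sh ti.
have [||k kh [oW sk]] := @inverse_pos (fun t => - h t) a b.
- exact: smoothN.
- by move=> t ti; rewrite D // oppr_gt0; exact: ph.
set W := [set _ | _ in _] in oW sk.
have oW' : open (h @` [set t : R | a < t < b]).
  apply: openR => _ [t ti <-]; have Wt : W (- h t) by exists t.
  have /nbhs1P[e e0 H] : nbhs (- h t) W by exact: open_nbhs_nbhs.
  exists e => // y hy; have [|s si E] := H (- y); first by rewrite opprK addrC distrC.
  by exists s => //; apply: oppr_inj.
exists (fun y => k (- y)); first by move=> t ti; rewrite kh.
split=> //; apply: (smooth_comp1 oW' _ sk); last by apply: smoothN => //; exact: smooth_id.
by move=> _ [t ti <-]; exists t.
Qed.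

End Inverse.

(** * Shears along vertical lines *)

Section Shear.
Context {R : realType}.
Implicit Types (eta zeta : R * R -> R) (H K : R * R -> R * R).

Lemma cvg_near_neq0 (F : set_system R) {FF : Filter F} (B : R -> R) (b : R) : B h @[h --> F] --> b -> b != 0 ->
  \forall h \near F, B h != 0.
Proof.
move=> /cvgrPdist_lt H b0; have := H `|b|; rewrite normr_gt0 => /(_ b0); apply: filterS => h.
by apply: contraTneq => ->; rewrite subr0 ltxx.
Qed.

Lemma cvg_cramer (F : set_system R) {FF : Filter F} (A B : R -> R) (a b v1 v2 : R) : A h @[h --> F] --> a -> B h @[h --> F] --> b ->
  b != 0 -> (v2 - A h * v1) / B h @[h --> F] --> (v2 - a * v1) / b.
Proof.
move=> cA cB b0; apply: cvgM; last exact: cvgV.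
by apply: cvgB; [exact: cvg_cst|apply: cvgM; [exact: cA|exact: cvg_cst]].
Qed.

(** Implicit differentiation: [A] and [B] will be the two slopes of the shear that [zeta] inverts,
    and dividing the relation by [h * B h] isolates the difference quotient of [zeta]. *)
Lemma cramer_derive (zeta : R * R -> R) (p v : R * R) (A B : R -> R) (a b : R) :
  A h @[h --> (0 : R)^'] --> a -> B h @[h --> (0 : R)^'] --> b -> b != 0 ->
  (forall h : R, h * v.2 = A h * (h * v.1) + B h * (zeta (h *: v + p) - zeta p)) ->
  is_derive p v zeta ((v.2 - a * v.1) / b).
Proof.
move=> cA cB b0 EAB.
suff Hc : h^-1 *: ((zeta \o shift p) (h *: v) - zeta p) @[h --> 0^'] --> (v.2 - a * v.1) / b.
  by split; [apply/cvg_ex; eexists; exact: Hc|apply/cvg_lim].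
have Hc := @cvg_cramer _ _ A B a b v.1 v.2 cA cB b0.
have {}Hc := Hc (dnbhs_filter _); apply: cvg_trans Hc; apply: near_eq_cvg; near=> h.
have h0 : h != 0 by near: h; exact: nbhs_dnbhs_neq.
have B0 : B h != 0 by near: h; exact: cvg_near_neq0 cB b0.
apply: (mulIf B0); rewrite divfK //; apply: (mulfI h0).
rewrite /= mulrBr EAB !/(_ *: _) /=; by field.
Unshelve. all: by end_near. Qed.

Definition vshear eta zeta :=
  [/\ smooth [set: R * R] eta /\ smooth [set: R * R] zeta,
      forall x y, eta (x, zeta (x, y)) = y, forall x y, zeta (x, eta (x, y)) = y,
      forall z, 0 < 'D_(0, 1) eta z & forall z, 0 < 'D_(0, 1) zeta z].

(** Increasing on each vertical line and the identity far out, [eta] is a bijection of the line.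
    Monotonicity traps the inverse between nearby values, hence continuity; implicit differentiation
    expresses its derivatives by those of [eta] at [zeta], and smoothness follows by induction on
    the order. *)
Lemma vshear_exists eta : smooth [set: R * R] eta -> (forall z, 0 < 'D_(0, 1) eta z) ->
  (exists M : R, forall x y, M <= `|y| -> eta (x, y) = y) -> exists zeta, vshear eta zeta.
Proof.
move=> se pe [M HM].
have dy x y : derivable (fun s => eta (x, s)) y 1 by rewrite -derivable01E; exact: (smooth_derivable se Logic.I).
have mono x y y' : y < y' -> eta (x, y) < eta (x, y').
  move=> yy; have Dpos z : y <= z <= y' -> 0 < 'D_1 (fun s => eta (x, s)) z by move=> _; rewrite -D01E; exact: pe.
  exact: (incr_lt (fun z _ => dy x z) Dpos (lexx y) yy (lexx y')).
have lt_eta x y y' : (eta (x, y) < eta (x, y')) = (y < y').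
  case: (ltgtP y y') => [|h|->]; [exact: mono| |exact: ltxx].
  by apply/negbTE; rewrite -leNgt ltW // mono.
have inj x y y' : eta (x, y) = eta (x, y') -> y = y'.
  by move=> E1; case: (ltgtP y y') => // /(mono x); rewrite E1 ltxx.
have surj x y : exists s, eta (x, s) = y.
  have [N NE] : exists N, N = Num.max `|M| `|y| by eexists.
  have N0 : 0 <= N by rewrite NE le_max normr_ge0.
  have MN : M <= N by rewrite NE le_max ler_norm.
  have yN : `|y| <= N by rewrite NE le_max lexx orbT.
  have [|z _||c _ cy] := @IVT_incr R (fun s => eta (x, s)) (- N) N y; last by exists c.
  - by clear -N0; lra.
  - by apply: differentiable_continuous; apply/derivable1_diffP; exact: dy.
  - by rewrite !HM ?normrN ?ger0_norm // -ler_norml.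
(* The default 0 is never taken, by [surj]. *)
pose zeta (z : R * R) : R := xget 0 [set s | eta (z.1, s) = z.2].
have Hz x y : eta (x, zeta (x, y)) = y.
  by rewrite /zeta; case: xgetP => [s -> //|H]; have [s sy] := surj x y; case: (H s).
have Hz' w : eta (w.1, zeta w) = w.2 by case: w => x y; exact: Hz.
have zH x y : zeta (x, eta (x, y)) = y by apply: (inj x); rewrite Hz.
have cz p : {for p, continuous zeta}.
  case: p => x0 y0; apply/cont2P => e e0; have [s0 s0E] : exists s0, s0 = zeta (x0, y0) by eexists.
  have lo : eta (x0, s0 - e) < y0 by rewrite -[ltRHS](Hz x0 y0) -s0E; apply: mono; clear -e0; lra.
  have hi : y0 < eta (x0, s0 + e) by rewrite -[ltLHS](Hz x0 y0) -s0E; apply: mono; clear -e0; lra.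
  have [a aE] : exists a, a = (y0 - eta (x0, s0 - e)) / 2 by eexists.
  have [b bE] : exists b, b = (eta (x0, s0 + e) - y0) / 2 by eexists.
  have a0 : 0 < a by clear -aE lo; lra.
  have b0 : 0 < b by clear -bE hi; lra.
  have ce q : {for q, continuous eta} by exact: (smooth_cont se Logic.I).
  have [d1 d10 H1] := (cont2P _ _).1 (ce (x0, s0 - e)) a a0.
  have [d2 d20 H2] := (cont2P _ _).1 (ce (x0, s0 + e)) b b0.
  exists (Num.min (Num.min d1 d2) (Num.min a b)); first by rewrite !lt_min d10 d20 a0 b0.
  move=> x y /=; rewrite !lt_min => /andP[/andP[x1 x2] _] /andP[_ /andP[ya yb]].
  have {H1}H1 := H1 x (s0 - e) x1 ltac:(by rewrite /= subrr normr0).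
  have {H2}H2 := H2 x (s0 + e) x2 ltac:(by rewrite /= subrr normr0).
  move: ya yb H1 H2; rewrite !ltr_norml /= => ya yb H1 H2.
  have h1 : s0 - e < zeta (x, y) by rewrite -(lt_eta x) Hz; clear -ya H1 aE; lra.
  have h2 : zeta (x, y) < s0 + e by rewrite -(lt_eta x) Hz; clear -yb H2 bE; lra.
  by rewrite -s0E; clear -h1 h2; lra.
have dz p v : is_derive p v zeta ((v.2 - 'D_(1, 0) eta (p.1, zeta p) * v.1) / 'D_(0, 1) eta (p.1, zeta p)).
  set q := (p.1, zeta p).
  have n0 : 'D_(0, 1) eta q != 0 by rewrite gt_eqF // pe.
  pose A (h : R) := slope1 eta q ((h *: v + p).1, zeta (h *: v + p)).
  pose B (h : R) := slope2 eta q ((h *: v + p).1, zeta (h *: v + p)).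
  have cq : ((h *: v + p).1, zeta (h *: v + p)) @[h --> (0 : R)^'] --> q.
    apply: cvg_pair2; last by apply: line_cvg; exact: cz.
    by apply: (@line_cvg R _ (fun z : R * R => z.1)); exact: cvg_fst.
  have cA : A h @[h --> 0^'] --> 'D_(1, 0) eta q.
    apply: cvg_comp cq _; apply: (@slope1_cvg R eta q setT (@openT _) Logic.I).
      by move=> w _; exact: (smooth_derivable se Logic.I).
    exact: (smooth_cont (smooth_derive ((1, 0) : R * R) se) Logic.I).
  have cB : B h @[h --> 0^'] --> 'D_(0, 1) eta q.
    apply: cvg_comp cq _; apply: (@slope2_cvg R eta q setT (@openT _) Logic.I).
      by move=> w _; exact: (smooth_derivable se Logic.I).
    exact: (smooth_cont (smooth_derive ((0, 1) : R * R) se) Logic.I).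
  have EAB (h : R) : h * v.2 = A h * (h * v.1) + B h * (zeta (h *: v + p) - zeta p).
    have S : (h *: v + p).2 - p.2 = A h * ((h *: v + p).1 - p.1) + B h * (zeta (h *: v + p) - zeta p).
      by rewrite -(Hz' (h *: v + p)) -[p.2](Hz' p); exact: slope12E.
    by rewrite -[h * v.2](addrK p.2) -[h * v.1](addrK p.1); exact: S.
  exact: cramer_derive cA cB n0 EAB.
have oT := @openT (R * R)%type.
have sz : smooth [set: R * R] zeta.
  elim=> [|k IH]; first by move=> p _; exact: cz.
  split=> [p _|v p _|v]; [exact: cz|by apply: ex_derive; exact: dz|].
  have Cc (f : R * R -> R) : smooth setT f -> is_Ck k [set: R * R] (fun p => f (p.1, zeta p)).
    by move=> sf; apply: (Ck_comp2 oT oT (fun _ _ => Logic.I) sf) => //; exact: (@smooth_fst R setT).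
  have C1 := Cc _ (smooth_derive ((1, 0) : R * R) se).
  have C2 := Cc _ (smooth_derive ((0, 1) : R * R) se).
  have CV : is_Ck k [set: R * R] (fun p => ('D_(0, 1) eta (p.1, zeta p))^-1).
    by apply: (Ck_comp1 oT _ smooth_inv C2) => p _ /=; rewrite gt_eqF.
  have CC := CkM oT (CkD oT (Ck_cst k setT (v.2 : R)) (CkN oT (CkM oT C1 (Ck_cst k setT (v.1 : R))))) CV.
  by apply: (Ck_ext oT _ CC) => p _; case: (dz p v).
exists zeta; split=> // z.
by have [_ ->] := dz z (0, 1); rewrite /= mulr0 subr0 divr_gt0.
Unshelve. all: exact: 0.
Qed.

End Shear.

(** * Profiles, strands and layers *)

Section Profiles.
Context {R : realType}.
Implicit Types (g : R -> R) (X L : seq R) (x y z u : R).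

(** A parametrisation of a level by a side of the rectangle. Being the identity outside a compact
    part of ]0, 1[, it closes up smoothly around the cylinder. *)
Definition profile g := [/\ smooth [set: R] g, forall x, 0 < 'D_1 g x &
  exists2 e : R, 0 < e & forall x, (x <= e) || (1 - e <= x) -> g x = x].

Lemma profile_derivable g x : profile g -> derivable g x 1.
Proof. by move=> [sg _ _]; exact: smooth_derivable sg I. Qed.

Lemma profile_lt g x y : profile g -> (g x < g y) = (x < y).
Proof.
move=> pg; have mono a b : a < b -> g a < g b.
  move=> ab; apply: (@incr_lt _ g a b) => //.
  - by move=> z _; exact: profile_derivable.
  - by move=> z _; case: pg.
case: (ltgtP x y) => [/mono -> //|/mono h|->]; last exact: ltxx.
by apply/negbTE; rewrite -leNgt ltW.
Qed.

Lemma profile_inj g : profile g -> injective g.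
Proof.
by move=> pg x y e; case: (ltgtP x y) => // xy; move: (xy); rewrite -(profile_lt _ _ pg) e ltxx.
Qed.

Lemma profile_surj g u : profile g -> 0 < u < 1 -> exists2 x, 0 < x < 1 & g x = u.
Proof.
move=> pg ui; have [_ _ [e e0 He]] := pg.
have g0 : g 0 = 0 by apply: He; rewrite (ltW e0).
have g1 : g 1 = 1 by apply: He; rewrite orbC gerBl (ltW e0).
have [|||x xi gx] := @IVT_incr R g 0 1 u; [lra| |rewrite g0 g1; lra|].
  by move=> z _; apply: derivable_cont; exact: profile_derivable.
exists x => //; rewrite !lt_neqAle.
have x0 : x != 0 by apply/eqP => x0; move: gx ui; rewrite x0 g0 => <-; rewrite ltxx.
have x1 : x != 1 by apply/eqP => x1; move: gx ui; rewrite x1 g1 => <-; rewrite ltxx andbF.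
by rewrite eq_sym x0 x1.
Qed.

Lemma profile_id : profile (fun x => x).
Proof.
split; [exact: smooth_id| |by exists 1].
by move=> x; rewrite (derive_val (is_derive := dI x)).
Qed.

Lemma half_min (u v : R) : 0 < u -> 0 < v -> exists2 d : R, 0 < d & 2 * d <= u /\ 2 * d <= v.
Proof.
by move=> u0 v0; case: (leP u v) => uv; [exists (u / 2)|exists (v / 2)]; try (split; lra); lra.
Qed.

Lemma stepl (a h x : R) : 0 < h -> x <= a -> step ((x - a) / h) = 0.
Proof. by move=> h0 xa; rewrite step0 // pmulr_lle0 ?invr_gt0 // subr_le0. Qed.
Lemma stepr (a h x : R) : 0 < h -> a + h <= x -> step ((x - a) / h) = 1.
Proof. by move=> h0 xa; rewrite step1 // ler_pdivlMr // mul1r lerBrDl. Qed.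
Lemma dstepl (a h x : R) : 0 < h -> x < a -> 'D_1 step ((x - a) / h) = 0.
Proof. by move=> h0 xa; rewrite step_const0 // pmulr_llt0 ?invr_gt0 // subr_lt0. Qed.
Lemma dstepr (a h x : R) : 0 < h -> a + h < x -> 'D_1 step ((x - a) / h) = 0.
Proof. by move=> h0 xa; rewrite step_const1 // ltr_pdivlMr // mul1r ltrBrDl. Qed.

Lemma convex_gt0 (S a b : R) : 0 <= S -> S <= 1 -> 0 < a -> 0 < b -> 0 < (1 - S) * a + S * b.
Proof.
move=> S0 S1 a0 b0; rewrite le_eqVlt in S0; case/orP: S0 => [/eqP <-|S0].
  by rewrite subr0 mul1r mul0r addr0.
by apply: ltr_wpDl; [apply: mulr_ge0; lra|exact: mulr_gt0].
Qed.

Lemma blend_derive (p q : R -> R) (a h x dp dq : R) :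
  is_derive x 1 p dp -> is_derive x 1 q dq ->
  is_derive x 1 (fun z => p z + step ((z - a) / h) * (q z - p z))
    ((1 - step ((x - a) / h)) * dp + step ((x - a) / h) * dq + 'D_1 step ((x - a) / h) / h * (q x - p x)).
Proof.
move=> Dp Dq.
have Da : is_derive x 1 (fun z : R => (z - a) / h) (1 / h).
  have := dM (dB (dI x) (dC x 1 a)) (dC x 1 h^-1).
  by move=> H; apply: (is_derive_eq H); rewrite mulr0 addr0 subr0.
have ca : {for x, continuous (fun z : R => (z - a) / h)}.
  by apply: derivable_cont; case: Da.
have Ds := @d1comp _ step _ (fun z : R => (z - a) / h) x 1 _ ca (@derivable_step R _) Da.
by apply: (is_derive_eq (dD Dp (dM Ds (dB Dq Dp)))); ring.
Qed.

Lemma smooth_blend (p q : R -> R) (a h : R) : smooth [set: R] p -> smooth [set: R] q ->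
  smooth [set: R] (fun z => p z + step ((z - a) / h) * (q z - p z)).
Proof.
have oT := @openT R; move=> sp sq; apply: smoothD => //; apply: smoothM => //; last exact: smoothB.
by apply: smooth_step => //; apply: smoothM => //; [apply: smoothB => //; [exact: smooth_id|exact: smooth_cst]|exact: smooth_cst].
Qed.

Lemma is_derive_affine (l e x0 x : R) : is_derive x 1 (fun z : R => l + e * (z - x0)) e.
Proof.
by apply: (is_derive_eq (dD (dC x 1 l) (dZ e (dB (dI x) (dC x 1 x0))))); ring.
Qed.

Lemma smooth_affine (l e x0 : R) : smooth [set: R] (fun z : R => l + e * (z - x0)).
Proof.
have oT := @openT R; apply: smoothD => //; first exact: smooth_cst.
by apply: smoothM => //; [exact: smooth_cst|apply: smoothB => //; [exact: smooth_id|exact: smooth_cst]].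
Qed.

(* Increasing interpolation by a staircase: near each X`_k the slope is e, and
   the rest of the rise happens between consecutive nodes. *)
Lemma stair X L (e : R) : size X = size L -> sorted <%R X ->
  (forall x, x \in X -> 0 < x < 1) -> (forall x, x \in L -> e < x < 1 - e) -> 0 < e < 1 ->
  (forall k, (k.+1 < size X)%N -> e * (X`_k.+1 - X`_k) <= L`_k.+1 - L`_k) ->
  exists g, [/\ profile g, [seq g x | x <- X] = L &
    forall k, (k.+1 < size X)%N -> e * (X`_k.+1 - X`_k) = L`_k.+1 - L`_k ->
      forall x, X`_k <= x <= X`_k.+1 -> g x = L`_k + e * (x - X`_k)].
Proof.
move=> sXL sX X01 L01 /andP[e0 e1] gap.
case: (posnP (size X)) => [X0|Xn0].
  exists (fun x => x); split; first exact: profile_id.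
    by rewrite (size0nil X0); apply/esym/size0nil; rewrite -sXL X0.
  by move=> k; rewrite X0.
have XP k : (k < size X)%N -> 0 < X`_k < 1 by move=> kn; apply/X01/mem_nth.
have LP k : (k < size X)%N -> e < L`_k < 1 - e by move=> kn; apply/L01/mem_nth; rewrite -sXL.
have Xlt k : (k.+1 < size X)%N -> X`_k < X`_k.+1.
  by move=> kn; apply: (sortedP 0 sX).
have eX k : (k < size X)%N -> 0 < e * X`_k < e.
  move=> kn; have /andP[x1 x2] := XP k kn; rewrite mulr_gt0 //=.
  by rewrite -[ltRHS]mulr1 ltr_pM2l.
(* Beyond its last node the partial map is a line of slope [e]; the next node only asks for a
   further rise, added before that node is reached. *)
have part j : (j < size X)%N -> exists g, [/\ smooth [set: R] g /\ (forall x, 0 < 'D_1 g x),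
    exists2 d : R, 0 < d & forall x, x <= d -> g x = x,
    forall x, X`_j <= x -> g x = L`_j + e * (x - X`_j),
    forall k, (k <= j)%N -> g X`_k = L`_k &
    forall k, (k < j)%N -> e * (X`_k.+1 - X`_k) = L`_k.+1 - L`_k ->
      forall x, X`_k <= x <= X`_k.+1 -> g x = L`_k + e * (x - X`_k)].
  elim: j => [|j IH] jn.
    have /andP[x1 x2] := XP 0%N jn; have /andP[l1 l2] := LP 0%N jn; have /andP[y1 y2] := eX 0%N jn.
    set x0 := X`_0 in x1 x2 y1 y2 *; set l0 := L`_0 in l1 l2 *.
    (* With this [d] the line [q] is above the identity on [0, 2d], where the blending takes place.
       Labels exceed [e] and nodes are below 1, so [l0 - e * x0] is positive. *)
    have [||d d0 [dx dl]] := @half_min x0 (l0 - e * x0); [by []|lra|].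
    pose q := fun z : R => l0 + e * (z - x0).
    pose g := fun z : R => z + step ((z - d) / d) * (q z - z).
    have Dg x := @blend_derive (fun z => z) q d d x 1 e (dI x) (is_derive_affine l0 e x0 x).
    have gl x : x <= d -> g x = x.
      by move=> xd; rewrite /g stepl // mul0r addr0.
    have gr x : 2 * d <= x -> g x = q x.
      by move=> xd; rewrite /g stepr ?mul1r ?subrKC // -mulr2n -mulr_natl.
    exists g; split.
    - split; first by apply: smooth_blend; [exact: smooth_id|exact: smooth_affine].
      move=> x; rewrite (derive_val (is_derive := Dg x)).
      have S0 := step_ge0 ((x - d) / d); have S1 := step_le1 ((x - d) / d).
      have h1 : 0 <= 'D_1 step ((x - d) / d) / d * (q x - x).
        case: (leP x (2 * d)) => xd; last first.
          by rewrite dstepr ?mul0r //; lra.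
        case: (leP 0 x) => x0'; last first.
          by rewrite dstepl ?mul0r //; lra.
        apply: mulr_ge0; first by apply: divr_ge0; [exact: step_incr|exact: ltW].
        by rewrite /q; nra.
      have h2 := convex_gt0 S0 S1 ltr01 e0.
      exact: ltr_wpDr.
    - by exists d.
    - by move=> x xx; apply: gr; lra.
    - by move=> k; rewrite leqn0 => /eqP ->; rewrite gr // /q subrr mulr0 addr0.
    - by [].
  have jn' := ltnW jn; have [g [[sg pg] gl gr gX gA]] := IH jn'.
  have xlt := Xlt j jn; have gp := gap j jn.
  set a := X`_j in xlt gp *; set b := X`_j.+1 in xlt gp *.
  (* The rise still missing at the next node; it vanishes exactly when the gap is to be affine of
     slope [e]. *)
  pose hh := (L`_j.+1 - L`_j) - e * (b - a).
  pose q := fun z : R => g z + hh.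
  pose g' := fun z : R => g z + step ((z - a) / (b - a)) * (q z - g z).
  have ba : 0 < b - a by lra.
  have dg x : is_derive x 1 g ('D_1 g x) by apply: derivableP; exact: smooth_derivable sg I.
  have dq x : is_derive x 1 q ('D_1 g x) by apply: (is_derive_eq (dD (dg x) (dC x 1 hh))); rewrite addr0.
  have Dg x := @blend_derive g q a (b - a) x _ _ (dg x) (dq x).
  have g'l x : x <= a -> g' x = g x.
    by move=> xd; rewrite /g' stepl // mul0r addr0.
  have g'r x : b <= x -> g' x = L`_j.+1 + e * (x - b).
    move=> xd; rewrite /g' stepr ?mul1r ?subrKC //.
    by rewrite /q /hh gr; [rewrite -/a; ring|rewrite -/a; lra].
  exists g'; split.
  - split; first by apply: smooth_blend => //; apply: smoothD; [exact: openT|by []|exact: smooth_cst].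
    move=> x; rewrite (derive_val (is_derive := Dg x)).
    have -> : forall S D : R, (1 - S) * D + S * D = D by move=> *; ring.
    apply: ltr_wpDr; last exact: pg.
    apply: mulr_ge0; first by apply: divr_ge0; [exact: step_incr|exact: ltW].
    by rewrite /q addrC addKr /hh subr_ge0.
  - have [d d0 Hd] := gl; exists (Num.min d a).
      by rewrite lt_min d0; have /andP[] := XP _ jn'.
    by move=> x; rewrite le_min => /andP[xd xa]; rewrite g'l // Hd.
  - exact: g'r.
  - move=> k; rewrite leq_eqVlt => /orP[/eqP ->|].
      by rewrite g'r -/b // subrr mulr0 addr0.
    rewrite ltnS => kj; rewrite g'l ?gX //; rewrite /a.
    apply: (sorted_leq_nth le_trans le_refl 0 (sub_sorted (@ltW _ _) sX)) => //; rewrite inE ?(leq_ltn_trans kj) //.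
  - move=> k; rewrite ltnS leq_eqVlt => /orP[/eqP ->|kj].
      rewrite -/a -/b => E x /andP[xa xb].
      by rewrite /g' /q /hh E subrr addr0 subrr mulr0 addr0 gr.
    move=> E x /andP[xa xb]; rewrite g'l; first by apply: gA => //; rewrite xa xb.
    apply: le_trans xb _; rewrite /a.
    apply: (sorted_leq_nth le_trans le_refl 0 (sub_sorted (@ltW _ _) sX)) => //; rewrite inE ?(leq_ltn_trans kj) //.
set n := (size X).-1; have nX : (n < size X)%N by rewrite /n prednK.
have [g [[sg pg] [d1 d10 gl] gr gX gA]] := part n nX.
have /andP[x1 x2] := XP n nX; have /andP[l1 l2] := LP n nX; have /andP[y1 y2] := eX n nX.
set a := X`_n in x1 x2 y1 y2 gr *; set l := L`_n in l1 l2 gr *.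
(* At the right end the last line is below the identity on the blending interval, so that returning
   to the identity again only adds to the slope. *)
have [||d d0 [dx' dl']] := @half_min (1 - a) (1 - (l + e * (1 - a))); [lra|lra|].
have [dx dl] : a <= 1 - 2 * d /\ l + e * (1 - a) <= 1 - 2 * d by split; lra.
pose q := fun z : R => z.
pose g' := fun z : R => g z + step ((z - (1 - 2 * d)) / d) * (q z - g z).
have dg x : is_derive x 1 g ('D_1 g x) by apply: derivableP; exact: smooth_derivable sg I.
have Dg x := @blend_derive g q (1 - 2 * d) d x _ _ (dg x) (dI x).
have g'l x : x <= 1 - 2 * d -> g' x = g x.
  by move=> xd; rewrite /g' stepl // mul0r addr0.
have g'r x : 1 - d <= x -> g' x = x.
  by move=> xd; rewrite /g' stepr ?mul1r ?subrKC //; lra.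
have Xa k : (k < size X)%N -> X`_k <= a.
  move=> kn; apply: (sorted_leq_nth le_trans le_refl 0 (sub_sorted (@ltW _ _) sX)); rewrite ?inE //.
  by rewrite /n -ltnS prednK.
exists g'; split.
- split.
  + by apply: smooth_blend => //; exact: smooth_id.
  + move=> x; rewrite (derive_val (is_derive := Dg x)).
    have S0 := step_ge0 ((x - (1 - 2 * d)) / d); have S1 := step_le1 ((x - (1 - 2 * d)) / d).
    have h1 : 0 <= 'D_1 step ((x - (1 - 2 * d)) / d) / d * (q x - g x).
      case: (leP (1 - 2 * d) x) => xd; last first.
        by rewrite dstepl ?mul0r //; lra.
      case: (leP x 1) => x1'; last first.
        by rewrite dstepr ?mul0r //; lra.
      apply: mulr_ge0; first by apply: divr_ge0; [exact: step_incr|exact: ltW].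
      by rewrite /q gr; [nra|lra].
    have h2 := convex_gt0 S0 S1 (pg x) ltr01.
    exact: ltr_wpDr.
  + exists (Num.min (Num.min d d1) (1 - 2 * d)).
      by rewrite !lt_min d0 d10 /=; lra.
    move=> x /orP[]; rewrite ?le_min.
      by move=> /andP[/andP[xd xd1] xd2]; rewrite g'l // gl.
    by move=> h; apply: g'r; apply: le_trans h; rewrite lerB // !ge_min lexx.
- apply: (@eq_from_nth _ 0); first by rewrite size_map.
  move=> k; rewrite size_map => kn; rewrite (nth_map 0) // g'l ?gX //.
    by rewrite /n -ltnS prednK.
  by apply: le_trans dx; exact: Xa.
- move=> k kn E x /andP[xa xb]; rewrite g'l; last by apply: le_trans dx; apply: le_trans xb (Xa _ kn).
  by apply: gA => //; [rewrite /n -ltnS prednK|rewrite xa xb].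
Qed.

Lemma min_gap L : sorted <%R L -> exists2 w : R, 0 < w & forall k, (k.+1 < size L)%N -> w <= L`_k.+1 - L`_k.
Proof.
elim: L => [|x [|y L] IH] /=; [by exists 1|by exists 1|].
move=> /andP[xy /IH[w w0 Hw]]; exists (Num.min w (y - x)); first by rewrite lt_min w0 subr_gt0.
by case=> [|k] kn; rewrite ge_min /= ?lexx ?orbT // (Hw k).
Qed.

End Profiles.

(** * Strands over an interval of levels, and how to follow them *)

Section Sweep.
Context {R : realType}.
Implicit Types (G : set (R * R)) (f : nat -> R -> R) (g : R -> R) (X : seq R) (x y z t u a b c w m al be ue : R).

(** The drawing lives in this box. The columns beside it leave room for parametrisations to return
    to the identity, and the levels -1/2 and 1/2, at distance 1/10 from it, bound the closing
    discs. *)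
Definition Bo : set (R * R) := [set z | 1 / 8 < z.1 < 7 / 8 /\ - (2 / 5) < z.2 < 2 / 5].

(** Strands are graphs over the vertical coordinate: [f k y] is the abscissa of strand [k] at level
    [y]. *)
Definition graphic G al be n f :=
  [/\ forall k, (k < n)%N -> smooth [set y : R | al < y < be] (f k),
      forall j k y, (j < k < n)%N -> al < y < be -> f j y < f k y &
      forall u y, al < y < be -> (G (u, y) <-> u \in mkseq (fun k => f k y) n)].

(* A cylinder at the levels [a, b] of the plane: (x, t) goes to
   (F (x, t), a + (b - a) t). *)
Record layer G (P : pattern R) (F : R * R -> R) a b : Prop := Layer {
  ly_wf : pattern_wf P;
  ly_smooth : smooth [set z : R * R | - (1 / 4) < z.2 < 5 / 4] F;
  ly_id : exists2 e : R, 0 < e & forall x t, (x <= e) || (1 - e <= x) -> F (x, t) = x;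
  ly_incr : forall x t, 0 <= t <= 1 -> 0 < 'D_(1, 0) F (x, t);
  ly_level : [/\ - (1 / 2) <= a, a < b & b <= 1 / 2];
  ly_graph : forall x t, 0 <= x <= 1 -> 0 <= t <= 1 ->
    (G (F (x, t), a + (b - a) * t) <-> pattern_graph P x t)
}.

Definition marks G a g X :=
  [/\ sorted <%R X, forall x, x \in X -> 0 < x < 1 &
      forall x, 0 <= x <= 1 -> (G (g x, a) <-> x \in X)].

(** The head of the list is the top layer, as in a composite. Successive layers agree as maps on the
    whole common level, not only at marked points, so that boundary circles get identified
    pointwise. *)
Inductive reach G : seq (pattern R * (R * R -> R) * R * R) -> R -> (R -> R) -> seq R -> Prop :=
| Reach0 g : (forall x, g x = x) -> reach G [::] (- (1 / 2)) g [::]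
| ReachS l P F a b g g' : reach G l a g (source P) -> layer G P F a b ->
    (forall x, F (x, 0) = g x) -> (forall x, F (x, 1) = g' x) ->
    reach G ((P, F, a, b) :: l) b g' (target P).

Lemma open_strip (p q : R) : open [set z : R * R | p < z.2 < q].
Proof.
apply: openR2 => -[x0 y0] /= /andP[h1 h2].
exists (Num.min (y0 - p) (q - y0)); first by rewrite lt_min !subr_gt0 h1 h2.
by move=> x y _; rewrite lt_min !ltr_norml => /andP[/andP[? ?] /andP[? ?]]; lra.
Qed.

Lemma layer_profile G P F a b t : layer G P F a b -> 0 <= t <= 1 -> profile (fun x => F (x, t)).
Proof.
move=> ly ti; have [wf sF [e e0 He] iF _ _] := ly; split.
- apply: (@smooth_comp2 _ _ [set z : R * R | - (1 / 4) < z.2 < 5 / 4] setT F (fun x => x) (fun=> t)).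
  + exact: openT.
  + exact: open_strip.
  + by move=> x _ /=; lra.
  + exact: sF.
  + exact: smooth_id.
  + exact: smooth_cst.
- by move=> x; rewrite -D10E; exact: iF.
- by exists e => // x /He.
Qed.

Lemma sorted_mkseq (h : nat -> R) n : (forall j k, (j < k < n)%N -> h j < h k) -> sorted <%R (mkseq h n).
Proof.
move=> H; apply/(sortedP 0) => k; rewrite size_mkseq => kn.
by rewrite !nth_mkseq // ?(ltnW kn) //; apply: H; rewrite ltnSn kn.
Qed.

Lemma mem_mkseqP (h : nat -> R) n u : reflect (exists2 k, (k < n)%N & u = h k) (u \in mkseq h n).
Proof.
apply: (iffP mapP) => [[k]|[k kn ->]]; first by rewrite mem_iota add0n => /andP[_ kn] ->; exists k.
by exists k => //; rewrite mem_iota add0n.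
Qed.

(** Both lists are strictly increasing and have the same members, the abscissae of [G] at level
    [a]. *)
Lemma marks_seq G al be n f a g X : G `<=` Bo -> profile g -> marks G a g X ->
  graphic G al be n f -> al < a < be -> [seq g x | x <- X] = mkseq (fun k => f k a) n.
Proof.
move=> GB pg [sX X01 mX] [_ sf Gf] ai; apply: lt_sorted_eq.
- by apply: homo_sorted sX => x y; rewrite profile_lt.
- by apply: sorted_mkseq => j k jk; exact: sf.
- move=> u; apply/idP/idP => [/mapP[x xX ->]|/Gf Gu].
    by apply/Gf => //; apply/mX => //; have /andP[/ltW-> /ltW->] := X01 x xX.
  have Gu' := Gu ai; have [/= u01 _] := GB _ Gu'.
  have [|x x01 gx] := @profile_surj R g u pg; first by lra.
  by rewrite -gx map_f //; apply/mX; [lra|rewrite gx].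
Qed.

Lemma seq_marks G al be n f a g X : profile g -> sorted <%R X -> (forall x, x \in X -> 0 < x < 1) ->
  graphic G al be n f -> al < a < be -> [seq g x | x <- X] = mkseq (fun k => f k a) n -> marks G a g X.
Proof.
move=> pg sX X01 [_ _ Gf] ai E; split=> // x _.
by rewrite Gf // -E (mem_map (profile_inj pg)).
Qed.

Lemma fin_pos n (P : nat -> R -> Prop) : (forall k, (k < n)%N -> exists2 d : R, 0 < d & P k d) ->
  (forall k (d d' : R), 0 < d' -> d' <= d -> P k d -> P k d') -> exists2 d : R, 0 < d & forall k, (k < n)%N -> P k d.
Proof.
move=> H mono; elim: n H => [|n IH] H; first by exists 1.
have [k kn|d d0 Hd] := IH; first by apply: H; exact: ltnW.
have [d' d'0 Hd'] := H n (ltnSn n).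
exists (Num.min d d'); first by rewrite lt_min d0.
move=> k; rewrite ltnS leq_eqVlt => /orP[/eqP ->|kn].
  by apply: mono Hd'; rewrite ?lt_min ?d0 // ge_min lexx orbT.
by apply: mono (Hd _ kn); rewrite ?lt_min ?d0 // ge_min lexx.
Qed.

(* Moves f k y0 to f k y for each k, scales by m about ue, and is the identity
   away from these points. *)
Definition Gh n f c w ue m (y0 : R) y u : R :=
  u + \sum_(k < n) plateau ((u - f k c) / w) * (f k y - f k y0)
  + (m - 1) * ((u - ue) * plateau ((u - ue) / w)).

Lemma is_derive_plateau (q w u : R) : is_derive u 1 (fun v : R => plateau ((v - q) / w)) ('D_1 plateau ((u - q) / w) / w).
Proof.
have Da : is_derive u 1 (fun z : R => (z - q) / w) (1 / w).
  have := dM (dB (dI u) (dC u 1 q)) (dC u 1 w^-1).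
  by move=> H; apply: (is_derive_eq H); rewrite mulr0 addr0 subr0.
have ca : {for u, continuous (fun z : R => (z - q) / w)} by apply: derivable_cont; case: Da.
have Ds := @d1comp _ plateau _ (fun z : R => (z - q) / w) u 1 _ ca (@derivable_plateau R _) Da.
by apply: (is_derive_eq Ds); rewrite mul1r.
Qed.

(** The three terms contribute 1, at least -1/4 by the choice of [mu], and at least -1/2 by
    [plateau_sign]. *)
Lemma Gh_derive n f c w ue m y0 y (C mu : R) u : 0 < w -> (forall v : R, `|'D_1 plateau v| <= C) ->
  (forall k, (k < n)%N -> `|f k y - f k y0| <= mu) -> n%:R * C * mu <= w / 4 -> 1 / 2 <= m <= 1 ->
  exists2 D : R, 1 / 4 <= D & is_derive u 1 (Gh n f c w ue m y0 y) D.
Proof.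
move=> w0 HC Hmu Hn /andP[m1 m2].
have Dk (k : 'I_n) : is_derive u 1 (fun v => plateau ((v - f k c) / w) * (f k y - f k y0))
   ('D_1 plateau ((u - f k c) / w) / w * (f k y - f k y0)).
  by apply: (is_derive_eq (dM (is_derive_plateau (f k c) w u) (dC u 1 (f k y - f k y0)))); rewrite mulr0 addr0.
have De : is_derive u 1 (fun v => (m - 1) * ((v - ue) * plateau ((v - ue) / w)))
   ((m - 1) * (plateau ((u - ue) / w) + (u - ue) / w * 'D_1 plateau ((u - ue) / w))).
  apply: (is_derive_eq (dZ (m - 1) (dM (dB (dI u) (dC u 1 ue)) (is_derive_plateau ue w u)))).
  by rewrite subr0 mul1r; congr (_ * (_ + _)); ring.
have D := dD (dD (dI u) (d_sum (index_enum _) Dk)) De.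
exists (1 + \sum_(k < n) 'D_1 plateau ((u - f k c) / w) / w * (f k y - f k y0) +
   (m - 1) * (plateau ((u - ue) / w) + (u - ue) / w * 'D_1 plateau ((u - ue) / w))) => //.
have S : `|\sum_(k < n) 'D_1 plateau ((u - f k c) / w) / w * (f k y - f k y0)| <= 1 / 4.
  apply: (le_trans (ler_norm_sum _ _ _)).
  apply: (@le_trans _ _ (\sum_(k < n) C / w * mu)).
    apply: ler_sum => k _; rewrite !normrM normfV (gtr0_norm w0); apply: ler_pM => //.
    - by rewrite divr_ge0 // ltW.
    - by rewrite ler_pM2r ?invr_gt0.
    - exact: Hmu.
  rewrite sumr_const card_ord -[_ *+ n]mulr_natl.
  have -> : n%:R * (C / w * mu) = n%:R * C * mu / w by ring.
  by rewrite ler_pdivrMr //; lra.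
have e1 : plateau ((u - ue) / w) + (u - ue) / w * 'D_1 plateau ((u - ue) / w) <= 1.
  by have := plateau_le1 ((u - ue) / w); have := plateau_sign ((u - ue) / w); lra.
move: S; rewrite ler_norml => /andP[S1 S2].
have : - (1 / 2) <= (m - 1) * (plateau ((u - ue) / w) + (u - ue) / w * 'D_1 plateau ((u - ue) / w)).
  move: e1; move: (_ + _ : R) => q q1; nra.
move: S1; move: (\sum_(k < n) _) (_ * _ : R) => A B; lra.
Qed.

Lemma smooth_Gh (V : normedModType R) (U : set V) (yf uf mf : V -> R) al be n f c w ue y0 : open U ->
  (forall k, (k < n)%N -> smooth [set y : R | al < y < be] (f k)) ->
  (forall v, U v -> al < yf v < be) -> smooth U yf -> smooth U uf -> smooth U mf ->
  smooth U (fun v => Gh n f c w ue (mf v) y0 (yf v) (uf v)).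
Proof.
move=> oU sf Uy sy su sm.
have sb q : smooth U (fun v => plateau ((uf v - q) / w)).
  apply: smooth_plateau => //; apply: smoothM => //; last exact: smooth_cst.
  by apply: smoothB => //; exact: smooth_cst.
apply: smoothD => //; first apply: smoothD => //.
  apply: smooth_sum => // k; apply: smoothM => //; apply: smoothB => //; last exact: smooth_cst.
  exact: (smooth_comp1 oU Uy (sf k (ltn_ord k))).
apply: smoothM => //; first by apply: smoothB => //; exact: smooth_cst.
by apply: smoothM => //; apply: smoothB => //; exact: smooth_cst.
Qed.

Lemma plateau_far (q w u : R) : 0 < w -> 2 * w <= `|u - q| -> plateau ((u - q) / w) = 0.
Proof. by move=> w0 H; apply: plateau0; rewrite normrM normfV (gtr0_norm w0) ler_pdivlMr. Qed.
Lemma plateau_close (q w u : R) : 0 < w -> `|u - q| <= w -> plateau ((u - q) / w) = 1.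
Proof. by move=> w0 H; apply: plateau1; rewrite normrM normfV (gtr0_norm w0) ler_pdivrMr // mul1r. Qed.

(** Cut-offs vanish beyond 2w, so gaps of 8w let each strand be moved without disturbing the
    others. *)
Definition spread n f c w := forall j k, (j < k < n)%N -> f j c + 8 * w <= f k c.

Lemma spread_far n f c w j k u : 0 < w -> spread n f c w -> (j < n)%N -> (k < n)%N -> j != k ->
  `|u - f k c| <= w -> 2 * w <= `|u - f j c|.
Proof.
move=> w0 sp jn kn; rewrite neq_ltn => /orP[jk|kj]; rewrite ler_norml ler_normr => H; apply/orP.
  by left; have := sp j k; rewrite jk kn => /(_ isT); lra.
by right; have := sp k j; rewrite kj jn => /(_ isT); lra.
Qed.

Lemma Gh_strand n f c w ue m y0 y u k : 0 < w -> spread n f c w -> (k < n)%N -> `|u - f k c| <= w ->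
  (m = 1 \/ 2 * w <= `|u - ue|) -> Gh n f c w ue m y0 y u = u + (f k y - f k y0).
Proof.
move=> w0 sp kn uk He; rewrite /Gh.
have -> : (m - 1) * ((u - ue) * plateau ((u - ue) / w)) = 0.
  by case: He => [->|/(plateau_far w0) ->]; rewrite ?subrr ?mul0r ?mulr0.
rewrite addr0 (bigD1 (Ordinal kn)) //= plateau_close // mul1r big1 ?addr0 // => j jk.
have jk' : (j : nat) != k by apply: contra jk => /eqP e; apply/eqP/val_inj.
by rewrite plateau_far ?mul0r //; exact: (spread_far w0 sp (ltn_ord j) kn jk' uk).
Qed.

Lemma Gh_center n f c w ue m y0 y u : 0 < w -> (forall k, (k < n)%N -> 2 * w <= `|u - f k c|) -> `|u - ue| <= w ->
  Gh n f c w ue m y0 y u = ue + m * (u - ue).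
Proof.
move=> w0 far ue1; rewrite /Gh big1 ?addr0; last by move=> k _; rewrite plateau_far ?mul0r //; exact: far.
by rewrite plateau_close //; ring.
Qed.

Lemma Gh_id n f c w ue m y0 y u : 0 < w -> (forall k, (k < n)%N -> 2 * w <= `|u - f k c|) ->
  (m = 1 \/ 2 * w <= `|u - ue|) -> Gh n f c w ue m y0 y u = u.
Proof.
move=> w0 far He; rewrite /Gh big1 ?addr0; last by move=> k _; rewrite plateau_far ?mul0r //; exact: far.
by case: He => [->|/(plateau_far w0) ->]; rewrite ?subrr ?mul0r ?mulr0 addr0.
Qed.

Lemma lt_spread (h : nat -> R) n : (forall j k, (j < k < n)%N -> h j < h k) ->
  exists2 w : R, 0 < w & forall w', w' <= w -> forall j k, (j < k < n)%N -> h j + 8 * w' <= h k.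
Proof.
move=> H; have [w w0 Hw] := min_gap (sorted_mkseq H).
exists (w / 8); first lra.
move=> w' w'w j k /andP[jk kn].
have jn := leq_ltn_trans jk kn.
have := Hw j; rewrite size_mkseq => /(_ jn); rewrite !nth_mkseq // ?(ltnW jn) // => h1.
have h2 : h j.+1 <= h k.
  by move: jk; rewrite leq_eqVlt => /orP[/eqP ->//|jk]; apply/ltW/H; rewrite jk.
lra.
Qed.

(** The order of choices matters: [w] below the gaps between strands at level [c], then [mu] so
    small that displacements by [mu] cost at most a quarter of the slope, then [d] by continuity.
    The bound 1/32 keeps the supports of the cut-offs at distance 1/16 from 0 and 1. *)
Lemma local_scale G al be n f c : G `<=` Bo -> graphic G al be n f -> al < c < be ->
  exists2 w0 : R, 0 < w0 & forall w C, 0 < w -> w <= w0 -> 0 < C ->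
  exists mu d : R, [/\ [/\ 0 < d, 0 < mu, mu <= w & n%:R * C * mu <= w / 4], spread n f c w /\ w <= 1 / 32,
    forall y, `|y - c| < d -> al < y < be,
    forall k, (k < n)%N -> 1 / 8 < f k c < 7 / 8 &
    forall k y, (k < n)%N -> `|y - c| < d -> `|f k y - f k c| <= mu / 2].
Proof.
move=> GB [sf of_ Gf] ci.
have [w0 w00 Hw0] := @lt_spread (fun k => f k c) n (fun j k jk => of_ j k c jk ci).
exists (Num.min w0 (1 / 32)); first by rewrite lt_min w00; lra.
move=> w C wp; rewrite le_min => /andP[ww0 w32] C0.
pose mu := w / (4 * (n%:R * C + 1)).
have nC : 0 <= n%:R * C by rewrite mulr_ge0 // ltW.
have den : 0 < 4 * (n%:R * C + 1) by lra.
have mu0 : 0 < mu by rewrite divr_gt0.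
have muw : mu * (4 * (n%:R * C + 1)) = w by rewrite divfK // gt_eqF.
have [k kn||d d0 Hd] := @fin_pos n (fun k d => forall y, `|y - c| < d -> `|f k y - f k c| <= mu / 2).
- have /cont1P/(_ (mu / 2))[|d d0 Hd] : {for c, continuous (f k)} by exact: smooth_cont (sf k kn) ci.
    by lra.
  by exists d => // y /Hd/ltW.
- by move=> k d d' d'0 dd' H y yd; apply: H; exact: lt_le_trans dd'.
exists mu, (Num.min d (Num.min (c - al) (be - c))); split.
- split=> //; [by rewrite !lt_min d0 !subr_gt0; move: ci => /andP[-> ->]|nra|nra].
- by split=> // j k jk; exact: Hw0.
- by move=> y; rewrite !lt_min !ltr_norml => /andP[_ /andP[/andP[? ?] /andP[? ?]]]; lra.
- by move=> k kn; have [] : Bo (f k c, c) by apply/GB/Gf => //; apply/mem_mkseqP; exists k.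
- by move=> k y kn; rewrite lt_min => /andP[yd _]; exact: Hd.
Qed.

End Sweep.

(** * Bands without events *)

Section Strands.
Context {R : realType}.
Implicit Types (G : set (R * R)) (f : nat -> R -> R) (g : R -> R) (X : seq R) (x y z t u a b c w m al be ue e : R).

Lemma smooth_lin2 (U : set (R * R)) a b : open U -> smooth U (fun z : R * R => a + b * z.2).
Proof.
move=> oU; apply: smoothD => //; first exact: smooth_cst.
by apply: smoothM => //; [exact: smooth_cst|exact: smooth_snd].
Qed.

Lemma smooth_fst_comp (U : set (R * R)) g : open U -> smooth [set: R] g -> smooth U (fun z : R * R => g z.1).
Proof. by move=> oU sg; apply: (@smooth_comp1 _ _ setT _ g _ oU) => //; exact: smooth_fst. Qed.

Lemma ends_min e e' x : (x <= Num.min e e') || (1 - Num.min e e' <= x) ->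
  ((x <= e) || (1 - e <= x)) /\ ((x <= e') || (1 - e' <= x)).
Proof. by case: (leP e e') => ? /orP[h|h]; split; apply/orP; [left|left|right|right|left|left|right|right]; lra. Qed.

Lemma der_lt (h : R -> R) x y : (forall z, exists2 D : R, 0 < D & is_derive z 1 h D) -> (h x < h y) = (x < y).
Proof.
move=> H; have mono a b : a < b -> h a < h b.
  move=> ab; apply: (@incr_lt _ h a b) => // z _; have [D D0 HD] := H z; first by case: HD.
  by rewrite (derive_val (is_derive := HD)).
case: (ltgtP x y) => [/mono -> //|/mono k|->]; last exact: ltxx.
by apply/negbTE; rewrite -leNgt ltW.
Qed.

Lemma der_inj (h : R -> R) : (forall z, exists2 D : R, 0 < D & is_derive z 1 h D) -> injective h.
Proof.
move=> H x y e; case: (ltgtP x y) => // xy.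
  by move: (der_lt x y H); rewrite e ltxx xy.
by move: (der_lt y x H); rewrite e ltxx xy.
Qed.

(* Near level c, strands are followed from the bottom parametrisation g and from
   the prescribed top parametrisation g1, and the two are averaged. *)
Lemma strands_step G al be n f c : G `<=` Bo -> graphic G al be n f -> al < c < be ->
  exists2 d : R, 0 < d & forall a b, `|a - c| < d -> `|b - c| < d -> - (1 / 2) <= a -> a < b -> b <= 1 / 2 ->
    forall l g g1 X, reach G l a g X -> profile g -> marks G a g X -> profile g1 -> marks G b g1 X ->
    exists l', reach G l' b g1 X.
Proof.
move=> GB gr ci; have [w w0 Hw] := local_scale GB gr ci.
have [C C0 HC] := @plateau_bound R.
have [mu [d [[d0 mu0 muw nmu] [sp w32] inb Hf0 Hmu]]] := Hw w C w0 (lexx w) C0.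
have [sf of_ Gf] := gr.
exists (d / 2); first lra.
move=> a b; rewrite !ltr_norml => ad bd a12 ab b12 l g g1 X Hr pg mg pg1 mg1.
have ai : al < a < be by apply: inb; rewrite ltr_norml; clear -ad d0; lra.
have bi : al < b < be by apply: inb; rewrite ltr_norml; clear -bd d0; lra.
have Ea := marks_seq GB pg mg gr ai; have Eb := marks_seq GB pg1 mg1 gr bi.
have [sX X01 _] := mg.
pose Y t := a + (b - a) * t.
have Yd t : - (1 / 4) < t < 5 / 4 -> `|Y t - c| < d.
  by move=> ti; rewrite /Y ltr_norml; clear -ti ad bd ab d0; nra.
(* The scaling is switched off: [m = 1] annihilates its term, and 10 is a dummy centre. [A] fits the
   lower end, [B] the upper one, and both carry the marks to the strands at every level, hence so
   does their average. *)
pose A (z : R * R) := Gh n f c w 10 1 a (Y z.2) (g z.1).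
pose B (z : R * R) := Gh n f c w 10 1 b (Y z.2) (g1 z.1).
pose F (z : R * R) := (1 - z.2) * A z + z.2 * B z.
have oU := @open_strip R (- (1 / 4)) (5 / 4).
have mm : 1 / 2 <= (1 : R) <= 1 by clear; lra.
have mv k y y' : (k < n)%N -> `|y - c| < d -> `|y' - c| < d -> `|f k y - f k y'| <= mu.
  move=> kn /(Hmu k y kn) h1 /(Hmu k y' kn); move: h1; rewrite !ler_norml; clear; lra.
have dA x t y0 h : profile h -> `|y0 - c| < d -> `|Y t - c| < d ->
   exists2 D : R, 0 < D & is_derive x 1 (fun s => Gh n f c w 10 1 y0 (Y t) (h s)) D.
  move=> ph yd Yd'.
  have [k|D D4 HD] := @Gh_derive _ n f c w 10 1 y0 (Y t) C mu (h x) w0 HC _ nmu mm; first by move=> kn; exact: mv.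
  have [_ hp _] := ph.
  exists (D * 'D_1 h x); first by apply: mulr_gt0; [clear -D4; lra|exact: hp].
  have [dG <-] := HD.
  have dh : derivable h x 1 by exact: profile_derivable ph.
  exact: (d1comp (derivable_cont dh) dG (derivableP dh)).
have far x : (x <= 1 / 16) || (15 / 16 <= x) -> forall k, (k < n)%N -> 2 * w <= `|x - f k c|.
  by move=> xe k kn; have := Hf0 k kn; rewrite ler_normr => fk; apply/orP; case/orP: xe => h; [right|left]; clear -h fk w32; lra.
have idF h : profile h -> exists2 e : R, 0 < e & forall x, (x <= e) || (1 - e <= x) -> forall y0 y, Gh n f c w 10 1 y0 y (h x) = x.
  move=> [_ _ [e e0 He]]; exists (Num.min e (1 / 16)); first by rewrite lt_min e0; clear; lra.
  move=> x /ends_min[xe xe'] y0 y.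
  rewrite He // Gh_id //; last by left.
  by apply: far; move/orP: xe' => [h1|h1]; apply/orP; [left|right]; clear -h1; lra.
have at_ h y0 t k : [seq h x | x <- X] = mkseq (fun k => f k y0) n -> (k < n)%N -> `|y0 - c| < d ->
    Gh n f c w 10 1 y0 (Y t) (h X`_k) = f k (Y t).
  move=> E kn yd; have hk : h X`_k = f k y0.
    have sXn : size X = n by rewrite -(size_map h X) E size_mkseq.
    by rewrite -(nth_map 0 0) ?sXn // E nth_mkseq.
  have H0 : `|f k y0 - f k c| <= w by apply: le_trans (Hmu k y0 kn yd) _; clear -mu0 muw; lra.
  by rewrite hk (@Gh_strand _ n f c w 10 1 y0 (Y t) _ k w0 sp kn H0 (or_introl erefl)) addrC subrK.
have sXn : size X = n by rewrite -(size_map g X) Ea size_mkseq.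
have dF x t : 0 <= t <= 1 -> exists2 D : R, 0 < D & is_derive x 1 (fun s => F (s, t)) D.
  move=> ti; have Yt : `|Y t - c| < d by apply: Yd; clear -ti; lra.
  have [DA DA0 HA] := dA x t a g pg ltac:(by rewrite ltr_norml; clear -ad d0; lra) Yt.
  have [DB DB0 HB] := dA x t b g1 pg1 ltac:(by rewrite ltr_norml; clear -bd d0; lra) Yt.
  exists ((1 - t) * DA + t * DB); first by apply: convex_gt0 => //; clear -ti; lra.
  exact: dD (dZ (1 - t) HA) (dZ t HB).
have ly : layer G (Pattern Strands X) F a b.
  split=> //.
  - rewrite /pattern_wf /= sX /= andbT; apply/allP => x /X01 //.
  - have sY : smooth [set z : R * R | - (1 / 4) < z.2 < 5 / 4] (fun z : R * R => Y z.2) by exact: smooth_lin2.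
    have H h y0 : profile h -> smooth [set z : R * R | - (1 / 4) < z.2 < 5 / 4] (fun z : R * R => Gh n f c w 10 1 y0 (Y z.2) (h z.1)).
      move=> [sh _ _]; apply: (@smooth_Gh R _ _ (fun z : R * R => Y z.2) (fun z : R * R => h z.1) (fun=> 1) al be n f c w 10 y0 oU sf _ sY).
      - by move=> v vi; apply: inb; apply: Yd; exact: vi.
      - exact: smooth_fst_comp.
      - exact: smooth_cst.
    apply: smoothD => //; apply: smoothM => //; [|exact: H|exact: smooth_snd|exact: H].
    by apply: smoothB => //; [exact: smooth_cst|exact: smooth_snd].
  - have [e e0 He] := idF g pg; have [e1 e10 He1] := idF g1 pg1.
    exists (Num.min e e1); first by rewrite lt_min e0.
    by move=> x t /ends_min[xe xe']; rewrite /F /A /B /= He // He1 //; ring.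
  - move=> x t ti; rewrite D10E; have [D D0 HD] := dF x t ti.
    by rewrite (derive_val (is_derive := HD)).
  - move=> x t xi ti /=; have Yt : al < Y t < be by apply/inb/Yd; clear -ti; lra.
    have inj : injective (fun s => F (s, t)).
      by apply: der_inj => z; exact: dF.
    have E : [seq F (s, t) | s <- X] = mkseq (fun k => f k (Y t)) n.
      apply: (@eq_from_nth _ 0); rewrite ?size_map ?size_iota // sXn => k kn.
      rewrite (nth_map 0) ?sXn // nth_mkseq // /F /A /B /= !at_ //; last by rewrite ltr_norml; clear -ad bd d0; lra.
        by ring.
      by rewrite ltr_norml; clear -ad bd d0; lra.
    by rewrite -/(Y t) Gf // -E (mem_map inj).
exists ((Pattern Strands X, F, a, b) :: l).
apply: (@ReachS _ G l (Pattern Strands X) F a b g g1) => //= x; rewrite /F /A /B /=.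
  rewrite subr0 mul1r mul0r addr0 /Y mulr0 addr0 /Gh big1 ?addr0 ?subrr ?mul0r ?addr0 //.
  by move=> k _; rewrite subrr mulr0.
rewrite subrr mul1r mul0r add0r /Y mulr1 addrC subrK /Gh big1 ?addr0 ?subrr ?mul0r ?addr0 //.
by move=> k _; rewrite subrr mulr0.
Qed.

(** The staircase gets a slope below all gaps between strands, so any marks of the right number can
    be kept at any level. This is what makes strands vertical over a long run of levels. *)
Lemma graphic_stair G al be n f b X : G `<=` Bo -> graphic G al be n f -> al < b < be -> size X = n ->
  sorted <%R X -> (forall x, x \in X -> 0 < x < 1) ->
  exists2 g, profile g & marks G b g X.
Proof.
move=> GB gr bi sXn sX X01; have [sf of_ Gf] := gr.
pose L := mkseq (fun k => f k b) n.
have sL : sorted <%R L by apply: sorted_mkseq => j k jk; exact: of_.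
have [w w0 Hw] := min_gap sL.
have [|e e0 [ew e8]] := @half_min R w (1 / 8) w0; first lra.
have c1 u : u \in L -> e < u < 1 - e.
  move=> uL; have [/= u1 _] : Bo (u, b) by apply/GB/Gf.
  lra.
have c2 k : (k.+1 < size X)%N -> e * (X`_k.+1 - X`_k) <= L`_k.+1 - L`_k.
  move=> kX; have kn : (k.+1 < n)%N by rewrite -sXn.
  have /andP[x1 x2] := X01 X`_k (mem_nth 0 (ltnW kX)); have /andP[x3 x4] := X01 X`_k.+1 (mem_nth 0 kX).
  have x5 : X`_k < X`_k.+1 by apply: (sortedP 0 sX).
  apply: (@le_trans _ _ w); last by apply: Hw; rewrite size_mkseq.
  by nra.
have sz : size X = size L by rewrite size_mkseq.
have e01 : 0 < e < 1 by lra.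
have [g [pg Eg _]] := stair sz sX X01 c1 e01 c2.
by exists g => //; apply: seq_marks gr bi Eg.
Qed.

Lemma strands_interval G al be n f a b l g g1 X : G `<=` Bo -> graphic G al be n f ->
  al < a -> b < be -> - (1 / 2) <= a -> a < b -> b <= 1 / 2 ->
  reach G l a g X -> profile g -> marks G a g X -> profile g1 -> marks G b g1 X ->
  exists l', reach G l' b g1 X.
Proof.
move=> GB gr ala bbe a12 ab b12 Hr pg mg pg1 mg1.
have sXn : size X = n.
  by rewrite -(size_map g X) (marks_seq GB pg mg gr) ?size_mkseq //; lra.
have [sX X01 _] := mg.
(* Quantifying over the upper parametrisation lets it be prescribed at [b]; the clause [a < y] makes
   the start vacuous, a layer having positive height. *)
pose P y := forall h, profile h -> marks G y h X -> a < y -> exists l', reach G l' y h X.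
suff : P b by apply.
apply: (@real_ind R P (fun _ => True) a b) => //; [exact: ltW| |by move=> h _ _; rewrite ltxx].
move=> c ci; have ci' : al < c < be by lra.
have [d d0 Hd] := strands_step GB gr ci'.
exists d => //; split=> // x y xd yd ax xy yb _ _ Px h ph mh ay.
have xi : al < x < be by lra.
have x12 : - (1 / 2) <= x by lra.
have y12 : y <= 1 / 2 by lra.
case: (leP x a) => xa.
  have Exa : x = a by apply/le_anti; rewrite xa ax.
  by apply: (Hd x y xd yd x12 xy y12 l g h X) => //; rewrite Exa.
have [g' pg' mg'] := graphic_stair GB gr xi sXn sX X01.
have [l' Hl'] := Px g' pg' mg' xa.
exact: (Hd x y xd yd x12 xy y12 l' g' h X).
Qed.

End Strands.

(** * Caps, cups and merges *)

Section Events.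
Context {R : realType}.
Implicit Types (G : set (R * R)) (f : nat -> R -> R) (g : R -> R) (X : seq R) (x y z t u a b c w m al be ue e k : R).

(* The two local models of an event at (ue, c): a maximum or a merging vertex. *)
Definition evset (cap : bool) k c ue u y : Prop :=
  if cap then c - y = k * (u - ue) ^+ 2
  else (y <= c /\ `|u - ue| = k * (c - y)) \/ (c <= y /\ u = ue).
(** In units of [rho], the half-width of the parabola at time t is the square root of 1 - 2t; in
    units of the half-gap, that of the half-ellipse is the square root of 1 - 4t^2. This scale is
    their quotient, and it stays smooth at the tip t = 1/2. *)
Definition evscale (cap : bool) t : R := if cap then (Num.sqrt (1 + 2 * t))^-1 else 1.
(** Half the height of the band: at this distance below [c] the two branches are at distance [rho]
    from [ue]. *)
Definition evheight (cap : bool) k (rho : R) : R := if cap then k * rho ^+ 2 else rho / k.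
Definition evshape (cap : bool) (i : nat) : Defs.shape := if cap then Cap i else Merge i.
Definition evpattern (cap : bool) (mid hg x t : R) : Prop :=
  if cap then ((x - mid) / hg) ^+ 2 + (2 * t) ^+ 2 = 1
  else (t <= 1 / 2 /\ `|x - mid| = hg * (1 - 2 * t)) \/ (1 / 2 <= t /\ x = mid).

Lemma evscale_bound cap t : 0 <= t <= 1 -> 1 / 2 <= evscale cap t <= 1.
Proof.
move=> ti; rewrite /evscale; case: cap; last lra.
have s0 : 0 < Num.sqrt (1 + 2 * t) by rewrite sqrtr_gt0; lra.
have s2 : Num.sqrt (1 + 2 * t) ^+ 2 = 1 + 2 * t by rewrite sqr_sqrtr //; lra.
have s1 : 1 <= Num.sqrt (1 + 2 * t) by nra.
have s3 : Num.sqrt (1 + 2 * t) <= 2 by nra.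
have v0 : 0 < (Num.sqrt (1 + 2 * t))^-1 by rewrite invr_gt0.
have qv : Num.sqrt (1 + 2 * t) * (Num.sqrt (1 + 2 * t))^-1 = 1 by rewrite mulfV // gt_eqF.
move: (Num.sqrt (1 + 2 * t)) (Num.sqrt (1 + 2 * t))^-1 v0 qv s1 s3 => q v v0 qv s1 s3.
have h1 : 0 <= v * (2 - q) by apply: mulr_ge0; lra.
have h2 : 0 <= v * (q - 1) by apply: mulr_ge0; lra.
apply/andP; split; lra.
Qed.

Lemma smooth_evscale cap : smooth [set z : R * R | - (1 / 4) < z.2 < 5 / 4] (fun z : R * R => evscale cap z.2).
Proof.
have oU := @open_strip R (- (1 / 4)) (5 / 4).
rewrite /evscale; case: cap; last exact: smooth_cst.
have sl := @smooth_lin2 R _ 1 2 oU.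
have p : forall z : R * R, [set z : R * R | - (1 / 4) < z.2 < 5 / 4] z -> [set x : R | 0 < x] (1 + 2 * z.2).
  by move=> z /= zi; lra.
apply: smoothV => //; last exact: (smooth_comp1 oU p (@smooth_sqrt R) sl).
by move=> z /p /= h; rewrite gt_eqF // sqrtr_gt0.
Qed.

(** Within the gap the map is linear about the event, and the scale turns one equation into the
    other. Beyond the gap the image is too far from [ue] to meet the event at this level, and the
    curve of the pattern is not there either. *)
Lemma ev_core cap k c ue (rho mid hg h r x t : R) : 0 < k -> 0 < rho -> rho < r -> 0 < hg -> 0 <= t <= 1 ->
  (`|x - mid| <= hg -> h = ue + evscale cap t * (rho * ((x - mid) / hg))) ->
  (hg < `|x - mid| -> evscale cap t * rho < `|h - ue|) ->
  (`|h - ue| < r /\ evset cap k c ue h (c - evheight cap k rho + 2 * evheight cap k rho * t)) <-> evpattern cap mid hg x t.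
Proof.
move=> k0 rho0 rr hg0 ti Hin Hout.
have /andP[m1 m2] := evscale_bound cap ti.
have xs : x - mid = hg * ((x - mid) / hg) by rewrite mulrC divfK // gt_eqF.
have ns : `|x - mid| = hg * `|(x - mid) / hg| by rewrite {1}xs normrM (gtr0_norm hg0).
have xm : (x = mid) <-> ((x - mid) / hg = 0).
  split=> [->|s0]; first by rewrite subrr mul0r.
  by apply/eqP; rewrite -subr_eq0 xs s0 mulr0.
rewrite /evpattern; move: ((x - mid) / hg) xs ns xm Hin Hout m1 m2 => s xs ns xm Hin Hout m1 m2.
have hr : `|x - mid| <= hg -> `|h - ue| < r.
  move=> /[dup] /Hin ->; rewrite ns => sh; rewrite addrC addKr !normrM (gtr0_norm rho0) ger0_norm; last lra.
  have s1 : `|s| <= 1 by rewrite -(ler_pM2l hg0) mulr1.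
  apply: le_lt_trans rr; have s0 := normr_ge0 s.
  apply: (@le_trans _ _ (1 * (rho * 1))); last by rewrite mul1r mulr1.
  by apply: ler_pM; [lra|apply: mulr_ge0 => //; exact: ltW|by []|rewrite ler_pM2l].
case: (leP `|x - mid| hg) => xh; last first.
  have {Hout} := Hout xh; have {Hin hr} s1 : 1 < `|s| by rewrite -(ltr_pM2l hg0) mulr1 -ns.
  move: m1 m2; rewrite /evscale /evheight /evset /evpattern; case: cap => m1 m2 Hout; split.
  - move=> [_ E]; exfalso.
    have [q0 q2] : 0 < Num.sqrt (1 + 2 * t) /\ Num.sqrt (1 + 2 * t) ^+ 2 = 1 + 2 * t.
      by rewrite sqrtr_gt0 sqr_sqrtr; lra.
    move: (Num.sqrt _) q0 q2 Hout => q q0 q2 Hout.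
    have A : rho ^+ 2 < (q * `|h - ue|) ^+ 2.
      rewrite ltr_pXn2r ?nnegrE ?(ltW rho0) // ?mulr_ge0 ?(ltW q0) //.
      by move: Hout; rewrite ltr_pdivrMl.
    rewrite exprMn q2 real_normK ?num_real // in A.
    have B : k * rho ^+ 2 * (1 - 2 * t) * (1 + 2 * t) = k * ((1 + 2 * t) * (h - ue) ^+ 2).
      by transitivity ((1 + 2 * t) * (k * (h - ue) ^+ 2)); [rewrite -E|]; ring.
    have D : k * rho ^+ 2 < k * rho ^+ 2 * (1 - 2 * t) * (1 + 2 * t) by rewrite B ltr_pM2l.
    have kr : 0 < k * rho ^+ 2 by rewrite mulr_gt0 // exprn_gt0.
    by nra.
  - move=> E; exfalso; have : 1 < `|s| ^+ 2 by rewrite expr_gt1.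
    by rewrite real_normK ?num_real //; nra.
  - move=> [_ E]; exfalso; move: Hout; rewrite mul1r => Hout.
    case: E => [[_ E]|[_ E]]; last by move: Hout; rewrite E subrr normr0; lra.
    have E' : k * (c - (c - rho / k + 2 * (rho / k) * t)) = rho * (1 - 2 * t) by field; rewrite gt_eqF.
    by move: Hout; rewrite E E'; nra.
  - case=> [[t2 E]|[_ E]]; exfalso.
      by move: xh; rewrite E; nra.
    by move: xh; rewrite E subrr normr0; lra.
split=> [[_]|Hp]; [|split; first exact: hr]; move: (Hin xh) => -> {Hin hr Hout}; rewrite /evset /evpattern /evscale /evheight in m1 m2 *.
  have s1 : `|s| <= 1 by rewrite -(ler_pM2l hg0) mulr1 -ns.
  case: cap m1 m2 => m1 m2; rewrite [ue + _]addrC addrK.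
    have [q0 q2] : 0 < Num.sqrt (1 + 2 * t) /\ Num.sqrt (1 + 2 * t) ^+ 2 = 1 + 2 * t.
      by rewrite sqrtr_gt0 sqr_sqrtr; lra.
    rewrite exprMn exprVn q2 exprMn => E.
    have t1 : 1 + 2 * t != 0 by rewrite gt_eqF //; lra.
    have kr : k * rho ^+ 2 != 0 by rewrite gt_eqF // mulr_gt0 // exprn_gt0.
    have : k * rho ^+ 2 * ((1 + 2 * t) * (1 - 2 * t)) = k * rho ^+ 2 * s ^+ 2.
      have -> : k * rho ^+ 2 * s ^+ 2 = (1 + 2 * t) * (k * ((1 + 2 * t)^-1 * (rho ^+ 2 * s ^+ 2))) by field.
      by rewrite -E; ring.
    by move/(mulfI kr) => E2; rewrite -E2; ring.
  rewrite !mul1r normrM (gtr0_norm rho0) => -[[E1 E2]|[E1 E2]].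
    left; have rk : 0 < rho / k by rewrite divr_gt0.
    have t2 : 2 * t <= 1 by rewrite -(ler_pM2l rk) mulr1; lra.
    split; first lra.
    rewrite ns; congr (_ * _); apply: (mulfI (lt0r_neq0 rho0)); rewrite E2.
    by field; rewrite gt_eqF.
  right; have rk : 0 < rho / k by rewrite divr_gt0.
  have t2 : 1 <= 2 * t by rewrite -(ler_pM2l rk) mulr1; lra.
  split; first lra.
  apply/xm; apply: (mulfI (lt0r_neq0 rho0)); rewrite mulr0.
  by apply: (addIr ue); rewrite add0r.
case: cap m1 m2 Hp => m1 m2 Hp; rewrite ?[ue + _]addrC ?addrK.
  have [q0 q2] : 0 < Num.sqrt (1 + 2 * t) /\ Num.sqrt (1 + 2 * t) ^+ 2 = 1 + 2 * t.
    by rewrite sqrtr_gt0 sqr_sqrtr; lra.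
  rewrite exprMn exprVn q2 exprMn.
  have -> : s ^+ 2 = (1 + 2 * t) * (1 - 2 * t) by rewrite -[LHS](addrK ((2 * t) ^+ 2)) Hp; ring.
  by field; rewrite gt_eqF //; lra.
have rk : 0 < rho / k by rewrite divr_gt0.
case: Hp => [[t2 E]|[t2 /xm E]].
  left; split; first by nra.
  have sE : `|s| = 1 - 2 * t by apply: (mulfI (lt0r_neq0 hg0)); rewrite -ns.
  rewrite !mul1r normrM (gtr0_norm rho0) sE.
  by field; rewrite gt_eqF.
right; split; first by nra.
by rewrite E !mulr0 add0r.
Qed.

Lemma nth_others X (i j : nat) : (i.+2 <= size X)%N -> (others X i)`_j = if (j < i)%N then X`_j else X`_j.+2.
Proof.
move=> iX; rewrite /others nth_cat size_takel; last by apply: leq_trans iX; rewrite -addn2 leq_addr.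
case: ltnP => ji; first by rewrite nth_take.
by rewrite nth_drop !addSn subnKC.
Qed.

Lemma size_others X i : (i.+2 <= size X)%N -> size (others X i) = (size X - 2)%N.
Proof.
move=> iX; rewrite size_cat size_takel; last by apply: leq_trans iX; rewrite -addn2 leq_addr.
by rewrite size_drop subnS subnS; lia.
Qed.

End Events.

Ltac nlia := repeat match goal with H : ?P |- _ => lazymatch P with
  | is_true (leq _ _) => fail | is_true (leq _ _ && leq _ _) => fail | is_true (~~ _) => fail
  | @eq nat _ _ => fail | @eq bool _ _ => fail | nat => fail | _ => clear H end end; lia.

Ltac rclear := repeat match goal with
  | H : forall _, _ |- _ => clear H | H : sorted _ _ = true |- _ => clear H | H := _ |- _ => clearbody H end.
Ltac ordhyp P := lazymatch P with
  | is_true (Order.le _ _) => idtac | is_true (Order.lt _ _) => idtac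
  | is_true (Order.le _ _ && Order.lt _ _) => idtac | is_true (Order.lt _ _ && Order.le _ _) => idtac
  | is_true (Order.lt _ _ && Order.lt _ _) => idtac | is_true (Order.le _ _ && Order.le _ _) => idtac
  | @eq (Real.sort _) _ _ => idtac | _ <> _ => idtac end.
Ltac shares P G := match goal with x : _ |- _ => match P with context [x] => match G with context [x] => idtac end end end.
Ltac grab := lazymatch goal with |- ?G => repeat match goal with H : ?P |- _ => ordhyp P; shares P G; revert H end end.
Ltac dropall := clear; repeat match goal with H := _ |- _ => clearbody H end.
Ltac rlra := first [solve [grab; dropall; intros; lra] | solve [grab; grab; dropall; intros; lra] | rclear; lra].

(** * The band of a cap or of a merge *)

Section EventLayer.
Context {R : realType}.
Implicit Types (G : set (R * R)) (f : nat -> R -> R) (g : R -> R) (X : seq R) (x y z t u a b c w m al be ue e k r : R).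

(** The other strands keep at distance [r] from the abscissa of the event; the number [i] of those
    on its left becomes the index of the pattern. *)
Record eventful G al be (cap : bool) k c ue r (n : nat) f (i : nat) : Prop := Eventful {
  evt_smooth : forall j, (j < n)%N -> smooth [set y : R | al < y < be] (f j);
  evt_incr : forall j l y, (j < l < n)%N -> al < y < be -> f j y < f l y;
  evt_left : forall j y, (j < n)%N -> (j < i)%N -> al < y < be -> f j y < ue - r;
  evt_right : forall j y, (j < n)%N -> (i <= j)%N -> al < y < be -> ue + r < f j y;
  evt_level : al < c < be;
  evt_k : 0 < k;
  evt_r : 0 < r;
  evt_i : (i <= n)%N;
  evt_graph : forall u y, al < y < be ->
    (G (u, y) <-> u \in mkseq (fun j => f j y) n \/ (`|u - ue| < r /\ evset cap k c ue u y))
}.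

Lemma ex_small (K M : R) : 0 < K -> 0 < M -> exists2 e : R, 0 < e & K * e <= M.
Proof. by move=> K0 M0; exists (M / K); [exact: divr_gt0|rewrite mulrC divfK // gt_eqF]. Qed.

Lemma ex_min (e e' : R) : 0 < e -> 0 < e' -> exists2 d : R, 0 < d & d <= e /\ d <= e'.
Proof. by move=> e0 e0'; exists (Num.min e e'); [rewrite lt_min e0|rewrite !ge_min !lexx orbT]. Qed.

(** The scales are fixed before the marked points are known, hence the clause about every half-gap
    [hg] up to 1/2. Bounding [(k + k^-1) * e] controls both possible heights, [k * rho ^+ 2] and
    [rho / k]; the bound 1/10 keeps the band between the levels -1/2 and 1/2. *)
Lemma event_scale G al be cap k c ue r n f i a0 : G `<=` Bo ->
  eventful G al be cap k c ue r n f i -> a0 < c ->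
  exists C w mu d e : R,
  [/\ [/\ 0 < w, 8 * w <= r, w <= 1 / 32 & 0 < mu <= w],
      [/\ n%:R * C * mu <= w / 4, forall v : R, `|'D_1 plateau v| <= C, spread n f c w & 0 < e <= 1 / 16 /\ e <= w / 2],
      [/\ forall y, `|y - c| < d -> al < y < be, forall j, (j < n)%N -> 1 / 8 < f j c < 7 / 8 &
          forall j y, (j < n)%N -> `|y - c| < d -> `|f j y - f j c| <= mu / 2],
      forall hg, 0 < hg -> hg <= 1 / 2 ->
        [/\ 0 < evheight cap k (e * hg), 2 * evheight cap k (e * hg) <= d,
            evheight cap k (e * hg) < c - a0 & evheight cap k (e * hg) <= 1 / 10] &
      1 / 8 < ue < 7 / 8 /\ - (2 / 5) < c < 2 / 5].
Proof.
move=> GB [sf of_ fl fr ci k0 r0 i_n Gf] a0c.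
(* The strands without the event, to which [local_scale] applies. *)
pose G' : set (R * R) := [set z | al < z.2 < be /\ z.1 \in mkseq (fun j => f j z.2) n].
have G'B : G' `<=` Bo.
  by move=> -[u y] [/= yi uf]; apply/GB/Gf => //; left.
have gr : graphic G' al be n f.
  by split=> // u y yi; split=> [[]//|uf]; split.
have Gue : G (ue, c).
  apply/Gf => //; right; rewrite subrr normr0; split=> //.
  by rewrite /evset; case: (cap); [rewrite !subrr expr0n mulr0|right].
have [/= ueB cB] := GB _ Gue.
have [w0 w00 Hw0] := local_scale G'B gr ci.
have [w w_0 [ww0 wr]] := @ex_min w0 (r / 8) w00 ltac:(clear -r0; lra).
have [C C0 HC] := @plateau_bound R.
have [mu [d [[d0 mu0 muw nmu] [sp w32] inb Hf0 Hmu]]] := Hw0 w C w_0 ww0 C0.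
have [M M0 [M1 [M2 M3]]] : exists2 M : R, 0 < M & M <= c - a0 /\ (M <= d /\ M <= 1 / 10).
  have [M1 M10 [p1 p2]] := @ex_min d (1 / 10) d0 ltac:(clear; lra).
  have [M2 M20 [p3 p4]] := @ex_min (c - a0) M1 ltac:(clear -a0c; lra) M10.
  by exists M2 => //; split=> //; split; clear -p1 p2 p3 p4; lra.
have kk : 0 < k + k^-1 by rewrite addr_gt0 // invr_gt0.
have [e e0 [ew [e16 eM]]] : exists2 e : R, 0 < e & e <= w / 2 /\ (e <= 1 / 16 /\ (k + k^-1) * e <= M / 2).
  have [e1 e10 He1] := @ex_small (k + k^-1) (M / 2) kk ltac:(clear -M0; lra).
  have [e2 e20 [p1 p2]] := @ex_min e1 (1 / 16) e10 ltac:(clear; lra).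
  have [e3 e30 [p3 p4]] := @ex_min e2 (w / 2) e20 ltac:(clear -w_0; lra).
  exists e3 => //; split=> //; split; first by clear -p2 p3; lra.
  by apply: le_trans He1; rewrite ler_pM2l //; clear -p1 p3; lra.
exists C, w, mu, d, e; split=> //.
- by split=> //; [clear -wr; lra|rewrite mu0].
- by split=> //; rewrite e0.
- move=> hg hg0 hg2.
  suff [del0 delM] : 0 < evheight cap k (e * hg) /\ evheight cap k (e * hg) <= M / 2.
    by move: (evheight _ _ _) del0 delM => q q0 qM; clear -q0 qM M1 M2 M3; split; lra.
  have rho0 : 0 < e * hg by rewrite mulr_gt0.
  have rhoe : e * hg <= e / 2 by rewrite ler_pM2l //; clear -hg2; lra.
  move: (e * hg) rho0 rhoe => rho rho0 rhoe; split.
    by rewrite /evheight; case: (cap); rewrite ?divr_gt0 // mulr_gt0 // exprn_gt0.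
  apply: le_trans eM; rewrite /evheight mulrDl; case: (cap).
    have ki : 0 <= k^-1 * e by rewrite mulr_ge0 ?invr_ge0 ?(ltW k0) ?(ltW e0).
    have : k * rho ^+ 2 <= k * e by rewrite ler_pM2l // expr2; clear -rho0 rhoe e0 e16; nra.
    by clear -ki; lra.
  have ke : 0 <= k * e by rewrite mulr_ge0 ?(ltW k0) ?(ltW e0).
  have : rho / k <= k^-1 * e by rewrite [leRHS]mulrC ler_pM2r ?invr_gt0 //; clear -rhoe e0; lra.
  by clear -ke; lra.
Qed.

(** The labels of the two event strands are [ue - rho] and [ue + rho], with [rho] equal to [e] times
    the half-gap. The gap between them is then the least one allowed by [stair], which makes the map
    affine there. *)
Lemma event_profile X (i n : nat) (h : nat -> R) ue w e : size X = n.+2 -> sorted <%R X ->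
  (forall x, x \in X -> 0 < x < 1) -> (i <= n)%N -> 0 < e <= 1 / 16 -> e <= w / 2 -> w <= 1 / 32 ->
  1 / 8 < ue < 7 / 8 -> (forall j, (j < n)%N -> 1 / 8 < h j < 7 / 8) ->
  (forall j j', (j < j' < n)%N -> h j + w <= h j') ->
  (forall j, (j < n)%N -> (j < i)%N -> h j + 2 * w <= ue) ->
  (forall j, (j < n)%N -> (i <= j)%N -> ue + 2 * w <= h j) ->
  exists2 g, profile g &
    [/\ forall j, (j < i)%N -> g X`_j = h j, forall j, (i <= j < n)%N -> g X`_j.+2 = h j &
    forall x, `|x - midpoint X i| <= half_gap X i -> g x = ue + e * (x - midpoint X i)].
Proof.
move=> sXn sX X01 i_n /andP[e0 e16] ew w32 ueB fB gapf fL fR.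
have iX : (i.+1 < size X)%N by rewrite sXn !ltnS.
have Xlt : X`_i < X`_i.+1 by apply: (sortedP 0 sX).
pose rho := e * half_gap X i.
have hgE : half_gap X i = (X`_i.+1 - X`_i) / 2 by [].
have /andP[X1 X2] := X01 X`_i (mem_nth 0 (ltnW iX)).
have /andP[X3 X4] := X01 X`_i.+1 (mem_nth 0 iX).
have rhoE : 2 * rho = e * (X`_i.+1 - X`_i) by rewrite /rho hgE; field.
have rho0 : 0 < rho by rewrite mulr_gt0 // hgE; lra.
have rhoe : rho <= e / 2 by rewrite ler_pM2l // hgE; lra.
(* Labels of the n + 2 nodes: the event strands are inserted at [i] and [i.+1], which shifts the
   later strands by 2. *)
pose l j := if (j < i)%N then h j else if j == i then ue - rho else if j == i.+1 then ue + rho else h (j - 2)%N.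
have li : l i = ue - rho by rewrite /l ltnn eqxx.
have li1 : l i.+1 = ue + rho by rewrite /l eqxx ltnNge leqnSn /= gtn_eqF.
have lL j : (j < i)%N -> l j = h j by rewrite /l => ->.
have lR j : (i <= j)%N -> l j.+2 = h j.
  move=> ij; rewrite /l; have -> : (j.+2 < i)%N = false by nlia.
  have -> : (j.+2 == i) = false by nlia.
  by have -> : (j.+2 == i.+1) = false by [nlia]; rewrite subn2.
have cases j : (j < n.+2)%N -> [\/ (j < i)%N, j = i, j = i.+1 | exists2 j', (i <= j' < n)%N & j = j'.+2].
  move=> jn; case: (ltngtP j i) => [?|h1|?]; [by constructor 1| |by constructor 2].
  case: (ltngtP j i.+1) => [?|h2|?]; [nlia| |by constructor 3].
  by constructor 4; exists (j - 2)%N; nlia.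
clearbody l rho.
pose L := mkseq l n.+2.
have c1 u : u \in L -> e < u < 1 - e.
  case/mem_mkseqP => j /cases[ji|->|->|[j' j'n ->]] ->.
  - by rewrite lL //; have := fB j (leq_trans ji i_n); rlra.
  - by rewrite li; rlra.
  - by rewrite li1; rlra.
  - by rewrite lR; [have := fB j' ltac:(nlia); rlra|nlia].
have c2 j : (j.+1 < size X)%N -> e * (X`_j.+1 - X`_j) <= L`_j.+1 - L`_j.
  move=> jX; rewrite !nth_mkseq; [|by rewrite -sXn ltnW|by rewrite -sXn].
  have /andP[x1 x2] := X01 X`_j (mem_nth 0 (ltnW jX)); have /andP[x3 x4] := X01 X`_j.+1 (mem_nth 0 jX).
  have x5 : X`_j < X`_j.+1 by apply: (sortedP 0 sX).
  have [->|/eqP ji] := eqVneq j i; first by rewrite li li1 -rhoE; rlra.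
  apply: (@le_trans _ _ e).
    by rewrite -[leRHS]mulr1 ler_pM2l //; rlra.
  rewrite sXn in jX; case: (ltngtP j.+1 i) => hj.
  - rewrite !lL; [|nlia|nlia]; have := gapf j j.+1 ltac:(nlia); rlra.
  - case: (cases j ltac:(nlia)) => [|//|jE|[j' j'n jE]]; first nlia.
      rewrite jE li1 lR //; have := fR i ltac:(nlia) ltac:(nlia); rlra.
    rewrite jE !lR; [|nlia|nlia]; have := gapf j' j'.+1 ltac:(nlia); rlra.
  - rewrite hj li lL; last nlia; have := fL j ltac:(nlia) ltac:(nlia); rlra.
have sz : size X = size L by rewrite size_mkseq.
have e01 : 0 < e < 1 by rlra.
have [g1 [pg1 Eg1 Ag1]] := stair sz sX X01 c1 e01 c2.
have g1X j : (j < n.+2)%N -> g1 X`_j = l j.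
  by move=> jn; rewrite -(nth_map 0 0) ?sXn // Eg1 nth_mkseq.
exists g1 => //; split.
- by move=> j ji; rewrite g1X ?lL //; nlia.
- by move=> j jn; rewrite g1X ?lR //; nlia.
- move=> x; have midE : midpoint X i = (X`_i + X`_i.+1) / 2 by [].
  rewrite ler_norml hgE => xm; rewrite (Ag1 i iX).
  + rewrite nth_mkseq; last nlia.
    by rewrite li midE; have -> : rho = e * (X`_i.+1 - X`_i) / 2 by [rlra]; field.
  + by rewrite !nth_mkseq; [|nlia|nlia]; rewrite li li1 -rhoE; ring.
  + by rewrite midE in xm; rlra.
Qed.

(** The band is symmetric about [c]. It starts from [event_profile]; going up, [Gh] moves the other
    strands and rescales about [ue] by [evscale], which is 1 at the bottom. *)
Lemma event_layer G al be cap k c ue r n f i X a0 : G `<=` Bo ->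
  eventful G al be cap k c ue r n f i -> size X = n.+2 -> sorted <%R X ->
  (forall x, x \in X -> 0 < x < 1) -> a0 < c ->
  exists a' F, [/\ a0 < a' < c, al < a' & 2 * c - a' < be] /\
    layer G (Pattern (evshape cap i) X) F a' (2 * c - a').
Proof.
move=> GB ev sXn sX X01 a0c.
have [C [w [mu [d [e [[w_0 wr w32 mu0] [nmu HC sp [e0 ew]] [inb Hf0 Hmu] Hdel [ueB cB]]]]]]] := event_scale GB ev a0c.
have [sf of_ fl fr ci k0 r0 i_n Gf] := ev.
have iX : (i.+1 < size X)%N by rewrite sXn !ltnS.
have Xlt : X`_i < X`_i.+1 by apply: (sortedP 0 sX).
have hg0 : 0 < half_gap X i by rewrite /half_gap; clear -Xlt; lra.
have hg2 : half_gap X i <= 1 / 2.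
  have /andP[X1 X2] := X01 X`_i (mem_nth 0 (ltnW iX)).
  have /andP[X3 X4] := X01 X`_i.+1 (mem_nth 0 iX).
  by rewrite /half_gap; clear -X1 X2 X3 X4; lra.
have [del0 deld dela del1] := Hdel _ hg0 hg2; clear Hdel.
have rho0 : 0 < e * half_gap X i by rewrite mulr_gt0 //; case/andP: e0.
have rhow : e * half_gap X i <= w.
  have : e * half_gap X i <= e * 1 by rewrite ler_pM2l; [clear -hg2; lra|case/andP: e0].
  by clear -ew w_0; lra.
have [del delE] : exists del : R, del = evheight cap k (e * half_gap X i) by exists (evheight cap k (e * half_gap X i)).
rewrite -delE in del0 deld dela del1.
have [a' a'E] : exists a' : R, a' = c - del by exists (c - del).
have bE : 2 * c - a' = c + del by rewrite a'E; ring.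
have a'd : `|a' - c| < d by rewrite a'E ltr_norml; clear -del0 deld; lra.
have b'd : `|c + del - c| < d by rewrite ltr_norml; clear -del0 deld; lra.
have ai := inb _ a'd; have bi := inb _ b'd.
pose Y t := a' + (2 * c - a' - a') * t.
have YE t : Y t = c - del + 2 * del * t by rewrite /Y a'E; ring.
have Yd t : - (1 / 4) < t < 5 / 4 -> `|Y t - c| < d.
  by move=> ti; rewrite YE ltr_norml; clear -ti del0 deld; nra.
have mv j y y' : (j < n)%N -> `|y - c| < d -> `|y' - c| < d -> `|f j y - f j y'| <= mu.
  move=> jn /(Hmu j y jn) h1 /(Hmu j y' jn); move: h1; rewrite !ler_norml; clear; lra.
have ue_far j y : (j < n)%N -> al < y < be -> 8 * w <= `|f j y - ue|.
  move=> jn yi; rewrite ler_normr; apply/orP; case: (ltnP j i) => ji.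
    by right; have := fl j y jn ji yi; clear -wr; lra.
  by left; have := fr j y jn ji yi; clear -wr; lra.
have [||||g1 pg1 [g1L g1R g1c]] := @event_profile X i n (fun j => f j a') ue w e sXn sX X01 i_n e0 ew w32 ueB.
- move=> j jn; have uf : f j a' \in mkseq (fun j => f j a') n by apply/mem_mkseqP; exists j.
  by have [] := GB _ (proj2 (Gf (f j a') a' ai) (or_introl uf)).
- move=> j j' jj; have := sp j j' jj; have := Hmu j a' ltac:(nlia) a'd; have := Hmu j' a' ltac:(nlia) a'd.
  rewrite !ler_norml; clear -w_0 mu0; lra.
- by move=> j jn ji; have := fl j a' jn ji ai; clear -wr w_0; lra.
- by move=> j jn ji; have := fr j a' jn ji ai; clear -wr w_0; lra.
pose F (z : R * R) := Gh n f c w ue (evscale cap z.2) a' (Y z.2) (g1 z.1).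
have dF x t : 0 <= t <= 1 -> exists2 D : R, 0 < D & is_derive x 1 (fun s => F (s, t)) D.
  move=> ti; have Yt : `|Y t - c| < d by apply: Yd; clear -ti; lra.
  have [j|D D4 HD] := @Gh_derive _ n f c w ue (evscale cap t) a' (Y t) C mu (g1 x) w_0 HC _ nmu (evscale_bound cap ti).
    by move=> jn; exact: mv.
  have [_ hp _] := pg1.
  exists (D * 'D_1 g1 x); first by apply: mulr_gt0 => //; clear -D4; lra.
  have [dG <-] := HD.
  have dg : derivable g1 x 1 by exact: profile_derivable pg1.
  exact: (d1comp (derivable_cont dg) dG (derivableP dg)).
have F_strand s t j : (j < n)%N -> g1 s = f j a' -> F (s, t) = f j (Y t).
  move=> jn E; rewrite /F /= E.
  have H0 : `|f j a' - f j c| <= w by apply: le_trans (Hmu j a' jn a'd) _; clear -mu0; lra.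
  have H1 : evscale cap t = 1 \/ 2 * w <= `|f j a' - ue| by right; have := ue_far j a' jn ai; clear -w_0; lra.
  by rewrite (@Gh_strand _ n f c w ue (evscale cap t) a' (Y t) _ j w_0 sp jn H0 H1) addrC subrK.
have F_center x t : `|x - midpoint X i| <= half_gap X i ->
    F (x, t) = ue + evscale cap t * (e * half_gap X i * ((x - midpoint X i) / half_gap X i)).
  move=> xm; have g1E := g1c x xm.
  have e_0 : 0 < e by case/andP: e0.
  have gu : `|g1 x - ue| <= w.
    by apply: le_trans rhow; rewrite g1E addrC addKr normrM (gtr0_norm e_0) ler_pM2l.
  have sE : e * half_gap X i * ((x - midpoint X i) / half_gap X i) = e * (x - midpoint X i).
    by field; rewrite gt_eqF.
  rewrite sE /F /= Gh_center //; first by rewrite g1E [ue + e * _]addrC addrK.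
  move=> j jn; have := ue_far j c jn ci; move: gu; rewrite !ler_norml !ler_normr => gu h.
  by apply/orP; case/orP: h => hh; [right|left]; clear -gu w_0 hh; lra.
exists a', F; split.
  by rewrite bE a'E in ai bi *; split; clear -ai bi del0 dela; lra.
split.
- rewrite /pattern_wf /evshape /=; apply/and3P; split => //; first by apply/allP => x /X01.
  by case: (cap) => /=.
- have oU := @open_strip R (- (1 / 4)) (5 / 4); have [sg1 _ _] := pg1.
  apply: (@smooth_Gh R _ _ (fun z : R * R => Y z.2) (fun z : R * R => g1 z.1) (fun z : R * R => evscale cap z.2) al be n f c w ue a' oU sf).
  + by move=> v vi; apply: inb; apply: Yd; exact: vi.
  + exact: smooth_lin2.
  + exact: smooth_fst_comp.
  + exact: smooth_evscale.
- have [_ _ [e2 e20 He2]] := pg1; exists (Num.min e2 (1 / 16)); first by rewrite lt_min e20; clear; lra.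
  move=> x t /ends_min[xe xe']; rewrite /F /= He2 // Gh_id //.
    move=> j jn; have := Hf0 j jn; rewrite ler_normr => fj; apply/orP.
    by case/orP: xe' => xx; [right|left]; clear -w32 fj xx; lra.
  right; rewrite ler_normr; apply/orP.
  by case/orP: xe' => xx; [right|left]; clear -w32 ueB xx; lra.
- move=> x t ti; rewrite D10E; have [D D0 HD] := dF x t ti.
  by rewrite (derive_val (is_derive := HD)).
- by rewrite bE a'E; split; clear -cB del0 del1; lra.
- move=> x t xi ti; rewrite -/(Y t); have Yt : al < Y t < be by apply/inb/Yd; clear -ti; lra.
  have mono s s' : (F (s, t) < F (s', t)) = (s < s').
    by apply: (@der_lt R (fun s => F (s, t))) => z; exact: dF.
  have inj : injective (fun s => F (s, t)) by apply: der_inj => z; exact: dF.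
  have E : [seq F (s, t) | s <- others X i] = mkseq (fun j => f j (Y t)) n.
    have so : size (others X i) = n by rewrite size_others // sXn subn2.
    apply: (@eq_from_nth _ 0); rewrite ?size_map ?size_iota // so => j jn.
    rewrite (nth_map 0) ?so // nth_mkseq // nth_others //.
    case: (ltnP j i) => ji; first by apply: F_strand => //; exact: g1L.
    by apply: F_strand => //; apply: g1R; rewrite ji.
  have core : (`|F (x, t) - ue| < r /\ evset cap k c ue (F (x, t)) (Y t)) <-> evpattern cap (midpoint X i) (half_gap X i) x t.
    rewrite YE delE; apply: ev_core => //; [by clear -rhow wr w_0; lra|exact: F_center|].
    (* Beyond the gap, monotonicity compares with the two ends of the gap, where the affine formula
       holds. *)
    move: (F_center) hg0; move: (midpoint X i) (half_gap X i) (e * half_gap X i) => mid hg rho Fc hg0 xh.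
    have Fl : F (mid - hg, t) = ue - evscale cap t * rho.
      rewrite Fc; last by rewrite addrC addKr normrN gtr0_norm.
      by field; rewrite gt_eqF.
    have Fr : F (mid + hg, t) = ue + evscale cap t * rho.
      rewrite Fc; last by rewrite addrC addKr gtr0_norm.
      by field; rewrite gt_eqF.
    move: xh; rewrite !ltr_normr => /orP[h|h]; apply/orP.
      left; have : F (mid + hg, t) < F (x, t) by rewrite mono; clear -h; lra.
      by rewrite Fr; clear; lra.
    right; have : F (x, t) < F (mid - hg, t) by rewrite mono; clear -h; lra.
    by rewrite Fl; clear; lra.
  rewrite Gf // -E (mem_map inj) core /pattern_graph /evpattern /evshape /=.
  case: (cap) => //=; split.
    by case=> [h|[h|h]]; [constructor 1|constructor 2|constructor 3].
  by case=> h; [left|right; left|right; right].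
Qed.

End EventLayer.

(** * Sweeping a tame drawing *)

Section LocalForms.
Context {R : realType}.
Implicit Types (G : set (R * R)) (f : nat -> R -> R) (g : R -> R) (X : seq R) (x y z t u v a b c d w m al be ue e r : R).

Definition strandat G u0 c := exists g w d, [/\ 0 < w, 0 < d,
  smooth [set y : R | c - d < y < c + d] g, g c = u0 &
  forall u y, `|u - u0| < w -> `|y - c| < d -> (G (u, y) <-> u = g y)].

Definition eventat (cap : bool) G ue c := exists k r, [/\ 0 < k, 0 < r &
  forall u y, `|u - ue| < r -> `|y - c| < r -> (G (u, y) <-> evset cap k c ue u y)].

Definition freeat G u0 c := exists2 e : R, 0 < e & forall u y, `|u - u0| < e -> `|y - c| < e -> ~ G (u, y).

Lemma graphic_sub G al be al' be' n f : al <= al' -> be' <= be -> graphic G al be n f -> graphic G al' be' n f.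
Proof.
move=> ha hb [sf of_ Gf]; split.
- by move=> k kn; apply: smooth_sub (sf k kn) => y /=; rlra.
- by move=> j k y jk yi; apply: of_ => //; rlra.
- by move=> u y yi; apply: Gf; rlra.
Qed.

Lemma close_itv y c d : (`|y - c| < d) = (c - d < y < c + d).
Proof. by rewrite ltr_norml ltrBrDl ltrBlDl addrC [X in _ && X]ltrBlDl ?[d + c]addrC. Qed.

Lemma strandat_cont g c d : 0 < d -> smooth [set y : R | c - d < y < c + d] g ->
  forall e, 0 < e -> exists2 d' : R, 0 < d' & forall y, `|y - c| < d' -> `|g y - g c| < e.
Proof.
move=> d0 sg e e0; have /cont1P/(_ _ e0)[d' d'0 H] : {for c, continuous g}.
  by apply: smooth_cont sg _ => /=; rlra.
by exists d'.
Qed.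

(** Real induction along the level [c]: [P v] describes the drawing to the left of [v] over a short
    interval of levels. It is only asked at points off the drawing, where no strand crosses the
    vertical line at [v]; each local piece adds at most one strand, on the right. *)
Lemma strands_graphic G c : (forall u y, G (u, y) -> 0 < u < 1) ->
  (forall u, strandat G u c \/ freeat G u c) ->
  exists d n f, 0 < d /\ graphic G (c - d) (c + d) n f.
Proof.
move=> G01 H.
pose P v := exists d n f, [/\ 0 < d, forall k, (k < n)%N -> smooth [set y : R | c - d < y < c + d] (f k),
  forall j k y, (j < k < n)%N -> c - d < y < c + d -> f j y < f k y,
  forall k y, (k < n)%N -> c - d < y < c + d -> f k y < v &
  forall u y, c - d < y < c + d -> u < v -> (G (u, y) <-> u \in mkseq (fun k => f k y) n)].
suff [d [n [f [d0 sf of_ fv Gf]]]] : P 1.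
  exists d, n, f; split=> //; split=> // u y yi; case: (ltP u 1) => u1; first exact: Gf.
  split=> [/G01|/mem_mkseqP[k kn uE]]; first rlra.
  by have := fv k y kn yi; rewrite -uE; rlra.
apply: (@real_ind R P (fun v => ~ G (v, c)) 0 1) => //; first last.
- exists 1, 0%N, (fun _ _ => 0); split=> //.
  + by move=> j k y; rewrite ltn0 andbF.
  + by move=> u y _ u0; split=> // /G01; rlra.
- by move=> /G01; rlra.
- by move=> /G01; rlra.
move=> v0 _; case: (H v0) => [[g [w [d0 [w0 d00 sg gc Gg]]]]|[e e0 He]]; last first.
  exists e => //; split; first by move=> x xe _ _; apply: He => //; rewrite subrr normr0.
  move=> x y xe ye _ xy _ _ _ [d [n [f [d0 sf of_ fv Gf]]]].
  have [d' d'0 [dd de]] := @ex_min R d e d0 e0.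
  exists d', n, f; split=> //.
  - by move=> k kn; apply: smooth_sub (sf k kn) => s /=; rlra.
  - by move=> j k s jk si; apply: of_ => //; rlra.
  - by move=> k s kn si; have := fv k s kn ltac:(rlra); rlra.
  - move=> u s si uy; have [ux|ux] := ltP u x; first by apply: Gf => //; rlra.
    split=> [Gu|/mem_mkseqP[k kn uE]].
      by exfalso; apply: (He u s) => //; rewrite close_itv; move: xe ye; rewrite !close_itv; rlra.
    by have := fv k s kn ltac:(rlra); rewrite -uE; rlra.
have cc : `|c - c| < d0 by rewrite subrr normr0.
exists w => //; split.
  by move=> x xw xv _ /(Gg x c xw cc); rewrite gc.
move=> x y xw yw _ xy _ gx gy [d [n [f [dp sf of_ fv Gf]]]].
have xv : x != v0 by apply/eqP => xE; apply: gx; apply/(Gg x c xw cc); rewrite gc.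
have yv : y != v0 by apply/eqP => yE; apply: gy; apply/(Gg y c yw cc); rewrite gc.
have q0 : 0 < Num.min `|x - v0| `|y - v0| by rewrite lt_min !normr_gt0 !subr_eq0 xv yv.
have [d1 d10 Hd1] := strandat_cont d00 sg q0.
have [d2 d20 [d2d d2d0]] := @ex_min R d d0 dp d00.
have [d' d'0 [d'1 d'2]] := @ex_min R d1 d2 d10 d20.
have gnear s : c - d' < s < c + d' -> `|g s - v0| < `|x - v0| /\ `|g s - v0| < `|y - v0|.
  move=> si; have := Hd1 s; rewrite gc lt_min => Q.
  by apply/andP; apply: Q; rewrite close_itv; rlra.
case: (boolP (x < v0 < y)) => [/andP[xv0 v0y]|Hxy]; last first.
  exists d', n, f; split=> //.
  - by move=> k kn; apply: smooth_sub (sf k kn) => s /=; rlra.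
  - by move=> j k s jk si; apply: of_ => //; rlra.
  - by move=> k s kn si; have := fv k s kn ltac:(rlra); rlra.
  - move=> u s si uy; have [ux|ux] := ltP u x; first by apply: Gf => //; rlra.
    split=> [|/mem_mkseqP[k kn uE]]; last first.
      by have := fv k s kn ltac:(rlra); rewrite -uE; rlra.
    have uw : `|u - v0| < w by move: xw yw; rewrite !ltr_norml; rlra.
    have sd0 : `|s - c| < d0 by rewrite close_itv; rlra.
    move=> /(Gg u s uw sd0) uE; exfalso.
    have [] := gnear s si; rewrite -uE.
    move: Hxy; rewrite negb_and -!leNgt => /orP[h|h].
      rewrite [X in _ < X]ger0_norm; last rlra.
      by rewrite ger0_norm; rlra.
    move=> _; rewrite [X in _ < X]ler0_norm; last rlra.
    by rewrite ler0_norm; rlra.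
have ex : `|x - v0| = v0 - x by rewrite ltr0_norm ?subr_lt0 // opprB.
have ey : `|y - v0| = y - v0 by rewrite gtr0_norm ?subr_gt0.
have gi s : c - d' < s < c + d' -> x < g s < y.
  by move=> si; have [] := gnear s si; rewrite ex ey !ltr_norml => /andP[? ?] /andP[? ?]; apply/andP; split; rlra.
clear gnear.
pose f' k := if (k < n)%N then f k else g.
exists d', n.+1, f'; split=> //.
- move=> k; rewrite /f'; case: ifP => kn _; first by apply: smooth_sub (sf k kn) => s /=; rlra.
  by apply: smooth_sub sg => s /=; rlra.
- move=> j k s /andP[jk kn] si; rewrite /f' (leq_trans jk kn).
  case: ifP => k'n; first by apply: of_; [rewrite jk|rlra].
  have := fv j s (leq_trans jk kn) ltac:(rlra); have /andP[gx' gy'] := gi s si.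
  by move=> h; exact: lt_trans h gx'.
- move=> k s kn si; rewrite /f'; case: ifP => k'n; first by have := fv k s k'n ltac:(rlra); rlra.
  by case/andP: (gi s si).
- move=> u s si uy.
  have mk : (u \in mkseq (fun k => f' k s) n.+1) = (u \in mkseq (fun k => f k s) n) || (u == g s).
    apply/mem_mkseqP/orP => [[k]|].
      rewrite ltnS leq_eqVlt => /orP[/eqP ->|kn]; first by rewrite /f' ltnn => ->; right.
      by rewrite /f' kn => ->; left; apply/mem_mkseqP; exists k.
    case=> [/mem_mkseqP[k kn ->]|/eqP ->]; first by exists k; [exact: ltnW|rewrite /f' kn].
    by exists n => //; rewrite /f' ltnn.
  rewrite mk; have /andP[g1 g2] := gi s si.
  have [ux|ux] := ltP u x.
    rewrite Gf //; last rlra.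
    have -> : (u == g s) = false by apply/negbTE/eqP; rlra.
    by rewrite orbF.
  have -> : (u \in mkseq (fun k => f k s) n) = false.
    apply/negbTE/negP => /mem_mkseqP[k kn uE].
    by have := fv k s kn ltac:(rlra); rewrite -uE; rlra.
  rewrite /= Gg; first by split=> [->|/eqP].
    by move: xw yw; rewrite !ltr_norml; rlra.
  by rewrite close_itv; rlra.
Qed.

Lemma ev_free cap k c ue r : 0 < k -> 0 < r ->
  exists2 e : R, 0 < e & forall u y, `|y - c| < e -> evset cap k c ue u y -> `|u - ue| < r.
Proof.
move=> k0 r0; case: cap.
  exists (k * r ^+ 2); first by rewrite mulr_gt0 // exprn_gt0.
  move=> u y yc /= E; rewrite ltNge; apply/negP => h.
  have : r ^+ 2 <= (u - ue) ^+ 2.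
    by rewrite -[(u - ue) ^+ 2]real_normK ?num_real // lerXn2r ?nnegrE // ltW.
  rewrite -(ler_pM2l k0) -E; move: yc; rewrite ltr_norml; rlra.
exists (r / k); first exact: divr_gt0.
move=> u y yc /= [[_ ->]|[_ ->]]; last by rewrite subrr normr0.
rewrite mulrC -ltr_pdivlMr //; move: yc; rewrite ltr_norml; rlra.
Qed.

Lemma event_local cap G ue c : (forall u y, G (u, y) -> 0 < u < 1) -> eventat cap G ue c ->
  (forall u, u <> ue -> strandat G u c \/ freeat G u c) ->
  exists d k r n f i, 0 < d /\ eventful G (c - d) (c + d) cap k c ue r n f i.
Proof.
move=> G01 [k [r0 [k0 r00 Gev]]] H.
have rp : 0 < r0 / 4 by rlra.
have [e e0 He] := @ev_free cap k c ue (r0 / 4) k0 rp.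
have [r rE] : exists r : R, r = r0 / 2 by exists (r0 / 2).
have bfree u : r0 / 4 < `|u - ue| -> `|u - ue| < r0 -> freeat G u c.
  move=> u1 u2; have [e1 e10 [e11 e12]] := @ex_min R (`|u - ue| - r0 / 4) (r0 - `|u - ue|) ltac:(rlra) ltac:(rlra).
  have [e2 e20 [e21 e22]] := @ex_min R e r0 e0 r00.
  have [e3 e30 [e31 e32]] := @ex_min R e1 e2 e10 e20.
  exists e3 => // u' y h1 h2.
  have T1 : `|u - ue| <= `|u' - u| + `|u' - ue|.
    by rewrite -[`|u' - u|]normrN opprB; apply: le_trans (ler_normD _ _); rewrite addrA subrK.
  have T2 : `|u' - ue| <= `|u' - u| + `|u - ue| by apply: le_trans (ler_normD _ _); rewrite addrA subrK.
  have hu : `|u' - ue| < r0 by clear -T2 h1 e31 e12; rlra.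
  have hy : `|y - c| < r0 by clear -h2 e32 e22; rlra.
  have hye : `|y - c| < e by clear -h2 e32 e21; rlra.
  by move=> /(Gev u' y hu hy) /(He u' y hye); clear -T1 h1 e31 e11; rlra.
have side (A : R -> Prop) : (forall u, A u -> r < `|u - ue|) ->
    (forall u, A u -> exists2 e : R, 0 < e & forall u', `|u' - u| < e -> A u') ->
    (forall u, ~ A u -> `|u - ue| = r \/ exists2 e : R, 0 < e & forall u', `|u' - u| < e -> ~ A u') ->
    exists d n f, 0 < d /\ graphic [set z | G z /\ A z.1] (c - d) (c + d) n f.
  move=> Ar Ao Ac; apply: strands_graphic; first by move=> u y [/G01].
  move=> u; case: (pselect (A u)) => Au.
    have [e1 e10 He1] := Ao u Au.
    have une : u <> ue by move=> uE; have := Ar u Au; rewrite uE subrr normr0 rE; rlra.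
    case: (H u une) => [[g [w [d [w0 d0 sg gc Gg]]]]|[e2 e20 He2]].
      left; have [w' w'0 [w'1 w'2]] := @ex_min R w e1 w0 e10.
      exists g, w', d; split=> // u' y hu hy; rewrite -(Gg u' y ltac:(rlra) hy) /=.
      by split=> [[]//|?]; split=> //; apply: He1; rlra.
    by right; exists e2 => // u' y hu hy [Gu _]; exact: (He2 u' y).
  right; case: (Ac u Au) => [ur|[e1 e10 He1]].
    have [||e2 e20 He2] := bfree u; rewrite ?ur ?rE; [rlra|rlra|].
    by exists e2 => // u' y hu hy [Gu _]; exact: (He2 u' y).
  by exists e1 => // u' y hu hy [_ Au']; exact: (He1 u').
have [|||d1 [n1 [f1 [d10 gr1]]]] := side (fun u => u < ue - r).
- by move=> u uu; rewrite ltr_normr; apply/orP; right; rlra.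
- by move=> u uu; exists (ue - r - u) => [|u']; [rlra|rewrite ltr_norml; rlra].
- move=> u /negP; rewrite -leNgt => uu; case: (ltgtP u (ue - r)) => h; [rlra| |].
    by right; exists (u - (ue - r)) => [|u']; [rlra|rewrite ltr_norml; rlra].
  by left; rewrite h addrC addKr normrN ger0_norm // rE; rlra.
have [|||d2 [n2 [f2 [d20 gr2]]]] := side (fun u => ue + r < u).
- by move=> u uu; rewrite ltr_normr; apply/orP; left; rlra.
- by move=> u uu; exists (u - (ue + r)) => [|u']; [rlra|rewrite ltr_norml; rlra].
- move=> u /negP; rewrite -leNgt => uu; case: (ltgtP u (ue + r)) => h; [|rlra|].
    by right; exists (ue + r - u) => [|u']; [rlra|rewrite ltr_norml; rlra].
  by left; rewrite h addrC addKr ger0_norm // rE; rlra.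
have [d3 d30 [d31 d32]] := @ex_min R d1 d2 d10 d20.
have [d4 d40 [d41 d42]] := @ex_min R e r0 e0 r00.
have [d d0 [dd3 dd4]] := @ex_min R d3 d4 d30 d40.
have {gr1} gr1 : graphic [set z | G z /\ z.1 < ue - r] (c - d) (c + d) n1 f1.
  by apply: graphic_sub gr1; rlra.
have {gr2} gr2 : graphic [set z | G z /\ ue + r < z.1] (c - d) (c + d) n2 f2.
  by apply: graphic_sub gr2; rlra.
have [sf1 of1 Gf1] := gr1; have [sf2 of2 Gf2] := gr2.
have L1 j y : (j < n1)%N -> c - d < y < c + d -> G (f1 j y, y) /\ f1 j y < ue - r.
  by move=> jn yi; apply/(Gf1 _ y yi)/mem_mkseqP; exists j.
have L2 j y : (j < n2)%N -> c - d < y < c + d -> G (f2 j y, y) /\ ue + r < f2 j y.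
  by move=> jn yi; apply/(Gf2 _ y yi)/mem_mkseqP; exists j.
pose f j := if (j < n1)%N then f1 j else f2 (j - n1)%N.
exists d, k, r, (n1 + n2)%N, f, n1; split=> //; split=> //.
- by move=> j jn; rewrite /f; case: ltnP => jn1; [exact: sf1|apply: sf2; rewrite ltn_subLR].
- move=> j l y jl yi; rewrite /f; case: (ltnP j n1) => jn; case: (ltnP l n1) => ln.
  + by apply: of1 => //; clear -jl ln; lia.
  + have [_ h1] := L1 j y jn yi; have [_ h2] := L2 (l - n1)%N y ltac:(clear -jl ln; lia) yi.
    by rewrite rE in h1 h2; rlra.
  + by exfalso; clear -jl jn ln; lia.
  + by apply: of2 => //; clear -jl jn ln; lia.
- by move=> j y jn jn1 yi; rewrite /f jn1; have [] := L1 j y jn1 yi.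
- by move=> j y jn jn1 yi; rewrite /f ltnNge jn1 /=; have [] := L2 (j - n1)%N y ltac:(clear -jn jn1; lia) yi.
- by rlra.
- by rewrite rE; rlra.
- exact: leq_addr.
move=> u y yi.
have mk : u \in mkseq (fun j => f j y) (n1 + n2) <-> u \in mkseq (fun k => f1 k y) n1 \/ u \in mkseq (fun k => f2 k y) n2.
  split.
    case/mem_mkseqP => j jn ->; rewrite /f; case: ltnP => jn1; [left|right]; apply/mem_mkseqP; first by exists j.
    by exists (j - n1)%N => //; rewrite ltn_subLR.
  case=> /mem_mkseqP[j jn ->]; apply/mem_mkseqP.
    by exists j; rewrite /f ?jn // (leq_trans jn) // leq_addr.
  by exists (n1 + j)%N; rewrite ?ltn_add2l // /f ltnNge leq_addr /= addKn.
rewrite mk -Gf1 // -Gf2 //=.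
have yc : `|y - c| < d by rewrite close_itv.
have [ur|ur] := leP `|u - ue| r; last first.
  split=> [Gu|].
    by left; move: ur; rewrite ltr_normr => /orP[h|h]; [right|left]; split=> //; rlra.
  by case=> [[[]|[]]//|[]]; move: ur; rlra.
have ur0 : `|u - ue| < r0 by move: ur; rewrite rE; rlra.
rewrite (Gev u y ur0 ltac:(rlra)); split=> [ev|].
  by right; split=> //; have := He u y ltac:(rlra) ev; rewrite rE; rlra.
by move: ur; rewrite ler_norml => ur [[[]|[]]|[]] //; rlra.
Qed.

End LocalForms.

(** * Marked points at the two ends of a band *)

Section LayerMarks.
Context {R : realType}.
Implicit Types (G : set (R * R)) (g : R -> R) (X A B : seq R) (x y p q a b : R).

Lemma seq_split2 X i : (i.+1 < size X)%N -> exists A p q B, X = A ++ p :: q :: B /\ size A = i.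
Proof.
move=> iX; exists (take i X), X`_i, X`_i.+1, (drop i.+2 X); split.
  by rewrite -(drop_nth 0 iX) -(drop_nth 0 (ltnW iX)) cat_take_drop.
by rewrite size_takel // ltnW // ltnW.
Qed.

Lemma others_cat A p q B : others (A ++ p :: q :: B) (size A) = A ++ B.
Proof. by rewrite /others take_size_cat // drop_cat ltnNge -addn2 leq_addr /= addKn /= drop0. Qed.

Lemma midpoint_cat A p q B : midpoint (A ++ p :: q :: B) (size A) = (p + q) / 2.
Proof. by rewrite /midpoint !nth_cat ltnn ltnNge leqnSn /= subnn subSnn. Qed.

Lemma half_gap_cat A p q B : half_gap (A ++ p :: q :: B) (size A) = (q - p) / 2.
Proof. by rewrite /half_gap !nth_cat ltnn ltnNge leqnSn /= subnn subSnn. Qed.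

Lemma sorted_split2 A p q B : sorted <%R (A ++ p :: q :: B) =
  [&& sorted <%R (A ++ B), p < q, all (fun x => x < p) A & all (fun x => q < x) B].
Proof.
rewrite !(sorted_pairwise (@lt_trans _ _)) !pairwise_cat !pairwise_cons /=.
have -> : allrel <%R A [:: p, q & B] = [&& all (fun x => x < p) A, all (fun x => x < q) A & allrel <%R A B].
  by rewrite !allrel_consr.
apply/idP/idP => [/and5P[/and3P[-> _ ->] -> /andP[-> _] -> ->]//|].
move=> /and4P[/and3P[-> -> ->] pq Ap Bq]; rewrite pq Ap Bq /=.
have -> : all (fun x => x < q) A by apply: sub_all Ap => x; move/lt_trans; apply.
by have -> : all (> p) B by apply: sub_all Bq => x; apply: lt_trans.
Qed.

Lemma sqr1 x hg : 0 < hg -> (x / hg) ^+ 2 = 1 <-> x = hg \/ x = - hg.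
Proof.
move=> h0; split=> [/eqP|[] ->]; last 2 first.
- by rewrite divff ?gt_eqF // expr1n.
- by rewrite mulNr divff ?gt_eqF // sqrrN expr1n.
rewrite sqrf_eq1 => /orP[] /eqP E; [left|right].
  by rewrite -[LHS](@divfK _ hg) ?gt_eqF // E mul1r.
by rewrite -[LHS](@divfK _ hg) ?gt_eqF // E mulN1r.
Qed.

(** At time 0 the legs of a merge and the half-ellipse of a cap end at half-gap distance from the
    midpoint, that is at the two marks; the arc of a cup has no point there, since the square of 2(1
    - t) is 4. *)
Lemma pattern_source (P : pattern R) x : pattern_wf P -> pattern_graph P x 0 <-> x \in source P.
Proof.
case: P => -[|i|i|i] X; rewrite /pattern_wf /pattern_graph /source /= => /and3P[sX _] //.
- move=> /seq_split2[A [p [q [B [XE iE]]]]]; subst X i.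
  rewrite others_cat midpoint_cat half_gap_cat mem_cat [in X in _ <-> X]mem_cat !inE.
  move: sX; rewrite sorted_split2 => /and4P[_ pq _ _].
  split=> [[/orP[->|->]|[_ /eqP]|[]]|].
  + by [].
  + by rewrite !orbT.
  + rewrite mulr0 subr0 mulr1 eqr_norml => /andP[/orP[/eqP e|/eqP e] _].
      rewrite (_ : x = q) ?eqxx ?orbT //; lra.
    rewrite (_ : x = p) ?eqxx ?orbT //; lra.
  + by lra.
  + case/or4P => [->|/eqP ->|/eqP ->|->]; rewrite ?orbT; [by constructor 1| | |by constructor 1].
      by constructor 2; split; [lra|rewrite ler0_norm; lra].
    by constructor 2; split; [lra|rewrite ger0_norm; lra].
- move=> /seq_split2[A [p [q [B [XE iE]]]]]; subst X i.
  rewrite others_cat midpoint_cat half_gap_cat mem_cat [in X in _ <-> X]mem_cat !inE.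
  move: sX; rewrite sorted_split2 => /and4P[_ pq _ _].
  rewrite mulr0 expr0n addr0 sqr1; last by lra.
  split=> [[/orP[->|->]|[e|e]]|]; rewrite ?orbT //.
  + rewrite (_ : x = q) ?eqxx ?orbT //; lra.
  + rewrite (_ : x = p) ?eqxx ?orbT //; lra.
  + case/or4P => [->|/eqP ->|/eqP ->|->]; rewrite ?orbT; [by left| | |by left].
      by right; right; lra.
    by right; left; lra.
- move=> _; split=> [[//|]|->]; last by left.
  by rewrite subr0 mulr1; set s := (_ / _); have := sqr_ge0 s; lra.
Qed.

Lemma pattern_target (P : pattern R) x : pattern_wf P -> pattern_graph P x 1 <-> x \in target P.
Proof.
case: P => -[|i|i|i] X; rewrite /pattern_wf /pattern_graph /target /= => /and3P[sX _] //.
- move=> _; rewrite [in X in _ <-> X]mem_cat inE /others mem_cat; split.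
    by case=> [/orP[->|->]|[]|[_ ->]]; rewrite ?eqxx ?orbT //; lra.
  case/or3P => [->|/eqP ->|->]; rewrite ?orbT; [by constructor 1|constructor 3|by constructor 1].
  by split=> //; lra.
- move=> _; split=> [[//|]|->]; last by left.
  by rewrite mulr1; set s := (_ / _); have := sqr_ge0 s; lra.
- move=> /seq_split2[A [p [q [B [XE iE]]]]]; subst X i.
  rewrite others_cat midpoint_cat half_gap_cat mem_cat [in X in _ <-> X]mem_cat !inE.
  move: sX; rewrite sorted_split2 => /and4P[_ pq _ _].
  rewrite subrr mulr0 expr0n addr0 sqr1; last by lra.
  split=> [[/orP[->|->]|[e|e]]|]; rewrite ?orbT //.
  + rewrite (_ : x = q) ?eqxx ?orbT //; lra.
  + rewrite (_ : x = p) ?eqxx ?orbT //; lra.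
  + case/or4P => [->|/eqP ->|/eqP ->|->]; rewrite ?orbT; [by left| | |by left].
      by right; right; lra.
    by right; left; lra.
Qed.

Lemma others_wf X i : (i.+1 < size X)%N -> sorted <%R X -> all (fun x : R => 0 < x < 1) X ->
  sorted <%R (others X i) /\ all (fun x : R => 0 < x < 1) (others X i).
Proof.
move=> /seq_split2[A [p [q [B [-> <-]]]]]; rewrite others_cat sorted_split2 !all_cat /=.
by move=> /and4P[-> _ _ _] /and4P[-> _ _ ->].
Qed.

Lemma source_wf (P : pattern R) : pattern_wf P -> sorted <%R (source P) /\ all (fun x : R => 0 < x < 1) (source P).
Proof. by case: P => -[|i|i|i] X /and3P[/= sX X01 iX] //; exact: others_wf. Qed.

Lemma target_wf (P : pattern R) : pattern_wf P -> sorted <%R (target P) /\ all (fun x : R => 0 < x < 1) (target P).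
Proof.
case: P => -[|i|i|i] X /and3P[/= sX X01 iX] //; last exact: others_wf.
rewrite /target /=; move: iX sX X01 => /seq_split2[A [p [q [B [-> <-]]]]].
rewrite midpoint_cat take_size_cat // drop_cat ltnNge -[(size A).+2]addn2 leq_addr /= addKn /= drop0.
rewrite sorted_split2 !all_cat /= => /and4P[sAB pq Ap Bq] /and4P[-> pp qq ->].
rewrite andbT; split; last by move: pp qq => /andP[? ?] /andP[? ?]; apply/andP; split; lra.
move: sAB; rewrite !(sorted_pairwise (@lt_trans _ _)) !pairwise_cat pairwise_cons allrel_consr.
move=> /and3P[-> -> ->]; rewrite /= !andbT; apply/andP; split.
  by apply: sub_all Ap => x /= xp; lra.
by apply: sub_all Bq => x /= xp; lra.
Qed.

Lemma layer_source G P F a b : layer G P F a b -> marks G a (fun x => F (x, 0)) (source P).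
Proof.
move=> [wf _ _ _ _ Hg]; have [s1 /allP s2] := source_wf wf; split=> // x x01.
by rewrite -pattern_source // -Hg ?mulr0 ?addr0 //; lra.
Qed.

Lemma layer_target G P F a b : layer G P F a b -> marks G b (fun x => F (x, 1)) (target P).
Proof.
move=> [wf _ _ _ _ Hg]; have [s1 /allP s2] := target_wf wf; split=> // x x01.
by rewrite -pattern_target // -Hg ?mulr1 ?[a + _]addrC ?subrK //; lra.
Qed.

Lemma marks_map G a g g' X X' : G `<=` Bo -> profile g -> profile g' -> marks G a g X -> marks G a g' X' ->
  [seq g x | x <- X] = [seq g' x | x <- X'].
Proof.
move=> GB pg pg' [sX X01 mX] [sX' X01' mX']; apply: lt_sorted_eq.
- by apply: homo_sorted sX => x y; rewrite profile_lt.
- by apply: homo_sorted sX' => x y; rewrite profile_lt.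
have aux h h' Y Y' u : profile h' -> (forall x, x \in Y -> 0 < x < 1) ->
    (forall x, 0 <= x <= 1 -> G (h x, a) <-> x \in Y) -> (forall x, 0 <= x <= 1 -> G (h' x, a) <-> x \in Y') ->
    u \in [seq h x | x <- Y] -> u \in [seq h' x | x <- Y'].
  move=> ph' Y01 mY mY' /mapP[x xY ->].
  have Gx : G (h x, a) by apply/mY => //; have /andP[/ltW-> /ltW->] := Y01 x xY.
  have [/= u01 _] := GB _ Gx.
  have [|x' x01 gx] := @profile_surj R h' (h x) ph'; first by lra.
  by rewrite -gx map_f //; apply/mY'; [lra|rewrite gx].
by move=> u; apply/idP/idP; apply: aux.
Qed.

(** The number of marks depends on the drawing alone; comparison with an auxiliary layer will
    determine it. *)
Lemma marks_size G a g g' X X' : G `<=` Bo -> profile g -> profile g' -> marks G a g X -> marks G a g' X' ->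
  size X = size X'.
Proof. by move=> GB pg pg' m m'; have /(congr1 size) := marks_map GB pg pg' m m'; rewrite !size_map. Qed.

(** A cup creates two marks between given ones: [lo] and [hi] bound a free interval, which is cut
    into thirds. *)
Lemma seq_room A B : sorted <%R (A ++ B) -> all (fun x : R => 0 < x < 1) (A ++ B) ->
  exists p q, sorted <%R (A ++ p :: q :: B) /\ all (fun x : R => 0 < x < 1) (A ++ p :: q :: B).
Proof.
move=> sAB; have : allrel <%R A B.
  by move: sAB; rewrite (sorted_pairwise (@lt_trans _ _)) pairwise_cat => /andP[].
rewrite all_cat => aAB /andP[A01 B01].
have [lo [lo0 lo1 Alo Blo]] : exists lo : R, [/\ 0 <= lo, lo < 1, all (fun x => x <= lo) A & all (fun x => lo < x) B].
  elim: A A01 aAB {sAB} => [_ _|x A IH]; first by exists 0; split=> //; apply: sub_all B01 => x /andP[].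
  rewrite /= allrel_consl => /andP[x01 A01] /andP[xB AB].
  have [lo [lo0 lo1 Alo Blo]] := IH A01 AB; case: (leP x lo) => xlo; first by exists lo; split; rewrite //= xlo.
  exists x; split=> //; [lra|lra|]; rewrite ?lexx //=.
  by apply: sub_all Alo => z /= zl; lra.
have [hi [hi1 hi0 Bhi]] : exists hi : R, [/\ hi <= 1, lo < hi & all (fun x => hi <= x) B].
  elim: B B01 Blo {sAB aAB} => [_ _|x B IH]; first by exists 1; split.
  rewrite /= => /andP[x01 B01] /andP[xB AB].
  have [hi [hi1 hi0 Bhi]] := IH B01 AB; case: (leP hi x) => xhi; first by exists hi; split; rewrite //= xhi.
  exists x; split=> //; [lra|]; rewrite ?lexx //=.
  by apply: sub_all Bhi => z /= zl; lra.
exists (lo + (hi - lo) / 3), (lo + (hi - lo) / 3 * 2); split.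
  rewrite sorted_split2 sAB /=; apply/and3P; split; first by lra.
    by apply: sub_all Alo => z /= zl; lra.
  by apply: sub_all Bhi => z /= zl; lra.
by rewrite all_cat A01 /= B01 andbT; apply/andP; split; apply/andP; split; lra.
Qed.

Lemma seq_exists n : exists X, [/\ size X = n, sorted <%R X & all (fun x : R => 0 < x < 1) X].
Proof.
exists (mkseq (fun k => (k.+1)%:R / (n.+1)%:R) n); split; first by rewrite size_mkseq.
  apply: sorted_mkseq => j k /andP[jk kn]; rewrite ltr_pM2r ?invr_gt0 ?ltr0n //.
  by rewrite ltr_nat.
apply/allP => x /mem_mkseqP[k kn ->]; rewrite divr_gt0 ?ltr0n //= ltr_pdivrMr ?ltr0n //.
by rewrite mul1r ltr_nat.
Qed.

End LayerMarks.

(** * Crossing the events one by one *)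

Section Sweeping.
Context {R : realType}.
Implicit Types (G : set (R * R)) (f : nat -> R -> R) (g : R -> R) (X A B E : seq R) (x y p q a b c u v ue : R).

(** Cups are caps of the drawing turned upside down, so that one analysis serves for both. *)
Definition refl G : set (R * R) := [set z | G (z.1, - z.2)].
Definition regat G u c := strandat G u c \/ freeat G u c.
Definition cupat G ue c := eventat true (refl G) ue (- c).

Lemma refl_Bo G : G `<=` Bo -> refl G `<=` Bo.
Proof. by move=> GB -[u y] /GB[/= u1 y1]; split=> /=; [|lra]. Qed.

Lemma smooth_opp : smooth [set: R] (fun x : R => - x).
Proof. by apply: smoothN; [exact: openT|exact: smooth_id]. Qed.

Lemma regat_refl G u c : regat G u c -> regat (refl G) u (- c).
Proof.
case=> [[g [w [d [w0 d0 sg gc Gg]]]]|[e e0 He]]; [left|right].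
  exists (fun y => g (- y)), w, d; rewrite opprK; split=> //.
    apply: (@smooth_comp1 _ _ [set y : R | c - d < y < c + d] _ g (fun y : R => - y)) => //.
    - exact: open_itvoo.
    - by move=> y /= yi; lra.
    - by apply: smooth_sub smooth_opp.
  move=> x y xw yd; rewrite /refl /= Gg //.
  by rewrite -normrN opprB opprK addrC.
exists e => // x y xe ye; apply: He => //=.
by rewrite -normrN opprD !opprK addrC; move: ye; rewrite opprK addrC.
Qed.

Lemma layer_reach G l P F a b g : reach G l a g (source P) -> layer G P F a b ->
  (forall x, F (x, 0) = g x) -> exists l' g', [/\ reach G l' b g' (target P), profile g' & marks G b g' (target P)].
Proof.
move=> Hr ly Hg; exists ((P, F, a, b) :: l), (fun x => F (x, 1)); split.
- by apply: ReachS Hr ly Hg _.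
- by apply: layer_profile ly _; rewrite ler01 lexx.
- exact: layer_target ly.
Qed.

Definition reached G b X := exists l g, [/\ reach G l b g X, profile g & marks G b g X].

(** The second conclusion lets the parametrisation at [b] be prescribed, so as to match the lower
    side of the next event band. *)
Lemma strands_region G a b X : G `<=` Bo -> - (1 / 2) <= a -> a < b -> b <= 1 / 2 ->
  (forall c u, a <= c <= b -> regat G u c) -> reached G a X ->
  reached G b X /\ forall g, profile g -> marks G b g X -> exists l, reach G l b g X.
Proof.
move=> GB a12 ab b12 Hreg ra.
have G01 u y : G (u, y) -> 0 < u < 1 by move=> /GB[/= h _]; lra.
have win c : a <= c <= b -> exists2 d : R, 0 < d & forall x y, `|x - c| < d -> `|y - c| < d -> a <= x -> x < y -> y <= b ->
    reached G x X -> reached G y X /\ forall g, profile g -> marks G y g X -> exists l, reach G l y g X.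
  move=> ci; have [d [n [f [d0 gr]]]] := strands_graphic G01 (fun u => Hreg c u ci).
  exists d => // x y; rewrite !close_itv => xc yc ax xy yb [l [g [rg pg mg]]].
  have sXn : size X = n.
    by rewrite -(size_map g X) (marks_seq GB pg mg gr) ?size_mkseq //; lra.
  have [sX X01 _] := mg.
  have int g1 : profile g1 -> marks G y g1 X -> exists l', reach G l' y g1 X.
    by apply: (strands_interval GB gr _ _ _ _ _ rg pg mg); lra.
  have [|g1 pg1 mg1] := @graphic_stair _ _ _ _ _ _ y _ GB gr _ sXn sX X01; first by lra.
  have [l' rl'] := int g1 pg1 mg1.
  by split=> //; exists l', g1; split.
have rb c : a <= c <= b -> reached G c X.
  move=> /andP[ac cb]; apply: (@real_ind R (fun y => reached G y X) (fun=> True) a c) => // c' c'i.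
  have [|d d0 Hd] := win c'; first by lra.
  by exists d => //; split=> // x y xd yd ax xy yc _ _ rx; apply: (Hd x y _ _ _ _ _ rx).1; lra.
have [|d d0 Hd] := win b; first by lra.
have [e [e0 ed eb]] : exists e : R, [/\ 0 < e, e < d & e <= b - a].
  by have [e e0 [e1 e2]] := @ex_min R (d / 2) (b - a) ltac:(lra) ltac:(lra); exists e; split=> //; lra.
apply: (Hd (b - e) b); rewrite ?subrr ?normr0 //; [|lra|lra|apply: rb; lra].
by rewrite close_itv; lra.
Qed.

Lemma event_step G cap k ue r n f i al be c x y X : G `<=` Bo -> eventful G al be cap k c ue r n f i ->
  - (1 / 2) <= x -> x < c -> c < y -> y <= 1 / 2 ->
  (forall u z, x <= z < c -> regat G u z) -> (forall u z, c < z <= y -> regat G u z) ->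
  reached G x X -> exists X', reached G y X'.
Proof.
move=> GB ev x12 xc cy y12 regl regr rx.
(* The band is symmetric about [c]: a lower level above [2 * c - y] puts its upper level below
   [y]. *)
have [a0 [xa0 a0y a0c]] : exists a0, [/\ x <= a0, 2 * c - y <= a0 & a0 < c].
  exists (Num.max x (2 * c - y)); split; rewrite ?le_max ?lexx ?orbT //.
  by rewrite gt_max; apply/andP; split; lra.
have lay Y : size Y = n.+2 -> sorted <%R Y -> (forall x, x \in Y -> 0 < x < 1) -> exists a' F,
    a0 < a' < c /\ layer G (Pattern (evshape cap i) Y) F a' (2 * c - a').
  move=> s1 s2 s3; have [a' [F [[h1 _ _] ly]]] := event_layer GB ev s1 s2 s3 a0c.
  by exists a', F.
have srcE Y : source (Pattern (evshape cap i) Y) = Y by case: (cap).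
(* A band on arbitrary marks of the right number is reached from below; its marks and those at hand
   then count the points of the same level. *)
have sX : size X = n.+2.
  have [Y [sY oY /allP Y01]] := @seq_exists R n.+2.
  have [a' [F [a'i ly]]] := lay Y sY oY Y01.
  have [|||[l [g [_ pg mg]]] _] := @strands_region G x a' X GB x12 _ _ _ rx; [lra|lra|by move=> z u zi; apply: regl; lra|].
  rewrite -sY; apply: (marks_size GB pg (layer_profile ly (t := 0) _) mg _); first by rewrite lexx ler01.
  by rewrite -[Y]srcE; exact: layer_source ly.
have [sX' X01] : sorted <%R X /\ forall x, x \in X -> 0 < x < 1 by case: rx => l [g [_ _ []]].
have [a' [F [a'i ly]]] := lay X sX sX' X01.
have [|||_ toF] := @strands_region G x a' X GB x12 _ _ _ rx; [lra|lra|by move=> z u zi; apply: regl; lra|].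
have [||l rl] := toF (fun x => F (x, 0)).
- by apply: layer_profile ly _; rewrite lexx ler01.
- by rewrite -[X in marks _ _ _ X]srcE; exact: layer_source ly.
rewrite -{1}[X]srcE in rl.
have rt := layer_reach rl ly (fun=> erefl).
exists (target (Pattern (evshape cap i) X)).
have [|||] := @strands_region G (2 * c - a') y _ GB _ _ y12 _ rt => //; [lra|lra|].
by move=> z u zi; apply: regr; lra.
Qed.

Lemma layer_refl G i X F a b : layer (refl G) (Pattern (Cap i) X) F a b ->
  layer G (Pattern (Cup i) X) (fun z => F (z.1, 1 - z.2)) (- b) (- a).
Proof.
move=> [wf sF [e e0 He] iF [l1 l2 l3] HG]; split=> //.
- have oS : open [set z : R * R | - (1 / 4) < z.2 < 5 / 4] by exact: open_strip.
  apply: (@smooth_comp2 _ _ [set z : R * R | - (1 / 4) < z.2 < 5 / 4] _ F (fun z : R * R => z.1) (fun z : R * R => 1 - z.2)) => //.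
  + by move=> z /= zi; lra.
  + by apply: smooth_sub (@smooth_fst R setT).
  + apply: smoothB => //; first exact: smooth_cst.
    by apply: smooth_sub (@smooth_snd R setT).
- by exists e => // x t /= /He.
- by move=> x t ti; rewrite D10E /= -(D10E F); apply: iF; lra.
- by split; lra.
- move=> x t xi ti /=; have ti' : 0 <= 1 - t <= 1 by lra.
  have := HG x (1 - t) xi ti'; rewrite /refl /= /pattern_graph /=.
  have -> : - (a + (b - a) * (1 - t)) = - b + (- a - - b) * t by ring.
  by [].
Qed.

Lemma cup_step G k ue r n f i al be c x y X : G `<=` Bo -> eventful (refl G) al be true k (- c) ue r n f i ->
  - (1 / 2) <= x -> x < c -> c < y -> y <= 1 / 2 ->
  (forall u z, x <= z < c -> regat G u z) -> (forall u z, c < z <= y -> regat G u z) ->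
  reached G x X -> exists X', reached G y X'.
Proof.
move=> GB ev x12 xc cy y12 regl regr rx.
(* Once turned back, the band found from the reflected level a' runs from 2c + a' to -a'; the two
   lower bounds on [a0] keep it inside ]x, y[. *)
have [a0 [xa0 a0y a0c]] : exists a0, [/\ - y <= a0, x - 2 * c <= a0 & a0 < - c].
  exists (Num.max (- y) (x - 2 * c)); split; rewrite ?le_max ?lexx ?orbT //.
  by rewrite gt_max; apply/andP; split; lra.
have lay Y : size Y = n.+2 -> sorted <%R Y -> (forall x, x \in Y -> 0 < x < 1) -> exists a' F,
    x < a' < c /\ layer G (Pattern (Cup i) Y) F a' (2 * c - a') /\ 2 * c - a' < y.
  move=> s1 s2 s3; have [a' [F [[h1 _ _] ly]]] := event_layer (refl_Bo GB) ev s1 s2 s3 a0c.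
  exists (- (2 * - c - a')), (fun z => F (z.1, 1 - z.2)); split; first by lra.
  split; last by lra.
  have -> : 2 * c - - (2 * - c - a') = - a' by ring.
  exact: layer_refl.
have iN : (i <= n)%N by case: ev.
have sX : size X = n.
  have [Y [sY oY /allP Y01]] := @seq_exists R n.+2.
  have [a' [F [a'i [ly _]]]] := lay Y sY oY Y01.
  have [|||[l [g [_ pg mg]]] _] := @strands_region G x a' X GB x12 _ _ _ rx; [lra|lra|by move=> z u zi; apply: regl; lra|].
  have -> : n = size (others Y i) by rewrite size_others sY ?subn2 // !ltnS.
  apply: (marks_size GB pg (layer_profile ly (t := 0) _) mg _); first by rewrite lexx ler01.
  exact: layer_source ly.
have [sX' X01] : sorted <%R X /\ all (fun x : R => 0 < x < 1) X by case: rx => l [g [_ _ [? /allP ?]]].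
have [Y [sY oY Y01 YX]] : exists Y, [/\ size Y = n.+2, sorted <%R Y, all (fun x : R => 0 < x < 1) Y & others Y i = X].
  have [||p [q [s1 s2]]] := @seq_room R (take i X) (drop i X); rewrite ?cat_take_drop //.
  exists (take i X ++ p :: q :: drop i X); split=> //.
    by rewrite size_cat /= size_takel ?sX // size_drop sX !addnS subnKC.
  have iE : size (take i X) = i by rewrite size_takel // sX.
  by rewrite -[X in others _ X]iE others_cat cat_take_drop.
have [a' [F [a'i [ly b'y]]]] := lay Y sY oY (allP Y01).
have [|||_ toF] := @strands_region G x a' X GB x12 _ _ _ rx; [lra|lra|by move=> z u zi; apply: regl; lra|].
have srcE : source (Pattern (Cup i) Y) = X by [].
have [||l rl] := toF (fun x => F (x, 0)).
- by apply: layer_profile ly _; rewrite lexx ler01.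
- by rewrite -[X in marks _ _ _ X]srcE; exact: layer_source ly.
rewrite -{1}srcE in rl.
have rt := layer_reach rl ly (fun=> erefl).
exists (target (Pattern (Cup i) Y)).
have [|||] := @strands_region G (2 * c - a') y _ GB _ _ y12 _ rt => //; [lra|].
by move=> z u zi; apply: regr; lra.
Qed.

(* E lists the critical levels, each carrying exactly one critical point. *)
Definition tame G E := [/\ G `<=` Bo, forall u c, c \notin E -> regat G u c &
  forall c, c \in E -> exists ue, [\/ eventat true G ue c, eventat false G ue c | cupat G ue c] /\
    forall u, u <> ue -> regat G u c].

Lemma seq_isolated E c : exists2 d : R, 0 < d & forall y, `|y - c| < d -> y <> c -> y \notin E.
Proof.
elim: E => [|x E [d d0 Hd]]; first by exists 1.
case: (x =P c) => [->|/eqP xc].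
  by exists d => // y yd yc; rewrite inE negb_or Hd // andbT; apply/eqP.
have xc0 : 0 < `|x - c| by rewrite normr_gt0 subr_eq0.
have [d' d'0 [h1 h2]] := @ex_min R d `|x - c| d0 xc0.
exists d' => // y yd yc; rewrite inE negb_or Hd ?(lt_le_trans yd) // andbT.
by apply/eqP => yx; move: yd; rewrite yx ltNge h2.
Qed.

(** Real induction over levels, the good ones being noncritical. The level 9/20 is above the box, so
    that no mark is left there, and a last stretch without strands restores the identity
    parametrisation at the level of the upper disc. *)
Theorem tame_sweep G E : tame G E -> exists l, l <> [::] /\ reach G l (1 / 2) (fun x => x) [::].
Proof.
move=> [GB reg crit].
have G01 u y : G (u, y) -> 0 < u < 1 by move=> /GB[/= h _]; lra.
have pid : profile (fun x : R => x).
  split; [exact: smooth_id| |by exists (1 / 4) => //; lra].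
  by move=> x; rewrite (derive_val (is_derive := dI x)).
have mnil c : 2 / 5 <= c \/ c <= - (2 / 5) -> marks G c (fun x => x) [::].
  by move=> hc; split=> // x _; split=> // /GB[/= _]; lra.
have regE c u : 2 / 5 < c \/ c < - (2 / 5) -> regat G u c.
  move=> hc; right; exists (Num.max (c - 2 / 5) (- (2 / 5) - c)).
    by rewrite lt_max; apply/orP; case: hc; [left|right]; lra.
  move=> x y _ yc /GB[/= _ h2]; move: yc; rewrite lt_max !ltr_norml => /orP[/andP[? ?]|/andP[? ?]]; lra.
have goodE y : 2 / 5 < y \/ y < - (2 / 5) -> y \notin E.
  move=> hy; apply/negP => /crit[ue [ev _]].
  have : G (ue, y).
    case: ev => [[k [r [k0 r0 H]]]|[k [r [k0 r0 H]]]|[k [r [k0 r0 H]]]].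
    - by apply/H; rewrite ?subrr ?normr0 //= !subrr expr0n mulr0.
    - by apply/H; rewrite ?subrr ?normr0 //=; right.
    - have : refl G (ue, - y) by apply/H; rewrite ?subrr ?normr0 //= !subrr expr0n mulr0.
      by rewrite /refl /= opprK.
  by move=> /GB[/= _]; lra.
have start : reached G (- (1 / 2)) [::].
  by exists [::], (fun x => x); split=> //; [exact: Reach0|apply: mnil; lra].
have sweep : exists X, reached G (9 / 20) X.
  apply: (@real_ind R (fun y => exists X, reached G y X) (fun y => y \notin E) (- (1 / 2)) (9 / 20)).
  - by lra.
  - move=> c ci; have [d d0 Hd] := seq_isolated E c.
    exists d => //; split; first by move=> x xd xc _; exact: Hd.
    move=> x y xd yd ax xy yb gx gy [X rX].
    have regne z u : `|z - c| < d -> z <> c -> regat G u z by move=> zd zc; apply: reg; exact: Hd.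
    rewrite !close_itv in xd yd.
    have y12 : y <= 1 / 2 by lra.
    (* If [c] is not strictly between, every level of [x, y] is noncritical: the ends are good, and
       only [c] could be critical nearby. *)
    case: (boolP (x < c < y)) => [/andP[xc cy]|xcy]; last first.
      exists X; apply: (strands_region GB ax xy y12 _ rX).1 => z u zi.
      case: (z =P c) => [zc|]; last by apply: regne; rewrite close_itv; lra.
      have [xz|] := boolP (z == x); first by apply: reg; rewrite (eqP xz).
      have [yz|] := boolP (z == y); first by move=> _; apply: reg; rewrite (eqP yz).
      by move=> /eqP h1 /eqP h2; exfalso; move/negP: xcy; apply; rewrite -zc; lra.
    have rl u z : x <= z < c -> regat G u z by move=> zi; apply: regne; [rewrite close_itv|]; lra.
    have rr u z : c < z <= y -> regat G u z by move=> zi; apply: regne; [rewrite close_itv|]; lra.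
    case: (boolP (c \in E)) => [/crit[ue [ev oth]]|cE]; last first.
      exists X; apply: (strands_region GB ax xy y12 _ rX).1 => z u zi.
      case: (z =P c) => [->|]; first exact: reg.
      by apply: regne; rewrite close_itv; lra.
    case: ev => ev.
    + have [d' [k [r [n [f [i [d'0 evf]]]]]]] := event_local G01 ev oth.
      exact: (event_step GB evf ax xc cy y12 rl rr rX).
    + have [d' [k [r [n [f [i [d'0 evf]]]]]]] := event_local G01 ev oth.
      exact: (event_step GB evf ax xc cy y12 rl rr rX).
    + have G01' u z : refl G (u, z) -> 0 < u < 1 by exact: G01.
      have [d' [k [r [n [f [i [d'0 evf]]]]]]] := event_local G01' ev (fun u h => regat_refl (oth u h)).
      exact: (cup_step GB evf ax xc cy y12 rl rr rX).
  - by apply: goodE; lra.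
  - by apply: goodE; lra.
  - by exists [::].
have [X [l [g [rl pg mg]]]] := sweep.
have X0 : X = [::].
  by apply/size0nil; rewrite (marks_size GB pg pid mg (mnil _ _)) //; lra.
rewrite X0 in rl mg.
have [|||||_ last1] := @strands_region G (9 / 20) (1 / 2) [::] GB; [lra|lra|lra| | |].
- by move=> c u ci; apply: regE; lra.
- by exists l, g; split.
have [|l1 rl1] := last1 _ pid; first by apply: mnil; lra.
exists l1; split=> // l1E; move: rl1; rewrite l1E => rl1.
have lev l2 b h Y : reach G l2 b h Y -> l2 = [::] -> b = - (1 / 2) by case.
by have := lev _ _ _ _ rl1 erefl; lra.
Qed.

End Sweeping.

(** * General position of the arcs *)

Ltac xclear := repeat match goal with H : ?P |- _ => lazymatch type of P with Prop => tryif ordhyp P then fail else clear H end end;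
  repeat match goal with H := _ |- _ => clearbody H end.
Ltac flra := first [solve [grab; dropall; intros; lra] | solve [grab; grab; dropall; intros; lra] | xclear; lra].
Section Zigzag.
Context {R : realType}.
Implicit Types (l u a b q : R -> R) (Z : seq R) (x y z al be ga om p H k t e h : R).

Lemma avoid Z x y : x < y -> exists2 h, x < h < y & h \notin Z.
Proof.
move=> xy; suff [x' [y' [xx xy' yy HZ]]] : exists x' y', [/\ x <= x', x' < y', y' <= y & forall h, x' < h < y' -> h \notin Z].
  exists ((x' + y') / 2); [|apply: HZ]; flra.
elim: Z => [|c Z [x' [y' [xx xy' yy HZ]]]]; first by exists x, y.
case: (leP c ((x' + y') / 2)) => cm.
  exists ((x' + y') / 2), y'; split=> //; [flra|flra|] => h hi.
  by rewrite inE negb_or HZ ?andbT; [apply/eqP; flra|flra].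
exists x', ((x' + y') / 2); split=> //; [flra|flra|] => h hi.
by rewrite inE negb_or HZ ?andbT; [apply/eqP; flra|flra].
Qed.

Lemma open_rgt x : open [set z : R | x < z].
Proof. exact: open_gt. Qed.

Lemma open_rlt x : open [set z : R | z < x].
Proof. exact: open_lt. Qed.

Definition parab H k p z := H - k * (z - p) ^+ 2.

Lemma smooth_parab (U : set R) H k p : open U -> smooth U (parab H k p).
Proof.
move=> oU; apply: smoothB => //; first exact: smooth_cst.
apply: smoothM => //; [exact: smooth_cst|apply: smoothX => //].
by apply: smoothB => //; [exact: smooth_id|exact: smooth_cst].
Qed.

Lemma is_derive_parab H k p z : is_derive z 1 (parab H k p) (- (k * (2 * (z - p)))).
Proof.
by apply: (is_derive_eq (dB (dC z 1 H) (dZ k (dX2 (dB (dI z) (dC z 1 p)))))); ring.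
Qed.

Lemma derive_eq_near (f g : R -> R) (U : set R) z : open U -> U z -> (forall y, U y -> f y = g y) -> 'D_1 f z = 'D_1 g z.
Proof.
move=> oU Uz fg; apply: near_eq_derive.
by near=> y; apply: fg; near: y; exact: open_nbhs_nbhs.
Unshelve. all: by end_near.
Qed.

Lemma is_derive_near (f g : R -> R) (U : set R) z d : open U -> U z -> (forall y, U y -> f y = g y) ->
  is_derive z 1 g d -> is_derive z 1 f d.
Proof.
move=> oU Uz fg dg; have E : \forall y \near z, g y = f y.
  by near=> y; apply/esym/fg; near: y; exact: open_nbhs_nbhs.
exact: (@near_eq_is_derive _ _ _ g f z 1 d E dg).
Unshelve. all: by end_near.
Qed.

(** Both derivatives exist, so one-sided agreement determines them: the slope of the difference
    vanishes on the right of [y] and is continuous at [y]. *)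
Lemma derive_eq_right (f g : R -> R) y : derivable f y 1 -> derivable g y 1 -> (forall z, y <= z -> f z = g z) ->
  'D_1 f y = 'D_1 g y.
Proof.
move=> df dg fg; have D := dB (derivableP df) (derivableP dg).
have dh : derivable (fun z => f z - g z) y 1 by exact: ex_derive.
have := slope_cvg dh; rewrite (derive_val (is_derive := D)) => cs.
apply/eqP; rewrite -subr_eq0; apply/negP => /negP D0.
have : {for y, continuous (slope (fun z => f z - g z) y)}.
  rewrite /prop_for /continuous_at; have -> : slope (fun z => f z - g z) y y = 'D_1 f y - 'D_1 g y.
    by rewrite /slope eqxx (derive_val (is_derive := D)).
  exact: cs.
move=> /cont1P/(_ `|'D_1 f y - 'D_1 g y|)[|d d0 Hd]; first by rewrite normr_gt0.
have := Hd (y + d / 2); rewrite addrAC subrr add0r gtr0_norm; last flra.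
rewrite [in slope _ _ y]/slope eqxx (derive_val (is_derive := D)) /slope gt_eqF; last flra.
rewrite !fg ?subrr ?mul0r ?sub0r ?normrN ?ltxx; [|flra|flra].
by move=> H; have := H ltac:(flra).
Qed.

Lemma near_pos l al be x : smooth [set z : R | al < z < be] l -> al < x < be -> 0 < 'D_1 l x ->
  forall e, 0 < e -> exists2 d : R, 0 < d & forall z, `|z - x| < d -> [/\ al < z < be, 0 < 'D_1 l z & `|l z - l x| < e].
Proof.
move=> sl xi Dl e e0.
have /cont1P/(_ _ e0)[d1 d10 H1] : {for x, continuous l} by apply: smooth_cont sl xi.
have /cont1P/(_ _ Dl)[d2 d20 H2] : {for x, continuous ('D_1 l)} by apply: (smooth_cont (smooth_derive (1 : R) sl)).
have [d3 d30 [d31 d32]] := @ex_min R d1 d2 d10 d20.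
have [d4 d40 [d41 d42]] := @ex_min R (x - al) (be - x) ltac:(flra) ltac:(flra).
have [d d0 [dd3 dd4]] := @ex_min R d3 d4 d30 d40.
exists d => // z zd; split.
- by move: zd; rewrite ltr_norml; flra.
- by have := H2 z ltac:(flra); rewrite ltr_norml; flra.
- by apply: H1; flra.
Qed.

(** Near [x] the function [l] increases and stays below the value of the parabola at [x], so a short
    blending from [l] to the parabola only adds to the slope; from there the parabola climbs to its
    vertex [p]. *)
Lemma rise l al be x p H k : smooth [set z : R | al < z < be] l -> al < x < be -> x < p -> 0 < 'D_1 l x ->
  0 < k -> l x < parab H k p x -> exists b t, [/\ 0 < t, x + t < p, smooth [set z : R | al < z] b,
   (forall z, z <= x -> b z = l z) /\ (forall z, x + t <= z -> b z = parab H k p z) &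
   (forall z, x <= z -> z < p -> 0 < 'D_1 b z) /\ (forall z, x <= z <= p -> l x <= b z <= H)].
Proof.
move=> sl xi xp Dl k0 lq; set q := parab H k p.
have e0 : 0 < q x - l x by rewrite subr_gt0.
have [d d0 Hd] := near_pos sl xi Dl e0.
have [t t0 [td tp]] := @half_min R d (p - x) d0 ltac:(flra).
pose b z := l z + step ((z - x) / t) * (q z - l z).
have bl z : z <= x -> b z = l z by move=> zx; rewrite /b stepl // mul0r addr0.
have bq z : x + t <= z -> b z = q z by move=> zx; rewrite /b stepr // mul1r; ring.
have oI : open [set z : R | al < z < be] by exact: open_itvoo.
have q_incr z z' : z <= z' -> z' <= p -> q z <= q z'.
  move=> zz zp; rewrite /q /parab; have : (z' - p) ^+ 2 <= (z - p) ^+ 2 by nra.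
  by move=> ?; rewrite lerB // ler_pM2l.
have Dq z : z < p -> 0 < - (k * (2 * (z - p))).
  move=> zp; have : 0 < k * (p - z) by rewrite mulr_gt0 // subr_gt0.
  flra.
have Db z : x <= z -> z < p -> exists2 D : R, 0 < D & is_derive z 1 b D.
  move=> xz zp; case: (leP z (x + t)) => zt; last first.
    exists (- (k * (2 * (z - p)))); first exact: Dq.
    apply: (@is_derive_near b q _ z _ (@open_rgt (x + t)) zt _ (is_derive_parab H k p z)).
    by move=> y /= /ltW/bq.
  have [zi Dlz lz] : [/\ al < z < be, 0 < 'D_1 l z & `|l z - l x| < q x - l x].
    by apply: Hd; rewrite ger0_norm; flra.
  have dl : is_derive z 1 l ('D_1 l z) by apply: DeriveDef => //; exact: smooth_derivable sl zi.
  have D := @blend_derive R l q x t z _ _ dl (is_derive_parab H k p z).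
  eexists; last exact: D.
  apply: ltr_pwDl; first by apply: convex_gt0 => //; [exact: step_ge0|exact: step_le1|exact: Dq].
  apply: mulr_ge0; first by rewrite divr_ge0 ?step_incr // ltW.
  rewrite subr_ge0; have := q_incr x z xz (ltW zp); move: lz; rewrite ltr_norml; flra.
exists b, t; split=> //; first by flra.
- apply: smooth_union => z /= zal; case: (ltP z be) => zb.
    exists [set z : R | al < z < be]; first by rewrite /= zal.
    apply: smoothD => //; apply: smoothM => //; last by apply: smoothB => //; exact: smooth_parab.
    apply: smooth_step => //; apply: smoothM => //; last exact: smooth_cst.
    by apply: smoothB => //; [exact: smooth_id|exact: smooth_cst].
  have xtb : x + t < be.
    have [|/andP[]//] := Hd (x + t); rewrite addrC addKr gtr0_norm //; flra.
  have oJ : open [set z : R | x + t < z] by exact: open_gt.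
  exists [set z : R | x + t < z]; first by rewrite /=; flra.
  by apply: (smooth_ext oJ _ (smooth_parab H k p oJ)) => y /= yt; rewrite bq // ltW.
- split=> [z xz zp|z /andP[xz zp]]; first by have [D D0 dD] := Db z xz zp; rewrite (derive_val (is_derive := dD)).
  have tp' : x + t < p by flra.
  have Dbp : is_derive p 1 b 0.
    apply: (@is_derive_near b q _ p _ (@open_rgt (x + t)) tp') => //.
      by move=> y /= /ltW/bq.
    by apply: (is_derive_eq (is_derive_parab H k p p)); rewrite subrr !mulr0 oppr0.
  have Dall y : x <= y <= p -> exists2 D : R, 0 <= D & is_derive y 1 b D.
    move=> /andP[xy]; rewrite le_eqVlt => /orP[/eqP ->|yp]; first by exists 0.
    by have [D D0 dD] := Db y xy yp; exists D => //; exact: ltW.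
  have mono v w : x <= v -> v <= w -> w <= p -> b v <= b w.
    apply: nondecr_le => y yi; have [D D0 dD] := Dall y yi; first exact: ex_derive.
    by rewrite (derive_val (is_derive := dD)).
  have bx : b x = l x by rewrite bl.
  have bp : b p = H by rewrite bq; [rewrite /q /parab subrr expr0n mulr0 subr0|flra].
  by rewrite -{1}bx -bp !mono.
Qed.

Lemma smooth_flip (f : R -> R) x y : smooth [set z : R | x < z < y] f -> smooth [set z : R | - y < z < - x] (fun z => f (- z)).
Proof.
move=> sf; apply: (@smooth_comp1 _ _ [set z : R | x < z < y] _ f (fun z : R => - z)) => //.
- exact: open_itvoo.
- by move=> z /= zi; flra.
- by apply: smooth_sub smooth_opp.
Qed.

Lemma derive_flip (f : R -> R) z : derivable f (- z) 1 -> 'D_1 (fun y => f (- y)) z = - 'D_1 f (- z).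
Proof.
move=> df; have D : is_derive z 1 (fun y => f (- y)) ('D_1 f (- z) * -1).
  have c : {for z, continuous (fun y : R => - y)} by apply: (smooth_cont smooth_opp).
  exact: (d1comp c df (dN (dI z))).
by rewrite (derive_val (is_derive := D)) mulrN1.
Qed.

(** Two rises towards the same parabola, one of them reflected, coincide with it around the vertex
    and therefore glue. *)
Lemma hump l u al be x y ga om H : smooth [set z : R | al < z < be] l -> smooth [set z : R | ga < z < om] u ->
  al < x < be -> ga < y < om -> x < y -> 0 < 'D_1 l x -> 'D_1 u y < 0 -> l x < H -> u y < H ->
  exists b p k t, [/\ [/\ 0 < k, 0 < t, x < p < y & forall z, `|z - p| < t -> b z = parab H k p z],
    smooth [set z : R | al < z < om] b,
    (forall z, z <= x -> b z = l z) /\ (forall z, y <= z -> b z = u z),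
    forall z, x <= z <= y -> z <> p -> 'D_1 b z != 0 &
    forall z, x <= z <= y -> l x <= b z <= H \/ u y <= b z <= H].
Proof.
move=> sl su xi yi xy Dl Du lH uH.
have [p pE] : exists p, p = (x + y) / 2 by exists ((x + y) / 2).
have L0 : 0 < p - x by flra.
have [M M0 [M1 M2]] := @ex_min R (H - l x) (H - u y) ltac:(flra) ltac:(flra).
(* The vertex being the midpoint, this [k] gives the parabola the value [H - M / 2] at both ends,
   above [l x] and [u y]. *)
have [k kE] : exists k : R, k = M / 2 / (p - x) ^+ 2 by eexists.
have k0 : 0 < k by rewrite kE divr_gt0 ?exprn_gt0 //; flra.
have kL : k * (p - x) ^+ 2 = M / 2 by rewrite kE divfK // gt_eqF // exprn_gt0.
have qE : parab H k p x = H - M / 2 by rewrite /parab -kL -[x - p]opprB sqrrN.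
have [||b1 [t1 [t10 xt1 sb1 [bl1 bq1] [Db1 B1]]]] := @rise l al be x p H k sl xi _ Dl k0; [flra|by rewrite qE; flra|].
have [|||||b2 [t2 [t20 xt2 sb2 [bl2 bq2] [Db2 B2]]]] := @rise (fun z => u (- z)) (- om) (- ga) (- y) (- p) H k _ _ _ _ k0.
- exact: smooth_flip.
- flra.
- flra.
- by rewrite derive_flip opprK; [flra|exact: smooth_derivable su yi].
- have -> : parab H k (- p) (- y) = H - M / 2 by rewrite -qE /parab; congr (_ - _ * _ ^+ 2); flra.
  by rewrite opprK; flra.
(* Around [p] both branches are the parabola, so either formula may be used on the overlap. *)
pose b z := if z < p then b1 z else b2 (- z).
have bq z : x + t1 <= z <= y - t2 -> b z = parab H k p z.
  move=> zi; rewrite /b; case: ifP => _; first by rewrite bq1 //; flra.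
  by rewrite bq2 /parab; [congr (_ - _ * _); ring|flra].
have E1 z : z < p -> b z = b1 z by rewrite /b => ->.
have E2 z : x + t1 < z -> b z = b2 (- z).
  move=> zt; rewrite /b; case: ifP => // zp; rewrite bq1; last flra.
  by rewrite bq2 /parab; [congr (_ - _ * _); ring|flra].
have oA : open [set z : R | al < z < p] by exact: open_itvoo.
have oB : open [set z : R | x + t1 < z < om] by exact: open_itvoo.
have sB : smooth [set z : R | x + t1 < z < om] (fun z => b2 (- z)).
  apply: (@smooth_comp1 _ _ [set z : R | - om < z] _ b2 (fun z : R => - z)) => //.
    by move=> z /= zi; flra.
  by apply: smooth_sub smooth_opp.
exists b, p, k, (Num.min (p - x - t1) (y - t2 - p)); split.
- split=> //; [by rewrite lt_min; apply/andP; split; flra|flra|].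
  move=> z; rewrite lt_min !ltr_norml => /andP[/andP[? ?] /andP[? ?]]; apply: bq; flra.
- apply: smooth_union => z /= zi; case: (ltP z p) => zp.
    exists [set z : R | al < z < p]; first by rewrite /=; flra.
    have sb1' : smooth [set z : R | al < z < p] b1 by apply: smooth_sub sb1 => w /= wi; flra.
    by apply: (smooth_ext oA _ sb1') => w /= wi; rewrite E1 //; flra.
  exists [set z : R | x + t1 < z < om]; first by rewrite /=; flra.
  by apply: (smooth_ext oB _ sB) => w /= wi; rewrite E2 //; flra.
- split=> z zi; first by rewrite E1 ?bl1 //; flra.
  by rewrite E2 ?bl2 ?opprK //; flra.
- move=> z zi zp; have [zp'|zp'] := ltP z p.
    rewrite (@derive_eq_near b b1 _ z (@open_rlt p)) //.
    by apply: lt0r_neq0; apply: Db1; flra.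
  have zp2 : p < z by flra.
  rewrite (@derive_eq_near b (fun z => b2 (- z)) _ z (@open_rgt (x + t1))) //; last by move=> /=; flra.
  rewrite derive_flip ?oppr_eq0; last by apply: smooth_derivable sb2 _ => /=; flra.
  by apply: lt0r_neq0; apply: Db2; flra.
- move=> z zi; have [zp'|zp'] := ltP z p; [left|right].
    by rewrite E1 //; apply: B1; flra.
  by rewrite E2; [have := B2 (- z); rewrite opprK; apply; clear -zi zp'; lra|flra].
Qed.

Lemma derive_opp (f : R -> R) z : derivable f z 1 -> 'D_1 (fun y => - f y) z = - 'D_1 f z.
Proof. by move=> df; have D := dN (derivableP df); rewrite (derive_val (is_derive := D)). Qed.

(** The extremum is put beyond both end values, yet within 2e of [h], at a height off the finite
    list [Z]. A minimum is obtained as a maximum of the opposite functions. *)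
Lemma node l u al be x y ga om h e Z : smooth [set z : R | al < z < be] l -> smooth [set z : R | ga < z < om] u ->
  al < x < be -> ga < y < om -> x < y -> 'D_1 l x * 'D_1 u y < 0 -> 0 < e -> `|l x - h| < e -> `|u y - h| < e ->
  exists b p k t, [/\ [/\ k != 0, 0 < t, x < p < y, b p \notin Z & forall z, `|z - p| < t -> b z = b p + k * (z - p) ^+ 2],
    smooth [set z : R | al < z < om] b,
    (forall z, z <= x -> b z = l z) /\ (forall z, y <= z -> b z = u z),
    forall z, x <= z <= y -> z <> p -> 'D_1 b z != 0 &
    forall z, x <= z <= y -> `|b z - h| < 2 * e].
Proof.
move=> sl su xi yi xy Dlu e0; rewrite !ltr_norml => lh uh.
have cc p t : 0 < t -> `|p - p| < t by rewrite subrr normr0.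
case: (ltP 0 ('D_1 l x)) => Dl.
  have Du : 'D_1 u y < 0 by move: Dlu; rewrite pmulr_rlt0.
  have [|H Hi HZ] := @avoid Z (h + e) (h + 2 * e); first by flra.
  have [||b [p [k [t [[k0 t0 pi bq] sb bE Db Bb]]]]] := @hump l u al be x y ga om H sl su xi yi xy Dl Du; [flra|flra|].
  have bp : b p = H by rewrite bq ?cc // /parab subrr expr0n mulr0 subr0.
  exists b, p, (- k), t; split=> //.
    split=> //; [by rewrite oppr_eq0 gt_eqF|by rewrite bp|].
    by move=> z zt; rewrite bq // bp /parab mulNr.
  by move=> z zi; rewrite ltr_norml; have := Bb z zi; flra.
have Dl' : 'D_1 l x < 0.
  by rewrite lt_neqAle Dl andbT; apply: contraTneq Dlu => ->; rewrite mul0r ltxx.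
have Du : 0 < 'D_1 u y by move: Dlu; rewrite nmulr_rlt0.
have [|H Hi HZ] := @avoid Z (h - 2 * e) (h - e); first by flra.
have oI v w := @open_itvoo R v w.
have [||||||b [p [k [t [[k0 t0 pi bq] sb [bl bu] Db Bb]]]]] := @hump (fun z => - l z) (fun z => - u z) al be x y ga om (- H) _ _ xi yi xy.
- exact: smoothN.
- exact: smoothN.
- by rewrite derive_opp ?oppr_gt0 //; exact: smooth_derivable sl xi.
- by rewrite derive_opp ?oppr_lt0 //; exact: smooth_derivable su yi.
- flra.
- flra.
have bp : b p = - H by rewrite bq ?cc // /parab subrr expr0n mulr0 subr0.
exists (fun z => - b z), p, k, t; split.
- split=> //; [by rewrite gt_eqF|by rewrite bp opprK|].
  by move=> z zt; rewrite bq // bp /parab; ring.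
- exact: smoothN.
- by split=> z zi; [rewrite bl|rewrite bu]; rewrite ?opprK.
- move=> z zi zp; rewrite derive_opp ?oppr_eq0; first exact: Db.
  by apply: smooth_derivable sb _ => /=; flra.
- by move=> z zi; rewrite ltr_norml; have := Bb z zi; flra.
Qed.

(** Invariant of a construction from left to right. Critical points are exact parabolas, not merely
    nondegenerate, since the event bands are built on that normal form. *)
Record wiggle a al x0 e Z x b (Cr : seq R) : Prop := Wiggle {
  wg_left : forall z, z <= x0 -> b z = a z;
  wg_close : forall z, x0 <= z <= x -> `|b z - a z| < e;
  wg_reg : forall z, x0 <= z <= x -> z \notin Cr -> 'D_1 b z != 0;
  wg_crit : forall c, c \in Cr -> x0 < c < x /\ exists k t, [/\ k != 0, 0 < t & forall z, `|z - c| < t -> b z = b c + k * (z - c) ^+ 2];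
  wg_uniq : uniq [seq b c | c <- Cr];
  wg_avoid : forall c, c \in Cr -> b c \notin Z
}.

(** One more node; its critical value is also kept off those already present, so that all of them
    remain distinct. *)
Lemma wiggle_extend a al x0 e Z x b Cr be u y ga om h : wiggle a al x0 e Z x b Cr ->
  smooth [set z : R | al < z < be] b -> al < x0 -> x0 <= x -> x < be -> b x = a x ->
  smooth [set z : R | ga < z < om] u -> ga < y < om -> u y = a y -> x < y ->
  'D_1 b x * 'D_1 u y < 0 -> 0 < e -> (forall z, x <= z <= y -> `|a z - h| < e / 4) ->
  exists b' Cr', [/\ wiggle a al x0 e Z y b' Cr', smooth [set z : R | al < z < om] b' &
    forall z, y <= z -> b' z = u z].
Proof.
move=> [wl wc wr wk wu wa] sb alx xx xb bx su yi uy xy D0 e0 ah.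
have xi : al < x < be by flra.
have e4 : 0 < e / 4 by flra.
have [||b' [p [k [t [[k0 t0 pi pZ bp] sb' [bl bu] Db' Bb]]]]] :=
  @node b u al be x y ga om h (e / 4) ([seq b c | c <- Cr] ++ Z) sb su xi yi xy D0 e4.
- by rewrite bx; apply: ah; flra.
- by rewrite uy; apply: ah; flra.
have bc c : c \in Cr -> b' c = b c by move=> /wk[ci _]; apply: bl; flra.
have pC : p \notin Cr by apply/negP => /wk[ci _]; flra.
have E : [seq b' c | c <- Cr] = [seq b c | c <- Cr] by apply/eq_in_map => c /bc.
move: pZ; rewrite mem_cat negb_or => /andP[pC' pZ].
exists b', (p :: Cr); split=> //; split.
- by move=> z zx; rewrite bl ?wl //; flra.
- move=> z zi; case: (leP z x) => zx; first by rewrite bl //; apply: wc; flra.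
  have := Bb z ltac:(flra); have := ah z ltac:(flra); rewrite !ltr_norml; flra.
- move=> z zi; rewrite inE negb_or => /andP[/eqP zp zC]; case: (ltP z x) => zx; last by apply: Db' => //; flra.
  rewrite (@derive_eq_near b' b _ z (@open_rlt x)) //; [by apply: wr => //; flra|].
  by move=> w /= wx; rewrite bl // ltW.
- move=> c; rewrite inE => /orP[/eqP ->|cC]; first by split; [flra|exists k, t].
  have [ci [k' [t' [k'0 t'0 H]]]] := wk c cC; split; first by flra.
  have [d d0 [d1 d2]] := @ex_min R t' (x - c) t'0 ltac:(flra).
  exists k', d; split=> // z zd; rewrite !bl; [apply: H; flra|flra|by move: zd; rewrite ltr_norml; flra].
- by rewrite /= E wu andbT.
- by move=> c; rewrite inE => /orP[/eqP -> //|cC]; rewrite bc //; exact: wa.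
Qed.

(** The derivative of [a] inside the interval is never looked at: over a step where [a] varies
    little compared with [e], one node reverses the sign of the slope of [b] and ends on the graph
    of [a], and two nodes keep the sign. Real induction chains such steps. *)
Lemma zigzag a al x0 x1 om e Z : smooth [set z : R | al < z < om] a -> al < x0 -> x0 < x1 -> x1 < om ->
  'D_1 a x0 != 0 -> 'D_1 a x1 != 0 -> 0 < e ->
  exists b Cr, [/\ wiggle a al x0 e Z x1 b Cr, smooth [set z : R | al < z < om] b & forall z, x1 <= z -> b z = a z].
Proof.
move=> sa alx xx xom Da0 Da1 e0.
(* Only the sign of [m] matters: it is that of the slope reached at [x]. *)
pose St x m := exists b Cr be, [/\ wiggle a al x0 e Z x b Cr, smooth [set z : R | al < z < be] b, x < be, b x = a x & 0 < 'D_1 b x * m].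
have osc c : x0 <= c <= x1 -> exists2 d : R, 0 < d & forall x, `|x - c| < d -> `|a x - a c| < e / 4.
  move=> ci; have /cont1P/(_ (e / 4))[|d d0 Hd] : {for c, continuous a} by apply: smooth_cont sa _ => /=; flra.
    flra.
  by exists d.
have line y m : m != 0 -> exists u, [/\ smooth [set z : R | y - 1 < z < y + 1] u, u y = a y & 'D_1 u y = m].
  move=> m0; exists (fun z => a y + m * (z - y)); split.
  - by apply: smooth_sub (smooth_affine (a y) m y).
  - by rewrite subrr mulr0 addr0.
  - by have D := is_derive_affine (a y) m y y; rewrite (derive_val (is_derive := D)).
have turn x y h m : x0 <= x -> x < y -> (forall z, x <= z <= y -> `|a z - h| < e / 4) -> St x m -> St y (- m).
  move=> x0x xy ah [b [Cr [be [wg sb xb bx Dx]]]].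
  have m0 : m != 0 by apply: contraTneq Dx => ->; rewrite mulr0 ltxx.
  have [u [su uy Du]] := @line y (- m) ltac:(by rewrite oppr_eq0).
  have yi : y - 1 < y < y + 1 by flra.
  have D0 : 'D_1 b x * 'D_1 u y < 0 by rewrite Du mulrN oppr_lt0.
  have [b' [Cr' [wg' sb' bu]]] := wiggle_extend wg sb alx x0x xb bx su yi uy xy D0 e0 ah.
  exists b', Cr', (y + 1); split=> //; [flra|by rewrite bu // uy|].
  have -> : 'D_1 b' y = 'D_1 u y.
    apply: derive_eq_right => //; first by apply: (smooth_derivable sb') => /=; clear -alx x0x xy; flra.
    exact: (smooth_derivable su).
  by rewrite Du -expr2 exprn_even_gt0 //= oppr_eq0.
have go x y h m : x0 <= x -> x < y -> (forall z, x <= z <= y -> `|a z - h| < e / 4) -> St x m -> St y m.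
  move=> x0x xy ah Sx; rewrite -[m]opprK.
  apply: (@turn ((x + y) / 2) y h); [flra|flra|by move=> z zi; apply: ah; flra|].
  by apply: (@turn x _ h) => //; [flra|by move=> z zi; apply: ah; flra].
have start : St x0 ('D_1 a x0).
  exists a, [::], om; split=> //; last 2 first.
  - flra.
  - by rewrite -expr2 exprn_even_gt0.
  split=> // z zi; first by rewrite subrr normr0.
  by rewrite (_ : z = x0) //; flra.
have all x : x0 <= x <= x1 -> St x ('D_1 a x0).
  move=> /andP[x0x xx1]; apply: (@real_ind R (fun y => St y ('D_1 a x0)) (fun=> True) x0 x) => // c ci.
  have [|d d0 Hd] := osc c; first by flra.
  exists d => //; split=> // v w vd wd xv vw wx _ _; apply: (go v w (a c)) => // z zi.
  by apply: Hd; move: vd wd; rewrite !ltr_norml; flra.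
have [|d d0 Hd] := osc x1; first by flra.
have [t t0 [td tx]] := @half_min R d (x1 - x0) d0 ltac:(flra).
have near_x1 z : x1 - t <= z <= x1 -> `|a z - a x1| < e / 4 by move=> zi; apply: Hd; rewrite ler0_norm; flra.
(* The last node joins slopes of opposite signs, so one more turn is made when the current sign
   agrees with that of [a] at [x1]. *)
have [y [m [yi Sy m0]]] : exists y m, [/\ x1 - t <= y < x1, St y m & m * 'D_1 a x1 < 0].
  case: (ltP ('D_1 a x0 * 'D_1 a x1) 0) => s.
    by exists (x1 - t), ('D_1 a x0); split=> //; [flra|apply: all; flra].
  exists (x1 - t / 2), (- 'D_1 a x0); split; [flra| |].
    apply: (@turn (x1 - t) _ (a x1)); [flra|flra| |apply: all; flra].
    by move=> z zi; apply: near_x1; flra.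
  by rewrite mulNr oppr_lt0 lt_neqAle s andbT eq_sym mulf_neq0.
move: Sy => [b [Cr [be [wg sb yb by_ Dy]]]].
have D0 : 'D_1 b y * 'D_1 a x1 < 0.
  have : 0 < ('D_1 b y * m) * - (m * 'D_1 a x1) by rewrite mulr_gt0 // oppr_gt0.
  have -> : ('D_1 b y * m) * - (m * 'D_1 a x1) = - ('D_1 b y * 'D_1 a x1) * m ^+ 2 by ring.
  have mn : m != 0 by apply: contraTneq m0 => ->; rewrite mul0r ltxx.
  by rewrite pmulr_lgt0 ?oppr_gt0 // exprn_even_gt0.
have [||||b' [Cr' [wg' sb' bu]]] := @wiggle_extend a al x0 e Z y b Cr be a x1 al om (a x1) wg sb alx _ yb by_ sa _ erefl _ D0 e0.
- flra.
- flra.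
- flra.
- by move=> z zi; apply: near_x1; flra.
by exists b', Cr'.
Qed.
End Zigzag.

(** * Diffeomorphisms supported in the box *)

Section Diffeos.
Context {R : realType}.
Implicit Types (G : set (R * R)) (H K : R * R -> R * R) (x y u c : R) (z : R * R).

Definition jac H z : R :=
  'D_(1, 0) (fun z => (H z).1) z * 'D_(0, 1) (fun z => (H z).2) z
  - 'D_(0, 1) (fun z => (H z).1) z * 'D_(1, 0) (fun z => (H z).2) z.

(** The smooth inverse is part of the data: it comes from explicit shears. Being the identity off
    the box, these maps are compatible with the period of the cylinder and with the closing discs; a
    positive Jacobian keeps the orientation. *)
Record diffeo H K : Prop := Diffeo {
  df_1 : smooth [set: R * R] (fun z => (H z).1);
  df_2 : smooth [set: R * R] (fun z => (H z).2);
  df_i1 : smooth [set: R * R] (fun z => (K z).1);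
  df_i2 : smooth [set: R * R] (fun z => (K z).2);
  df_HK : cancel H K;
  df_KH : cancel K H;
  df_jac : forall z, 0 < jac H z;
  df_off : forall z, ~ Bo z -> H z = z
}.

(** The image of the drawing under the inverse [K], written as a preimage under [H]. *)
Definition pull H G : set (R * R) := [set z | G (H z)].

Lemma pair_eta (z : R * R) : (z.1, z.2) = z.
Proof. by case: z. Qed.

Lemma smooth_pair_comp (V : normedModType R) (U : set V) (W : set (R * R)) (g : R * R -> R) (F : V -> R * R) : open U -> open W ->
  (forall v, U v -> W (F v)) -> smooth W g -> smooth U (fun v => (F v).1) -> smooth U (fun v => (F v).2) ->
  smooth U (fun v => g (F v)).
Proof.
move=> oU oW UW sg s1 s2.
have s := @smooth_comp2 _ _ W U g (fun v => (F v).1) (fun v => (F v).2) oU oW.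
apply: (smooth_ext oU (f := fun v => g ((F v).1, (F v).2))); first by move=> v _; rewrite pair_eta.
by apply: s => // v /UW; rewrite pair_eta.
Qed.

Lemma derive_pair_comp (V : normedModType R) (W : set (R * R)) (g : R * R -> R) (F : V -> R * R) (x v : V) (d1 d2 : R) : open W -> W (F x) -> smooth W g ->
  {for x, continuous (fun v => (F v).1)} -> {for x, continuous (fun v => (F v).2)} ->
  is_derive x v (fun v => (F v).1) d1 -> is_derive x v (fun v => (F v).2) d2 ->
  is_derive x v (fun v => g (F v)) ('D_(1, 0) g (F x) * d1 + 'D_(0, 1) g (F x) * d2).
Proof.
move=> oW WF sg c1 c2 D1 D2.
have WF' : W ((F x).1, (F x).2) by rewrite pair_eta.
have := @is_derive_comp2 _ _ g W (fun v => (F v).1) (fun v => (F v).2) x v d1 d2 oW WF' sg c1 c2 D1 D2.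
rewrite pair_eta; have -> // : (fun y : V => g ((F y).1, (F y).2)) = (fun v => g (F v)).
by apply/funext => y; rewrite pair_eta.
Qed.

Lemma jac_comp (U W : set (R * R)) H K z : open U -> open W -> U z -> W (K z) ->
  smooth W (fun z => (H z).1) -> smooth W (fun z => (H z).2) ->
  smooth U (fun z => (K z).1) -> smooth U (fun z => (K z).2) ->
  jac (fun z => H (K z)) z = jac H (K z) * jac K z.
Proof.
move=> oU oW Uz WK sH1 sH2 sK1 sK2.
have c1 : {for z, continuous (fun z => (K z).1)} by exact: smooth_cont sK1 Uz.
have c2 : {for z, continuous (fun z => (K z).2)} by exact: smooth_cont sK2 Uz.
have D (g : R * R -> R) (v : R * R) : smooth W g -> 'D_v (fun z => g (K z)) z =
    'D_(1, 0) g (K z) * 'D_v (fun z => (K z).1) z + 'D_(0, 1) g (K z) * 'D_v (fun z => (K z).2) z.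
  move=> sg.
  have d1 : is_derive z v (fun z => (K z).1) ('D_v (fun z => (K z).1) z) by apply: derivableP; exact: (smooth_derivable sK1).
  have d2 : is_derive z v (fun z => (K z).2) ('D_v (fun z => (K z).2) z) by apply: derivableP; exact: (smooth_derivable sK2).
  have DD := derive_pair_comp oW WK sg c1 c2 d1 d2.
  by rewrite (derive_val (is_derive := DD)).
rewrite /jac (D (fun z => (H z).1) (1, 0) sH1) (D (fun z => (H z).1) (0, 1) sH1).
rewrite (D (fun z => (H z).2) (1, 0) sH2) (D (fun z => (H z).2) (0, 1) sH2).
have alg (p q r t p' q' r' t' : R) : (p * p' + q * r') * (r * q' + t * t') - (p * q' + q * t') * (r * p' + t * r') =
    (p * t - q * r) * (p' * t' - q' * r') by ring.
exact: alg.
Qed.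

Lemma diffeo_id : diffeo id id.
Proof.
split=> //; try exact: smooth_fst; try exact: smooth_snd.
move=> z; have d1 v := derive_val (is_derive := @is_derive_fst R z v).
have d2 v := derive_val (is_derive := @is_derive_snd R z v).
by rewrite /jac !d1 !d2 /= mulr1 mul0r subr0 ltr01.
Qed.

Lemma diffeo_comp H K H' K' : diffeo H K -> diffeo H' K' -> diffeo (fun z => H (H' z)) (fun z => K' (K z)).
Proof.
move=> [s1 s2 t1 t2 HK KH j off] [s1' s2' t1' t2' HK' KH' j' off'].
have oT := @openT (R * R)%type.
split.
- exact: (@smooth_pair_comp _ setT setT (fun z => (H z).1) H').
- exact: (@smooth_pair_comp _ setT setT (fun z => (H z).2) H').
- exact: (@smooth_pair_comp _ setT setT (fun z => (K' z).1) K).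
- exact: (@smooth_pair_comp _ setT setT (fun z => (K' z).2) K).
- by move=> z; rewrite HK HK'.
- by move=> z; rewrite KH' KH.
- by move=> z; rewrite (@jac_comp setT setT H H' z oT oT I I s1 s2 s1' s2') mulr_gt0.
- by move=> z zB; rewrite off' // off.
Qed.

Definition vmap (eta : R * R -> R) z := (z.1, eta z).
(** A [vshear] acts along vertical lines; exchanging the coordinates yields a horizontal shear. *)
Definition hmap (eta : R * R -> R) z := (eta (z.2, z.1), z.2).

Lemma vmap_diffeo eta zeta : vshear eta zeta -> (forall z, ~ Bo z -> eta z = z.2) -> diffeo (vmap eta) (vmap zeta).
Proof.
move=> [[se sz] ez ze pe pz] off; split=> //=; try exact: smooth_fst.
- by move=> [x y]; rewrite /vmap /= ze.
- by move=> [x y]; rewrite /vmap /= ez.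
- move=> z; have d1 v := derive_val (is_derive := @is_derive_fst R z v).
  by rewrite /jac /= !d1 /= mul1r mul0r subr0.
- by move=> [x y] zB; rewrite /vmap off.
Qed.

Lemma hmap_diffeo eta zeta : vshear eta zeta -> (forall x y, ~ Bo (x, y) -> eta (y, x) = x) -> diffeo (hmap eta) (hmap zeta).
Proof.
move=> [[se sz] ez ze pe pz] off.
have oT := @openT (R * R)%type.
have sw (f : R * R -> R) : smooth [set: R * R] f -> smooth [set: R * R] (fun z => f (z.2, z.1)).
  by move=> sf; apply: (@smooth_comp2 _ _ setT setT f snd fst) => //; [exact: smooth_snd|exact: smooth_fst].
split=> //=; try exact: smooth_snd; try exact: sw.
- by move=> [x y]; rewrite /hmap /= ze.
- by move=> [x y]; rewrite /hmap /= ez.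
- move=> [x y]; have d2 v := derive_val (is_derive := @is_derive_snd R (x, y) v).
  rewrite /jac /= !d2 /= mulr1 mulr0 subr0 D10E /= -(D01E eta); exact: pe.
- by move=> [x y] zB; rewrite /hmap /= off.
Qed.

Lemma pull_Bo H K G : diffeo H K -> G `<=` Bo -> pull H G `<=` Bo.
Proof.
move=> D GB z; rewrite /pull /= => Gz; apply: contrapT => zB; apply: (zB).
by apply: GB; rewrite -(df_off D zB).
Qed.

End Diffeos.

(** * Replacing flat stretches by zigzags *)

Section Flattening.
Context {R : realType}.
Implicit Types (G : set (R * R)) (H K : R * R -> R * R) (a b : R -> R) (x y u c w d e k : R) (z : R * R).

Definition agree G G' u c := exists2 r : R, 0 < r & forall x y, `|x - u| < r -> `|y - c| < r -> (G (x, y) <-> G' (x, y)).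

Lemma agree_center G G' u c : agree G G' u c -> (G (u, c) <-> G' (u, c)).
Proof. by move=> [r r0 H]; apply: H; rewrite subrr normr0. Qed.

Lemma agree_refl G G' u c : agree G G' u c -> agree (refl G) (refl G') u (- c).
Proof.
by move=> [r r0 H]; exists r => // x y xr yr; apply: H => //=; rewrite -normrN opprD opprK addrC; move: yr; rewrite opprK addrC.
Qed.

Lemma agree_strandat G G' u c : agree G G' u c -> strandat G u c -> strandat G' u c.
Proof.
move=> [r r0 H] [g [w [d [w0 d0 sg gc Gg]]]].
have [w' w'0 [w1 w2]] := @ex_min R w r w0 r0.
have [d' d'0 [d1 d2]] := @ex_min R d r d0 r0.
exists g, w', d'; split=> //.
  apply: smooth_sub sg => y /= /andP[y1 y2]; apply/andP; split; lra.
by move=> x y xw yd; rewrite -H ?Gg //; [exact: lt_le_trans w1|exact: lt_le_trans d1|exact: lt_le_trans w2|exact: lt_le_trans d2].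
Qed.

Lemma agree_eventat cap G G' u c : agree G G' u c -> eventat cap G u c -> eventat cap G' u c.
Proof.
move=> [r r0 H] [k [r' [k0 r'0 Hev]]].
have [d d0 [d1 d2]] := @ex_min R r r' r0 r'0.
exists k, d; split=> // x y xd yd.
by rewrite -H ?Hev //; [exact: lt_le_trans d2|exact: lt_le_trans d2|exact: lt_le_trans d1|exact: lt_le_trans d1].
Qed.

Lemma agree_freeat G G' u c : agree G G' u c -> freeat G u c -> freeat G' u c.
Proof.
move=> [r r0 H] [e e0 He]; have [d d0 [d1 d2]] := @ex_min R r e r0 e0.
exists d => // x y xd yd; rewrite -H; [|exact: lt_le_trans d1|exact: lt_le_trans d1].
by apply: He; exact: lt_le_trans d2.
Qed.

Definition critat G u c := [\/ eventat true G u c, eventat false G u c | cupat G u c].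

Lemma agree_critat G G' u c : agree G G' u c -> critat G u c -> critat G' u c.
Proof.
move=> ag [] ev; [constructor 1|constructor 2|constructor 3]; try exact: agree_eventat ev.
exact: agree_eventat (agree_refl ag) ev.
Qed.

Lemma critat_in G u c : critat G u c -> G (u, c).
Proof.
case=> [[k [r [k0 r0 Hev]]]|[k [r [k0 r0 Hev]]]|[k [r [k0 r0 Hev]]]].
- by apply/Hev; rewrite ?subrr ?normr0 //= !subrr expr0n mulr0.
- by apply/Hev; rewrite ?subrr ?normr0 //=; right.
- have : refl G (u, - c) by apply/Hev; rewrite ?subrr ?normr0 //= !subrr expr0n mulr0.
  by rewrite /refl /= opprK.
Qed.

(** A graph over the horizontal axis, whereas [strandat] asks for one over the vertical axis: only
    the latter can be swept. *)
Definition graphat G a x0 := exists2 d : R, 0 < d &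
  forall x y, `|x - x0| < d -> `|y - a x0| < d -> (G (x, y) <-> y = a x).

Lemma agree_graphat G G' a x0 : agree G G' x0 (a x0) -> graphat G a x0 -> graphat G' a x0.
Proof.
move=> [r r0 H] [e e0 He]; have [d d0 [d1 d2]] := @ex_min R r e r0 e0.
exists d => // x y xd yd; rewrite -H ?He //; [exact: lt_le_trans d2|exact: lt_le_trans d2|exact: lt_le_trans d1|exact: lt_le_trans d1].
Qed.

Lemma graphat_in G a x0 : graphat G a x0 -> G (x0, a x0).
Proof. by move=> [d d0 H]; apply/H => //; rewrite subrr normr0. Qed.

Lemma graphat_strand G a x0 r : 0 < r -> smooth [set x : R | x0 - r < x < x0 + r] a -> graphat G a x0 ->
  'D_1 a x0 != 0 -> strandat G x0 (a x0).
Proof.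
move=> r0 sa [d1 d10 H1] Da; have x0i : x0 - r < x0 < x0 + r by lra.
have Da0 : 0 < `|'D_1 a x0| by rewrite normr_gt0.
have /cont1P/(_ _ Da0)[d2 d20 H2] : {for x0, continuous ('D_1 a)} by apply: (smooth_cont (smooth_derive (1 : R) sa)).
have [d3 d30 [d31 d32]] := @ex_min R d1 d2 d10 d20.
have [d d0 [d13 dr]] := @ex_min R d3 r d30 r0.
have nb x : x0 - d < x < x0 + d -> `|x - x0| < d by rewrite -close_itv.
have sa' : smooth [set x : R | x0 - d < x < x0 + d] a by apply: smooth_sub sa => x /= xi; clear -xi dr; lra.
have [|kk kK [oW sk]] := inverse_ne0 sa'.
  move=> t /nb td; apply/negP => /eqP t0; have := H2 t; rewrite t0 sub0r normrN ltxx.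
  by move=> h; suff : false by []; apply: h; clear -td d13 d32; lra.
have Wx0 : (a @` [set t : R | x0 - d < t < x0 + d]) (a x0) by exists x0 => //=; clear -d0; lra.
have /nbhs1P[e e0 He] := open_nbhs_nbhs (conj oW Wx0).
have [e' e'0 [e1 e2]] := @ex_min R e d1 e0 d10.
exists kk, d, e'; split=> //.
- by apply: smooth_sub sk => y /= yi; apply: He; rewrite close_itv; clear -yi e1; lra.
- by apply: kK; clear -d0; lra.
- move=> u y ud ye; rewrite H1; [|clear -ud d13 d31; lra|clear -ye e2; lra].
  split=> [->|uE]; first by rewrite kK // -close_itv.
  have [t ti ty] : (a @` [set t : R | x0 - d < t < x0 + d]) y by apply: He; clear -ye e1; lra.
  by rewrite uE -ty kK.
Qed.

(** A parabola opening upwards is a minimum, hence a cup; one opening downwards is a cap. *)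
Lemma graphat_crit G a c k r : k != 0 -> 0 < r -> (forall x, `|x - c| < r -> a x = a c + k * (x - c) ^+ 2) ->
  graphat G a c -> critat G c (a c).
Proof.
move=> k0 r0 aE [d d0 H]; have [e e0 [e1 e2]] := @ex_min R r d r0 d0.
case: (ltP 0 k) => kp.
  constructor 3; exists k, e; split=> // u y ue ye.
  rewrite /refl /= H; [|exact: lt_le_trans e2|].
    by rewrite aE; [split=> h; lra|exact: lt_le_trans e1].
  by rewrite -normrN opprD opprK addrC; move: ye; rewrite opprK addrC => /lt_le_trans; apply.
constructor 1; exists (- k), e; split=> //; first by rewrite oppr_gt0 lt_neqAle k0.
move=> u y ue ye; rewrite /= H; [|exact: lt_le_trans e2|exact: lt_le_trans e2].
by rewrite aE; [split=> h; lra|exact: lt_le_trans e1].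
Qed.

(** Real induction along the graph makes local widths uniform, also slightly beyond both ends. *)
Lemma tube a x1 x2 (Q : R -> R -> Prop) : x1 <= x2 -> (forall x, x1 <= x <= x2 -> {for x, continuous a}) ->
  (forall x0, x1 <= x0 <= x2 -> exists2 d : R, 0 < d & forall x y, `|x - x0| < d -> `|y - a x0| < d -> Q x y) ->
  exists2 w : R, 0 < w & forall x y, x1 - w < x < x2 + w -> `|y - a x| < w -> Q x y.
Proof.
move=> x12 ca HQ.
have loc x0 : x1 <= x0 <= x2 -> exists2 d : R, 0 < d & forall x y, `|x - x0| < d -> `|y - a x| < d -> Q x y.
  move=> xi; have [d d0 Hd] := HQ x0 xi; have d2 : 0 < d / 2 by lra.
  have /cont1P/(_ _ d2)[e e0 He] := ca x0 xi.
  have [r r0 [r1 r2]] := @ex_min R e (d / 2) e0 d2.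
  exists r => // x y xr yr; apply: Hd; first by clear -xr r2 r0 d0; lra.
  have := He x (lt_le_trans xr r1); move: yr; rewrite !ltr_norml; clear -r2; lra.
pose P t := exists2 w : R, 0 < w & forall x y, x1 - w < x -> x <= t -> `|y - a x| < w -> Q x y.
have ext t d v : P t -> 0 < d -> (forall x y, t < x -> x <= v -> `|y - a x| < d -> Q x y) -> P v.
  move=> [w w0 Hw] d0 Hd; have [r r0 [r1 r2]] := @ex_min R w d w0 d0.
  exists r => // x y xx xv yr; case: (ltP t x) => tx.
    by apply: Hd => //; exact: lt_le_trans r2.
  by apply: Hw => //; [clear -xx r1; lra|exact: lt_le_trans r1].
have [w w0 Hw] : P x2.
  apply: (@real_ind R P (fun=> True) x1 x2) => //.
    move=> c ci; have [d d0 Hd] := loc c ci; exists d => //; split=> // x y xd yd _ xy _ _ _ Px.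
    apply: (ext x d y Px d0) => v v' xv vy v'd; apply: Hd => //.
    by move: xd yd; rewrite !ltr_norml; clear -xv vy; lra.
  have [|d d0 Hd] := loc x1; first by rewrite lexx.
  exists d => // x y xx xx1 yd; apply: Hd => //; rewrite ler0_norm; clear -xx xx1; lra.
have [|d d0 Hd] := loc x2; first by rewrite lexx x12.
have [r r0 [r1 r2]] := @ex_min R w d w0 d0.
exists r => // x y xx yr; case: (leP x x2) => xx2.
  by apply: Hw => //; [clear -xx r1; lra|exact: lt_le_trans r1].
apply: Hd; last exact: lt_le_trans r2.
by rewrite gtr0_norm; clear -xx xx2 r2; lra.
Qed.

(** Nonzero slopes at the ends are what [zigzag] starts from and arrives at. *)
Definition piece G a x1 x2 := [/\ x1 < x2, exists2 d : R, 0 < d & smooth [set x : R | x1 - d < x < x2 + d] a,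
  'D_1 a x1 != 0, 'D_1 a x2 != 0 & forall x0, x1 <= x0 <= x2 -> graphat G a x0].

Definition on_piece a x1 x2 : set (R * R) := [set z | x1 <= z.1 <= x2 /\ z.2 = a z.1].

(* Away from B, the curves of G are transverse to the levels except at the
   critical points Ev. *)
Record state G (Ev : seq (R * R)) (B : set (R * R)) : Prop := State {
  st_Bo : G `<=` Bo;
  st_free : forall u c, ~ G (u, c) -> freeat G u c;
  st_nice : forall u c, G (u, c) -> [\/ B (u, c), strandat G u c | (u, c) \in Ev];
  st_crit : forall p, p \in Ev -> critat G p.1 p.2;
  st_EvB : forall p, p \in Ev -> ~ B p;
  st_B : B `<=` G;
  st_uniq : uniq [seq p.2 | p <- Ev]
}.

(** Where [b] is within [w] of [a], the shear carries the graph of [b] to that of [a], so that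
    pulling back replaces [a] by [b]. Since [a - b] is below [e] and [e] times the derivative of the
    cut-off is at most w/2, a slope of at least 1/2 remains. *)
Lemma flat_shear a b x1 x2 d e w : x1 < x2 -> 0 < d -> smooth [set x : R | x1 - d < x < x2 + d] a ->
  smooth [set x : R | x1 - d < x < x2 + d] b -> (forall x, x <= x1 -> b x = a x) -> (forall x, x2 <= x -> b x = a x) ->
  (forall x, x1 <= x <= x2 -> `|b x - a x| < e) -> (forall x, x1 <= x <= x2 -> `|a x| <= 1) -> 0 < w -> w <= 1 ->
  0 < e -> (forall v : R, e * `|'D_1 plateau v| <= w / 2) ->
  exists eta zeta : R * R -> R, [/\ vshear eta zeta,
    forall x y, x1 <= x <= x2 -> eta (x, y) = y + (a x - b x) * plateau ((y - a x) / w) &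
    forall x y, x <= x1 \/ x2 <= x -> eta (x, y) = y].
Proof.
move=> x12 d0 sa sb bl br be a1 w0 w1 e0 eC.
pose h x := if x1 <= x <= x2 then a x - b x else 0.
have oI := @open_itvoo R (x1 - d) (x2 + d).
have hE x : x1 - d < x < x2 + d -> h x = a x - b x.
  rewrite /h => _; case: ifP => // /negbT; rewrite negb_and -!ltNge => /orP[/ltW/bl ->|/ltW/br ->]; by rewrite subrr.
have h0 x : x <= x1 \/ x2 <= x -> h x = 0.
  by rewrite /h => xx; case: ifP => // _; case: xx => [/bl ->|/br ->]; rewrite subrr.
have he x : `|h x| < e.
  by rewrite /h; case: ifP => [/be|_]; [rewrite distrC|rewrite normr0].
pose eta (z : R * R) := z.2 + h z.1 * plateau ((z.2 - a z.1) / w).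
have oS (p q : R) : open [set z : R * R | p < z.1 < q].
  apply: openR2 => -[x y] /= /andP[px xq].
  have [r r0 [r1 r2]] := @ex_min R (x - p) (q - x) ltac:(lra) ltac:(lra).
  by exists r => // x' y'; rewrite ltr_norml => xr _; clear -xr r1 r2; lra.
have se : smooth [set: R * R] eta.
  apply: smooth_union => -[x y] _; case: (pselect (x1 - d < x < x2 + d)) => xi.
    exists [set z : R * R | x1 - d < z.1 < x2 + d] => //.
    have oU := oS (x1 - d) (x2 + d).
    have sf : smooth [set z : R * R | x1 - d < z.1 < x2 + d] (fun z => z.1) by exact: smooth_fst.
    have ss : smooth [set z : R * R | x1 - d < z.1 < x2 + d] (fun z => z.2) by exact: smooth_snd.
    have sa' : smooth [set z : R * R | x1 - d < z.1 < x2 + d] (fun z => a z.1) by apply: (smooth_comp1 oU _ sa sf).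
    have sb' : smooth [set z : R * R | x1 - d < z.1 < x2 + d] (fun z => b z.1) by apply: (smooth_comp1 oU _ sb sf).
    apply: (smooth_ext oU (f := fun z => z.2 + (a z.1 - b z.1) * plateau ((z.2 - a z.1) / w))).
      by move=> z zi; rewrite /eta hE.
    apply: smoothD => //; apply: smoothM => //; first exact: smoothB.
    apply: smooth_plateau => //; apply: smoothM => //; first exact: smoothB.
    exact: smooth_cst.
  have oV : open [set z : R * R | z.1 < x1 \/ x2 < z.1].
    apply: openR2 => -[x' y'] /= [xx|xx].
      exists (x1 - x'); first by rewrite subr_gt0.
      by move=> u v; rewrite ltr_norml => uu _; left; clear -uu; lra.
    exists (x' - x2); first by rewrite subr_gt0.
    by move=> u v; rewrite ltr_norml => uu _; right; clear -uu; lra.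
  exists [set z : R * R | z.1 < x1 \/ x2 < z.1].
    move/negP: xi; rewrite negb_and -!leNgt /= => /orP[xi|xi]; [left|right]; clear -xi d0; lra.
  apply: (smooth_ext oV (f := fun z => z.2)); last exact: smooth_snd.
  by move=> z zi; rewrite /eta h0 ?mul0r ?addr0 //; case: zi => [/ltW|/ltW]; [left|right].
have De z : 0 < 'D_(0, 1) eta z.
  case: z => x y; rewrite D01E.
  have D := dD (dI y) (dZ (h x) (is_derive_plateau (a x) w y)).
  rewrite (derive_val (is_derive := D)).
  have hb : `|h x * ('D_1 plateau ((y - a x) / w) / w)| <= 1 / 2.
    rewrite !normrM normfV (gtr0_norm w0) mulrA ler_pdivrMr //.
    have := eC ((y - a x) / w); have : `|h x| * `|'D_1 plateau ((y - a x) / w)| <= e * `|'D_1 plateau ((y - a x) / w)|.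
      by rewrite ler_wpM2r // ltW.
    have -> : 1 / 2 * w = w / 2 by ring.
    by move=> h1 h2; exact: le_trans h1 h2.
  by move: hb; rewrite ler_norml; move: (_ * _ : R) => q; clear; lra.
have [|zeta vs] := vshear_exists se De.
  exists 3 => x y y3; rewrite /eta /= /h; case: ifP => xi; last by rewrite mul0r addr0.
  rewrite plateau_far ?mulr0 ?addr0 //; apply: le_trans (lerB_dist _ _).
  by have := a1 x xi; clear -y3 w1; lra.
exists eta, zeta; split=> //.
  by move=> x y xi; rewrite /eta /= /h xi.
by move=> x y xx; rewrite /eta /= h0 // mul0r addr0.
Qed.


(** The zigzag avoids the levels of the events already present. Outside a closed tube around the
    piece nothing changes; inside it the drawing was the graph of [a] and becomes that of [b], whose
    points are strands or parabolic extrema. *)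
Lemma flat_step G Ev B a x1 x2 : piece G a x1 x2 -> on_piece a x1 x2 `&` B = set0 ->
  state G Ev (on_piece a x1 x2 `|` B) ->
  exists H K Ev', [/\ diffeo H K, state (pull H G) Ev' B &
    forall a' x1' x2', on_piece a x1 x2 `&` on_piece a' x1' x2' = set0 -> piece G a' x1' x2' -> piece (pull H G) a' x1' x2'].
Proof.
move=> [x12 [d d0 sa] Da1 Da2 Hg] disj [GB fr nice crit EvB BG uq].
have ca x : x1 <= x <= x2 -> {for x, continuous a} by move=> xi; apply: (smooth_cont sa) => /=; clear -xi d0; lra.
have oBo : open (@Bo R).
  have -> : @Bo R = [set z | 1 / 8 < z.1 < 7 / 8] `&` [set z | - (2 / 5) < z.2 < 2 / 5] by [].
  apply: openI; last exact: open_strip.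
  apply: openR2 => -[x y] /= /andP[xl xr].
  have [r r0 [r1 r2]] := @ex_min R (x - 1 / 8) (7 / 8 - x) ltac:(lra) ltac:(lra).
  by exists r => // x' y'; rewrite ltr_norml => xr' _; clear -xr' r1 r2; lra.
have [|w0 w00 Hw0] := @tube a x1 x2 (fun x y => Bo (x, y) /\ (G (x, y) <-> y = a x)) (ltW x12) ca.
  move=> x0 x0i; have [r r0 Hr] := Hg x0 x0i.
  have /nbhs2P[r' r'0 Hr'] : nbhs (x0, a x0) (@Bo R).
    have BB : Bo (x0, a x0) by exact: (GB _ (graphat_in (Hg x0 x0i))).
    exact: (open_nbhs_nbhs (conj oBo BB)).
  have [q q0 [q1 q2]] := @ex_min R r r' r0 r'0.
  by exists q => // x y xq yq; split; [apply: Hr'; exact: lt_le_trans q2|apply: Hr; exact: lt_le_trans q1].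
have [v v0 [vd v1]] := @ex_min R d 1 d0 ltr01.
have [W W0 [Ww Wv]] := @ex_min R w0 v w00 v0.
have HW x y : x1 <= x <= x2 -> `|y - a x| < W -> Bo (x, y) /\ (G (x, y) <-> y = a x).
  by move=> xi yW; apply: Hw0; [clear -xi w00; lra|exact: lt_le_trans Ww].
have HW' x y : x1 - W < x < x2 + W -> `|y - a x| < W -> G (x, y) <-> y = a x.
  by move=> xi yW; apply: (Hw0 x y _ _).2; [clear -xi Ww; lra|exact: lt_le_trans Ww].
(* An eighth of the width [W] on which the drawing is known: small neighbourhoods of the 2w-tube,
   displaced by at most [e <= w], remain within [W]. *)
have [w wE] : exists w, w = W / 8 by exists (W / 8).
have wp : 0 < w by rewrite wE; lra.
have [C C0 HC] := @plateau_bound R.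
have [e [e0 ew eC]] : exists e : R, [/\ 0 < e, e <= w & e * C <= w / 2].
  have [e e0 [e1 e2]] := @ex_min R w (w / 2 / C) wp ltac:(by rewrite !divr_gt0).
  by exists e; split=> //; rewrite -ler_pdivlMr.
have [||b [Cr [[bl bc breg bcrit buq bav] sb br]]] := @zigzag R a (x1 - d) x1 x2 (x2 + d) e [seq p.2 | p <- Ev] sa _ x12 _ Da1 Da2 e0.
- by clear -d0; lra.
- by clear -d0; lra.
have [||||eta [zeta [vs etaE eta0]]] := @flat_shear a b x1 x2 d e w x12 d0 sa sb bl br _ _ wp _ e0.
- move=> x xi; case: (ltP x x2) => xx; first by apply: bc.
  by rewrite br // subrr normr0.
- move=> x xi; have [] := HW x (a x) xi; first by rewrite subrr normr0.
  by case=> _ /= ai _; rewrite ler_norml; clear -ai; lra.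
- by rewrite wE; clear -Wv v1 W0; lra.
- move=> z; apply: le_trans eC; rewrite ler_pM2l //.
have be x : x1 <= x <= x2 -> `|b x - a x| < e by exact: bc.
have [_ ez ze _ _] := vs.
have eta_far x y : ~ (x1 <= x <= x2 /\ `|y - a x| < 2 * w) -> eta (x, y) = y.
  move=> H; case: (boolP (x1 <= x <= x2)) => xi; last first.
    by apply: eta0; move: xi; rewrite negb_and -!ltNge => /orP[/ltW|/ltW]; [left|right].
  rewrite etaE // plateau_far ?mulr0 ?addr0 // leNgt; apply/negP => h; exact: H.
have eta_close x y : `|eta (x, y) - y| <= e.
  case: (boolP (x1 <= x <= x2)) => xi; last first.
    rewrite eta_far; first by rewrite subrr normr0 ltW.
    by move=> -[xi' _]; exact: (negP xi).
  rewrite etaE // addrC addKr normrM (ger0_norm (plateau_ge0 _)).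
  have := be x xi; rewrite distrC => h; apply: le_trans (ltW h).
  by rewrite ler_piMr ?plateau_le1.
have eta_b x : eta (x, b x) = a x.
  case: (boolP (x1 <= x <= x2)) => xi.
    rewrite etaE // plateau_close ?mulr1; [by rewrite addrC subrK|exact: wp|].
    by apply: ltW; exact: lt_le_trans (be x xi) ew.
  move: xi; rewrite negb_and -!ltNge => /orP[/ltW h|/ltW h]; first by rewrite eta0 ?bl //; left.
  by rewrite eta0 ?br //; right.
have D : diffeo (vmap eta) (vmap zeta).
  apply: vmap_diffeo => // -[x y] zB /=; apply: eta_far => -[xi yw]; apply: zB.
  by apply: (HW x y xi _).1; rewrite wE in yw; clear -yw W0; lra.
have clA x y : x1 - W < x < x2 + W -> `|y - a x| < W / 2 -> (pull (vmap eta) G (x, y) <-> y = b x).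
  move=> xi yW; rewrite /pull /vmap /= HW' //; last first.
    have := eta_close x y; move: yW ew; rewrite wE !ltr_norml ler_norml; move: (eta (x, y)) => q; clear; lra.
  rewrite -eta_b; split=> [E|-> //].
  by rewrite -(ze x y) E ze.
(* Near every point outside this closed tube the shear is the identity. *)
pose T u c := x1 <= u <= x2 /\ `|c - a u| <= 2 * w.
have clB u c : ~ T u c -> agree G (pull (vmap eta) G) u c.
  move=> nT.
  suff [r r0 Hr] : exists2 r : R, 0 < r & forall x y, `|x - u| < r -> `|y - c| < r -> ~ (x1 <= x <= x2 /\ `|y - a x| < 2 * w).
    by exists r => // x y xr yr; rewrite /pull /vmap /= eta_far //; exact: Hr.
  case: (boolP (x1 <= u <= x2)) => ui; last first.
    have [r r0 Hr] : exists2 r : R, 0 < r & forall x, `|x - u| < r -> ~~ (x1 <= x <= x2).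
      move: ui; rewrite negb_and -!ltNge => /orP[ui|ui].
        by exists (x1 - u) => [|x]; [|rewrite ltr_norml negb_and -!ltNge => xr; apply/orP; left]; clear -ui xr || clear -ui; lra.
      by exists (u - x2) => [|x]; [|rewrite ltr_norml negb_and -!ltNge => xr; apply/orP; right]; clear -ui xr || clear -ui; lra.
    by exists r => // x y xr _ [xi _]; exact: (negP (Hr x xr)).
  have far : 0 < (`|c - a u| - 2 * w) / 2.
    by rewrite divr_gt0 // subr_gt0 ltNge; apply/negP => h; apply: nT.
  have /cont1P/(_ _ far)[r r0 Hr] := ca u ui.
  have [q q0 [q1 q2]] := @ex_min R r ((`|c - a u| - 2 * w) / 2) r0 far.
  exists q => // x y xq yq [xi yw].
  have h1 := Hr x (lt_le_trans xq q1); have h2 := lt_le_trans yq q2.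
  have : `|c - a u| <= `|y - c| + `|y - a x| + `|a x - a u|.
    have -> : c - a u = (c - y) + (y - a x) + (a x - a u) by ring.
    by apply: le_trans (ler_normD _ _) _; rewrite lerD2r; apply: le_trans (ler_normD _ _) _; rewrite distrC.
  move: h1 h2 yw; move: `|c - a u| `|y - c| `|y - a x| `|a x - a u| => p1 p2 p3 p4; clear; lra.
have clC u c : T u c -> G (u, c) -> on_piece a x1 x2 (u, c).
  move=> [ui cw] Gu; have cW : `|c - a u| < W by move: cw; rewrite wE; clear -W0; lra.
  by split=> //=; apply: (HW u c ui cW).2.1.
have TA u c : T u c -> pull (vmap eta) G (u, c) <-> c = b u.
  move=> [ui cw]; apply: clA; first by clear -ui W0; lra.
  by move: cw; rewrite wE; clear -W0; lra.
have cb u : x1 <= u <= x2 -> {for u, continuous b}.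
  by move=> ui; apply: (smooth_cont sb) => /=; clear -ui d0; lra.
have grb u : x1 <= u <= x2 -> graphat (pull (vmap eta) G) b u.
  move=> ui; have /cont1P/(_ _ wp)[r r0 Hr] := ca u ui.
  have [q q0 [q1 q2]] := @ex_min R r w r0 wp.
  exists q => // x y xq yq; apply: clA; first by move: xq; rewrite ltr_norml; clear -ui W0 q2 wE; lra.
  have h1 := Hr x (lt_le_trans xq q1); have h2 := lt_le_trans yq q2; have h3 := lt_le_trans (be u ui) ew.
  move: h1 h2 h3 W0; rewrite wE !ltr_norml; clear; move: (a x) (a u) (b u) => p q' r'; lra.
have TB z : B z -> ~ T z.1 z.2.
  case: z => u c Bz Tz; have : (on_piece a x1 x2 `&` B) (u, c) by split=> //; apply: clC => //; apply: BG; right.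
  by rewrite disj.
have bT u : x1 <= u <= x2 -> T u (b u).
  move=> ui; split=> //; have := be u ui; rewrite !ltr_norml ler_norml; clear -ew wp; move: (b u) (a u) => p q; lra.
exists (vmap eta), (vmap zeta), ([seq (c, b c) | c <- Cr] ++ Ev); split=> //.
- split.
  + exact: pull_Bo D GB.
  + move=> u c nG; case: (pselect (T u c)) => Tu; last first.
      by apply: agree_freeat (clB _ _ Tu) _; apply: fr => Gu; apply: nG; apply/(agree_center (clB _ _ Tu)).
    have cbn : 0 < `|c - b u| / 2.
      by rewrite divr_gt0 // normr_gt0 subr_eq0; apply/eqP => h; apply: nG; apply/(TA u c Tu).
    have /cont1P/(_ _ cbn)[r r0 Hr] := cb u Tu.1.
    have /cont1P/(_ _ wp)[r' r'0 Hr'] := ca u Tu.1.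
    have [q1 q10 [qr qr']] := @ex_min R r r' r0 r'0.
    have [q2 q20 [qc qw]] := @ex_min R (`|c - b u| / 2) w cbn wp.
    have [q q0 [qq1 qq2]] := @ex_min R q1 q2 q10 q20.
    exists q => // x y xq yq /clA E.
    have xr := Hr x ltac:(by apply: lt_le_trans xq _; exact: le_trans qr).
    have xr' := Hr' x ltac:(by apply: lt_le_trans xq _; exact: le_trans qr').
    have yc : `|y - c| < `|c - b u| / 2 by apply: lt_le_trans yq _; exact: le_trans qc.
    have yw : `|y - c| < w by apply: lt_le_trans yq _; exact: le_trans qw.
    have yb : y = b x.
      apply: E; first by move: xq; rewrite ltr_norml; case: Tu => ui _; clear -ui W0 qq2 qw wE; lra.
      case: Tu => _; move: xr' yw W0; rewrite wE !ltr_norml ler_norml; clear; move: (a x) (a u) => p q'; lra.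
    have : `|c - b u| <= `|y - c| + `|b x - b u|.
      have -> : c - b u = (c - y) + (b x - b u) by rewrite yb; ring.
      by apply: le_trans (ler_normD _ _) _; rewrite distrC.
    move: xr yc; clear; move: `|b x - b u| `|y - c| `|c - b u| => p q' r''; lra.
  + move=> u c Gu; case: (pselect (T u c)) => Tu.
      have cE := (TA u c Tu).1 Gu; case: (boolP (u \in Cr)) => uC.
        by constructor 3; rewrite mem_cat cE map_f.
      constructor 2; rewrite cE; apply: (@graphat_strand _ _ u d d0); last 2 first.
      * exact: grb Tu.1.
      * exact: breg Tu.1 uC.
      by apply: smooth_sub sb => x /= xi; case: Tu => ui _; clear -xi ui; lra.
    have ag := clB u c Tu; case: (nice u c) => [|[opu|Bu]|su|eu].
    * exact/(agree_center ag).
    * by exfalso; apply: Tu; case: opu => /= ui ->; split=> //; rewrite subrr normr0; clear -wp; lra.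
    * by constructor 1.
    * by constructor 2; exact: agree_strandat ag su.
    * by constructor 3; rewrite mem_cat eu orbT.
  + move=> p; rewrite mem_cat => /orP[/mapP[c cC ->]|pE] /=.
      have [ci [k [t [k0 t0 Hk]]]] := bcrit c cC.
      by apply: graphat_crit k0 t0 Hk _; apply: grb; clear -ci; lra.
    apply: agree_critat (crit p pE); apply: clB => Tp.
    have op := clC _ _ Tp (critat_in (crit p pE)).
    by apply: (EvB p pE); left; rewrite -(pair_eta p).
  + move=> p; rewrite mem_cat => /orP[/mapP[c cC ->]|pE] Bp; last by apply: (EvB p pE); right.
    have [ci _] := bcrit c cC; apply: (TB _ Bp); apply: bT => /=; clear -ci; lra.
  + by move=> [u c] Bz; apply/(agree_center (clB u c (TB _ Bz))); apply: BG; right.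
  + rewrite map_cat -map_comp cat_uniq buq uq andbT /=; apply/hasPn => y /mapP[p pE ->].
    apply/negP => /mapP[c cC /= pc]; have /negP := bav c cC; apply; rewrite -pc; exact: map_f.
- move=> a' x1' x2' dj [x12' sm Da1' Da2' Hg']; split=> // x0 x0i.
  apply: agree_graphat (Hg' x0 x0i); apply: clB => Tx.
  have : (on_piece a x1 x2 `&` on_piece a' x1' x2') (x0, a' x0).
    by split=> //; apply: clC => //; exact: (graphat_in (Hg' x0 x0i)).
  by rewrite dj.
Qed.

Fixpoint on_pieces (L : seq ((R -> R) * R * R)) : set (R * R) :=
  if L is (a, x1, x2) :: L' then on_piece a x1 x2 `|` on_pieces L' else set0.

Fixpoint pieces G (L : seq ((R -> R) * R * R)) : Prop :=
  if L is (a, x1, x2) :: L' then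
    [/\ piece G a x1 x2, on_piece a x1 x2 `&` on_pieces L' = set0 & pieces G L']
  else True.

(** The events have distinct levels, so every other point of a critical level is regular. *)
Lemma state_tame G Ev : state G Ev set0 -> tame G [seq p.2 | p <- Ev].
Proof.
move=> [GB fr nice crit _ _ uq].
have reg u c : ((u, c) \notin Ev) -> regat G u c.
  move=> nE; case: (pselect (G (u, c))) => Gu; last by right; exact: fr.
  by case: (nice u c Gu) => [//|su|eu]; [left|rewrite eu in nE].
split=> // [u c cE|c /mapP[p pE ->]].
  by apply: reg; apply: contra cE => eu; apply/mapP; exists (u, c).
exists p.1; split; first exact: crit.
move=> u up; apply: reg; apply/negP => eu; apply: up.
have [s1 [s2 EvE]] : exists s1 s2, Ev = s1 ++ p :: s2 by case/splitPr: pE => s1 s2; exists s1, s2.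
move: eu uq; rewrite EvE map_cat cat_uniq /= mem_cat inE => /or3P[eu|/eqP/(congr1 fst)//|eu] /and3P[_ h /andP[h' _]].
  by case/norP: h => /negP h _; exfalso; apply: h; apply/mapP; exists (u, p.2).
by exfalso; move/negP: h'; apply; apply/mapP; exists (u, p.2).
Qed.

(** Disjointness keeps the remaining pieces intact while one of them is treated. *)
Theorem flats_all L G Ev : pieces G L -> state G Ev (on_pieces L) ->
  exists H K E, diffeo H K /\ tame (pull H G) E.
Proof.
elim: L G Ev => [|[[a x1] x2] L IH] G Ev.
  by move=> _ st; exists id, id, [seq p.2 | p <- Ev]; split; [exact: diffeo_id|exact: state_tame].
move=> [pc disj pcs] st; have [H [K [Ev' [D st' oth]]]] := flat_step pc disj st.
have [|H' [K' [E [D' tE]]]] := IH (pull H G) Ev' _ st'.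
  elim: L {IH st st'} disj pcs => [//|[[a' x1'] x2'] L IH] disj [pc' disj' pcs]; split=> //.
    by apply: oth pc'; rewrite -subset0 -disj => z [z1 z2]; split=> //; left.
  by apply: IH pcs; rewrite -subset0 -disj => z [z1 z2]; split=> //; right.
exists (fun z => H (H' z)), (fun z => K' (K z)), E; split; first exact: diffeo_comp.
exact: tE.
Qed.
End Flattening.

(** * Steep points and flat stretches of the arcs *)

Section Arcs.
Context {R : realType}.
Implicit Types (G : set (R * R)) (p q : R -> R) (x y s t u c r e k al be eta : R).

(** Where the abscissa [p] increases, the curve is the graph of [q] composed with the inverse of
    [p]; the last hypothesis says that nothing else of the drawing comes near. *)
Lemma piece_pos G p q al be s t : smooth [set x : R | al < x < be] p -> smooth [set x : R | al < x < be] q ->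
  al < s -> s < t -> t < be -> (forall x, al < x < be -> 0 < 'D_1 p x) -> 'D_1 q s != 0 -> 'D_1 q t != 0 ->
  (forall x, al < x < be -> G (p x, q x)) ->
  (forall x, s <= x <= t -> exists2 r : R, 0 < r & forall u v, G (u, v) -> `|u - p x| < r -> `|v - q x| < r ->
     exists2 x', al < x' < be & u = p x' /\ v = q x') ->
  exists a x1 x2, piece G a x1 x2 /\ forall z, on_piece a x1 x2 z <-> exists2 x, s <= x <= t & z = (p x, q x).
Proof.
move=> sp sq als st tbe Dp Dqs Dqt Gin loc.
have [|k kp [oW sk]] := inverse_ne0 sp; first by move=> x xi; rewrite gt_eqF // Dp.
have dp x : al < x < be -> derivable p x 1 by move=> xi; exact: (smooth_derivable sp).
have p_lt x y : al < x -> x < y -> y < be -> p x < p y.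
  move=> ax xy yb; apply: (@incr_lt R p x y _ _ x y) => // z zi; [apply: dp|apply: Dp]; clear -ax yb zi; lra.
have p_le x y : al < x -> x <= y -> y < be -> p x <= p y.
  move=> ax; rewrite le_eqVlt => /orP[/eqP -> //|xy yb]; apply: ltW; exact: p_lt.
have cp x : al < x < be -> {for x, continuous p} by move=> xi; exact: (smooth_cont sp).
have ivt x y u : al < x -> x <= y -> y < be -> p x <= u <= p y -> exists2 z, x <= z <= y & p z = u.
  by move=> ax xy yb ui; apply: IVT_incr => // z zi; apply: cp; clear -ax yb zi; lra.
have [s' s'E] : exists s', s' = (al + s) / 2 by eexists.
have [t' t'E] : exists t', t' = (t + be) / 2 by eexists.
pose a x := q (k x).
have aE x : al < x < be -> a (p x) = q x by move=> xi; rewrite /a kp.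
have ps : p s' < p s by apply: p_lt; clear -s'E als st tbe; lra.
have pt : p t < p t' by apply: p_lt; clear -t'E als st tbe; lra.
have pst : p s < p t by apply: p_lt; clear -als st tbe; lra.
have [d d0 [d1 d2]] := @ex_min R (p s - p s') (p t' - p t) ltac:(by rewrite subr_gt0) ltac:(by rewrite subr_gt0).
have wide x : p s - d < x < p t + d -> exists2 z, al < z < be & p z = x.
  move=> xi; have [||||z zi zx] := ivt s' t' x.
  - clear -s'E als st; lra.
  - clear -s'E t'E als st tbe; lra.
  - clear -t'E st tbe; lra.
  - clear -xi d1 d2; lra.
  by exists z => //; clear -zi s'E t'E als st tbe; lra.
have sa : smooth [set x : R | p s - d < x < p t + d] a.
  have oI := @open_itvoo R (p s - d) (p t + d).
  apply: (@smooth_comp1 _ _ [set x : R | al < x < be] _ q k) => //.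
    by move=> x /wide[z zi <-]; rewrite kp.
  by apply: smooth_sub sk => x /wide[z zi <-]; exists z.
have Da x : p s - d < p x < p t + d -> al < x < be -> 'D_1 a (p x) * 'D_1 p x = 'D_1 q x.
  move=> pi xi; have da : derivable a (p x) 1 by exact: (smooth_derivable sa).
  have D := d1comp (cp x xi) da (derivableP (dp x xi)).
  rewrite -(derive_val (is_derive := D)); apply: (derive_eq_near (@open_itvoo R al be) xi) => y yi.
  exact: aE.
have on x : p s <= x <= p t -> exists2 z, s <= z <= t & p z = x.
  by move=> xi; apply: ivt => //; exact: ltW.
exists a, (p s), (p t); split.
  split=> //; first by exists d.
  - apply: contraNN Dqs => /eqP E; rewrite -Da ?E ?mul0r //; clear -d0 pst als st tbe; lra.
  - apply: contraNN Dqt => /eqP E; rewrite -Da ?E ?mul0r //; clear -d0 pst als st tbe; lra.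
  - move=> x0 /on[z zi <-]; have zi' : al < z < be by clear -zi als tbe; lra.
    have [r r0 Hr] := loc z zi; rewrite /graphat aE //.
    have [r' r'0 [r'1 r'2]] := @ex_min R r d r0 d0.
    exists r' => // x y xr yr; split=> [Gxy|->].
      have [x' x'i [-> ->]] := Hr x y Gxy (lt_le_trans xr r'1) (lt_le_trans yr r'1).
      by rewrite aE.
    have [|w wi <-] := wide x; last by rewrite aE //; exact: Gin.
    have : p s <= p z <= p t.
      move: zi => /andP[sz zt]; rewrite !p_le //; clear -als sz zt tbe; lra.
    by move: xr; rewrite ltr_norml; move: (p s) (p z) (p t) => p1 p2 p3; clear -r'2; lra.
move=> [u v]; split=> [[/= /on[z zi <-] ->]|[z zi [-> ->]]].
  by exists z => //; rewrite aE //; clear -zi als tbe; lra.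
split=> /=; last by rewrite aE //; clear -zi als tbe; lra.
move: zi => /andP[sz zt]; rewrite !p_le //; clear -als sz zt tbe; lra.
Qed.

Lemma piece_ne0 G p q al be s t : smooth [set x : R | al < x < be] p -> smooth [set x : R | al < x < be] q ->
  al < s -> s < t -> t < be -> (forall x, al < x < be -> 'D_1 p x != 0) -> 'D_1 q s != 0 -> 'D_1 q t != 0 ->
  (forall x, al < x < be -> G (p x, q x)) ->
  (forall x, s <= x <= t -> exists2 r : R, 0 < r & forall u v, G (u, v) -> `|u - p x| < r -> `|v - q x| < r ->
     exists2 x', al < x' < be & u = p x' /\ v = q x') ->
  exists a x1 x2, piece G a x1 x2 /\ forall z, on_piece a x1 x2 z <-> exists2 x, s <= x <= t & z = (p x, q x).
Proof.
move=> sp sq als st tbe Dp Dqs Dqt Gin loc.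
have cD x : al < x < be -> {for x, continuous ('D_1 p)} by move=> xi; apply: (smooth_cont (smooth_derive (1 : R) sp)).
case: (sign_const cD Dp) => sg; first exact: (piece_pos sp sq als st tbe).
have flipi x : - be < x < - al -> al < - x < be by clear; lra.
have dp x : al < x < be -> derivable p x 1 by move=> xi; exact: (smooth_derivable sp).
have dq x : al < x < be -> derivable q x 1 by move=> xi; exact: (smooth_derivable sq).
have [||||||||||a [x1 [x2 [pc on]]]] := @piece_pos G (fun x => p (- x)) (fun x => q (- x)) (- be) (- al) (- t) (- s).
- exact: smooth_flip.
- exact: smooth_flip.
- by rewrite ltrN2.
- by rewrite ltrN2.
- by rewrite ltrN2.
- by move=> x /flipi xi; rewrite derive_flip ?oppr_gt0; [exact: sg|exact: dp].
- by rewrite derive_flip opprK ?oppr_eq0 //; apply: dq; clear -als st tbe; lra.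
- by rewrite derive_flip opprK ?oppr_eq0 //; apply: dq; clear -als st tbe; lra.
- by move=> x /flipi; exact: Gin.
- move=> x xi; have [|r r0 Hr] := loc (- x); first by clear -xi; lra.
  exists r => // u v Guv ur vr; have [x' x'i [-> ->]] := Hr u v Guv ur vr.
  by exists (- x'); rewrite ?opprK //; clear -x'i; lra.
exists a, x1, x2; split=> // z; rewrite on; split=> -[x xi ->]; exists (- x); rewrite ?opprK //; clear -xi; lra.
Qed.

(** Arcs are taken on the open interval, their ends entering as limits at points of [V]. [ar_loc] is
    the embedding property: near an interior point the drawing has only points of the same arc with
    nearby parameters. *)
Record arcs (I : finType) (c1 c2 : I -> R -> R) (V : seq (R * R)) G : Prop := Arcs {
  ar_Bo : G `<=` Bo;
  ar_free : forall u c, ~ G (u, c) -> freeat G u c;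
  ar_s1 : forall i, smooth [set t : R | 0 < t < 1] (c1 i);
  ar_s2 : forall i, smooth [set t : R | 0 < t < 1] (c2 i);
  ar_reg : forall i t, 0 < t < 1 -> 'D_1 (c1 i) t != 0 \/ 'D_1 (c2 i) t != 0;
  ar_in : forall i t, 0 < t < 1 -> G (c1 i t, c2 i t);
  ar_cover : forall z, G z -> z \in V \/ exists i t, 0 < t < 1 /\ z = (c1 i t, c2 i t);
  ar_inj : forall i j s t, 0 < s < 1 -> 0 < t < 1 -> c1 i s = c1 j t -> c2 i s = c2 j t -> i = j /\ s = t;
  ar_avoid : forall i t, 0 < t < 1 -> (c1 i t, c2 i t) \notin V;
  ar_loc : forall i t eta, 0 < t < 1 -> 0 < eta -> exists2 r : R, 0 < r & forall u v, G (u, v) ->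
    `|u - c1 i t| < r -> `|v - c2 i t| < r -> exists t', [/\ 0 < t' < 1, `|t' - t| < eta, u = c1 i t' & v = c2 i t'];
  ar_start : forall i, exists2 v, v \in V & forall r, 0 < r -> exists2 eta : R, 0 < eta &
    forall t, 0 < t < eta -> t < 1 -> `|c1 i t - v.1| < r /\ `|c2 i t - v.2| < r;
  ar_end : forall i, exists2 v, v \in V & forall r, 0 < r -> exists2 eta : R, 0 < eta &
    forall t, 1 - eta < t < 1 -> 0 < t -> `|c1 i t - v.1| < r /\ `|c2 i t - v.2| < r
}.

Lemma arc_cont1 (I : finType) (c1 c2 : I -> R -> R) (V : seq (R * R)) G (A : arcs c1 c2 V G) i t : 0 < t < 1 -> {for t, continuous (c1 i)}.
Proof. by move=> ti; exact: smooth_cont (ar_s1 A i) ti. Qed.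
Lemma arc_cont2 (I : finType) (c1 c2 : I -> R -> R) (V : seq (R * R)) G (A : arcs c1 c2 V G) i t : 0 < t < 1 -> {for t, continuous (c2 i)}.
Proof. by move=> ti; exact: smooth_cont (ar_s2 A i) ti. Qed.

(** Where the height has nonzero derivative the arc can be parametrised by height, and [ar_loc]
    excludes any other point of the drawing. *)
Lemma arc_strand (I : finType) (c1 c2 : I -> R -> R) (V : seq (R * R)) G (A : arcs c1 c2 V G) i t : 0 < t < 1 -> 'D_1 (c2 i) t != 0 -> strandat G (c1 i t) (c2 i t).
Proof.
move=> ti D0; have D0' : 0 < `|'D_1 (c2 i) t| by rewrite normr_gt0.
have /cont1P/(_ _ D0')[d1 d10 H1] : {for t, continuous ('D_1 (c2 i))}.
  by apply: (smooth_cont (smooth_derive (1 : R) (ar_s2 A i))).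
have [d2 d20 [d21 d22]] := @ex_min R t (1 - t) ltac:(by case/andP: ti) ltac:(by rewrite subr_gt0; case/andP: ti).
have [d d0 [dd1 dd2]] := @ex_min R d1 d2 d10 d20.
have sub : [set s : R | t - d < s < t + d] `<=` [set s : R | 0 < s < 1] by move=> s /=; clear -dd2 d21 d22; lra.
have s1 := smooth_sub sub (ar_s1 A i); have s2 := smooth_sub sub (ar_s2 A i).
have [|k kE [oW sk]] := inverse_ne0 s2.
  move=> s si; apply/negP => /eqP s0; have := H1 s; rewrite s0 sub0r normrN ltxx close_itv.
  by move=> h; suff : false by []; apply: h; clear -si dd1; lra.
have Wt : (c2 i @` [set s : R | t - d < s < t + d]) (c2 i t) by exists t => //=; clear -d0; lra.
have /nbhs1P[e e0 He] := open_nbhs_nbhs (conj oW Wt).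
have [r r0 Hr] := ar_loc A i ti d0.
have [r' r'0 [r1 r2]] := @ex_min R e r e0 r0.
have W y : c2 i t - r' < y < c2 i t + r' -> (c2 i @` [set s : R | t - d < s < t + d]) y.
  by rewrite -close_itv => yr; apply: He; exact: lt_le_trans r1.
exists (fun y => c1 i (k y)), r', r'; split=> //.
- apply: (@smooth_comp1 _ _ [set s : R | t - d < s < t + d] _ (c1 i) k) => //.
  + exact: open_itvoo.
  + by move=> y /W[s si <-]; rewrite kE.
  + by apply: smooth_sub sk => y /W.
- by rewrite kE //; clear -d0; lra.
move=> u y ur yr; split=> [Guy|->].
  have [s [si sd -> ->]] := Hr u y Guy (lt_le_trans ur r2) (lt_le_trans yr r2).
  by rewrite kE // -close_itv.
have [|s si <-] := W y; first by rewrite -close_itv.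
by rewrite kE //; apply: (ar_in A); apply: sub.
Qed.

(** A regular arc that runs along a line which is not horizontal has nonzero vertical velocity. *)
Lemma arc_affine (I : finType) (c1 c2 : I -> R -> R) (V : seq (R * R)) G (A : arcs c1 c2 V G) i t (a b : R) : 0 < t < 1 -> (exists2 d : R, 0 < d & forall s, `|s - t| < d -> c1 i s = a + b * c2 i s) ->
  'D_1 (c2 i) t != 0.
Proof.
move=> ti [d d0 Hd]; have d2 : derivable (c2 i) t 1 by exact: (smooth_derivable (ar_s2 A i)).
have D := dD (dC t 1 a) (dZ b (derivableP d2)).
have E : 'D_1 (c1 i) t = b * 'D_1 (c2 i) t.
  rewrite -[RHS]add0r -(derive_val (is_derive := D)).
  apply: (@derive_eq_near _ _ _ [set s : R | t - d < s < t + d]).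
  - exact: open_itvoo.
  - by rewrite /=; clear -d0; lra.
  - by move=> s si; apply: Hd; rewrite close_itv.
by case: (ar_reg A i ti) => //; rewrite E mulf_eq0 negb_or => /andP[].
Qed.

(** The arc avoids the vertex, so near a given parameter continuity keeps it on one of the three
    legs of the straight Y; each leg lies on a line [u = a + b * y]. *)
Lemma arc_event (I : finType) (c1 c2 : I -> R -> R) (V : seq (R * R)) G (A : arcs c1 c2 V G) i t v k r : v \in V -> 0 < t < 1 -> 0 < k ->
  (forall u y, `|u - v.1| < r -> `|y - v.2| < r -> (G (u, y) <-> evset false k v.2 v.1 u y)) ->
  `|c1 i t - v.1| < r -> `|c2 i t - v.2| < r -> 'D_1 (c2 i) t != 0.
Proof.
move=> vV ti k0 Hev c1r c2r.
have near : exists2 d : R, 0 < d & forall s, `|s - t| < d ->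
    [/\ 0 < s < 1, `|c1 i s - v.1| < r, `|c2 i s - v.2| < r &
     (c1 i t != v.1 -> 0 < (c1 i s - v.1) * (c1 i t - v.1)) /\ (c2 i t != v.2 -> 0 < (c2 i s - v.2) * (c2 i t - v.2))].
  have aux (f : R -> R) w : {for t, continuous f} -> `|f t - w| < r ->
      exists2 d : R, 0 < d & forall s, `|s - t| < d -> `|f s - w| < r /\ (f t != w -> 0 < (f s - w) * (f t - w)).
    move=> cf fr; have fr' : 0 < r - `|f t - w| by rewrite subr_gt0.
    have /cont1P/(_ _ fr')[d1 d10 H1] := cf.
    have tri s : `|f s - w| <= `|f s - f t| + `|f t - w|.
      by apply: le_trans (ler_normD _ _); rewrite addrA subrK.
    case: (f t =P w) => [E|/eqP nE].
      exists d1 => // s sd; split=> //; have := tri s; have := H1 s sd; clear; lra.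
    have f0 : 0 < `|f t - w| by rewrite normr_gt0 subr_eq0.
    have /cont1P/(_ _ f0)[d2 d20 H2] := cf.
    have [d d0 [dd1 dd2]] := @ex_min R d1 d2 d10 d20.
    exists d => // s sd; split; first by have := tri s; have := H1 s (lt_le_trans sd dd1); clear; lra.
    move=> _; have := H2 s (lt_le_trans sd dd2).
    have -> : f s - w = (f s - f t) + (f t - w) by ring.
    move: (f s - f t) (f t - w) f0 => p q; rewrite normr_gt0 => q0.
    case: (ltP 0 q) => qs; first by rewrite (gtr0_norm qs) ltr_norml => h; rewrite pmulr_lgt0 //; clear -h; lra.
    have qs' : q < 0 by rewrite lt_neqAle q0.
    by rewrite (ltr0_norm qs') ltr_norml => h; rewrite nmulr_lgt0 //; clear -h; lra.
  have [d1 d10 H1] := aux _ _ (arc_cont1 A ti) c1r.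
  have [d2 d20 H2] := aux _ _ (arc_cont2 A ti) c2r.
  have [d3 d30 [d31 d32]] := @ex_min R t (1 - t) ltac:(by case/andP: ti) ltac:(by rewrite subr_gt0; case/andP: ti).
  have [d4 d40 [d41 d42]] := @ex_min R d1 d2 d10 d20.
  have [d d0 [dd3 dd4]] := @ex_min R d3 d4 d30 d40.
  exists d => // s sd; have [h1 h2] := H1 s ltac:(clear -sd dd4 d41; lra).
  have [h3 h4] := H2 s ltac:(clear -sd dd4 d42; lra); split=> //.
  by move: sd; rewrite ltr_norml; clear -dd3 d31 d32; lra.
have ev s : 0 < s < 1 -> `|c1 i s - v.1| < r -> `|c2 i s - v.2| < r -> evset false k v.2 v.1 (c1 i s) (c2 i s).
  by move=> si h1 h2; apply/Hev => //; exact: (ar_in A).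
have cv : ~ (c1 i t = v.1 /\ c2 i t = v.2).
  by move=> [e1 e2]; have := ar_avoid A i ti; rewrite e1 e2 pair_eta vV.
have [d d0 Hd] := near.
case: (ev t ti c1r c2r) => [[yc uE]|[cy uE]]; last first.
  have c2v : c2 i t != v.2 by apply/eqP => E; apply: cv.
  have c2p : 0 < c2 i t - v.2 by rewrite subr_gt0 lt_neqAle eq_sym c2v.
  apply: (@arc_affine I c1 c2 V G A i t v.1 0) => //; exists d => // s sd; have [si h1 h2 [_ /(_ c2v)]] := Hd s sd.
  rewrite pmulr_lgt0 // => h; rewrite mul0r addr0.
  by case: (ev s si h1 h2) => [[h' _]|[]//]; clear -h h'; lra.
have c1v : c1 i t != v.1.
  apply/eqP => E; apply: cv; split=> //; move: uE; rewrite E subrr normr0 => /esym/eqP.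
  by rewrite mulf_eq0 gt_eqF //= subr_eq0 => /eqP.
have aux s : `|s - t| < d -> `|c1 i s - v.1| = k * (v.2 - c2 i s).
  move=> sd; have [si h1 h2 [/(_ c1v) h _]] := Hd s sd.
  case: (ev s si h1 h2) => [[]//|[_ E]]; by move: h; rewrite E subrr mul0r ltxx.
case: (ltP 0 (c1 i t - v.1)) => sg.
  apply: (@arc_affine I c1 c2 V G A i t (v.1 + k * v.2) (- k)) => //; exists d => // s sd.
  have [si h1 h2 [/(_ c1v)]] := Hd s sd; rewrite pmulr_lgt0 // => h _.
  by have := aux s sd; rewrite gtr0_norm // => E; move: E; clear; lra.
have sg' : c1 i t - v.1 < 0 by rewrite lt_neqAle subr_eq0 c1v.
apply: (@arc_affine I c1 c2 V G A i t (v.1 - k * v.2) k) => //; exists d => // s sd.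
have [si h1 h2 [/(_ c1v)]] := Hd s sd; rewrite nmulr_lgt0 // => h _.
by have := aux s sd; rewrite ltr0_norm // => E; move: E; clear; lra.
Qed.

Lemma arc_start_steep (I : finType) (c1 c2 : I -> R -> R) (V : seq (R * R)) G (A : arcs c1 c2 V G) (EV : forall v, v \in V -> eventat false G v.1 v.2) i : exists eta, 0 < eta < 1 / 2 /\ forall t, 0 < t <= eta -> 'D_1 (c2 i) t != 0.
Proof.
have [v vV Hv] := ar_start A i; have [k [r [k0 r0 Hev]]] := EV v vV.
have [e e0 He] := Hv r r0; have [d d0 [d1 d2]] := @ex_min R e (1 / 2) e0 ltac:(lra).
exists (d / 2); split=> [|t ti]; first by clear -d0 d2; lra.
have [||h1 h2] := He t; [clear -ti d1 d0; lra|clear -ti d2 d0; lra|].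
by apply: (arc_event A vV _ k0 Hev h1 h2); clear -ti d2 d0; lra.
Qed.

Lemma arc_end_steep (I : finType) (c1 c2 : I -> R -> R) (V : seq (R * R)) G (A : arcs c1 c2 V G) (EV : forall v, v \in V -> eventat false G v.1 v.2) i : exists eta, 0 < eta < 1 / 2 /\ forall t, 1 - eta <= t < 1 -> 'D_1 (c2 i) t != 0.
Proof.
have [v vV Hv] := ar_end A i; have [k [r [k0 r0 Hev]]] := EV v vV.
have [e e0 He] := Hv r r0; have [d d0 [d1 d2]] := @ex_min R e (1 / 2) e0 ltac:(lra).
exists (d / 2); split=> [|t ti]; first by clear -d0 d2; lra.
have [||h1 h2] := He t; [clear -ti d1 d0; lra|clear -ti d2 d0; lra|].
by apply: (arc_event A vV _ k0 Hev h1 h2); clear -ti d2 d0; lra.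
Qed.


Lemma arc_piece (I : finType) (c1 c2 : I -> R -> R) (V : seq (R * R)) G (A : arcs c1 c2 V G) i s t :
  0 < s -> s < t -> t < 1 -> (forall x, s <= x <= t -> 'D_1 (c1 i) x != 0) ->
  'D_1 (c2 i) s != 0 -> 'D_1 (c2 i) t != 0 ->
  exists a x1 x2, piece G a x1 x2 /\ forall z, on_piece a x1 x2 z <-> exists2 x, s <= x <= t & z = (c1 i x, c2 i x).
Proof.
move=> s0 st t1 D1 Ds Dt.
have loc x : 0 < x < 1 -> 'D_1 (c1 i) x != 0 -> exists2 d : R, 0 < d & forall y, `|y - x| < d -> 0 < y < 1 /\ 'D_1 (c1 i) y != 0.
  move=> xi Dx; have D0 : 0 < `|'D_1 (c1 i) x| by rewrite normr_gt0.
  have /cont1P/(_ _ D0)[d1 d10 H1] : {for x, continuous ('D_1 (c1 i))}.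
    by apply: (smooth_cont (smooth_derive (1 : R) (ar_s1 A i))).
  have [d2 d20 [d21 d22]] := @ex_min R x (1 - x) ltac:(by case/andP: xi) ltac:(by rewrite subr_gt0; case/andP: xi).
  have [d d0 [dd1 dd2]] := @ex_min R d1 d2 d10 d20.
  exists d => // y yd; split; first by move: yd; rewrite ltr_norml; clear -dd2 d21 d22; lra.
  apply/negP => /eqP y0; have := H1 y (lt_le_trans yd dd1).
  by rewrite y0 sub0r normrN ltxx.
have [|d d0 Hd] := loc s _ (D1 s ltac:(by rewrite lexx ltW)); first by clear -s0 st t1; lra.
have [|e e0 He] := loc t _ (D1 t ltac:(by rewrite lexx ltW)); first by clear -s0 st t1; lra.
have all x : s - d < x < t + e -> 0 < x < 1 /\ 'D_1 (c1 i) x != 0.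
  move=> xi; case: (ltP x s) => xs; first by apply: Hd; rewrite close_itv; clear -xi xs d0; lra.
  case: (leP x t) => xt; first by split; [clear -xs xt s0 t1; lra|apply: D1; rewrite xs].
  by apply: He; rewrite close_itv; clear -xi xt e0; lra.
apply: (@piece_ne0 G (c1 i) (c2 i) (s - d) (t + e)) => //.
- by apply: smooth_sub (ar_s1 A i) => x /all[].
- by apply: smooth_sub (ar_s2 A i) => x /all[].
- by clear -d0; lra.
- by clear -e0; lra.
- by move=> x /all[].
- by move=> x /all[xi _]; exact: (ar_in A).
- move=> x xi; have [m m0 [m1 m2]] := @ex_min R d e d0 e0.
  have [|r r0 Hr] := ar_loc A i (t := x) (eta := m) _ m0; first by clear -xi s0 t1; lra.
  exists r => // u v Guv ur vr; have [x' [x'i x'd -> ->]] := Hr u v Guv ur vr.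
  by exists x' => //; move: x'd; rewrite close_itv; clear -xi m1 m2; lra.
Qed.

(* Flat stretches of an arc are covered one after the other: a stretch may be
   left open (the second alternative of P) until the arc is no longer flat. *)
Lemma arc_flats (I : finType) (c1 c2 : I -> R -> R) (V : seq (R * R)) G (A : arcs c1 c2 V G)
    (EV : forall v, v \in V -> eventat false G v.1 v.2) i L0 :
  pieces G L0 -> (forall z, on_pieces L0 z -> exists j t, [/\ j <> i, 0 < t < 1 & z = (c1 j t, c2 j t)]) ->
  exists L, [/\ pieces G L, on_pieces L0 `<=` on_pieces L,
    forall z, on_pieces L z -> on_pieces L0 z \/ exists2 t, 0 < t < 1 & z = (c1 i t, c2 i t) &
    forall t, 0 < t < 1 -> 'D_1 (c2 i) t = 0 -> on_pieces L (c1 i t, c2 i t)].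
Proof.
move=> p0 o0; have [e0 [e0i He0]] := arc_start_steep A EV i; have [e1 [e1i He1]] := arc_end_steep A EV i.
pose Q x L := [/\ pieces G L, on_pieces L0 `<=` on_pieces L,
    forall z, on_pieces L z -> on_pieces L0 z \/ exists2 t, 0 < t <= x & z = (c1 i t, c2 i t) &
    forall t, 0 < t <= x -> 'D_1 (c2 i) t = 0 -> on_pieces L (c1 i t, c2 i t)].
(* [s] is where the open stretch starts: the arc is steep there, and the list covers the flat points
   up to [s]. *)
pose P x := exists L s, [/\ 0 < s <= x, Q s L, 'D_1 (c2 i) s != 0 /\
    (forall t, on_pieces L (c1 i t, c2 i t) -> 0 < t < 1 -> t < s) &
    (forall y, s <= y <= x -> 'D_1 (c2 i) y != 0) \/ (forall y, s <= y <= x -> 'D_1 (c1 i) y != 0)].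
have inj s t : 0 < s < 1 -> 0 < t < 1 -> (c1 i s, c2 i s) = (c1 i t, c2 i t) -> s = t.
  by move=> si ti [E1 E2]; have [] := ar_inj A si ti E1 E2.
(* a stretch reaching a point where the arc is not flat can be closed *)
have close x : 0 < x < 1 -> 'D_1 (c2 i) x != 0 -> P x -> exists2 L, Q x L &
    forall t, on_pieces L (c1 i t, c2 i t) -> 0 < t < 1 -> t <= x.
  move=> xi Dx [L [s [si [pL sub inc cov] [Ds lt_s] [D2|D1]]]].
    exists L; last by move=> t Lt ti; apply/ltW/(lt_le_trans (lt_s t Lt ti)); case/andP: si.
    split=> //.
      move=> z /inc[|[t ti ->]]; [by left|right; exists t => //; clear -ti si; lra].
    move=> t ti D0; case: (leP t s) => ts; first by apply: cov => //; rewrite ts; case/andP: ti => ->.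
    by exfalso; have := D2 t; rewrite D0 eqxx => h; suff : false by []; apply: h; clear -ti ts; lra.
  case: (s =P x) => [sx|/eqP sx].
    exists L; first by rewrite -sx; split.
    by move=> t Lt ti; apply/ltW/(lt_le_trans (lt_s t Lt ti)); case/andP: si.
  have s_x : s < x by rewrite lt_neqAle sx; case/andP: si.
  have [||a [x1 [x2 [pc on]]]] := arc_piece A (i := i) _ s_x _ D1 Ds Dx.
    by case/andP: si.
    by case/andP: xi.
  exists ((a, x1, x2) :: L); last first.
    move=> t [/on[y yi E]|Lt] ti; last by apply/ltW/(lt_le_trans (lt_s t Lt ti)); exact: ltW.
    by rewrite (inj t y ti _ E); [case/andP: yi|clear -yi si xi; lra].
  split.
  - split=> //; rewrite -subset0 => z [/on[y yi ->] Lz].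
    have yi' : 0 < y < 1 by clear -yi si xi; lra.
    by have := lt_s y Lz yi'; clear -yi; lra.
  - by move=> z /sub; right.
  - move=> z [/on[y yi ->]|/inc[|[t ti ->]]]; [|by left|].
      by right; exists y => //; clear -yi si; lra.
    by right; exists t => //; clear -ti s_x; lra.
  - move=> t ti D0; case: (leP t s) => ts; first by right; apply: cov => //; rewrite ts; case/andP: ti => ->.
    by left; apply/on; exists t => //; rewrite (ltW ts); case/andP: ti.
(* Over a short interval either the arc is steep, and the open stretch can be closed, or it is not
   vertical, and a stretch is opened or prolonged. *)
have adv x y : 0 < x -> x < y -> y < 1 -> (forall z, x <= z <= y -> 'D_1 (c2 i) z != 0) \/ (forall z, x <= z <= y -> 'D_1 (c1 i) z != 0) ->
    P x -> P y.
  move=> x0 xy y1 [D2 Px|D1 [L [s [si QL [Ds lt_s] HH]]]].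
    have [||L [pL sub inc cov] le_x] := close x _ _ Px; [clear -x0 xy y1; lra|by apply: D2; rewrite lexx ltW|].
    exists L, y; split; [by rewrite lexx (lt_trans x0 xy)| |split|left].
    - split=> //; first by move=> z /inc[|[t ti ->]]; [left|right; exists t => //; clear -ti xy; lra].
      move=> t ti D0; case: (leP t x) => tx; first by apply: cov => //; rewrite tx; case/andP: ti => ->.
      by exfalso; have := D2 t; rewrite D0 eqxx => h; suff : false by []; apply: h; clear -ti tx; lra.
    - by apply: D2; rewrite lexx ltW.
    - by move=> t Lt ti; exact: le_lt_trans (le_x t Lt ti) xy.
    - by move=> z zi; apply: D2; clear -zi xy; lra.
  case: HH => [D2|D1'].
    (* the arc is transverse on [s, x]: move the start of the stretch to x *)
    have [pL sub inc cov] := QL.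
    exists L, x; split; [by rewrite x0 ltW| |split|right].
    - split=> //; first by move=> z /inc[|[t ti ->]]; [left|right; exists t => //; clear -ti si; lra].
      move=> t ti D0; case: (leP t s) => ts; first by apply: cov => //; rewrite ts; case/andP: ti => ->.
      by exfalso; have := D2 t; rewrite D0 eqxx => h; suff : false by []; apply: h; clear -ti ts; lra.
    - by apply: D2; case/andP: si => _ ->; rewrite lexx.
    - by move=> t Lt ti; apply: lt_le_trans (lt_s t Lt ti) _; case/andP: si.
    - exact: D1.
  exists L, s; split=> //; first by clear -si xy; lra.
  by right=> z zi; case: (leP z x) => zx; [apply: D1'|apply: D1]; clear -zi zx; lra.
have start : P e0.
  exists L0, e0; split; [by rewrite lexx; case/andP: e0i => -> | |split|left].
  - split=> //; first by left.
    by move=> t ti D0; have := He0 t ti; rewrite D0 eqxx.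
  - by apply: He0; rewrite lexx; case/andP: e0i => ->.
  - move=> t /o0[j [t' [ji t'i [E1 E2]]]] ti; exfalso.
    by apply: ji; have [] := ar_inj A ti t'i E1 E2.
  - by move=> z zi; have -> : z = e0 by [clear -zi; lra]; apply: He0; rewrite lexx; case/andP: e0i => ->.
have Pe : P (1 - e1).
  apply: (@real_ind R P (fun=> True) e0 (1 - e1)) => //; first by clear -e0i e1i; lra.
  move=> c ci; have c01 : 0 < c < 1 by clear -ci e0i e1i; lra.
  have aux (f : I -> R -> R) : smooth [set t : R | 0 < t < 1] (f i) -> 'D_1 (f i) c != 0 ->
      exists2 d : R, 0 < d & forall z, `|z - c| < d -> 'D_1 (f i) z != 0.
    move=> sf Dc; have D0 : 0 < `|'D_1 (f i) c| by rewrite normr_gt0.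
    have /cont1P/(_ _ D0)[d d0 Hd] : {for c, continuous ('D_1 (f i))}.
      by apply: (smooth_cont (smooth_derive (1 : R) sf)).
    exists d => // z zd; apply/negP => /eqP z0; have := Hd z zd.
    by rewrite z0 sub0r normrN ltxx.
  have [d d0 Hd] : exists2 d : R, 0 < d & forall x y, `|x - c| < d -> `|y - c| < d ->
      (forall z, x <= z <= y -> 'D_1 (c2 i) z != 0) \/ (forall z, x <= z <= y -> 'D_1 (c1 i) z != 0).
    case: (ar_reg A i c01) => [/(aux c1 (ar_s1 A i))|/(aux c2 (ar_s2 A i))] [d d0 Hd]; exists d => // x y;
      rewrite !close_itv => xd yd; [right|left] => z zi; apply: Hd; rewrite close_itv; clear -xd yd zi; lra.
  exists d => //; split=> // x y xd yd ex xy ye _ _; apply: adv => //; [| |exact: Hd]; clear -ex xy ye e0i e1i; lra.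
have [||L [pL sub inc cov] _] := close (1 - e1) _ _ Pe.
- by clear -e1i; lra.
- by apply: He1; clear -e1i; lra.
exists L; split=> //.
  by move=> z /inc[|[t ti ->]]; [left|right; exists t => //; clear -ti e1i; lra].
move=> t ti D0; apply: cov => //; case/andP: ti => t0 t1; rewrite t0 leNgt; apply/negP => h.
by have := He1 t; rewrite D0 eqxx => h'; suff : false by []; apply: h'; clear -h t1; lra.
Qed.

(** Flat points are covered by pieces, arc by arc. All other points of the arcs are strands already,
    and the vertices are the initial events. *)
Theorem arcs_tame (I : finType) (c1 c2 : I -> R -> R) (V : seq (R * R)) G : arcs c1 c2 V G ->
  (forall v, v \in V -> eventat false G v.1 v.2) -> uniq [seq v.2 | v <- V] ->
  exists H K E, diffeo H K /\ tame (pull H G) E.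
Proof.
move=> A EV uq.
have [L [pL inc cov]] : exists L, [/\ pieces G L,
    forall z, on_pieces L z -> exists j t, [/\ j \in enum I, 0 < t < 1 & z = (c1 j t, c2 j t)] &
    forall j t, j \in enum I -> 0 < t < 1 -> 'D_1 (c2 j) t = 0 -> on_pieces L (c1 j t, c2 j t)].
  elim: (enum I) (enum_uniq I) => [_|i s IH] /=; first by exists [::].
  move=> /andP[is_ /IH[L0 [p0 inc0 cov0]]].
  have [|L [pL sub inc cov]] := arc_flats A EV p0 (i := i).
    by move=> z /inc0[j [t [js ti zE]]]; exists j, t; split=> // ji; rewrite -ji js in is_.
  exists L; split=> //.
    move=> z /inc[/inc0[j [t [js ti zE]]]|[t ti zE]]; [exists j, t|exists i, t]; split=> //; by rewrite inE ?eqxx ?js ?orbT.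
  by move=> j t; rewrite inE => /orP[/eqP -> |js] ti D0; [exact: cov|apply: sub; exact: cov0].
have onV z : on_pieces L z -> z \notin V by move=> /inc[j [t [_ ti ->]]]; exact: (ar_avoid A).
apply: (@flats_all _ L G V) => //; split.
- exact: (ar_Bo A).
- exact: (ar_free A).
- move=> u c /(ar_cover A)[uV|[i [t [ti [-> ->]]]]]; first by constructor 3.
  case: ('D_1 (c2 i) t =P 0) => [D0|/eqP D0]; first by constructor 1; apply: cov => //; rewrite mem_enum.
  by constructor 2; exact: (arc_strand A).
- by move=> v vV; constructor 2; exact: EV.
- by move=> v vV /onV; rewrite vV.
- by move=> z /inc[j [t [_ ti ->]]]; exact: (ar_in A).
- exact: uq.
Qed.
End Arcs.

(** * General position of the vertices *)

Section LocalDiffeo.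
Context {R : realType}.
Implicit Types (G : set (R * R)) (H K M : R * R -> R * R) (F g : R * R -> R) (x y u c r e k : R) (z w p : R * R).

Definition box p r : set (R * R) := [set z | `|z.1 - p.1| < r /\ `|z.2 - p.2| < r].

Lemma box_center p r : 0 < r -> box p r p.
Proof. by rewrite /box /= !subrr normr0. Qed.

Lemma box_sub p r r' : r <= r' -> box p r `<=` box p r'.
Proof. by move=> rr z [h1 h2]; split; [exact: lt_le_trans h1 rr|exact: lt_le_trans h2 rr]. Qed.

Lemma box_nbhs p r z : box p r z -> exists2 e : R, 0 < e & box z e `<=` box p r.
Proof.
move=> [h1 h2]; have [e e0 [e1 e2]] := @ex_min R (r - `|z.1 - p.1|) (r - `|z.2 - p.2|) ltac:(by rewrite subr_gt0) ltac:(by rewrite subr_gt0).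
exists e => // w [w1 w2]; split.
  have : `|w.1 - p.1| <= `|w.1 - z.1| + `|z.1 - p.1| by apply: le_trans (ler_normD _ _); rewrite addrA subrK.
  by move=> h; apply: le_lt_trans h _; rewrite -ltrBrDr; exact: lt_le_trans w1 e1.
have : `|w.2 - p.2| <= `|w.2 - z.2| + `|z.2 - p.2| by apply: le_trans (ler_normD _ _); rewrite addrA subrK.
by move=> h; apply: le_lt_trans h _; rewrite -ltrBrDr; exact: lt_le_trans w2 e2.
Qed.

Lemma open_box p r : open (box p r).
Proof.
by apply: openR2 => z /box_nbhs[e e0 He]; exists e => // x y xe ye; apply: He.
Qed.

Lemma dist_tri x y u : `|x - u| <= `|y - x| + `|y - u|.
Proof. by rewrite [`|y - x|]distrC; apply: le_trans (ler_normD _ _); rewrite addrA subrK. Qed.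

Lemma plateau_flat v : 2 < `|v| -> 'D_1 plateau v = 0 :> R.
Proof.
rewrite derive_plateau ltr_normr => /orP[v2|v2].
  by rewrite (@step_const0 R (2 - v)) ?(@step0 R (2 - v)) ?oppr0 ?mul0r ?addr0 //; clear -v2; lra.
by rewrite (@step_const0 R (2 + v)) ?(@step0 R (2 + v)) ?mulr0 ?addr0 //; clear -v2; lra.
Qed.

Lemma far_nbhs p r z : r <= `|z.1 - p.1| \/ r <= `|z.2 - p.2| -> forall r', r' < r -> forall w, box z (r - r') w ->
  ~ box p r' w.
Proof.
move=> zr r' rr w [w1 w2] [h1 h2]; case: zr => zr.
  have := dist_tri z.1 w.1 p.1.
  move: w1 h1 zr; move: `|w.1 - z.1| `|w.1 - p.1| `|z.1 - p.1| => a b d; clear; lra.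
have := dist_tri z.2 w.2 p.2.
move: w2 h2 zr; move: `|w.2 - z.2| `|w.2 - p.2| `|z.2 - p.2| => a b d; clear; lra.
Qed.

(** Differentiating a cut-off of width [e] costs a factor 1/e, which the bound [k * e] on the
    function compensates. *)
Lemma cutoff_bound (P Q D e a b C k : R) : `|P| <= 1 -> `|Q| <= 1 -> `|D| <= C -> 0 < e -> `|a| <= k * e -> `|b| <= k ->
  `|P * (D / e) * a + P * Q * b| <= (C + 1) * k.
Proof.
move=> P1 Q1 DC e0 ae bk; have en : `|e^-1| = e^-1 by rewrite gtr0_norm ?invr_gt0.
apply: le_trans (ler_normD _ _) _; rewrite !normrM en mulrDl mul1r.
have t1 : `|P| * (`|D| / e) * `|a| <= 1 * (C / e) * (k * e).
  apply: ler_pM => //; first by rewrite mulr_ge0 // divr_ge0 // ltW.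
  apply: ler_pM => //; first by rewrite divr_ge0 // ltW.
  by rewrite ler_pM2r ?invr_gt0.
have t2 : `|P| * `|Q| * `|b| <= 1 * 1 * k.
  by apply: ler_pM => //; apply: ler_pM.
apply: le_trans (lerD t1 t2) _.
by have -> : 1 * (C / e) * (k * e) = C * k; [field; rewrite gt_eqF|rewrite !mul1r].
Qed.

(* Extends a shear given near p. The cut-off is much narrower in the direction
   of x, along which F is only continuous, than in that of y, where F is
   tangent to y. *)
Lemma local_shear F p r0 rho : 0 < r0 -> 0 < rho -> smooth (box p r0) F -> F p = p.2 -> 'D_(0, 1) F p = 1 ->
  exists eta zeta d, [/\ vshear eta zeta, 0 < d, forall z, box p d z -> eta z = F z & forall z, ~ box p rho z -> eta z = z.2].
Proof.
move=> r00 rho0 sF Fp DF; have [C C0 HC] := @plateau_bound R.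
pose g z := F z - z.2.
have oB := @open_box p r0.
have sg : smooth (box p r0) g by apply: smoothB => //; exact: smooth_snd.
have Dg z : box p r0 z -> 'D_(0, 1) g z = 'D_(0, 1) F z - 1.
  move=> Bz; have D := dB (derivableP (smooth_derivable (v := ((0, 1) : R * R)) sF Bz)) (is_derive_snd z ((0, 1) : R * R)).
  by rewrite (derive_val (is_derive := D)).
have gp : g p = 0 by rewrite /g Fp subrr.
have Bp := @box_center p r0 r00.
(* With this [ka] the perturbation of the slope is at most [3 * ka * (C + 1)], that is 3/16, below
   1/2. *)
have [ka kaE] : exists ka : R, ka = (16 * (C + 1))^-1 by eexists.
have ka0 : 0 < ka by rewrite kaE invr_gt0; clear -C0; lra.
have kaC : ka * (C + 1) = 1 / 16.
  have C1 : C + 1 != 0 by rewrite gt_eqF //; clear -C0; lra.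
  by rewrite kaE invfM mulrVK ?unitfE //; lra.
have [r1 r10 H1] : exists2 r1 : R, 0 < r1 & forall z, box p r1 z -> `|'D_(0, 1) g z| < ka.
  have /cont2P/(_ _ ka0)[d d0 Hd] : {for p, continuous ('D_(0, 1) g)} by apply: (smooth_cont (smooth_derive ((0, 1) : R * R) sg)).
  exists d => // -[x y] [xd yd]; have := Hd x y xd yd.
  by rewrite (Dg p) // DF subrr subr0.
have [r2 r20 [r21 r22]] := @ex_min R r1 rho r10 rho0.
have [r3 r30 [r31 r32]] := @ex_min R r2 r0 r20 r00.
have [e2 e2E] : exists e2, e2 = r3 / 3 by eexists.
have e20 : 0 < e2 by rewrite e2E; clear -r30; lra.
have [q q0 Hq] : exists2 q : R, 0 < q & forall x, `|x - p.1| < q -> `|g (x, p.2)| <= ka * e2.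
  have ke : 0 < ka * e2 by exact: mulr_gt0.
  have /cont2P/(_ _ ke)[d d0 Hd] : {for p, continuous g} by apply: (smooth_cont sg).
  by exists d => // x xd; have := Hd x p.2 xd; rewrite subrr normr0 gp subr0 => /(_ d0)/ltW.
have [e1' e1'0 [e1q e1e]] := @ex_min R q e2 q0 e20.
have [e1 e1E] : exists e1, e1 = e1' / 3 by eexists.
have e10 : 0 < e1 by rewrite e1E; clear -e1'0; lra.
have in_box x y : `|x - p.1| <= 2 * e1 -> `|y - p.2| <= 2 * e2 -> box p r3 (x, y).
  by move=> h1 h2; split => /=; move: h1 h2; rewrite e1E e2E; clear -e1e e2E r30 e1'0; lra.
have gsmall x y : `|x - p.1| <= 2 * e1 -> `|y - p.2| <= 2 * e2 -> `|g (x, y)| <= 3 * ka * e2.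
  move=> h1 h2.
  have mmi t : Num.min p.2 y <= t <= Num.max p.2 y -> `|t - p.2| <= 2 * e2.
    by move: h2; rewrite ge_min le_max !ler_norml => h2 /andP[/orP[a|a] /orP[b|b]]; clear -h2 a b e20; lra.
  have [|t ti E] := @MVTe R (fun y => g (x, y)) p.2 y.
    move=> t /mmi tt; rewrite -derivable01E; apply: (smooth_derivable sg); apply: box_sub r32 _ _.
    exact: in_box.
  have bt : `|'D_1 (fun y => g (x, y)) t| <= ka.
    rewrite -D01E; apply/ltW/H1; apply: (@box_sub p r3); last by apply: in_box => //; exact: mmi.
    exact: le_trans r31 r21.
  have h3 : `|g (x, p.2)| <= ka * e2 by apply: Hq; clear -h1 e1E e1q e1'0; lra.
  have -> : g (x, y) = g (x, p.2) + 'D_1 (fun y => g (x, y)) t * (y - p.2) by rewrite -E addrC subrK.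
  apply: le_trans (ler_normD _ _) _; rewrite normrM.
  have : `|'D_1 (fun y => g (x, y)) t| * `|y - p.2| <= ka * (2 * e2) by apply: ler_pM.
  move: h3; move: `|g _| (`|_| * `|_| : R) => a b; clear; lra.
pose be z := plateau ((z.1 - p.1) / e1) * plateau ((z.2 - p.2) / e2).
have be0 z : 2 * e1 <= `|z.1 - p.1| \/ 2 * e2 <= `|z.2 - p.2| -> be z = 0.
  by case=> h; rewrite /be (plateau_far _ h) ?mul0r ?mulr0.
pose eta z := z.2 + be z * g z.
have sbe : smooth [set: R * R] be.
  have oT := @openT (R * R)%type; apply: smoothM => //; apply: smooth_plateau => //; apply: smoothM => //; try exact: smooth_cst.
    by apply: smoothB => //; [exact: smooth_fst|exact: smooth_cst].
  by apply: smoothB => //; [exact: smooth_snd|exact: smooth_cst].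
have seta : smooth [set: R * R] eta.
  apply: smooth_union => z _; case: (pselect (box p r0 z)) => Bz.
    exists (box p r0) => //; apply: smoothD => //; first exact: smooth_snd.
    by apply: smoothM => //; exact: smooth_sub sbe.
  pose U : set (R * R) := [set z | 2 * e1 < `|z.1 - p.1| \/ 2 * e2 < `|z.2 - p.2|].
  have oU : open U.
    apply: openR2 => w [h|h].
      exists (`|w.1 - p.1| - 2 * e1); first by rewrite subr_gt0.
      move=> x y xw _; left => /=; have := dist_tri w.1 x p.1.
      move: xw; move: `|w.1 - p.1| `|x - w.1| `|x - p.1| => a b d; clear; lra.
    exists (`|w.2 - p.2| - 2 * e2); first by rewrite subr_gt0.
    move=> x y _ yw; right => /=; have := dist_tri w.2 y p.2.
    move: yw; move: `|w.2 - p.2| `|y - w.2| `|y - p.2| => a b d; clear; lra.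
  exists U.
    apply: contrapT => nU; apply: Bz; apply: box_sub r32 _ _; rewrite -(pair_eta z).
    apply: in_box; rewrite leNgt; apply/negP => h; apply: nU; [by left|by right].
  apply: (smooth_ext oU (f := fun z => z.2)); last exact: smooth_snd.
  by move=> w Uw; rewrite /eta be0 ?mul0r ?addr0 //; case: Uw => /ltW; [left|right].
have Deta z : 0 < 'D_(0, 1) eta z.
  case: z => x y; rewrite D01E.
  case: (pselect (`|x - p.1| < 2 * e1 + e1 /\ `|y - p.2| < 2 * e2 + e2)) => far; last first.
    have U : exists2 d : R, 0 < d & forall y', `|y' - y| < d -> eta (x, y') = y'.
      case: (leP (3 * e1) `|x - p.1|) => h1.
        by exists 1 => // y' _; rewrite /eta be0 ?mul0r ?addr0 //; left => /=; clear -h1 e10; lra.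
      have h2 : 3 * e2 <= `|y - p.2|.
        by rewrite leNgt; apply/negP => h; apply: far; clear -h h1; split; lra.
      exists e2 => // y' y'd; rewrite /eta be0 ?mul0r ?addr0 //; right => /=.
      have := dist_tri y y' p.2.
      move: y'd h2; move: `|y - p.2| `|y' - y| `|y' - p.2| => a b d; clear; lra.
    have [d d0 Hd] := U.
    have D : is_derive y 1 (fun s => eta (x, s)) 1.
      apply: (@is_derive_near _ _ (fun s => s) _ _ _ (@open_itvoo R (y - d) (y + d))) => //=.
      - by clear -d0; lra.
      - by move=> s; rewrite -close_itv => /Hd.
    by rewrite (derive_val (is_derive := D)).
  have Bxy : box p r0 (x, y).
    by case: far => h1 h2; apply: box_sub r32 _ _; split=> /=; move: h1 h2; rewrite e1E e2E; clear -e1e e2E r30 e1'0; lra.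
  have dg : is_derive y 1 (fun s => g (x, s)) ('D_(0, 1) g (x, y)).
    by rewrite D01E; apply: derivableP; rewrite -derivable01E; exact: (smooth_derivable sg).
  have D := dD (dI y) (dM (dZ (plateau ((x - p.1) / e1)) (is_derive_plateau p.2 e2 y)) dg).
  rewrite (_ : (fun s => eta (x, s)) = (fun s => s + plateau ((x - p.1) / e1) * plateau ((s - p.2) / e2) * g (x, s))) //.
  rewrite (derive_val (is_derive := D)).
  case: (leP (2 * e1) `|x - p.1|) => h1.
    by rewrite (plateau_far _ h1) // !mul0r !addr0.
  have b1 : `|plateau ((x - p.1) / e1)| <= 1 by rewrite ger0_norm ?plateau_ge0 ?plateau_le1.
  have b2 : `|plateau ((y - p.2) / e2)| <= 1 by rewrite ger0_norm ?plateau_ge0 ?plateau_le1.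
  suff : `|plateau ((x - p.1) / e1) * ('D_1 plateau ((y - p.2) / e2) / e2) * g (x, y) +
      plateau ((x - p.1) / e1) * plateau ((y - p.2) / e2) * 'D_(0, 1) g (x, y)| <= 1 / 2.
    by rewrite ler_norml; move: (_ + _ * 'D_(0, 1) g _ : R) => a; clear; lra.
  case: (ltP (2 * e2) `|y - p.2|) => h2.
    rewrite plateau_flat; last by rewrite normrM normfV (gtr0_norm e20) ltr_pdivlMr.
    by rewrite mul0r mulr0 mul0r add0r (plateau_far _ (ltW h2)) // mulr0 mul0r normr0.
  have gs := gsmall x y (ltW h1) h2.
  have Dgs : `|'D_(0, 1) g (x, y)| <= ka.
    by apply/ltW/H1; apply: (@box_sub p r3); [exact: le_trans r31 r21|apply: in_box => //; exact: ltW].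
  have Dgs' : `|'D_(0, 1) g (x, y)| <= 3 * ka by clear -Dgs ka0; lra.
  apply: le_trans (cutoff_bound b1 b2 (HC _) e20 gs Dgs') _.
  by clear -kaC; lra.
have [|zeta vs] := vshear_exists seta Deta.
  exists (`|p.2| + 3 * e2) => x y yM; rewrite /eta be0 ?mul0r ?addr0 //; right => /=.
  by apply: le_trans (lerB_dist _ _); clear -yM e20; lra.
have [d d0 [dd1 dd2]] := @ex_min R e1 e2 e10 e20.
exists eta, zeta, d; split=> //.
  move=> z [z1 z2]; rewrite /eta /be !plateau_close ?mul1r /g; [by rewrite addrC subrK|exact: e20|exact/ltW/(lt_le_trans z2)|exact: e10|exact/ltW/(lt_le_trans z1)].
move=> z nB; rewrite /eta be0 ?mul0r ?addr0 //; apply: contrapT => h; apply: nB.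
apply: (@box_sub p r3); first exact: le_trans r31 r22.
rewrite -(pair_eta z); apply: in_box; rewrite leNgt; apply/negP => h'; apply: h; [left|right]; exact: ltW.
Qed.

Lemma diffeo_sym H K : diffeo H K -> diffeo K H.
Proof.
move=> D; have [s1 s2 t1 t2 HK KH j off] := D; split=> //.
- move=> z; have oT := @openT (R * R)%type.
  have := @jac_comp R setT setT H K z oT oT I I s1 s2 t1 t2.
  have -> : (fun z => H (K z)) = id by apply/funext => w; rewrite KH.
  have d1 v := derive_val (is_derive := @is_derive_fst R z v).
  have d2 v := derive_val (is_derive := @is_derive_snd R z v).
  rewrite {1}/jac !d1 !d2 /= mulr1 mul0r subr0 => E.
  by have := @ltr01 R; rewrite E pmulr_rgt0.
- by move=> z zB; rewrite -{1}(off z zB) HK.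
Qed.

Lemma diffeo_near H K : diffeo H K -> forall z r, 0 < r -> exists2 d : R, 0 < d & forall w, box z d w -> box (H z) r (H w).
Proof.
move=> [s1 s2 _ _ _ _ _ _] z r r0.
have /cont2P/(_ _ r0)[d1 d10 H1] : {for z, continuous (fun z => (H z).1)} by exact: smooth_cont s1 I.
have /cont2P/(_ _ r0)[d2 d20 H2] : {for z, continuous (fun z => (H z).2)} by exact: smooth_cont s2 I.
have [d d0 [dd1 dd2]] := @ex_min R d1 d2 d10 d20.
exists d => // -[x y] [/= w1 w2]; split.
  by apply: H1; exact: lt_le_trans dd1.
by apply: H2; exact: lt_le_trans dd2.
Qed.

(** The map (M1, M2) is the horizontal shear (M1, y) followed by the vertical shear whose height is
    M2 after the inverse of the first. The two normalisations at [p] are exactly what [local_shear]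
    asks of each factor. *)
Lemma local_diffeo (M1 M2 : R * R -> R) p r0 rho : 0 < r0 -> 0 < rho -> box p rho `<=` Bo ->
  smooth (box p r0) M1 -> smooth (box p r0) M2 -> M1 p = p.1 -> M2 p = p.2 -> 'D_(1, 0) M1 p = 1 ->
  'D_(0, 1) M2 p - 'D_(0, 1) M1 p * 'D_(1, 0) M2 p = 1 ->
  exists H K d, [/\ diffeo H K, 0 < d, forall z, box p d z -> H z = (M1 z, M2 z) & forall z, ~ box p rho z -> H z = z].
Proof.
move=> r00 rho0 rB sM1 sM2 M1p M2p D1 D2.
have boxsw q r x y : box (q.2, q.1) r (y, x) <-> box q r (x, y) by split=> -[].
have oB q r : open (box q r) by exact: open_box.
have sF : smooth (box (p.2, p.1) r0) (fun z => M1 (z.2, z.1)).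
  apply: (@smooth_comp2 _ _ (box p r0) _ M1 snd fst) => //; try exact: smooth_snd; try exact: smooth_fst.
  by move=> [x y] [].
have [||eta1 [zeta1 [d1 [vs1 d10 eta1E off1]]]] := local_shear r00 rho0 sF.
- by rewrite /= pair_eta.
- by rewrite D01E /= -(D10E M1) pair_eta.
have DS1 : diffeo (hmap eta1) (hmap zeta1).
  by apply: hmap_diffeo vs1 _ => x y nB; rewrite off1 // => b; apply: nB; apply: rB; apply/boxsw.
have S1E z : box p d1 z -> hmap eta1 z = (M1 z, z.2).
  by case: z => x y b; rewrite /hmap /= eta1E //; apply/boxsw.
have S1p : hmap eta1 p = p by rewrite S1E ?M1p ?pair_eta //; exact: box_center.
have K1p : hmap zeta1 p = p by rewrite -{1}S1p (df_HK DS1).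
have [_ _ sK1 sK2 _ _ _ _] := DS1.
have [m m0 [m1 m2]] := @ex_min R d1 r0 d10 r00.
have [q q0] := diffeo_near (diffeo_sym DS1) p m0; rewrite K1p => Hq.
have sF2 : smooth (box p q) (fun z => M2 (hmap zeta1 z)).
  apply: (@smooth_pair_comp _ _ _ (box p r0)) => //; [by move=> z /Hq; exact: box_sub|exact: smooth_sub sK1|exact: smooth_sub sK2].
have DF2 : 'D_(0, 1) (fun z => M2 (hmap zeta1 z)) p = 1.
  have c1 : {for p, continuous (fun z => (hmap zeta1 z).1)} by exact: smooth_cont sK1 I.
  have c2 : {for p, continuous (fun z => (hmap zeta1 z).2)} by exact: smooth_cont sK2 I.
  have e1 := derivableP (smooth_derivable (v := ((0, 1) : R * R)) sK1 (I : setT p)).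
  have e2 : is_derive p ((0, 1) : R * R) (fun z => (hmap zeta1 z).2) 1 by exact: is_derive_snd.
  have W : box p r0 (hmap zeta1 p) by rewrite K1p; exact: box_center.
  have E1 := derive_pair_comp (oB p r0) W sM1 c1 c2 e1 e2.
  have E2 := derive_pair_comp (oB p r0) W sM2 c1 c2 e1 e2.
  rewrite (derive_val (is_derive := E2)) K1p.
  (* After the inverse shear [M1] is the first coordinate near [p]; its vertical derivative 0
     determines that of the inverse shear. *)
  have : 'D_(0, 1) (fun z => M1 (hmap zeta1 z)) p = 0.
    have -> : 'D_(0, 1) (fun z => M1 (hmap zeta1 z)) p = 'D_(0, 1) (fun z : R * R => z.1) p.
      apply: near_eq_derive; apply/nbhs2P; exists q => // x y xq yq.
      have b : box p d1 (hmap zeta1 (x, y)) by apply: box_sub m1 _ _; exact: Hq.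
      by have := df_KH DS1 (x, y); rewrite S1E // => /(congr1 fst).
    by rewrite (derive_val (is_derive := @is_derive_fst R p ((0, 1) : R * R))).
  rewrite (derive_val (is_derive := E1)) K1p D1 mul1r mulr1 => /eqP; rewrite addr_eq0 => /eqP ->.
  by rewrite mulr1 mulrN mulrC addrC.
have F2p : M2 (hmap zeta1 p) = p.2 by rewrite K1p.
have [eta2 [zeta2 [d2 [vs2 d20 eta2E off2]]]] := local_shear q0 rho0 sF2 F2p DF2.
have DS2 : diffeo (vmap eta2) (vmap zeta2).
  by apply: vmap_diffeo vs2 _ => z nB; rewrite off2 // => b; apply: nB; exact: rB.
have [s s0] := diffeo_near DS1 p d20; rewrite S1p => Hs.
have [d d0 [dd1 dd2]] := @ex_min R d1 s d10 s0.
exists (fun z => vmap eta2 (hmap eta1 z)), (fun z => hmap zeta1 (vmap zeta2 z)), d; split=> //.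
- exact: diffeo_comp.
- move=> z zd; have z1 : box p d1 z by exact: box_sub dd1 _ _.
  have z2 : box p d2 (hmap eta1 z) by apply: Hs; exact: box_sub dd2 _ _.
  by rewrite /vmap eta2E // (df_HK DS1) S1E.
- move=> z nb; have -> : hmap eta1 z = z.
    by case: z nb => x y nb; rewrite /hmap off1 //= => b; apply: nb; apply/boxsw.
  by rewrite /vmap off2 // pair_eta.
Qed.

Definition chartat G p := exists ps r, [/\ 0 < r, smooth (box (0, 0) r) (fun z => (ps z).1) /\ smooth (box (0, 0) r) (fun z => (ps z).2),
  ps (0, 0) = p, 0 < jac ps (0, 0) & forall z, box (0, 0) r z -> (G (ps z) <-> tripod R z)].

(** A linear map of determinant 1 and order 3, which permutes the three legs cyclically. *)
Lemma tripod_rot x y : tripod R (x, y) <-> tripod R (- (1 / 2) * x - 1 / 2 * y, 3 / 2 * x - 1 / 2 * y).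
Proof.
rewrite /tripod /=; split=> [[[-> y0]|[y0 xy]]|[[E y0]|[y0 xy]]].
- by right; split; [lra|rewrite ler0_norm; lra].
- case: (ltP 0 x) xy => x0; first by rewrite gtr0_norm // => xy; left; split; lra.
  by rewrite ler0_norm // => xy; right; split; [lra|rewrite ger0_norm; lra].
- by right; split; [lra|rewrite ger0_norm; lra].
- case: (ltP 0 (- (1 / 2) * x - 1 / 2 * y)) xy => x0.
    by rewrite gtr0_norm // => xy; right; split; [lra|rewrite ler0_norm; lra].
  by rewrite ler0_norm // => xy; left; split; lra.
Qed.

(** The first columns of the three powers of this map add up to 0 and span the plane, so a nonzero
    linear form is positive on one of them. *)
Lemma tripod_turn (a b : R) : (a, b) <> (0, 0) -> exists l11 l12 l21 l22 : R, [/\ l11 * l22 - l12 * l21 = 1, 0 < a * l11 + b * l21 &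
  forall x y, tripod R (l11 * x + l12 * y, l21 * x + l22 * y) <-> tripod R (x, y)].
Proof.
move=> ab; case: (ltP 0 a) => a0.
  exists 1, 0, 0, 1; split; [by ring|by rewrite mulr1 mulr0 addr0|].
  by move=> x y; rewrite !mul1r !mul0r addr0 add0r.
case: (ltP 0 (- (1 / 2) * a + 3 / 2 * b)) => b0.
  exists (- (1 / 2)), (- (1 / 2)), (3 / 2), (- (1 / 2)); split; [by field|by clear -b0; lra|].
  by move=> x y; rewrite (tripod_rot x y) !mulNr.
exists (- (1 / 2)), (1 / 2), (- (3 / 2)), (- (1 / 2)); split; [by field| |].
  rewrite lt_neqAle; apply/andP; split; last by clear -a0 b0; lra.
  apply/eqP => E; apply: ab; have -> : a = 0 by clear -a0 b0 E; lra.
  by have -> : b = 0 by clear -a0 b0 E; lra.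
move=> x y; rewrite (tripod_rot x y) (tripod_rot (- (1 / 2) * x - 1 / 2 * y) (3 / 2 * x - 1 / 2 * y)).
have -> : - (1 / 2) * (- (1 / 2) * x - 1 / 2 * y) - 1 / 2 * (3 / 2 * x - 1 / 2 * y) = - (1 / 2) * x + 1 / 2 * y by field.
by have -> : 3 / 2 * (- (1 / 2) * x - 1 / 2 * y) - 1 / 2 * (3 / 2 * x - 1 / 2 * y) = - (3 / 2) * x + - (1 / 2) * y by field.
Qed.

(** The chart is precomposed with a symmetry of the tripod and a rescaling of both axes. The
    symmetry makes the horizontal derivative of the first coordinate positive; [k1] and [k2] then
    normalise this derivative and the Jacobian to 1, as [local_diffeo] requires. Rescaling only
    changes the opening of the lower legs, to [k2 / k1]. *)
Lemma vertex_form G p rho : chartat G p -> 0 < rho -> box p rho `<=` Bo -> exists H K,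
  [/\ diffeo H K, H p = p, eventat false (pull H G) p.1 p.2 & forall z, ~ box p rho z -> H z = z].
Proof.
move=> [ps [r [r0 [s1 s2] psp jp Gps]]] rho0 rB.
move: jp; rewrite /jac.
set a11 := 'D_(1, 0) (fun z => (ps z).1) _; set a22 := 'D_(0, 1) (fun z => (ps z).2) _.
set a12 := 'D_(0, 1) (fun z => (ps z).1) _; set a21 := 'D_(1, 0) (fun z => (ps z).2) _ => jp.
have [|l11 [l12 [l21 [l22 [detl lp tri]]]]] := @tripod_turn a11 a12.
  by case=> e1 e2; move: jp; rewrite e1 e2 !mul0r subrr ltxx.
have [k1 k1E] : exists k1 : R, k1 = (a11 * l11 + a12 * l21)^-1 by eexists.
have k10 : 0 < k1 by rewrite k1E invr_gt0.
have k1M : (a11 * l11 + a12 * l21) * k1 = 1 by rewrite k1E mulfV ?gt_eqF.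
have [k2 k2E] : exists k2 : R, k2 = ((a11 * a22 - a12 * a21) * k1)^-1 by eexists.
have k20 : 0 < k2 by rewrite k2E invr_gt0 mulr_gt0.
have k2M : (a11 * a22 - a12 * a21) * k1 * k2 = 1 by rewrite k2E mulfV // gt_eqF // mulr_gt0.
pose L z : R * R := (l11 * (k1 * (z.1 - p.1)) + l12 * (k2 * (z.2 - p.2)), l21 * (k1 * (z.1 - p.1)) + l22 * (k2 * (z.2 - p.2))).
have lin (la lb : R) : smooth [set: R * R] (fun z : R * R => la * (k1 * (z.1 - p.1)) + lb * (k2 * (z.2 - p.2))) /\
    forall z v, is_derive z v (fun z : R * R => la * (k1 * (z.1 - p.1)) + lb * (k2 * (z.2 - p.2))) (la * (k1 * v.1) + lb * (k2 * v.2)).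
  have oT := @openT (R * R)%type; split.
    apply: smoothD => //; apply: smoothM => //; try exact: smooth_cst; apply: smoothM => //; try exact: smooth_cst.
      by apply: smoothB => //; [exact: smooth_fst|exact: smooth_cst].
    by apply: smoothB => //; [exact: smooth_snd|exact: smooth_cst].
  move=> z v; have D := dD (dZ la (dZ k1 (dB (is_derive_fst z v) (dC z v p.1)))) (dZ lb (dZ k2 (dB (is_derive_snd z v) (dC z v p.2)))).
  by apply: (is_derive_eq D); rewrite !subr0.
have [sL1 dL1] := lin l11 l12; have [sL2 dL2] := lin l21 l22.
have Lp : L p = (0, 0) by rewrite /L !subrr !mulr0 addr0.
have [q q0 Hq] : exists2 q : R, 0 < q & forall z, box p q z -> box (0, 0) r (L z).
  have /cont2P/(_ _ r0)[q1 q10 H1] : {for p, continuous (fun z => (L z).1)} by exact: smooth_cont sL1 I.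
  have /cont2P/(_ _ r0)[q2 q20 H2] : {for p, continuous (fun z => (L z).2)} by exact: smooth_cont sL2 I.
  have [q q0 [qq1 qq2]] := @ex_min R q1 q2 q10 q20.
  exists q => // -[x y] [/= w1 w2]; split.
    by have := H1 x y (lt_le_trans w1 qq1) (lt_le_trans w2 qq1); rewrite Lp.
  by have := H2 x y (lt_le_trans w1 qq2) (lt_le_trans w2 qq2); rewrite Lp.
have oq : open (box p q) by exact: open_box.
have or : open (box (0, 0) r) by exact: open_box.
have sM (g : R * R -> R) : smooth (box (0, 0) r) g -> smooth (box p q) (fun z => g (L z)).
  by move=> sg; apply: (@smooth_pair_comp _ _ _ (box (0, 0) r)) => //; [exact: smooth_sub sL1|exact: smooth_sub sL2].
have DM (g : R * R -> R) (v : R * R) : smooth (box (0, 0) r) g -> 'D_v (fun z => g (L z)) p =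
    'D_(1, 0) g (0, 0) * (l11 * (k1 * v.1) + l12 * (k2 * v.2)) + 'D_(0, 1) g (0, 0) * (l21 * (k1 * v.1) + l22 * (k2 * v.2)).
  move=> sg; have c1 : {for p, continuous (fun z => (L z).1)} by exact: smooth_cont sL1 I.
  have c2 : {for p, continuous (fun z => (L z).2)} by exact: smooth_cont sL2 I.
  have W : box (0, 0) r (L p) by rewrite Lp; exact: box_center.
  have D := derive_pair_comp or W sg c1 c2 (dL1 p v) (dL2 p v).
  by rewrite (derive_val (is_derive := D)) Lp.
have [||||||H [K [d [D d0 HE off]]]] := @local_diffeo (fun z => (ps (L z)).1) (fun z => (ps (L z)).2) p q rho q0 rho0 rB.
- exact: sM s1.
- exact: sM s2.
- by rewrite Lp psp.
- by rewrite Lp psp.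
- rewrite (DM (fun z => (ps z).1)) //= -/a11 -/a12 !mulr0 !mulr1 !addr0 -[RHS]k1M; ring.
- rewrite (DM (fun z => (ps z).1)) // !(DM (fun z => (ps z).2)) //= -/a11 -/a12 -/a21 -/a22.
  rewrite !mulr0 !mulr1 !addr0 !add0r.
  have alg : (a21 * (l12 * k2) + a22 * (l22 * k2)) * ((a11 * l11 + a12 * l21) * k1) - (a11 * (l12 * k2) + a12 * (l22 * k2)) * (a21 * (l11 * k1) + a22 * (l21 * k1))
     = ((a11 * a22 - a12 * a21) * k1 * k2) * (l11 * l22 - l12 * l21) by ring.
  by move: alg; rewrite k1M k2M detl !mulr1.
have [m m0 [m1 m2]] := @ex_min R d q d0 q0.
exists H, K; split=> //.
  by rewrite HE; [rewrite Lp psp pair_eta|exact: box_center].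
exists (k2 / k1), m; split=> //; first exact: divr_gt0.
move=> u y ub yb; have Bm : box p m (u, y) by [].
have Bd := box_sub m1 Bm; have Bq := box_sub m2 Bm.
rewrite /pull /= HE // pair_eta (Gps _ (Hq _ Bq)) /L tri /=.
have k1n : k1 != 0 by rewrite gt_eqF.
have kk : k2 / k1 * (p.2 - y) = - (k2 * (y - p.2)) / k1 by field.
have nn : `|k1 * (u - p.1)| = k1 * `|u - p.1| by rewrite normrM gtr0_norm.
rewrite /tripod /= nn; split=> [[[/eqP E y0]|[y0 E]]|[[y0 E]|[y0 ->]]].
- right; move: E; rewrite mulf_eq0 (negbTE k1n) subr_eq0 => /eqP ->.
  by split=> //; move: y0; rewrite pmulr_rge0 // subr_ge0.
- left; split; first by move: y0; rewrite pmulr_rle0 // subr_le0.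
  by rewrite kk -E mulrAC divff ?mul1r.
- right; split; first by rewrite pmulr_rle0 // subr_le0.
  by rewrite E kk mulrC divfK.
- by left; rewrite subrr mulr0; split=> //; rewrite pmulr_rge0 // subr_ge0.
Qed.

(** Near [p] the shear is a vertical translation, which keeps the straight Y. Its amount is small
    against the cut-off, and is chosen so that the new level avoids [Z]. *)
Lemma vertex_shift G p rho (Z : seq R) : eventat false G p.1 p.2 -> 0 < rho -> box p rho `<=` Bo -> exists H K h,
  [/\ diffeo H K, K p = (p.1, h), h \notin Z, eventat false (pull H G) p.1 h & forall z, ~ box p rho z -> H z = z].
Proof.
move=> [k [r [k0 r0 Gev]]] rho0 rB; have [C C0 HC] := @plateau_bound R.
have [e eE] : exists e, e = rho / 2 by eexists.
have e0 : 0 < e by rewrite eE; clear -rho0; lra.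
have [q q0 [q1 q2]] := @ex_min R (e / (2 * (C + 1))) (e / 2) ltac:(by rewrite divr_gt0 // mulr_gt0 // addr_gt0) ltac:(clear -e0; lra).
have [s s0 [s1 s2]] := @ex_min R q (r / 2) q0 ltac:(clear -r0; lra).
have [h' h'i h'Z] := @avoid R Z (p.2 - s) p.2 ltac:(clear -s0; lra).
have [h hE] : exists h, h = p.2 - h' by eexists.
have h0 : 0 < h by rewrite hE; clear -h'i; lra.
have hs : h < s by rewrite hE; clear -h'i; lra.
have h'E : h' = p.2 - h by rewrite hE; ring.
have hC : h * (C + 1) <= e / 2.
  have : h <= e / (2 * (C + 1)) by clear -hs s1 q1; lra.
  rewrite ler_pdivlMr ?mulr_gt0 ?addr_gt0 //; clear; lra.
pose eta (z : R * R) := z.2 + h * (plateau ((z.1 - p.1) / e) * plateau ((z.2 - p.2) / e)).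
have oT := @openT (R * R)%type.
have seta : smooth [set: R * R] eta.
  apply: smoothD => //; first exact: smooth_snd.
  apply: smoothM => //; first exact: smooth_cst.
  apply: smoothM => //; apply: smooth_plateau => //; apply: smoothM => //; try exact: smooth_cst.
    by apply: smoothB => //; [exact: smooth_fst|exact: smooth_cst].
  by apply: smoothB => //; [exact: smooth_snd|exact: smooth_cst].
have Deta z : 0 < 'D_(0, 1) eta z.
  case: z => x y; rewrite D01E.
  have D := dD (dI y) (dZ h (dZ (plateau ((x - p.1) / e)) (is_derive_plateau p.2 e y))).
  rewrite (_ : (fun s => eta (x, s)) = (fun s => s + h * (plateau ((x - p.1) / e) * plateau ((s - p.2) / e)))) //.
  rewrite (derive_val (is_derive := D)).
  suff : `|h * (plateau ((x - p.1) / e) * ('D_1 plateau ((y - p.2) / e) / e))| <= 1 / 2.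
    by rewrite ler_norml; move: (h * _ : R) => a; clear; lra.
  have P1 : `|plateau ((x - p.1) / e)| <= 1 by rewrite ger0_norm ?plateau_ge0 ?plateau_le1.
  have z0 : `|0 : R| <= h / e by rewrite normr0 divr_ge0 // ltW.
  have hh : `|h| <= h / e * e by rewrite divfK ?gt_eqF // gtr0_norm.
  have := cutoff_bound P1 P1 (HC ((y - p.2) / e)) e0 hh z0.
  move: (plateau _) ('D_1 plateau _) => P D' b; have -> : h * (P * (D' / e)) = P * (D' / e) * h + P * P * 0 by ring.
  apply: le_trans b _.
  by rewrite mulrA ler_pdivrMr //; move: hC; rewrite [h * _]mulrC; clear; lra.
have eoff z : ~ box p rho z -> eta z = z.2.
  move=> nb; rewrite /eta; case: (leP (2 * e) `|z.1 - p.1|) => h1.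
    by rewrite (plateau_far e0 h1) mul0r mulr0 addr0.
  case: (leP (2 * e) `|z.2 - p.2|) => h2.
    by rewrite (plateau_far e0 h2) !mulr0 addr0.
  by exfalso; apply: nb; rewrite eE in h1 h2; split; [clear -h1|clear -h2]; lra.
have [|zeta vs] := vshear_exists seta Deta.
  exists (`|p.2| + rho) => x y yM; rewrite eoff //= => -[_ /=]; apply/negP; rewrite -leNgt.
  by apply: le_trans (lerB_dist _ _); clear -yM; lra.
have D : diffeo (vmap eta) (vmap zeta).
  by apply: vmap_diffeo => // z nB; apply: eoff => b; apply: nB; exact: rB.
have etaE x y : `|x - p.1| <= e -> `|y - p.2| <= e -> eta (x, y) = y + h.
  by move=> h1 h2; rewrite /eta !plateau_close // !mulr1.
have Hp : vmap eta (p.1, h') = p.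
  by rewrite /vmap /= etaE ?subrr ?normr0 ?(ltW e0) // h'E; [rewrite subrK pair_eta|rewrite addrAC subrr add0r normrN gtr0_norm //; clear -hs s1 q2 e0; lra].
exists (vmap eta), (vmap zeta), h'; split=> //.
- by rewrite -{1}Hp (df_HK D).
- have [m m0 [m1 m2]] := @ex_min R (e / 2) (r / 2) ltac:(clear -e0; lra) ltac:(clear -r0; lra).
  exists k, m; split=> // u y um ym.
  have y1 : `|y - p.2| <= e by move: ym; rewrite h'E ltr_norml ler_norml; clear -m1 hs s1 q2 e0 h0; lra.
  have y2 : `|y + h - p.2| < r by move: ym; rewrite h'E !ltr_norml; clear -m2 r0 h0 hs s2; lra.
  rewrite /pull /vmap /= etaE //; last by clear -um m1 e0; lra.
  rewrite Gev //; last by clear -um m2 r0; lra.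
  rewrite /= h'E; have -> : p.2 - (y + h) = p.2 - h - y by ring.
  by split=> [[[a b]|[a b]]|[[a b]|[a b]]]; [left|right|left|right]; split=> //; clear -a; lra.
- by move=> z nb; rewrite /vmap eoff // pair_eta.
Qed.

Lemma chartat_pull H K G p : diffeo H K -> chartat G p -> chartat (pull H G) (K p).
Proof.
move=> D [ps [r [r0 [s1 s2] psp jp Gps]]]; have [_ _ t1 t2 HK KH _ _] := D.
have oT := @openT (R * R)%type; have oB : open (box (0, 0) r) by exact: open_box.
have B0 : box (0, 0) r (0, 0) by exact: box_center.
exists (fun z => K (ps z)), r; split=> //.
- split; first exact: (@smooth_pair_comp R _ _ setT (fun z => (K z).1) ps).
  exact: (@smooth_pair_comp R _ _ setT (fun z => (K z).2) ps).
- by rewrite psp.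
- by rewrite (jac_comp oB oT B0 I t1 t2 s1 s2) mulr_gt0 // (df_jac (diffeo_sym D)).
- by move=> z zB; rewrite /pull /= KH Gps.
Qed.

Lemma arcs_pull (I : finType) (c1 c2 : I -> R -> R) (V : seq (R * R)) G H K : diffeo H K -> arcs c1 c2 V G ->
  arcs (fun i t => (K (c1 i t, c2 i t)).1) (fun i t => (K (c1 i t, c2 i t)).2) (map K V) (pull H G).
Proof.
move=> D A; have D' := diffeo_sym D; have [s1 s2 t1 t2 HK KH _ _] := D.
have oT := @openT (R * R)%type; have oI : open [set t : R | 0 < t < 1] by exact: open_itvoo.
have sK i (g : R * R -> R) : smooth [set: R * R] g -> smooth [set t : R | 0 < t < 1] (fun t => g (c1 i t, c2 i t)).
  by move=> sg; apply: (@smooth_comp2 _ _ setT) => //; [exact: (ar_s1 A)|exact: (ar_s2 A)].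
have KE i t : ((K (c1 i t, c2 i t)).1, (K (c1 i t, c2 i t)).2) = K (c1 i t, c2 i t) by exact: pair_eta.
split.
- exact: pull_Bo D (ar_Bo A).
- move=> u c nG; have [e e0 He] := ar_free A (u := (H (u, c)).1) (c := (H (u, c)).2) ltac:(by rewrite pair_eta).
  have [d d0 Hd] := diffeo_near D (u, c) e0.
  exists d => // x y xd yd; rewrite /pull /= -(pair_eta (H (x, y))).
  by have [h1 h2] := Hd (x, y) (conj xd yd); exact: He.
- by move=> i; exact: (sK i (fun z => (K z).1)).
- by move=> i; exact: (sK i (fun z => (K z).2)).
- move=> i t ti; set k1 := (fun t => _); set k2 := (fun t => _).
  have sk1 : smooth [set t : R | 0 < t < 1] k1 by exact: (sK i (fun z => (K z).1)).
  have sk2 : smooth [set t : R | 0 < t < 1] k2 by exact: (sK i (fun z => (K z).2)).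
  case: ('D_1 k1 t =P 0) => [E1|/eqP]; last by left.
  case: ('D_1 k2 t =P 0) => [E2|/eqP]; last by right.
  (* Otherwise the chain rule through [H] would make both derivatives of the original arc vanish. *)
  exfalso; have d1 := derivableP (smooth_derivable (v := (1 : R)) sk1 ti); have d2 := derivableP (smooth_derivable (v := (1 : R)) sk2 ti).
  have cc1 : {for t, continuous k1} by exact: smooth_cont sk1 ti.
  have cc2 : {for t, continuous k2} by exact: smooth_cont sk2 ti.
  have zero (g : R * R -> R) : smooth setT g -> 'D_1 (fun s => g (k1 s, k2 s)) t = 0.
    move=> sg; have DD := @is_derive_comp2 _ _ g setT k1 k2 t 1 _ _ oT Logic.I sg cc1 cc2 d1 d2.
    by rewrite (derive_val (is_derive := DD)) E1 E2 !mulr0 addr0.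
  have Z1 := zero _ s1; have Z2 := zero _ s2.
  have e1 : (fun s => (H (k1 s, k2 s)).1) = c1 i by apply/funext => s; rewrite /k1 /k2 KE KH.
  have e2 : (fun s => (H (k1 s, k2 s)).2) = c2 i by apply/funext => s; rewrite /k1 /k2 KE KH.
  by case: (ar_reg A i ti); rewrite -?e1 -?e2 ?Z1 ?Z2 eqxx.
- by move=> i t ti; rewrite KE /pull /= KH; exact: (ar_in A).
- move=> z /(ar_cover A)[zV|[i [t [ti E]]]]; first by left; rewrite -(HK z) map_f.
  by right; exists i, t; split=> //; rewrite KE -E HK.
- move=> i j s t si ti E1 E2.
  have E : K (c1 i s, c2 i s) = K (c1 j t, c2 j t) by rewrite -KE E1 E2 KE.
  have /(can_inj KH) [F1 F2] := E.
  exact: (ar_inj A si ti F1 F2).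
- by move=> i t ti; rewrite KE (mem_map (can_inj KH)); exact: (ar_avoid A).
- move=> i t eta ti eta0; have [r r0 Hr] := ar_loc A i ti eta0.
  have [d d0 Hd] := diffeo_near D (K (c1 i t, c2 i t)) r0.
  exists d => // u v Guv ud vd; have [] := Hd (u, v) (conj ud vd); rewrite KH => h1 h2.
  have [|t' [t'i t'd E1 E2]] := Hr (H (u, v)).1 (H (u, v)).2 _ h1 h2; first by rewrite pair_eta.
  exists t'; rewrite -E1 -E2 pair_eta HK; split=> //.
- move=> i; have [v vV Hv] := ar_start A i; exists (K v); first exact: map_f.
  move=> r r0; have [d d0 Hd] := diffeo_near D' v r0; have [e e0 He] := Hv d d0.
  by exists e => // t ti t1'; have [h1 h2] := He t ti t1'; exact: (Hd (c1 i t, c2 i t) (conj h1 h2)).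
- move=> i; have [v vV Hv] := ar_end A i; exists (K v); first exact: map_f.
  move=> r r0; have [d d0 Hd] := diffeo_near D' v r0; have [e e0 He] := Hv d d0.
  by exists e => // t ti t1'; have [h1 h2] := He t ti t1'; exact: (Hd (c1 i t, c2 i t) (conj h1 h2)).
Qed.

Lemma arcs_eqV (I : finType) (c1 c2 : I -> R -> R) (V V' : seq (R * R)) G : V =i V' -> arcs c1 c2 V G -> arcs c1 c2 V' G.
Proof.
move=> VV [a1 a2 a3 a4 a5 a6 a7 a8 a9 a10 a11 a12]; split=> //.
- by move=> z /a7; rewrite VV.
- by move=> i t /a9 h; rewrite -VV.
- by move=> i; have [v vV Hv] := a11 i; exists v; rewrite -?VV.
- by move=> i; have [v vV Hv] := a12 i; exists v; rewrite -?VV.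
Qed.

Lemma isolate (V : seq (R * R)) p : p \notin V -> exists2 r : R, 0 < r & forall v, v \in V -> r <= `|v.1 - p.1| \/ r <= `|v.2 - p.2|.
Proof.
elim: V => [_|v V IH]; first by exists 1.
rewrite inE negb_or => /andP[pv /IH[r r0 Hr]].
have [s s0 Hs] : exists2 s : R, 0 < s & s <= `|v.1 - p.1| \/ s <= `|v.2 - p.2|.
  case: (v.1 =P p.1) => [e1|/eqP n1].
    exists `|v.2 - p.2|; last by right.
    rewrite normr_gt0 subr_eq0; apply: contra pv => /eqP e2; apply/eqP.
    by rewrite -(pair_eta p) -(pair_eta v) e1 e2.
  by exists `|v.1 - p.1|; [rewrite normr_gt0 subr_eq0|left].
have [q q0 [q1 q2]] := @ex_min R r s r0 s0.
exists q => // w; rewrite inE => /orP[/eqP ->|/Hr[h|h]].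
- by case: Hs => h; [left|right]; exact: le_trans q2 h.
- by left; exact: le_trans q1 h.
- by right; exact: le_trans q1 h.
Qed.

Lemma box_Bo p : Bo p -> exists2 r : R, 0 < r & box p r `<=` Bo.
Proof.
move=> [p1 p2].
have [a a0 [a1 a2]] := @ex_min R (p.1 - 1 / 8) (7 / 8 - p.1) ltac:(clear -p1; lra) ltac:(clear -p1; lra).
have [b b0 [b1 b2]] := @ex_min R (p.2 + 2 / 5) (2 / 5 - p.2) ltac:(clear -p2; lra) ltac:(clear -p2; lra).
have [q q0 [q1 q2]] := @ex_min R a b a0 b0.
exists q => // z [h1 h2]; move: h1 h2; rewrite !ltr_norml => h1 h2.
by split; [clear -h1 a1 a2 q1|clear -h2 b1 b2 q2]; lra.
Qed.

Lemma box_agree H G p rho z : (forall w, ~ box p rho w -> H w = w) ->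
  rho + rho <= `|z.1 - p.1| \/ rho + rho <= `|z.2 - p.2| -> 0 < rho -> agree G (pull H G) z.1 z.2.
Proof.
move=> off far rho0; have lt : rho < rho + rho by clear -rho0; lra.
exists rho => // x y xr yr; rewrite /pull /= off //.
by apply: (far_nbhs far lt); rewrite addrK; split.
Qed.

(** [W] lists the vertices still to be treated, [D] those already straight and at distinct levels.
    The moves are supported in a box around [p] away from all other vertices, which keep their
    positions and, for [D], their straight form. *)
Lemma vertices_step (I : finType) (c1 c2 : I -> R -> R) (W D : seq (R * R)) G p : arcs c1 c2 (p :: W ++ D) G ->
  uniq (p :: W ++ D) -> chartat G p -> (forall v, v \in W -> chartat G v) ->
  (forall v, v \in D -> eventat false G v.1 v.2) -> uniq [seq v.2 | v <- D] ->
  exists H K p', [/\ diffeo H K,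
    [/\ exists d1 d2 : I -> R -> R, arcs d1 d2 (W ++ p' :: D) (pull H G), uniq (W ++ p' :: D) &
    (forall v, v \in W -> chartat (pull H G) v)],
    (forall v, v \in p' :: D -> eventat false (pull H G) v.1 v.2) & uniq [seq v.2 | v <- p' :: D]].
Proof.
move=> A /andP[pWD uWD] chp chW evD uqD.
have pB : Bo p.
  have [ps [r [r0 _ <- _ Gps]]] := chp; apply: (ar_Bo A); apply/Gps; first exact: box_center.
  by left.
have [r r0 Hr] := isolate pWD; have [b b0 Hb] := box_Bo pB.
have [q q0 [q1 q2]] := @ex_min R (r / 2) b ltac:(clear -r0; lra) b0.
have qB : box p q `<=` Bo by move=> z /(box_sub q2); exact: Hb.
have far v : v \in W ++ D -> q + q <= `|v.1 - p.1| \/ q + q <= `|v.2 - p.2|.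
  by move=> /Hr[h|h]; [left|right]; clear -h q1; lra.
have nb v : v \in W ++ D -> ~ box p q v.
  by move=> /far[h|h] [h1 h2]; move: h h1 h2; move: `|v.1 - p.1| `|v.2 - p.2| => ? ?; clear -q0; lra.
have [H1 [K1 [D1 H1p ev1 off1]]] := vertex_form chp q0 qB.
have [H2 [K2 [h [D2 K2p hZ ev2 off2]]]] := vertex_shift [seq v.2 | v <- D] ev1 q0 qB.
have off z : ~ box p q z -> H1 (H2 z) = z by move=> nz; rewrite off2 // off1.
have DD := diffeo_comp D1 D2.
have Kv v : v \in W ++ D -> K2 (K1 v) = v by move=> /nb/off E; rewrite -{1}E (df_HK D1) (df_HK D2).
have K1p : K1 p = p by rewrite -{1}H1p (df_HK D1).
have mapE : map (fun z => K2 (K1 z)) (p :: W ++ D) = (p.1, h) :: W ++ D.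
  by rewrite /= K1p K2p; congr (_ :: _); rewrite -[RHS]map_id; apply/eq_in_map => v /Kv.
exists (fun z => H1 (H2 z)), (fun z => K2 (K1 z)), (p.1, h); split=> //.
- have AA := arcs_pull DD A; rewrite mapE in AA.
  have pm : perm_eq ((p.1, h) :: W ++ D) (W ++ (p.1, h) :: D) by rewrite -cat1s perm_catCA.
  split.
  + by do 2 eexists; exact: (arcs_eqV (perm_mem pm) AA).
  + rewrite -(perm_uniq pm) -mapE map_inj_uniq /= ?pWD //.
    by move=> x y E; rewrite -(df_KH D1 x) -(df_KH D2 (K1 x)) E (df_KH D2) (df_KH D1).
  + move=> v vW; have vWD : v \in W ++ D by rewrite mem_cat vW.
    by rewrite -(Kv v vWD); exact: chartat_pull DD (chW v vW).
- move=> v; rewrite inE => /orP[/eqP -> //|vD].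
  have vWD : v \in W ++ D by rewrite mem_cat vD orbT.
  exact: agree_eventat (@box_agree (fun z => H1 (H2 z)) G p q v off (far v vWD) q0) (evD v vD).
- by rewrite /= hZ.
Qed.

Theorem drawing_tame (I : finType) (c1 c2 : I -> R -> R) (W D : seq (R * R)) G : arcs c1 c2 (W ++ D) G ->
  uniq (W ++ D) -> (forall v, v \in W -> chartat G v) ->
  (forall v, v \in D -> eventat false G v.1 v.2) -> uniq [seq v.2 | v <- D] ->
  exists H K E, diffeo H K /\ tame (pull H G) E.
Proof.
elim: W c1 c2 D G => [|p W IH] c1 c2 D G A uq chW evD uqD; first exact: arcs_tame A evD uqD.
have [||H [K [p' [DH [[d1 [d2 A']] uq' ch'] ev' uqD']]]] := vertices_step A uq _ _ evD uqD.
- by apply: chW; rewrite mem_head.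
- by move=> v vW; apply: chW; rewrite inE vW orbT.
have [H' [K' [E [DH' tE]]]] := IH d1 d2 (p' :: D) (pull H G) A' uq' ch' ev' uqD'.
exists (fun z => H (H' z)), (fun z => K' (K z)), E; split; first exact: diffeo_comp.
exact: tE.
Qed.
End LocalDiffeo.

(** * Charts of the sphere *)

Section Vectors.
Context {R : realType}.
Implicit Types (a b c : R) (u v w : 'rV[R]_3).

Definition vec a b c : 'rV[R]_3 := \row_(j < 3) [:: a; b; c]`_j.

Lemma vecE a b c : [/\ vec a b c 0 0 = a, vec a b c 0 1 = b & vec a b c 0 2 = c].
Proof. by rewrite !mxE. Qed.

Lemma vec_eta v : vec (v 0 0) (v 0 1) (v 0 2) = v.
Proof.
apply/rowP => j; rewrite mxE; case: j => -[|[|[|//]]] h /=; by congr (v 0 _); apply/val_inj.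
Qed.

Lemma sum3 (F : 'I_3 -> R) : \sum_(i < 3) F i = F 0 + F 1 + F 2.
Proof.
rewrite !big_ord_recl big_ord0 addr0 addrA; congr (F _ + F _ + F _); exact/val_inj.
Qed.

Lemma sphere_vec a b c : sphere R (vec a b c) <-> a ^+ 2 + b ^+ 2 + c ^+ 2 = 1.
Proof. by rewrite /sphere /= sum3; have [-> -> ->] := vecE a b c. Qed.

Definition dt (a1 a2 a3 b1 b2 b3 c1 c2 c3 : R) := a1 * (b2 * c3 - b3 * c2) - a2 * (b1 * c3 - b3 * c1) + a3 * (b1 * c2 - b2 * c1).

Definition rows3 u v w : 'M[R]_3 := (col_mx u (col_mx v w) : 'M[R]_(1 + (1 + 1), 3)).

Lemma rows3E u v w (i j : 'I_3) :
  rows3 u v w i j = if val i == 0%N then u 0 j else if val i == 1%N then v 0 j else w 0 j.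
Proof.
rewrite /rows3 mxE; case: splitP => k /= ->; first by rewrite ord1.
by rewrite mxE; case: splitP => l /= ->; rewrite ord1.
Qed.

Lemma rows3_mul u v w : vec 1 0 0 *m rows3 u v w = u.
Proof.
have RE := rows3E u v w; move: (rows3 u v w) RE => M RE.
apply/rowP => j; rewrite mxE sum3; have [-> -> ->] := vecE (1 : R) 0 0.
by rewrite RE /= mul1r !mul0r !addr0.
Qed.

Lemma det3E a1 a2 a3 b1 b2 b3 c1 c2 c3 : det3 (vec a1 a2 a3) (vec b1 b2 b3) (vec c1 c2 c3) = dt a1 a2 a3 b1 b2 b3 c1 c2 c3.
Proof.
rewrite -[LHS]/(\det (rows3 _ _ _)); have AE := rows3E (vec a1 a2 a3) (vec b1 b2 b3) (vec c1 c2 c3).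
move: (rows3 _ _ _) AE => A AE.
rewrite (expand_det_row _ 0) sum3 /cofactor !(expand_det_row _ 0) !big_ord_recl !big_ord0 /cofactor !det_mx11.
rewrite /row' /col' !mxE /= !AE /= !mxE /= /bump /= !(add0n, addn0) /=.
by rewrite (_ : ((1 %% 3 + 1 %% 3) %% 3)%N = 2%N) // /dt; ring.
Qed.

Lemma vec_mul a b c (E : 'M[R]_3) : vec a b c *m E = a *: row 0 E + b *: row 1 E + c *: row 2 E.
Proof. by apply/rowP => j; rewrite !mxE sum3 !mxE. Qed.

Lemma det3_mul u v w (E : 'M[R]_3) : det3 (u *m E) (v *m E) (w *m E) = det3 u v w * \det E.
Proof.
have E1 : col_mx u (col_mx v w) *m E = col_mx (u *m E) (col_mx (v *m E) (w *m E)) by rewrite !mul_col_mx.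
by rewrite /det3 -det_mulmx; congr (\det _); exact: esym.
Qed.

Section VectorCk.
Variable V : normedModType R.
Implicit Types (U : set V) (f g h : V -> R) (F : V -> 'rV[R]_3).

Lemma Ck_scale k U f v : open U -> is_Ck k U f -> is_Ck k U (fun z => f z *: v).
Proof.
move=> oU; elim: k f => [|k IH] f /=; first by move=> H z Uz; apply: cvgZr_tmp; exact: H.
case=> f1 f2 f3; have D (w z : V) : U z -> is_derive z w (fun z => f z *: v) ('D_w f z *: v).
  move=> Uz; have df := f2 w z Uz.
  have E (i : 'I_1) (j : 'I_3) : is_derive z w (fun z => (f z *: v) i j) ('D_w f z * v i j).
    rewrite (_ : (fun z => _) = (fun z => f z * v i j)); last by apply/funext => y; rewrite mxE.
    by apply: (is_derive_eq (dM (derivableP df) (dC z w (v i j)))); rewrite mulr0 addr0.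
  have dv : derivable (fun z => f z *: v) z w by apply/derivable_mxP => i j; exact: ex_derive.
  apply: DeriveDef => //; rewrite (derive_mx dv); apply/matrixP => i j; rewrite !mxE.
  exact: (derive_val (is_derive := E i j)).
split.
- by move=> z Uz; apply: cvgZr_tmp; exact: f1.
- by move=> w z Uz; case: (D w z Uz).
- move=> w; apply: (Ck_ext oU) (IH _ (f3 w)) => z Uz.
  by rewrite (derive_val (is_derive := D w z Uz)).
Qed.

Lemma Ck_coord k U F (j : 'I_3) : open U -> is_Ck k U F -> is_Ck k U (fun z => F z 0 j).
Proof.
move=> oU; elim: k F => [|k IH] F /=.
  by move=> H z Uz; apply: (cvg_comp F (fun M : 'rV[R]_3 => M 0 j) (H z Uz)); exact: coord_continuous.
case=> f1 f2 f3; split.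
- by move=> z Uz; apply: (cvg_comp F (fun M : 'rV[R]_3 => M 0 j) (f1 z Uz)); exact: coord_continuous.
- by move=> w z Uz; have /derivable_mxP := f2 w z Uz; apply.
- move=> w; apply: (Ck_ext oU) (IH _ (f3 w)) => z Uz.
  by rewrite (derive_mx (f2 w z Uz)) mxE.
Qed.


Lemma Ck_vec k U F : open U -> (forall j, is_Ck k U (fun z => F z 0 j)) -> is_Ck k U F.
Proof.
move=> oU H; have FE z : F z 0 0 *: row 0 1%:M + F z 0 1 *: row 1 1%:M + F z 0 2 *: row 2 1%:M = F z.
  by rewrite -vec_mul mulmx1 vec_eta.
apply: (Ck_ext oU (f := fun z => F z 0 0 *: row 0 1%:M + F z 0 1 *: row 1 1%:M + F z 0 2 *: row 2 1%:M)) => [z _|]; first exact: FE.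
by apply: CkD => //; [apply: CkD => //|]; apply: Ck_scale.
Qed.

Lemma Ck_vec_mul k U f g h (E : 'M[R]_3) : open U -> is_Ck k U f -> is_Ck k U g -> is_Ck k U h ->
  is_Ck k U (fun z => vec (f z) (g z) (h z) *m E).
Proof.
move=> oU sf sg sh.
apply: (Ck_ext oU (f := fun z => f z *: row 0 E + g z *: row 1 E + h z *: row 2 E)) => [z _|]; first by rewrite vec_mul.
by apply: CkD => //; [apply: CkD => //|]; apply: Ck_scale.
Qed.

Lemma derive_vec_mul f g h (E : 'M[R]_3) (z v : V) df dg dh : is_derive z v f df -> is_derive z v g dg -> is_derive z v h dh ->
  'D_v (fun z => vec (f z) (g z) (h z) *m E) z = vec df dg dh *m E.
Proof.
move=> Df Dg Dh; set F := (fun z => _).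
have FE (i : 'I_1) (j : 'I_3) : is_derive z v (fun z => F z i j) (df * E 0 j + dg * E 1 j + dh * E 2 j).
  rewrite (_ : (fun z => F z i j) = (fun z => f z * E 0 j + g z * E 1 j + h z * E 2 j)); last first.
    by apply/funext => y; rewrite /F ord1 vec_mul !mxE.
  apply: (is_derive_eq (dD (dD (dM Df (dC z v (E 0 j))) (dM Dg (dC z v (E 1 j)))) (dM Dh (dC z v (E 2 j))))).
  by rewrite !mulr0 !addr0.
have dF : derivable F z v by apply/derivable_mxP => i j; case: (FE i j).
rewrite (derive_mx dF) vec_mul; apply/matrixP => i j; rewrite ord1 !mxE.
exact: (derive_val (is_derive := FE 0 j)).
Qed.

End VectorCk.

Lemma det3_lin u v w a b c d : det3 u (a *: v + b *: w) (c *: v + d *: w) = (a * d - b * c) * det3 u v w.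
Proof.
rewrite -[u]vec_eta -[v]vec_eta -[w]vec_eta.
move: (u 0 0) (u 0 1) (u 0 2) (v 0 0) (v 0 1) (v 0 2) (w 0 0) (w 0 1) (w 0 2) => u1 u2 u3 v1 v2 v3 w1 w2 w3.
have E x y : x *: vec v1 v2 v3 + y *: vec w1 w2 w3 = vec (x * v1 + y * w1) (x * v2 + y * w2) (x * v3 + y * w3).
  by apply/rowP => -[[|[|[|//]]] h]; rewrite !mxE.
by rewrite !E !det3E /dt; ring.
Qed.

Section Plane.
Implicit Types (F : R * R -> 'rV[R]_3) (K : R * R -> R * R) (U W : set (R * R)).

Lemma Ck_vec_comp k U W F K : open U -> open W -> (forall z, U z -> W (K z)) ->
  (forall k, is_Ck k W F) -> smooth U (fun z => (K z).1) -> smooth U (fun z => (K z).2) -> is_Ck k U (fun z => F (K z)).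
Proof.
move=> oU oW UW sF s1 s2; apply: Ck_vec => // j.
have sj : smooth W (fun z => F z 0 j) by move=> l; exact: Ck_coord.
exact: (smooth_pair_comp oU oW UW sj s1 s2).
Qed.

(** The derivatives of the composite are combinations of those of [F], with the entries of the
    Jacobian matrix of [K] as coefficients. *)
Lemma det3_comp U W F K z : open U -> open W -> U z -> W (K z) -> (forall z, U z -> W (K z)) ->
  (forall k, is_Ck k W F) -> smooth U (fun z => (K z).1) -> smooth U (fun z => (K z).2) ->
  det3 (F (K z)) ('D_(1, 0) (fun z => F (K z)) z) ('D_(0, 1) (fun z => F (K z)) z) =
  jac K z * det3 (F (K z)) ('D_(1, 0) F (K z)) ('D_(0, 1) F (K z)).
Proof.
move=> oU oW Uz WK UW sF s1 s2.
have c1 : {for z, continuous (fun z => (K z).1)} by exact: smooth_cont s1 Uz.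
have c2 : {for z, continuous (fun z => (K z).2)} by exact: smooth_cont s2 Uz.
have D (v : R * R) : 'D_v (fun z => F (K z)) z =
    'D_v (fun z => (K z).1) z *: 'D_(1, 0) F (K z) + 'D_v (fun z => (K z).2) z *: 'D_(0, 1) F (K z).
  have [_ dF _] := Ck_vec_comp 1 oU oW UW sF s1 s2.
  have [_ dF' _] := sF 1%N.
  have d1 := derivableP (smooth_derivable (v := v) s1 Uz).
  have d2 := derivableP (smooth_derivable (v := v) s2 Uz).
  rewrite (derive_mx (dF v z Uz)) (derive_mx (dF' (1, 0) _ WK)) (derive_mx (dF' (0, 1) _ WK)).
  apply/rowP => j; rewrite [LHS]mxE [RHS]mxE; rewrite [X in _ = X + _]mxE [X in _ = _ + X]mxE [X in _ = _ * X + _]mxE [X in _ = _ + _ * X]mxE.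
  have sj : smooth W (fun z => F z 0 j) by move=> l; exact: Ck_coord.
  have DD := derive_pair_comp oW WK sj c1 c2 d1 d2.
  by rewrite (derive_val (is_derive := DD)) [X in X + _]mulrC [X in _ + X]mulrC.
rewrite !D det3_lin /jac; congr (_ * _).
by rewrite [X in _ - X]mulrC.
Qed.

End Plane.
End Vectors.

(** * Rotations taking a base vector to a given point *)

Section Frames.
Context {R : realType}.

(** For [a] other than -1 the rows are those of the rotation in the plane of [vec 1 0 0] and [q],
    with [d = (1 + a)^-1]; for the antipode a half-turn about the third axis is taken. *)
Lemma frame (q : 'rV[R]_3) : sphere R q -> exists E : 'M[R]_3, [/\ E *m E^T = 1%:M, \det E = 1 & vec 1 0 0 *m E = q].
Proof.
rewrite -[q]vec_eta sphere_vec; move: (q 0 0) (q 0 1) (q 0 2) => a b c S.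
have orth (u v w : R * R * R) : let vc (x : R * R * R) := vec x.1.1 x.1.2 x.2 in
    let dp (x y : R * R * R) := x.1.1 * y.1.1 + x.1.2 * y.1.2 + x.2 * y.2 in
    [/\ dp u u = 1, dp v v = 1 & dp w w = 1] -> [/\ dp u v = 0, dp u w = 0 & dp v w = 0] ->
    rows3 (vc u) (vc v) (vc w) *m (rows3 (vc u) (vc v) (vc w))^T = 1%:M.
  move=> vc dp [uu vv ww] [uv uw vw]; have RE := rows3E (vc u) (vc v) (vc w).
  move: (rows3 _ _ _) RE => M RE.
  apply/matrixP => i j; rewrite [LHS]mxE sum3 ![M^T _ _]mxE !RE [RHS]mxE.
  have dpC x y : dp x y = dp y x by rewrite /dp; ring.
  case: i => -[|[|[|//]]] hi; case: j => -[|[|[|//]]] hj; rewrite /= ?(vecE _ _ _) /vc !mxE /=.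
  - exact: uu. - exact: uv. - exact: uw.
  - by rewrite -/(dp v u) dpC. - exact: vv. - exact: vw.
  - by rewrite -/(dp w u) dpC. - by rewrite -/(dp w v) dpC. - exact: ww.
case: (a =P -1) => [aE|/eqP an].
  have bc : b = 0 /\ c = 0.
    have : b ^+ 2 + c ^+ 2 = 0 by rewrite aE in S; lra.
    move/eqP; rewrite paddr_eq0 ?sqr_ge0 // !sqrf_eq0 => /andP[/eqP -> /eqP ->]; by split.
  case: bc => -> ->; exists (rows3 (vec (-1) 0 0) (vec 0 (-1) 0) (vec 0 0 1)); split.
  - by apply: (orth (-1, 0, 0) (0, -1, 0) (0, 0, 1)); split; rewrite /=; ring.
  - by rewrite -[LHS]/(det3 _ _ _) det3E /dt; ring.
  - by rewrite rows3_mul aE.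
have a1 : 1 + a != 0 by apply: contra an => /eqP h; apply/eqP; lra.
have [d dE] : exists d : R, d = (1 + a)^-1 by eexists.
have d1 : d * (1 + a) = 1 by rewrite dE mulVf.
have bcd : (b ^+ 2 + c ^+ 2) * d = 1 - a.
  have -> : b ^+ 2 + c ^+ 2 = (1 - a) * (1 + a) by have := S; lra.
  by rewrite -mulrA [_ * d]mulrC d1 mulr1.
exists (rows3 (vec a b c) (vec (- b) (1 - b ^+ 2 * d) (- (b * c * d))) (vec (- c) (- (b * c * d)) (1 - c ^+ 2 * d))); split.
- apply: (orth (a, b, c) (- b, 1 - b ^+ 2 * d, - (b * c * d)) (- c, - (b * c * d), 1 - c ^+ 2 * d)); split; rewrite /=.
  + by rewrite -S; ring.
  + have -> : - b * - b + (1 - b ^+ 2 * d) * (1 - b ^+ 2 * d) + - (b * c * d) * - (b * c * d) =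
      1 + b ^+ 2 - b ^+ 2 * d * (2 - (b ^+ 2 + c ^+ 2) * d) by ring.
    rewrite bcd (_ : b ^+ 2 * d * (2 - (1 - a)) = b ^+ 2 * (d * (1 + a))); last by ring.
    by rewrite d1; ring.
  + have -> : - c * - c + - (b * c * d) * - (b * c * d) + (1 - c ^+ 2 * d) * (1 - c ^+ 2 * d) =
      1 + c ^+ 2 - c ^+ 2 * d * (2 - (b ^+ 2 + c ^+ 2) * d) by ring.
    rewrite bcd (_ : c ^+ 2 * d * (2 - (1 - a)) = c ^+ 2 * (d * (1 + a))); last by ring.
    by rewrite d1; ring.
  + have -> : a * - b + b * (1 - b ^+ 2 * d) + c * - (b * c * d) = b * (1 - a - (b ^+ 2 + c ^+ 2) * d) by ring.
    by rewrite bcd subrr mulr0.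
  + have -> : a * - c + b * - (b * c * d) + c * (1 - c ^+ 2 * d) = c * (1 - a - (b ^+ 2 + c ^+ 2) * d) by ring.
    by rewrite bcd subrr mulr0.
  + have -> : - b * - c + (1 - b ^+ 2 * d) * - (b * c * d) + - (b * c * d) * (1 - c ^+ 2 * d) =
      b * c * (1 - d * (2 - (b ^+ 2 + c ^+ 2) * d)) by ring.
    rewrite bcd (_ : d * (2 - (1 - a)) = d * (1 + a)); last by ring.
    by rewrite d1 subrr mulr0.
- rewrite -[LHS]/(det3 _ _ _) det3E /dt.
  have -> : a * ((1 - b ^+ 2 * d) * (1 - c ^+ 2 * d) - - (b * c * d) * - (b * c * d)) - b * (- b * (1 - c ^+ 2 * d) - - (b * c * d) * - c) + c * (- b * - (b * c * d) - (1 - b ^+ 2 * d) * - c)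
    = a * (1 - (b ^+ 2 + c ^+ 2) * d) + (b ^+ 2 + c ^+ 2) by ring.
  by rewrite bcd -S; ring.
- exact: rows3_mul.
Qed.

End Frames.

(** * Lorentz boosts of the sphere *)

Section Boost.
Context {R : realType}.
Implicit Types (x y k : R) (t s q : R) (E : 'M[R]_3) (U : set (R * R)) (P : 'rV[R]_3) (z v : R * R).

(* A Lorentz boost of the sphere towards vec 1 0 0, followed by the rotation E. *)
Definition boost t s E q1 q2 q3 : 'rV[R]_3 :=
  vec ((t + q1) / (1 + t * q1)) (s * q2 / (1 + t * q1)) (s * q3 / (1 + t * q1)) *m E.

Definition frame_coord E P (i : 'I_3) : R := (P *m E^T) 0 i.

(** Inverse boost: the same formulas with [- t], after taking coordinates in the frame [E]. *)
Definition back1 t s E P : R := (frame_coord E P 0 - t) / (1 - t * frame_coord E P 0).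
Definition back2 t s E P : R := s * frame_coord E P 1 / (1 - t * frame_coord E P 0).
Definition back3 t s E P : R := s * frame_coord E P 2 / (1 - t * frame_coord E P 0).

Record placement t s E : Prop := Placement {
  pl_t : 0 < t < 1;
  pl_s : 0 < s;
  pl_ts : t ^+ 2 + s ^+ 2 = 1;
  pl_E : E *m E^T = 1%:M;
  pl_det : \det E = 1
}.

Lemma sphere_bound q1 q2 q3 : q1 ^+ 2 + q2 ^+ 2 + q3 ^+ 2 = 1 -> -1 <= q1 <= 1.
Proof. by move=> S; have h2 := sqr_ge0 q2; have h3 := sqr_ge0 q3; apply/andP; split; nra. Qed.

Lemma boost_den t q1 : 0 < t < 1 -> -1 <= q1 <= 1 -> 0 < 1 + t * q1 /\ 0 < 1 - t * q1.
Proof. by move=> ti qi; split; nra. Qed.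

Lemma sphere_mul (E : 'M[R]_3) P : E *m E^T = 1%:M -> (sphere R (P *m E) <-> sphere R P).
Proof.
have norm (Q : 'rV[R]_3) : \sum_(i < 3) Q 0 i ^+ 2 = (Q *m Q^T) 0 0.
  by rewrite mxE; apply: eq_bigr => i _; rewrite mxE expr2.
by move=> EE; rewrite /sphere /= !norm trmx_mul mulmxA -[P *m E *m _]mulmxA EE mulmx1.
Qed.

Lemma frame_coord_mul E a b c : E *m E^T = 1%:M ->
  [/\ frame_coord E (vec a b c *m E) 0 = a, frame_coord E (vec a b c *m E) 1 = b & frame_coord E (vec a b c *m E) 2 = c].
Proof. by move=> EE; rewrite /frame_coord -mulmxA EE mulmx1; exact: vecE. Qed.

Lemma frame_coord_eta E P : E *m E^T = 1%:M -> vec (frame_coord E P 0) (frame_coord E P 1) (frame_coord E P 2) *m E = P.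
Proof. by move=> EE; rewrite vec_eta -mulmxA (mulmx1C EE) mulmx1. Qed.

Lemma frame_coord_sphere E P : E *m E^T = 1%:M -> sphere R P ->
  frame_coord E P 0 ^+ 2 + frame_coord E P 1 ^+ 2 + frame_coord E P 2 ^+ 2 = 1.
Proof. by move=> EE SP; apply/sphere_vec; apply/(sphere_mul _ EE); rewrite frame_coord_eta. Qed.

Lemma boost_sphere t s E q1 q2 q3 : placement t s E -> q1 ^+ 2 + q2 ^+ 2 + q3 ^+ 2 = 1 -> sphere R (boost t s E q1 q2 q3).
Proof.
move=> [ti s0 ts EE _] S; have [d0 _] := boost_den ti (sphere_bound S).
apply/(sphere_mul _ EE)/sphere_vec; have n0 : 1 + t * q1 != 0 by rewrite gt_eqF.
have -> : ((t + q1) / (1 + t * q1)) ^+ 2 + (s * q2 / (1 + t * q1)) ^+ 2 + (s * q3 / (1 + t * q1)) ^+ 2 =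
  ((t + q1) ^+ 2 + s ^+ 2 * (q2 ^+ 2 + q3 ^+ 2)) / (1 + t * q1) ^+ 2 by field.
have -> : q2 ^+ 2 + q3 ^+ 2 = 1 - q1 ^+ 2 by rewrite -S; ring.
have -> : s ^+ 2 = 1 - t ^+ 2 by rewrite -ts; ring.
by apply: (canLR (mulfK _)); [rewrite expf_eq0|ring].
Qed.

Lemma back_boost t s E q1 q2 q3 : placement t s E -> q1 ^+ 2 + q2 ^+ 2 + q3 ^+ 2 = 1 ->
  [/\ back1 t s E (boost t s E q1 q2 q3) = q1, back2 t s E (boost t s E q1 q2 q3) = q2 & back3 t s E (boost t s E q1 q2 q3) = q3].
Proof.
move=> [ti s0 ts EE _] S; have [d0 _] := boost_den ti (sphere_bound S).
rewrite /back1 /back2 /back3 /boost; have [-> -> ->] := frame_coord_mul ((t + q1) / (1 + t * q1)) (s * q2 / (1 + t * q1)) (s * q3 / (1 + t * q1)) EE.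
have n0 : 1 + t * q1 != 0 by rewrite gt_eqF.
have sn : s ^+ 2 != 0 by rewrite expf_eq0 gt_eqF.
have E1 : 1 - t * ((t + q1) / (1 + t * q1)) = s ^+ 2 / (1 + t * q1).
  by rewrite (_ : s ^+ 2 = 1 - t ^+ 2); [field|rewrite -ts; ring].
have s1 : s != 0 by rewrite gt_eqF.
rewrite E1; split.
- have -> : (t + q1) / (1 + t * q1) - t = s ^+ 2 * q1 / (1 + t * q1).
    by rewrite (_ : s ^+ 2 = 1 - t ^+ 2); [field|rewrite -ts; ring].
  by field; rewrite n0 s1.
- by field; rewrite n0 s1.
- by field; rewrite n0 s1.
Qed.

Lemma back_sphere t s E P : placement t s E -> sphere R P ->
  back1 t s E P ^+ 2 + back2 t s E P ^+ 2 + back3 t s E P ^+ 2 = 1.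
Proof.
move=> [ti s0 ts EE _] SP; have := frame_coord_sphere EE SP; rewrite /back1 /back2 /back3.
move: (frame_coord E P 0) (frame_coord E P 1) (frame_coord E P 2) => u1 u2 u3 S.
have [_ d0] := boost_den ti (sphere_bound S); have n0 : 1 - t * u1 != 0 by rewrite gt_eqF.
have -> : ((u1 - t) / (1 - t * u1)) ^+ 2 + (s * u2 / (1 - t * u1)) ^+ 2 + (s * u3 / (1 - t * u1)) ^+ 2 =
  ((u1 - t) ^+ 2 + s ^+ 2 * (u2 ^+ 2 + u3 ^+ 2)) / (1 - t * u1) ^+ 2 by field.
have -> : u2 ^+ 2 + u3 ^+ 2 = 1 - u1 ^+ 2 by rewrite -S; ring.
have -> : s ^+ 2 = 1 - t ^+ 2 by rewrite -ts; ring.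
by apply: (canLR (mulfK _)); [rewrite expf_eq0|ring].
Qed.

Lemma boost_back t s E P : placement t s E -> sphere R P -> boost t s E (back1 t s E P) (back2 t s E P) (back3 t s E P) = P.
Proof.
move=> [ti s0 ts EE _] SP; have S := frame_coord_sphere EE SP; rewrite -[RHS](frame_coord_eta P EE) /boost /back1 /back2 /back3.
move: (frame_coord E P 0) (frame_coord E P 1) (frame_coord E P 2) S => u1 u2 u3 S.
have [_ d0] := boost_den ti (sphere_bound S); have n0 : 1 - t * u1 != 0 by rewrite gt_eqF.
have s1 : s != 0 by rewrite gt_eqF.
have E1 : 1 + t * ((u1 - t) / (1 - t * u1)) = s ^+ 2 / (1 - t * u1).
  by rewrite (_ : s ^+ 2 = 1 - t ^+ 2); [field|rewrite -ts; ring].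
rewrite E1; congr (vec _ _ _ *m E).
- have -> : t + (u1 - t) / (1 - t * u1) = s ^+ 2 * u1 / (1 - t * u1).
    by rewrite (_ : s ^+ 2 = 1 - t ^+ 2); [field|rewrite -ts; ring].
  by field; rewrite n0 s1.
- by field; rewrite n0 s1.
- by field; rewrite n0 s1.
Qed.

Lemma boost_smooth t s E (V : normedModType R) (U : set V) (f1 f2 f3 : V -> R) : open U -> placement t s E ->
  smooth U f1 -> smooth U f2 -> smooth U f3 -> (forall w : V, U w -> f1 w ^+ 2 + f2 w ^+ 2 + f3 w ^+ 2 = 1) ->
  forall l : nat, is_Ck l U (fun w => boost t s E (f1 w) (f2 w) (f3 w)).
Proof.
move=> oU [ti s0 ts EE _] s1 s2 s3 S k.
have c w : smooth U (fun=> w : R) by exact: smooth_cst.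
have sd : smooth U (fun z : V => (1 + t * f1 z)^-1).
  apply: smoothV => //; last by apply: smoothD => //; exact: smoothM.
  by move=> z /S/sphere_bound/(boost_den ti)[d0 _]; rewrite gt_eqF.
apply: Ck_vec_mul => //.
- by have : smooth U (fun z : V => (t + f1 z) / (1 + t * f1 z)) by apply: smoothM => //; exact: smoothD.
- by have : smooth U (fun z : V => s * f2 z / (1 + t * f1 z)) by apply: smoothM => //; exact: smoothM.
- by have : smooth U (fun z : V => s * f3 z / (1 + t * f1 z)) by apply: smoothM => //; exact: smoothM.
Qed.

(* The boost is conformal. *)
Lemma boost_dt t s q1 q2 q3 a1 a2 a3 b1 b2 b3 : t ^+ 2 + s ^+ 2 = 1 -> 1 + t * q1 != 0 ->
  q1 ^+ 2 + q2 ^+ 2 + q3 ^+ 2 = 1 -> q1 * a1 + q2 * a2 + q3 * a3 = 0 -> q1 * b1 + q2 * b2 + q3 * b3 = 0 ->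
  let N := 1 + t * q1 in
  dt ((t + q1) / N) (s * q2 / N) (s * q3 / N)
     (s ^+ 2 * a1 / N ^+ 2) (s * (a2 * N - q2 * (t * a1)) / N ^+ 2) (s * (a3 * N - q3 * (t * a1)) / N ^+ 2)
     (s ^+ 2 * b1 / N ^+ 2) (s * (b2 * N - q2 * (t * b1)) / N ^+ 2) (s * (b3 * N - q3 * (t * b1)) / N ^+ 2)
  = (s / N) ^+ 2 * dt q1 q2 q3 a1 a2 a3 b1 b2 b3.
Proof.
move=> ts n0 S Sa Sb N.
(* Both vectors are tangent at q, so their cross product is a multiple of q, the factor being the
   determinant. *)
have E1 : a2 * b3 - a3 * b2 = q1 * dt q1 q2 q3 a1 a2 a3 b1 b2 b3.
  have -> : a2 * b3 - a3 * b2 = (a2 * b3 - a3 * b2) * (q1 ^+ 2 + q2 ^+ 2 + q3 ^+ 2) by rewrite S mulr1.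
  have -> : (a2 * b3 - a3 * b2) * (q1 ^+ 2 + q2 ^+ 2 + q3 ^+ 2) = q1 * dt q1 q2 q3 a1 a2 a3 b1 b2 b3
     + (q2 * b3 - q3 * b2) * (q1 * a1 + q2 * a2 + q3 * a3) - (q2 * a3 - q3 * a2) * (q1 * b1 + q2 * b2 + q3 * b3) by rewrite /dt; ring.
  by rewrite Sa Sb !mulr0 addr0 subr0.
have -> : dt ((t + q1) / N) (s * q2 / N) (s * q3 / N)
     (s ^+ 2 * a1 / N ^+ 2) (s * (a2 * N - q2 * (t * a1)) / N ^+ 2) (s * (a3 * N - q3 * (t * a1)) / N ^+ 2)
     (s ^+ 2 * b1 / N ^+ 2) (s * (b2 * N - q2 * (t * b1)) / N ^+ 2) (s * (b3 * N - q3 * (t * b1)) / N ^+ 2) =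
   s ^+ 2 * ((N * (s ^+ 2 + t * (t + q1)) - N * N) * (dt q1 q2 q3 a1 a2 a3 b1 b2 b3 - q1 * (a2 * b3 - a3 * b2)) + N ^+ 2 * (dt q1 q2 q3 a1 a2 a3 b1 b2 b3 + t * (a2 * b3 - a3 * b2))) / N ^+ 5.
  rewrite /dt; field. exact: n0.
have -> : s ^+ 2 + t * (t + q1) = N by rewrite /N -ts; ring.
rewrite subrr mul0r add0r E1 /N; field; exact: n0.
Qed.

Lemma dV (V : normedModType R) (F : V -> R) (w u : V) (a : R) : {for w, continuous F} -> F w != 0 -> is_derive w u F a ->
  is_derive w u (fun w => (F w)^-1) (- a / F w ^+ 2).
Proof.
move=> cF F0 DF; have di : derivable (fun x : R => x^-1) (F w) 1 by apply: (smooth_derivable (@smooth_inv R)).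
have := d1comp cF di DF; have -> : 'D_1 (fun x : R => x^-1) (F w) = - (F w) ^- 2.
  have H := @is_deriveV R (fun x : R => x) (F w) 1 1 F0 (dI _).
  by rewrite (derive_val (is_derive := H)) /(_ *: _) /= mulr1.
by move=> H; apply: (is_derive_eq H); field.
Qed.

Lemma boost_det3 t s E U (f1 f2 f3 : R * R -> R) z : open U -> placement t s E -> U z ->
  smooth U f1 -> smooth U f2 -> smooth U f3 -> (forall z, U z -> f1 z ^+ 2 + f2 z ^+ 2 + f3 z ^+ 2 = 1) ->
  0 < dt (f1 z) (f2 z) (f3 z) ('D_(1, 0) f1 z) ('D_(1, 0) f2 z) ('D_(1, 0) f3 z) ('D_(0, 1) f1 z) ('D_(0, 1) f2 z) ('D_(0, 1) f3 z) ->
  0 < det3 (boost t s E (f1 z) (f2 z) (f3 z)) ('D_(1, 0) (fun z => boost t s E (f1 z) (f2 z) (f3 z)) z)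
    ('D_(0, 1) (fun z => boost t s E (f1 z) (f2 z) (f3 z)) z).
Proof.
move=> oU [ti s0 ts EE dE] Uz s1 s2 s3 S dpos.
have [d0 _] := boost_den ti (sphere_bound (S z Uz)); have n0 : 1 + t * f1 z != 0 by rewrite gt_eqF.
have D (f : R * R -> R) v : smooth U f -> is_derive z v f ('D_v f z).
  by move=> sf; apply: derivableP; exact: (smooth_derivable sf).
have tang v : f1 z * 'D_v f1 z + f2 z * 'D_v f2 z + f3 z * 'D_v f3 z = 0.
  have DD := dD (dD (dX2 (D f1 v s1)) (dX2 (D f2 v s2))) (dX2 (D f3 v s3)).
  have : 'D_v (fun z => f1 z ^+ 2 + f2 z ^+ 2 + f3 z ^+ 2) z = 0.
    have -> : 'D_v (fun z => f1 z ^+ 2 + f2 z ^+ 2 + f3 z ^+ 2) z = 'D_v (fun=> 1 : R) z; last exact: derive_cst.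
    apply: near_eq_derive.
    by near=> w; apply: S; near: w; exact: open_nbhs_nbhs.
  rewrite (derive_val (is_derive := DD)); move: ('D_v f1 z) ('D_v f2 z) ('D_v f3 z) => a b c; lra.
have DV v : 'D_v (fun z => boost t s E (f1 z) (f2 z) (f3 z)) z =
   vec (s ^+ 2 * 'D_v f1 z / (1 + t * f1 z) ^+ 2) (s * ('D_v f2 z * (1 + t * f1 z) - f2 z * (t * 'D_v f1 z)) / (1 + t * f1 z) ^+ 2)
       (s * ('D_v f3 z * (1 + t * f1 z) - f3 z * (t * 'D_v f1 z)) / (1 + t * f1 z) ^+ 2) *m E.
  have c1 : {for z, continuous (fun z => 1 + t * f1 z)}.
    by apply: (@smooth_cont _ _ _ U) => //; apply: smoothD => //; [exact: smooth_cst|apply: smoothM => //; exact: smooth_cst].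
  have Dn := dD (dC z v 1) (dZ t (D f1 v s1)).
  have iv : is_derive z v (fun z => (1 + t * f1 z)^-1) (- (t * 'D_v f1 z) / (1 + t * f1 z) ^+ 2).
    by apply: (is_derive_eq (dV c1 n0 Dn)); rewrite add0r.
  rewrite /boost; apply: derive_vec_mul.
  - apply: (is_derive_eq (dM (dD (dC z v t) (D f1 v s1)) iv)).
    by rewrite (_ : s ^+ 2 = 1 - t ^+ 2); [field|rewrite -ts; ring].
  - by apply: (is_derive_eq (dM (dZ s (D f2 v s2)) iv)); field.
  - by apply: (is_derive_eq (dM (dZ s (D f3 v s3)) iv)); field.
rewrite !DV /boost det3_mul dE mulr1 det3E (boost_dt ts n0 (S z Uz) (tang _) (tang _)).
by rewrite mulr_gt0 // exprn_even_gt0 //= mulf_neq0 ?invr_eq0 // gt_eqF.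
Unshelve. all: by end_near.
Qed.
End Boost.

(** * Longitude and latitude, and the polar caps *)

Section Globe.
Context {R : realType}.
Implicit Types (x y c : R) (t s q a b : R) (E : 'M[R]_3) (P : 'rV[R]_3) (z v : R * R).

(** Half the difference of the angles has sine 0 and lies in [0, pi[. *)
Lemma circle_inj a b : 0 <= a < 2 * pi -> 0 <= b < 2 * pi -> cos a = cos b -> sin a = sin b -> a = b.
Proof.
wlog ab : a b / a <= b => [th ai bi ec es|].
  by case: (leP a b) => [|/ltW] h; [exact: th|apply/esym/th].
move=> ai bi ec es; have [d dE] : exists d, d = (b - a) / 2 by eexists.
have E1 : cos (d *+ 2) = 1.
  have -> : d *+ 2 = b + - a by rewrite dE mulr2n; field.
  by rewrite cosD cosN sinN ec es -(cos2Dsin2 b); ring.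
have s0 : sin d = 0.
  apply/eqP; rewrite -(sqrf_eq0 (sin d)); move: E1 (cos2Dsin2 d); rewrite cos_mulr2n.
  by move: (cos d ^+ 2) (sin d ^+ 2) => u1 u2 h1 h2; apply/eqP; lra.
have [d0|d0] := leP d 0; first by apply/eqP; rewrite eq_le ab /=; lra.
by have := @sin_gt0_pi R d ltac:(clear -ai bi dE d0; lra); rewrite s0 ltxx.
Qed.

Lemma turn_angle c a b : c != 0 -> 2 * c * (a + b / (2 * c)) = b + 2 * c * a.
Proof. by move=> c0; field. Qed.

Lemma circle_ex c s : c ^+ 2 + s ^+ 2 = 1 -> exists x, [/\ 0 <= x < 1, cos (2 * pi * x) = c & sin (2 * pi * x) = s].
Proof.
move=> S; have ci : -1 <= c <= 1 by have s2 := sqr_ge0 s; apply/andP; split; nra.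
have p0 := @pi_gt0 R; have pn : pi != 0 :> R by rewrite gt_eqF.
have [/andP[th0 thp] cth] := acos_def ci; have sth := sin_acos ci.
have ss : 1 - c ^+ 2 = s ^+ 2 by rewrite -S; ring.
rewrite ss sqrtr_sqr in sth; have [s0|s0] := leP 0 s.
  exists (acos c / (2 * pi)).
  have -> : 2 * pi * (acos c / (2 * pi)) = acos c by rewrite -[acos c / _]add0r turn_angle // mulr0 addr0.
  rewrite cth sth ger0_norm //; split=> //.
  by rewrite ler_pdivlMr ?mul0r ?ltr_pdivrMr ?mul1r; [clear -p0 th0 thp; lra|lra..].
have c1 : c < 1 by rewrite lt_neqAle (andP ci).2 andbT; apply/eqP => E1; move: S; rewrite E1 => S; nra.
have th1 : 0 < acos c by apply: acos_gt0; rewrite c1 (andP ci).1.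
(* The arccosine only reaches nonnegative sines; a negative one calls for the opposite angle, plus a
   full turn. *)
exists (1 - acos c / (2 * pi)).
have -> : 2 * pi * (1 - acos c / (2 * pi)) = - acos c + pi *+ 2 by rewrite -mulNr turn_angle // mulr2n; ring.
rewrite cosD2pi sinD2pi cosN sinN cth sth ltr0_norm // opprK; split=> //.
have h1 : 0 < acos c / (2 * pi) by rewrite divr_gt0 // mulr_gt0.
have h2 : acos c / (2 * pi) <= 1 by rewrite ler_pdivrMr ?mul1r; [clear -p0 thp; lra|lra].
by move: h1 h2; move: (acos c / (2 * pi)) => u; clear; lra.
Qed.

(** [lat] and [hgt] are the cosine and sine of the latitude, [y] being the tangent of half of it.
    This makes levels 1/2 and -1/2 correspond to the rational heights 4/5 and -4/5. *)
Definition lat y := (1 - y ^+ 2) / (1 + y ^+ 2).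
Definition hgt y := 2 * y / (1 + y ^+ 2).

Lemma lat_den y : 1 + y ^+ 2 != 0.
Proof. by rewrite gt_eqF // ltr_pwDl // sqr_ge0. Qed.

Lemma lat_hgt y : lat y ^+ 2 + hgt y ^+ 2 = 1.
Proof. by have := lat_den y; rewrite /lat /hgt => n0; field. Qed.

Lemma lat_gt0 y : -1 < y < 1 -> 0 < lat y.
Proof. by move=> yi; rewrite divr_gt0 //; [nra|have := sqr_ge0 y; lra]. Qed.

Lemma hgt_mono y y' : -1 < y < 1 -> -1 < y' < 1 -> y < y' -> hgt y < hgt y'.
Proof.
move=> yi yi' yy; rewrite -subr_gt0.
have -> : hgt y' - hgt y = 2 * (y' - y) * (1 - y * y') / ((1 + y ^+ 2) * (1 + y' ^+ 2)).
  by rewrite /hgt; field; rewrite !lat_den.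
rewrite divr_gt0 ?mulr_gt0 ?subr_gt0 //; first nra.
  by have := sqr_ge0 y; lra.
by have := sqr_ge0 y'; lra.
Qed.

Lemma hgt_lt y y' : -1 < y < 1 -> -1 < y' < 1 -> (hgt y < hgt y') = (y < y').
Proof.
move=> yi yi'; case: (ltgtP y y') => [||->]; last exact: ltxx.
  exact: hgt_mono.
by move=> h; apply/negbTE; rewrite -leNgt ltW //; exact: hgt_mono.
Qed.

Lemma hgt_inj y y' : -1 < y < 1 -> -1 < y' < 1 -> hgt y = hgt y' -> y = y'.
Proof.
move=> yi yi' E; apply/eqP; rewrite eq_le !leNgt -(hgt_lt yi yi') -(hgt_lt yi' yi) E.
by rewrite !ltxx.
Qed.

Lemma hgt_half : hgt (1 / 2) = 4 / 5 /\ hgt (- (1 / 2)) = - (4 / 5).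
Proof. by rewrite /hgt; split; field. Qed.

(** Half-angle formula for the tangent. *)
Lemma lat_solve q c : 0 < c -> c ^+ 2 + q ^+ 2 = 1 -> [/\ -1 < q / (1 + c) < 1, lat (q / (1 + c)) = c & hgt (q / (1 + c)) = q].
Proof.
move=> c0 S; have n0 : 1 + c != 0 by rewrite gt_eqF // addr_gt0.
have cp : 0 < 1 + c by rewrite addr_gt0.
have E1 : 1 + (q / (1 + c)) ^+ 2 = 2 / (1 + c).
  have -> : 1 + (q / (1 + c)) ^+ 2 = (1 + 2 * c + (c ^+ 2 + q ^+ 2)) / (1 + c) ^+ 2 by field.
  by rewrite S; field.
have E2 : 1 - (q / (1 + c)) ^+ 2 = 2 * c / (1 + c).
  have -> : 1 - (q / (1 + c)) ^+ 2 = (1 + 2 * c + 2 * c ^+ 2 - (c ^+ 2 + q ^+ 2)) / (1 + c) ^+ 2 by field.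
  by rewrite S; field.
rewrite /lat /hgt E1 E2; split; [|by field|by field].
by rewrite ltr_pdivlMr // ltr_pdivrMr //; nra.
Qed.

Lemma smooth_lat : smooth [set: R] lat.
Proof.
have oT := @openT R; have sX : smooth [set: R] (fun y => y ^+ 2) by apply: smoothX => //; exact: smooth_id.
apply: smoothM => //; first by apply: smoothB => //; exact: smooth_cst.
by apply: smoothV => //; [move=> y _; exact: lat_den|apply: smoothD => //; exact: smooth_cst].
Qed.

Lemma smooth_hgt : smooth [set: R] hgt.
Proof.
have oT := @openT R; have sX : smooth [set: R] (fun y => y ^+ 2) by apply: smoothX => //; exact: smooth_id.
apply: smoothM => //; first by apply: smoothM => //; [exact: smooth_cst|exact: smooth_id].
by apply: smoothV => //; [move=> y _; exact: lat_den|apply: smoothD => //; exact: smooth_cst].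
Qed.

Lemma lat_den_cont y : {for y, continuous (fun y => 1 + y ^+ 2)}.
Proof.
by apply: (@smooth_cont _ _ _ setT) => //; apply: smoothD => //; [exact: openT|exact: smooth_cst|apply: smoothX; [exact: openT|exact: smooth_id]].
Qed.

Lemma derive_lat y : 'D_1 lat y = - 4 * y / (1 + y ^+ 2) ^+ 2.
Proof.
have DX := dX2 (dI y); have H := dM (dB (dC y 1 1) DX) (dV (@lat_den_cont y) (lat_den y) (dD (dC y 1 1) DX)).
by rewrite (derive_val (is_derive := H)); field; exact: lat_den.
Qed.

Lemma derive_hgt y : 'D_1 hgt y = 2 * (1 - y ^+ 2) / (1 + y ^+ 2) ^+ 2.
Proof.
have DX := dX2 (dI y); have H := dM (dZ 2 (dI y)) (dV (@lat_den_cont y) (lat_den y) (dD (dC y 1 1) DX)).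
by rewrite (derive_val (is_derive := H)); field; exact: lat_den.
Qed.

(** [z.1] is the longitude in turns. The poles are at levels 1 and -1, outside the strip in use. *)
Definition globe t s E z : 'rV[R]_3 :=
  boost t s E (lat z.2 * cos (2 * pi * z.1)) (lat z.2 * sin (2 * pi * z.1)) (hgt z.2).

Lemma globe_unit z : (lat z.2 * cos (2 * pi * z.1)) ^+ 2 + (lat z.2 * sin (2 * pi * z.1)) ^+ 2 + hgt z.2 ^+ 2 = 1.
Proof.
have := lat_hgt z.2; have := cos2Dsin2 (2 * pi * z.1); move: (lat _) (hgt _) (cos _) (sin _) => l h c s S <-.
by rewrite !exprMn -mulrDr S mulr1.
Qed.

Lemma smooth_angle : smooth [set: R * R] (fun z => cos (2 * pi * z.1)) /\ smooth [set: R * R] (fun z => sin (2 * pi * z.1)).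
Proof.
have oT := @openT (R * R)%type; have sl : smooth [set: R * R] (fun z => 2 * pi * z.1).
  by apply: smoothM => //; [exact: smooth_cst|exact: smooth_fst].
split; [apply: (@smooth_comp1 _ _ setT _ cos) => //; apply: smooth_cos|apply: (@smooth_comp1 _ _ setT _ sin) => //; apply: smooth_sin]; exact: openT.
Qed.

Lemma smooth_lat2 : smooth [set: R * R] (fun z => lat z.2) /\ smooth [set: R * R] (fun z => hgt z.2).
Proof.
have oT := @openT (R * R)%type; have ss := @smooth_snd R setT.
by split; [apply: (smooth_comp1 oT _ smooth_lat ss)|apply: (smooth_comp1 oT _ smooth_hgt ss)].
Qed.

Lemma globe_smooth t s E : placement t s E -> forall l : nat, is_Ck l [set: R * R] (globe t s E).
Proof.
move=> pl; have oT := @openT (R * R)%type; have [sc ss] := smooth_angle; have [sl sh] := smooth_lat2.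
apply: boost_smooth => //; [exact: smoothM|exact: smoothM|by move=> z _; exact: globe_unit].
Qed.

Lemma globe_sphere t s E z : placement t s E -> sphere R (globe t s E z).
Proof. by move=> pl; apply: boost_sphere => //; exact: globe_unit. Qed.

Lemma globe_det3 t s E z : placement t s E -> -1 < z.2 < 1 ->
  0 < det3 (globe t s E z) ('D_(1, 0) (globe t s E) z) ('D_(0, 1) (globe t s E) z).
Proof.
move=> pl zi; have oT := @openT (R * R)%type; have [sc ss] := smooth_angle; have [sl sh] := smooth_lat2.
apply: (@boost_det3 R t s E setT (fun z => lat z.2 * cos (2 * pi * z.1)) (fun z => lat z.2 * sin (2 * pi * z.1)) (fun z => hgt z.2)) => //; [exact: smoothM|exact: smoothM|by move=> w _; exact: globe_unit|].
have cf (v : R * R) := is_derive_fst z v; have cs (v : R * R) := is_derive_snd z v.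
have k1 : {for z, continuous (fun z : R * R => 2 * pi * z.1)}.
  by apply: (@smooth_cont _ _ _ setT) => //; apply: smoothM => //; [exact: smooth_cst|exact: smooth_fst].
have k2 : {for z, continuous (fun z : R * R => z.2)} by apply: (@smooth_cont _ _ _ setT) => //; exact: smooth_snd.
have Dl v : is_derive z v (fun z => lat z.2) ('D_1 lat z.2 * v.2) by exact: (d1comp k2 (smooth_derivable smooth_lat Logic.I) (cs v)).
have Dh v : is_derive z v (fun z => hgt z.2) ('D_1 hgt z.2 * v.2) by exact: (d1comp k2 (smooth_derivable smooth_hgt Logic.I) (cs v)).
have Dc v : is_derive z v (fun z : R * R => cos (2 * pi * z.1)) (- sin (2 * pi * z.1) * (2 * pi * v.1)).
  have <- : 'D_1 cos (2 * pi * z.1) = - sin (2 * pi * z.1) by exact: (derive_val (is_derive := is_derive_cos _)).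
  have d1 : derivable cos (2 * pi * z.1) 1 by apply: ex_derive.
  exact: (d1comp k1 d1 (dZ (2 * pi) (cf v))).
have Ds v : is_derive z v (fun z : R * R => sin (2 * pi * z.1)) (cos (2 * pi * z.1) * (2 * pi * v.1)).
  have <- : 'D_1 sin (2 * pi * z.1) = cos (2 * pi * z.1) by exact: (derive_val (is_derive := is_derive_sin _)).
  have d1 : derivable sin (2 * pi * z.1) 1 by apply: ex_derive.
  exact: (d1comp k1 d1 (dZ (2 * pi) (cf v))).
have V1 v := derive_val (is_derive := dM (Dl v) (Dc v)); have V2 v := derive_val (is_derive := dM (Dl v) (Ds v)).
have V3 v := derive_val (is_derive := Dh v).
rewrite !V1 !V2 !V3 /= derive_lat derive_hgt.
have S := cos2Dsin2 (2 * pi * z.1); have n0 := lat_den z.2.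
have l0 := lat_gt0 zi; have p0 := @pi_gt0 R.
move: S; move: (cos _) (sin _) => c' s' S.
set D := dt _ _ _ _ _ _ _ _ _.
have -> : D = 2 * pi * lat z.2 * (2 / (1 + z.2 ^+ 2)) * (c' ^+ 2 + s' ^+ 2) by rewrite /D /dt /lat /hgt; field.
have d0 : 0 < 1 + z.2 ^+ 2 by have := sqr_ge0 z.2; clear; lra.
have h1 : 0 < 2 * pi * lat z.2 by rewrite mulr_gt0 // mulr_gt0.
by rewrite S mulr1 mulr_gt0 // divr_gt0.
Qed.

Lemma globe_period t s E x y : globe t s E (x + 1, y) = globe t s E (x, y).
Proof.
have E1 : 2 * pi * (x + 1) = 2 * pi * x + pi *+ 2 by rewrite mulr2n; ring.
by rewrite /globe /= E1 cosD2pi sinD2pi.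
Qed.

Lemma globe_back t s E z : placement t s E -> [/\ back1 t s E (globe t s E z) = lat z.2 * cos (2 * pi * z.1),
  back2 t s E (globe t s E z) = lat z.2 * sin (2 * pi * z.1) & back3 t s E (globe t s E z) = hgt z.2].
Proof. by move=> pl; apply: back_boost => //; exact: globe_unit. Qed.

Lemma globe_inj t s E z (w : R * R) : placement t s E -> 0 <= z.1 < 1 -> -1 < z.2 < 1 -> 0 <= w.1 < 1 -> -1 < w.2 < 1 ->
  globe t s E z = globe t s E w -> z = w.
Proof.
move=> pl z1 z2 w1 w2 E0; have [a1 a2 a3] := globe_back z pl; have [b1 b2 b3] := globe_back w pl.
rewrite E0 in a1 a2 a3; have e2 : z.2 = w.2 by apply: hgt_inj => //; rewrite -a3.
have l0 : lat w.2 != 0 by rewrite gt_eqF // lat_gt0.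
have p0 := @pi_gt0 R; have pn : pi != 0 :> R by rewrite gt_eqF.
rewrite e2 in a1 a2.
have e1 : 2 * pi * z.1 = 2 * pi * w.1.
  apply: circle_inj; [nra|nra|apply: (mulfI l0); by rewrite -a1|apply: (mulfI l0); by rewrite -a2].
rewrite -[z]pair_eta -[w]pair_eta e2; congr (_, _).
by apply: (mulfI _ e1); rewrite mulf_neq0 // pnatr_eq0.
Qed.

Lemma globe_ex t s E P : placement t s E -> sphere R P -> -1 < back3 t s E P < 1 ->
  exists x y, [/\ 0 <= x < 1, -1 < y < 1, globe t s E (x, y) = P & hgt y = back3 t s E P].
Proof.
move=> pl SP bi; have S := back_sphere pl SP; have BB := boost_back pl SP.
move: (back1 t s E P) (back2 t s E P) (back3 t s E P) bi S BB => q1 q2 q3 bi S <-.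
have [c [c0 cE]] : exists c, 0 < c /\ c ^+ 2 = q1 ^+ 2 + q2 ^+ 2.
  have p : 0 < q1 ^+ 2 + q2 ^+ 2 by clear -S bi; nra.
  by exists (Num.sqrt (q1 ^+ 2 + q2 ^+ 2)); rewrite sqrtr_gt0 sqr_sqrtr // ltW.
have n0 : c != 0 by rewrite gt_eqF.
have [|yi yl yh] := @lat_solve q3 c c0; first by rewrite cE -S; ring.
have [|x [xi xc xs]] := @circle_ex (q1 / c) (q2 / c).
  have -> : (q1 / c) ^+ 2 + (q2 / c) ^+ 2 = (q1 ^+ 2 + q2 ^+ 2) / c ^+ 2 by field.
  by rewrite -cE divff // expf_eq0.
exists x, (q3 / (1 + c)); split=> //.
by rewrite /globe /= yl yh xc xs !mulrA ![c * _]mulrC !mulfK.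
Qed.

(** Coordinates on the half where [back1] is negative: longitudes there are within a quarter turn of
    1/2, so a single branch of the arctangent suffices. *)
Definition crd1 t s E P : R := 1 / 2 + atan (back2 t s E P / back1 t s E P) / (2 * pi).
Definition crd2 t s E P : R := back3 t s E P / (1 + Num.sqrt (1 - back3 t s E P ^+ 2)).

Lemma crd_range t s E P : 1 / 4 < crd1 t s E P < 3 / 4.
Proof.
rewrite /crd1; set u := _ / back1 _ _ _ _; have h1 := atan_ltpi2 u; have h2 := atan_gtNpi2 u.
have p0 := @pi_gt0 R.
have b1 : atan u / (2 * pi) < 1 / 4 by rewrite ltr_pdivrMr; lra.
have b2 : - (1 / 4) < atan u / (2 * pi) by rewrite ltr_pdivlMr; lra.
by move: b1 b2; move: (_ / (2 * pi)) => k b1 b2; lra.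
Qed.

Lemma globe_crd t s E P : placement t s E -> sphere R P -> back1 t s E P < 0 ->
  globe t s E (crd1 t s E P, crd2 t s E P) = P /\ -1 < crd2 t s E P < 1.
Proof.
move=> pl SP; have S := back_sphere pl SP; have BB := boost_back pl SP; rewrite /crd1 /crd2.
move: (back1 t s E P) (back2 t s E P) (back3 t s E P) S BB => q1 q2 q3 S <- q10.
have [c cE] : exists c, c = Num.sqrt (1 - q3 ^+ 2) by eexists.
have g0 : 0 < 1 - q3 ^+ 2 by rewrite -S; nra.
have c0 : 0 < c by rewrite cE sqrtr_gt0.
have c2 : c ^+ 2 + q3 ^+ 2 = 1 by rewrite cE sqr_sqrtr ?subrK // ltW.
rewrite -cE; have [yi yl yh] := lat_solve c0 c2; split=> //.
have n0 : c != 0 by rewrite gt_eqF.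
have q1n : q1 != 0 by rewrite lt_eqF.
have p0 := @pi_gt0 R; have pn : pi != 0 :> R by rewrite gt_eqF.
(* The arctangent only sees the quotient; since [q1] is negative the angle differs from it by half a
   turn. *)
have ang : 2 * pi * (1 / 2 + atan (q2 / q1) / (2 * pi)) = atan (q2 / q1) + pi by rewrite turn_angle //; field.
have ca : cos (atan (q2 / q1)) = - (q1 / c).
  rewrite cos_atan (_ : 1 + (q2 / q1) ^+ 2 = (- (c / q1)) ^+ 2); last first.
    have -> : 1 + (q2 / q1) ^+ 2 = (q1 ^+ 2 + q2 ^+ 2) / q1 ^+ 2 by field.
    have -> : q1 ^+ 2 + q2 ^+ 2 = c ^+ 2 by apply: (addIr (q3 ^+ 2)); rewrite c2.
    by field.
  rewrite sqrtr_sqr normrN ltr0_norm ?pmulr_rlt0 ?invr_lt0 //.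
  by rewrite invrN invf_div.
have sa : sin (atan (q2 / q1)) = - (q2 / c).
  have := atanK (q2 / q1); rewrite /tan => h.
  have -> : sin (atan (q2 / q1)) = q2 / q1 * cos (atan (q2 / q1)).
    by rewrite -[X in X * cos _]h divfK // ca oppr_eq0 mulf_neq0 // invr_eq0.
  by rewrite ca; field; rewrite q1n n0.
rewrite /globe /= ang cosDpi sinDpi ca sa yl yh !opprK.
by rewrite !mulrA ![c * _]mulrC !mulfK.
Qed.

(** A first coordinate of at least 4/5 in absolute value leaves a height of at most 3/5, and (3/5) /
    (1 + 4/5) = 1/3. *)
Lemma crd2_bound t s E P : placement t s E -> sphere R P -> back1 t s E P <= - (4 / 5) -> - (1 / 3) <= crd2 t s E P <= 1 / 3.
Proof.
move=> pl SP; have := back_sphere pl SP; rewrite /crd2.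
move: (back1 t s E P) (back2 t s E P) (back3 t s E P) => q1 q2 q3 S q10.
have h3 : q3 ^+ 2 <= (3 / 5) ^+ 2 by have := sqr_ge0 q2; nra.
have h3' : - (3 / 5) <= q3 <= 3 / 5 by apply/andP; split; nra.
have h4 : 4 / 5 <= Num.sqrt (1 - q3 ^+ 2).
  rewrite -[leLHS]ger0_norm -?sqrtr_sqr ?ler_wsqrtr //; lra.
have d0 : 0 < 1 + Num.sqrt (1 - q3 ^+ 2) by lra.
by rewrite ler_pdivlMr // ler_pdivrMr //; move: h4; move: (Num.sqrt _) => u h4; lra.
Qed.

Lemma frame_coord_smooth (V : normedModType R) (U : set V) (F : V -> 'rV[R]_3) E i : open U -> (forall l : nat, is_Ck l U F) ->
  smooth U (fun w => frame_coord E (F w) i).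
Proof.
move=> oU sF; have sj j : smooth U (fun w => F w 0 j) by move=> k; exact: Ck_coord.
have sm : smooth U (fun w => \sum_(j <- index_enum 'I_3) F w 0 j * E^T j i).
  by apply: smooth_sum => // j; apply: smoothM => //; exact: smooth_cst.
by apply: (smooth_ext oU _ sm) => w _; rewrite /frame_coord mxE.
Qed.

Lemma crd_smooth (V : normedModType R) (U : set V) (F : V -> 'rV[R]_3) t s E : placement t s E -> open U ->
  (forall l : nat, is_Ck l U F) -> (forall w, U w -> sphere R (F w)) -> (forall w, U w -> back1 t s E (F w) < 0) ->
  smooth U (fun w => crd1 t s E (F w)) /\ smooth U (fun w => crd2 t s E (F w)).
Proof.
move=> pl oU sF sph neg; have c (k : R) : smooth U (fun=> k : R) by exact: smooth_cst.
have f i := @frame_coord_smooth V U F E i oU sF.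
have sd : smooth U (fun w => (1 - t * frame_coord E (F w) 0)^-1).
  apply: smoothV => //; last by apply: smoothB => //; exact: smoothM.
  move=> w Uw; have [_ d0] := boost_den (pl_t pl) (sphere_bound (frame_coord_sphere (pl_E pl) (sph w Uw))).
  by rewrite gt_eqF.
have b1 : smooth U (fun w => back1 t s E (F w)) by apply: smoothM => //; exact: smoothB.
have b2 : smooth U (fun w => back2 t s E (F w)) by apply: smoothM => //; exact: smoothM.
have b3 : smooth U (fun w => back3 t s E (F w)) by apply: smoothM => //; exact: smoothM.
split.
  have sq : smooth U (fun w => back2 t s E (F w) / back1 t s E (F w)).
    by apply: smoothM => //; apply: smoothV => // w /neg h; rewrite lt_eqF.
  have sa : smooth U (fun w => atan (back2 t s E (F w) / back1 t s E (F w))).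
    by apply: (smooth_comp1 oU _ (smooth_atan (@openT R)) sq).
  by apply: smoothD => //; exact: smoothM.
have pos w : U w -> 0 < 1 - back3 t s E (F w) ^+ 2.
  move=> Uw; have := back_sphere pl (sph w Uw); have := neg w Uw.
  by move: (back1 _ _ _ _) (back2 _ _ _ _) (back3 _ _ _ _) => q1 q2 q3 n S; nra.
have sr : smooth U (fun w => Num.sqrt (1 - back3 t s E (F w) ^+ 2)).
  by apply: (smooth_comp1 oU pos smooth_sqrt); apply: smoothB => //; exact: smoothX.
apply: smoothM => //; apply: smoothV => //; last exact: smoothD.
Qed.

(* Stereographic projections: sg is 1 for the top cap and -1 for the bottom one. *)
Definition capden z : R := 1 + (z.1 ^+ 2 + z.2 ^+ 2) / 9.
Definition polar t s E (sg : R) z : 'rV[R]_3 :=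
  boost t s E (2 / 3 * z.1 / capden z) (sg * (2 / 3) * z.2 / capden z) (sg * (2 - capden z) / capden z).

Lemma capden_gt0 z : 0 < capden z.
Proof. by rewrite /capden; have := sqr_ge0 z.1; have := sqr_ge0 z.2; move: (z.1 ^+ 2) (z.2 ^+ 2) => u v; lra. Qed.

Lemma polar_unit sg z : sg ^+ 2 = 1 ->
  (2 / 3 * z.1 / capden z) ^+ 2 + (sg * (2 / 3) * z.2 / capden z) ^+ 2 + (sg * (2 - capden z) / capden z) ^+ 2 = 1.
Proof.
move=> S; have n0 : capden z != 0 by rewrite gt_eqF // capden_gt0.
have -> : (2 / 3 * z.1 / capden z) ^+ 2 + (sg * (2 / 3) * z.2 / capden z) ^+ 2 + (sg * (2 - capden z) / capden z) ^+ 2 =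
  (4 / 9 * z.1 ^+ 2 + sg ^+ 2 * (4 / 9 * z.2 ^+ 2 + (2 - capden z) ^+ 2)) / capden z ^+ 2 by field.
rewrite S mul1r; apply: (canLR (mulfK _)); first by rewrite expf_eq0.
by rewrite /capden; field.
Qed.

Lemma smooth_capden : smooth [set: R * R] capden /\ smooth [set: R * R] (fun z => (capden z)^-1).
Proof.
have oT := @openT (R * R)%type; have s1 := @smooth_fst R setT; have s2 := @smooth_snd R setT.
have c (k : R) : smooth [set: R * R] (fun=> k : R) by exact: smooth_cst.
have sd : smooth [set: R * R] capden by apply: smoothD => //; apply: smoothM => //; apply: smoothD => //; exact: smoothX.
by split=> //; apply: smoothV => // z _; rewrite gt_eqF // capden_gt0.
Qed.

Lemma polar_parts sg : [/\ smooth [set: R * R] (fun z => 2 / 3 * z.1 / capden z), smooth [set: R * R] (fun z => sg * (2 / 3) * z.2 / capden z) &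
  smooth [set: R * R] (fun z => sg * (2 - capden z) / capden z)].
Proof.
have oT := @openT (R * R)%type; have s1 := @smooth_fst R setT; have s2 := @smooth_snd R setT.
have c (k : R) : smooth [set: R * R] (fun=> k : R) by exact: smooth_cst.
have [sd sV] := smooth_capden; split; apply: smoothM => //; apply: smoothM => //; exact: smoothB.
Qed.

Lemma polar_smooth t s E sg : sg ^+ 2 = 1 -> placement t s E -> forall l : nat, is_Ck l [set: R * R] (polar t s E sg).
Proof.
move=> S pl; have [p1 p2 p3] := polar_parts sg; apply: boost_smooth => //; first exact: openT.
by move=> z _; exact: polar_unit.
Qed.

Lemma polar_sphere t s E sg z : sg ^+ 2 = 1 -> placement t s E -> sphere R (polar t s E sg z).
Proof. by move=> S pl; apply: boost_sphere => //; exact: polar_unit. Qed.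

Lemma polar_det3 t s E sg z : sg ^+ 2 = 1 -> placement t s E ->
  0 < det3 (polar t s E sg z) ('D_(1, 0) (polar t s E sg) z) ('D_(0, 1) (polar t s E sg) z).
Proof.
move=> S pl; have oT := @openT (R * R)%type; have [p1 p2 p3] := polar_parts sg.
apply: (@boost_det3 R t s E setT (fun z => 2 / 3 * z.1 / capden z) (fun z => sg * (2 / 3) * z.2 / capden z)
  (fun z => sg * (2 - capden z) / capden z)) => //; first by move=> w _; exact: polar_unit.
have n0 : capden z != 0 by rewrite gt_eqF // capden_gt0.
have cf (v : R * R) := is_derive_fst z v; have cs (v : R * R) := is_derive_snd z v.
have Dd v : is_derive z v capden ((2 * z.1 * v.1 + 2 * z.2 * v.2) / 9).
  have H := dD (dC z v 1) (dM (dD (dX2 (cf v)) (dX2 (cs v))) (dC z v (9^-1))).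
  by apply: (is_derive_eq H); rewrite mulr0 addr0 add0r.
have cd : {for z, continuous capden} by apply: (smooth_cont smooth_capden.1).
have DV v := dV cd n0 (Dd v).
have V1 v := derive_val (is_derive := dM (dZ (2 / 3) (cf v)) (DV v)).
have V2 v := derive_val (is_derive := dM (dZ (sg * (2 / 3)) (cs v)) (DV v)).
have V3 v := derive_val (is_derive := dM (dZ sg (dB (dC z v 2) (Dd v))) (DV v)).
rewrite !V1 !V2 !V3 /=; set D := dt _ _ _ _ _ _ _ _ _.
have -> : D = sg ^+ 2 * (4 / 9) / capden z ^+ 2.
  rewrite /D /dt; move: n0; clear; rewrite /capden => n0; field.
  by rewrite gt_eqF // ltr_pwDl ?addr_ge0 // sqr_ge0.
by rewrite S mul1r divr_gt0 ?exprn_gt0 ?capden_gt0 //; lra.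
Qed.

Lemma polar_back t s E sg z : sg ^+ 2 = 1 -> placement t s E -> [/\ back1 t s E (polar t s E sg z) = 2 / 3 * z.1 / capden z,
  back2 t s E (polar t s E sg z) = sg * (2 / 3) * z.2 / capden z & back3 t s E (polar t s E sg z) = sg * (2 - capden z) / capden z].
Proof. by move=> S pl; apply: back_boost => //; exact: polar_unit. Qed.

Lemma polar_inj t s E sg : sg ^+ 2 = 1 -> placement t s E -> injective (polar t s E sg).
Proof.
move=> S pl z w zw; have [a1 a2 a3] := polar_back z S pl; have [b1 b2 b3] := polar_back w S pl.
have sg0 : sg != 0 by rewrite -sqrf_eq0 S oner_eq0.
have nz : capden z != 0 by rewrite gt_eqF // capden_gt0.
have nw : capden w != 0 by rewrite gt_eqF // capden_gt0.
have e v : capden v != 0 -> (2 - capden v) / capden v = 2 / capden v - 1 by move=> nv; rewrite mulrBl divff.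
have ed : capden z = capden w.
  have : sg * ((2 - capden z) / capden z) = sg * ((2 - capden w) / capden w) by rewrite !mulrA -a3 -b3 zw.
  move/(mulfI sg0); rewrite !e // => /(addIr _)/(mulfI _) h.
  by apply: invr_inj; apply: h; rewrite pnatr_eq0.
rewrite -[z]pair_eta -[w]pair_eta; congr (_, _).
  have : 2 / 3 * z.1 / capden z = 2 / 3 * w.1 / capden z by rewrite -a1 zw b1 ed.
  move/(mulIf _) => h; have {h} := h ltac:(by rewrite invr_eq0).
  by move/(mulfI _); apply; rewrite mulf_neq0 ?invr_eq0 ?pnatr_eq0.
have : sg * (2 / 3) * z.2 / capden z = sg * (2 / 3) * w.2 / capden z by rewrite -a2 zw b2 ed.
move/(mulIf _) => h; have {h} := h ltac:(by rewrite invr_eq0).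
by move/(mulfI _); apply; rewrite !mulf_neq0 ?invr_eq0 ?pnatr_eq0.
Qed.

(** On the unit circle [capden] is 10/9, whence the height (2 - 10/9) / (10/9) = 4/5, up to the sign
    [sg]. *)
Lemma polar_height t s E sg z : sg ^+ 2 = 1 -> placement t s E ->
  (disc R z <-> 4 / 5 <= sg * back3 t s E (polar t s E sg z)) /\ (open_disc R z <-> 4 / 5 < sg * back3 t s E (polar t s E sg z)).
Proof.
move=> S pl; have [_ _ ->] := polar_back z S pl; have d0 := capden_gt0 z.
rewrite !mulrA -expr2 S mul1r ler_pdivlMr // ltr_pdivlMr // /capden /disc /open_disc /=.
by move: (z.1 ^+ 2) (z.2 ^+ 2) => a b; split; split; lra.
Qed.

Lemma polar_ex t s E sg P : sg ^+ 2 = 1 -> placement t s E -> sphere R P -> -1 < sg * back3 t s E P -> exists z, polar t s E sg z = P.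
Proof.
move=> S pl SP; have S1 := back_sphere pl SP; have BB := boost_back pl SP.
move: (back1 t s E P) (back2 t s E P) (back3 t s E P) S1 BB => q1 q2 q3 S1 <- q30.
have d0 : 0 < 1 + sg * q3 by lra.
have n0 : 1 + sg * q3 != 0 by rewrite gt_eqF.
have e u : u = sg ^+ 2 * u by rewrite S mul1r.
(* Stereographic projection from the opposite pole, enlarged by 3 so that the parallel at height 4/5
   becomes the unit circle. *)
exists (3 * q1 / (1 + sg * q3), sg * 3 * q2 / (1 + sg * q3)); rewrite /polar /=.
have E1 : capden (3 * q1 / (1 + sg * q3), sg * 3 * q2 / (1 + sg * q3)) = 2 / (1 + sg * q3).
  rewrite /capden /=.
  have -> : (3 * q1 / (1 + sg * q3)) ^+ 2 + (sg * 3 * q2 / (1 + sg * q3)) ^+ 2 = 9 * (q1 ^+ 2 + sg ^+ 2 * q2 ^+ 2) / (1 + sg * q3) ^+ 2 by field.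
  rewrite S mul1r; have -> : q1 ^+ 2 + q2 ^+ 2 = (1 - sg * q3) * (1 + sg * q3).
    have -> : (1 - sg * q3) * (1 + sg * q3) = 1 - sg ^+ 2 * q3 ^+ 2 by ring.
    by rewrite S mul1r -S1; ring.
  by field.
rewrite E1; congr boost.
- by field.
- by rewrite [RHS](e q2); field.
- by rewrite [RHS](e q3); field.
Qed.

(** The factor [sg] on the second coordinate keeps the lower cap positively oriented and makes its
    boundary circle run clockwise. *)
Lemma polar_circle t s E sg x : sg ^+ 2 = 1 -> polar t s E sg (cos (2 * pi * x), sg * sin (2 * pi * x)) = globe t s E (x, sg * (1 / 2)).
Proof.
move=> S; have e u : u = sg ^+ 2 * u by rewrite S mul1r.
rewrite /polar /globe /=.
have -> : capden (cos (2 * pi * x), sg * sin (2 * pi * x)) = 10 / 9.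
  by rewrite /capden /= exprMn S mul1r cos2Dsin2; field.
have q : (sg * (1 / 2)) ^+ 2 = 1 / 4 by rewrite exprMn S; field.
rewrite /lat /hgt q; congr boost.
- by field.
- by rewrite [RHS]e; field.
- by field.
Qed.

End Globe.

(** * From the sphere to the plane and back *)

Section Locus.
Context {R : realType}.
Implicit Types (Gm : planar_trivalent_graph R) (t s : R) (E : 'M[R]_3) (P : 'rV[R]_3).

Lemma fin_posT (I : finType) (Q : I -> R -> Prop) : (forall i, exists2 d : R, 0 < d & Q i d) ->
  (forall i (d d' : R), 0 < d' -> d' <= d -> Q i d -> Q i d') -> exists2 d : R, 0 < d & forall i, Q i d.
Proof.
move=> H mono; have [k kn|k d d' d0 dd Hk i ik|d d0 Hd] := @fin_pos R #|I| (fun k d => forall i : I, enum_rank i = k :> nat -> Q i d).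
- have [d d0 Qd] := H (enum_val (Ordinal kn)); exists d => // i ik.
  by rewrite (_ : i = enum_val (Ordinal kn)) // -(enum_rankK i); congr enum_val; apply: val_inj.
- exact: mono (Hk i ik).
- by exists d => // i; apply: (Hd (enum_rank i)).
Qed.

Lemma arc_on_sphere Gm (e : edge (ptg_graph Gm)) t : 0 <= t <= 1 -> sphere R (ptg_arc e t).
Proof. exact: (arc_sphere (ptg_embedding Gm)). Qed.

Lemma arc_or_end Gm (e : edge (ptg_graph Gm)) t : 0 <= t <= 1 -> 0 < t < 1 \/ exists v : vertex (ptg_graph Gm), ptg_arc e t = ptg_pos v.
Proof.
move=> /andP[]; rewrite le_eqVlt => /orP[/eqP <- _|t0].
  by right; exists (end_of e false); exact: (arc_start (ptg_embedding Gm) e).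
rewrite le_eqVlt => /orP[/eqP ->|t1]; last by left; rewrite t0.
by right; exists (end_of e true); exact: (arc_finish (ptg_embedding Gm) e).
Qed.

Lemma locus_arc Gm (e : edge (ptg_graph Gm)) t : 0 <= t <= 1 -> graph_locus Gm (ptg_arc e t).
Proof. by move=> ti; right; exists e => //; exists t => //; rewrite /= in_itv. Qed.

Lemma locus_pos Gm (v : vertex (ptg_graph Gm)) : graph_locus Gm (ptg_pos v).
Proof. by left; exists v. Qed.

Lemma locusE Gm P : graph_locus Gm P -> (exists v : vertex (ptg_graph Gm), P = ptg_pos v) \/
  exists (e : edge (ptg_graph Gm)) (t : R), 0 < t < 1 /\ P = ptg_arc e t.
Proof.
move=> [[v _ <-]|[e _ [t ti <-]]]; first by left; exists v.
rewrite /= in_itv /= in ti; have [ti'|[v ->]] := arc_or_end e ti; [right|by left; exists v].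
by exists e, t.
Qed.

Lemma locus_sphere Gm P : graph_locus Gm P -> sphere R P.
Proof.
case/locusE => [[v ->]|[e [t [ti ->]]]]; first exact: (pos_sphere (ptg_embedding Gm)).
by apply: arc_on_sphere; case/andP: ti => t0 t1; rewrite !ltW.
Qed.

Lemma arc_Ck Gm (e : edge (ptg_graph Gm)) : exists U : set R, [/\ open U, (forall t, 0 <= t <= 1 -> U t) & forall l : nat, is_Ck l U (ptg_arc e)].
Proof.
have [U [oU AU sm]] := arc_smooth (ptg_embedding Gm) e; exists U; split=> //.
Qed.

Lemma arc_cont Gm (e : edge (ptg_graph Gm)) t : 0 <= t <= 1 -> {for t, continuous (@ptg_arc R Gm e)}.
Proof. by move=> ti; have [U [_ AU sm]] := arc_Ck e; apply: (sm 0%N); exact: AU. Qed.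

Lemma arc_closed Gm (e : edge (ptg_graph Gm)) (a b : R) : 0 <= a -> b <= 1 -> closed (ptg_arc e @` [set t | a <= t <= b]).
Proof.
move=> a0 b1; apply: compact_closed; first exact: norm_hausdorff.
have -> : [set t | a <= t <= b] = `[a, b]%classic by rewrite set_itvcc.
apply: continuous_compact; last exact: segment_compact.
apply: continuous_in_subspaceT => t; rewrite inE /= in_itv /= => /andP[at_ tb].
by apply: arc_cont; rewrite (le_trans a0 at_) (le_trans tb b1).
Qed.

Lemma pos_closed Gm : closed (range (@ptg_pos R Gm)).
Proof.
apply: compact_closed; first exact: norm_hausdorff.
by apply: finite_compact; apply: finite_image; exact: finite_finset.
Qed.

Lemma locus_closed Gm : closed (graph_locus Gm).
Proof.
apply: closedU; first exact: pos_closed.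
apply: closed_bigcup; first exact: finite_finset.
by move=> e _; rewrite set_itvcc; exact: arc_closed.
Qed.

(** The vertices, the other arcs and the remainder of the same arc form a closed set that misses the
    point; its complement is the neighbourhood. *)
Lemma arc_isolated Gm (e : edge (ptg_graph Gm)) t (eta : R) : 0 < t < 1 -> 0 < eta ->
  exists U : set 'rV[R]_3, [/\ open U, U (ptg_arc e t) & forall P, graph_locus Gm P -> U P ->
    exists t', [/\ 0 < t' < 1, `|t' - t| < eta & P = ptg_arc e t']].
Proof.
move=> ti eta0.
pose K := range (@ptg_pos R Gm) `|` (\bigcup_(e' in [set e' | e' <> e]) (ptg_arc e' @` [set t' : R | 0 <= t' <= 1])
  `|` (ptg_arc e @` [set t' : R | 0 <= t' <= t - eta] `|` ptg_arc e @` [set t' : R | t + eta <= t' <= 1])).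
have cK : closed K.
  apply: closedU; first exact: pos_closed.
  apply: closedU; first by apply: closed_bigcup => [|e' _]; [exact: finite_finset|exact: arc_closed].
  apply: closedU; apply: arc_closed => //; clear -ti eta0; lra.
have emb := ptg_embedding Gm.
have avoid (v : vertex (ptg_graph Gm)) : ptg_arc e t <> ptg_pos v by exact: (@arc_avoid _ _ _ _ emb e t v ti).
have sep e' t' : 0 <= t' <= 1 -> ptg_arc e' t' = ptg_arc e t -> e' = e /\ t' = t.
  move=> ti' E1; have [ti''|[v vE]] := arc_or_end e' ti'; first exact: (@arc_disjoint _ _ _ _ emb e' e t' t).
  by case: (avoid v); rewrite -E1.
exists (~` K); split.
- exact: closed_openC.
- move=> [[v _ /esym]|[[e' /= ne [t' ti' /(sep _ _ ti')[]]]|[[t' /= ti' E1]|[t' /= ti' E1]]]] //; first exact: avoid.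
    have [|_] := sep e t' _ E1; first by clear -ti ti' eta0; lra.
    by clear -ti' eta0; lra.
  have [|_] := sep e t' _ E1; first by clear -ti ti' eta0; lra.
  by clear -ti' eta0; lra.
move=> P /locusE[[v ->]|[e' [t' [ti' ->]]]] nK; first by case: nK; left; exists v.
have [ee|ne] := pselect (e' = e); last first.
  by case: nK; right; left; exists e' => //; exists t' => //=; clear -ti'; lra.
subst e'; exists t'; split=> //; rewrite ltNge; apply/negP => h; case: nK; right; right.
have [h1|h1] := lerP t' t; [left|right]; exists t' => //=.
  by move: h; rewrite ler0_norm ?subr_le0 // => h; clear -h h1 ti'; lra.
by move: h; rewrite gtr0_norm ?subr_gt0 // => h; clear -h h1 ti'; lra.
Qed.

Lemma frame_coordE E P i : frame_coord E P i = P 0 0 * E^T 0 i + P 0 1 * E^T 1 i + P 0 2 * E^T 2 i.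
Proof. by rewrite /frame_coord mxE sum3. Qed.

Section Cont.
Context {V : topologicalType}.
Implicit Types (F : V -> 'rV[R]_3) (w : V).

Lemma frame_coord_cont F w E i : {for w, continuous F} -> {for w, continuous (fun w => frame_coord E (F w) i)}.
Proof.
move=> cF; have cj j : {for w, continuous (fun w => F w 0 j)}.
  by apply: (continuous_comp (f := F) (g := fun P : 'rV[R]_3 => P 0 j)) => //; exact: coord_continuous.
have -> : (fun w => frame_coord E (F w) i) = (fun w => F w 0 0 * E^T 0 i + F w 0 1 * E^T 1 i + F w 0 2 * E^T 2 i).
  by apply/funext => u; exact: frame_coordE.
by apply: cvgD; [apply: cvgD|]; apply: cvgM; try exact: cvg_cst; exact: cj.
Qed.

Lemma back_cont F w t s E : placement t s E -> sphere R (F w) -> {for w, continuous F} ->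
  [/\ {for w, continuous (fun w => back1 t s E (F w))}, {for w, continuous (fun w => back2 t s E (F w))} &
      {for w, continuous (fun w => back3 t s E (F w))}].
Proof.
move=> pl SP cF; have cf i := @frame_coord_cont F w E i cF.
have [_ d0] := boost_den (pl_t pl) (sphere_bound (frame_coord_sphere (pl_E pl) SP)).
have cV : {for w, continuous (fun w => (1 - t * frame_coord E (F w) 0)^-1)}.
  apply: (@cvgV _ _ _ _ (fun w => 1 - t * frame_coord E (F w) 0)); first by rewrite gt_eqF.
  by apply: cvgB; [exact: cvg_cst|apply: cvgM; [exact: cvg_cst|exact: cf]].
split; apply: cvgM => //.
- by apply: cvgB; [exact: cf|exact: cvg_cst].
- by apply: cvgM; [exact: cvg_cst|exact: cf].
- by apply: cvgM; [exact: cvg_cst|exact: cf].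
Qed.

Lemma crd_cont F w t s E : placement t s E -> sphere R (F w) -> back1 t s E (F w) < 0 -> {for w, continuous F} ->
  {for w, continuous (fun w => crd1 t s E (F w))} /\ {for w, continuous (fun w => crd2 t s E (F w))}.
Proof.
move=> pl SP neg cF; have [b1 b2 b3] := back_cont pl SP cF; split.
  apply: cvgD; first exact: cvg_cst.
  apply: cvgM; last exact: cvg_cst.
  apply: (continuous_comp (f := fun w => back2 t s E (F w) / back1 t s E (F w)) (g := atan)); last exact: continuous_atan.
  by apply: cvgM => //; apply: (@cvgV _ _ _ _ (fun w => back1 t s E (F w))) => //; rewrite lt_eqF.
apply: cvgM => //; apply: (@cvgV _ _ _ _ (fun w => 1 + Num.sqrt (1 - back3 t s E (F w) ^+ 2))).
  by rewrite gt_eqF // ltr_pwDl // sqrtr_ge0.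
apply: cvgD; first exact: cvg_cst.
apply: (continuous_comp (f := fun w => 1 - back3 t s E (F w) ^+ 2) (g := fun x : R => Num.sqrt x)); last exact: sqrt_continuous.
by apply: cvgB; [exact: cvg_cst|apply: cvgM].
Qed.
End Cont.

(** Once the boost is undone, the graph lies in a small cap opposite to the point it was pushed away
    from. The bound 4/5 keeps it inside the box of the plane and off the polar caps. *)
Definition well_placed Gm t s E := placement t s E /\ forall P, graph_locus Gm P -> back1 t s E P <= - (4 / 5).

(** [globe] is periodic; intersecting with the box keeps a single copy of the graph. *)
Definition plane Gm t s E : set (R * R) := [set z | Bo z /\ graph_locus Gm (globe t s E z)].
Definition crd t s E P : R * R := (crd1 t s E P, crd2 t s E P).

Lemma well_placed_neg Gm t s E P : well_placed Gm t s E -> graph_locus Gm P -> back1 t s E P < 0.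
Proof. by move=> [_ far] /far; clear; lra. Qed.

Lemma crd_well_placed Gm t s E P : well_placed Gm t s E -> graph_locus Gm P ->
  [/\ globe t s E (crd t s E P) = P, plane Gm t s E (crd t s E P), 1 / 4 < (crd t s E P).1 < 3 / 4 & - (1 / 3) <= (crd t s E P).2 <= 1 / 3].
Proof.
move=> sp GP; have [pl far] := sp; have SP := locus_sphere GP.
have [gP _] := globe_crd pl SP (well_placed_neg sp GP).
have r1 := crd_range t s E P; have r2 := crd2_bound pl SP (far _ GP).
split=> //; split; last by rewrite /crd gP.
by rewrite /Bo /=; clear -r1 r2; lra.
Qed.

Lemma plane_crd Gm t s E z : well_placed Gm t s E -> plane Gm t s E z -> crd t s E (globe t s E z) = z.
Proof.
move=> sp [zB Gz]; have [gz _ r1 r2] := crd_well_placed sp Gz; move: zB; rewrite /Bo /= => zB.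
by apply: (globe_inj sp.1 _ _ _ _ gz); clear -zB r1 r2; lra.
Qed.

Lemma globe_cont t s E z : placement t s E -> {for z, continuous (globe t s E)}.
Proof. by move=> pl; exact: (globe_smooth pl 0%N). Qed.

Lemma globe_near t s E z (U : set 'rV[R]_3) : placement t s E -> open U -> U (globe t s E z) ->
  exists2 r : R, 0 < r & forall u v, `|u - z.1| < r -> `|v - z.2| < r -> U (globe t s E (u, v)).
Proof.
move=> pl oU Uz; have := @globe_cont t s E z pl; move/(_ U (open_nbhs_nbhs (conj oU Uz))).
by move/nbhs2P.
Qed.

Lemma plane_free Gm t s E u c : well_placed Gm t s E -> ~ plane Gm t s E (u, c) -> freeat (plane Gm t s E) u c.
Proof.
move=> sp nP; have [B|nB] := pselect (Bo (u, c)).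
  have [|r r0 Hr] := @globe_near t s E (u, c) _ sp.1 (closed_openC (@locus_closed Gm)).
    by move=> /= GP; apply: nP.
  by exists r => // x y xr yr [_ /(Hr x y xr yr)].
(* The drawing is contained in the rectangle [1/4, 3/4] x [-1/3, 1/3], at distance more than 1/100
   from the complement of the box. *)
exists (1 / 100) => // x y xr yr P; have [_ _] := crd_well_placed sp P.2.
rewrite (plane_crd sp P) /= => r1 r2; apply: nB; rewrite /Bo /=.
by move: xr yr; rewrite !ltr_norml => xr yr; clear -xr yr r1 r2; lra.
Qed.

Definition arc1 Gm t s E (e : edge (ptg_graph Gm)) (x : R) : R := crd1 t s E (ptg_arc e x).
Definition arc2 Gm t s E (e : edge (ptg_graph Gm)) (x : R) : R := crd2 t s E (ptg_arc e x).
Definition nodes Gm t s E : seq (R * R) := [seq crd t s E (ptg_pos v) | v <- enum (vertex (ptg_graph Gm))].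

Lemma crd_inj Gm t s E P P' : well_placed Gm t s E -> graph_locus Gm P -> graph_locus Gm P' -> crd t s E P = crd t s E P' -> P = P'.
Proof. by move=> sp GP GP' E0; have [<- _ _ _] := crd_well_placed sp GP; have [<- _ _ _] := crd_well_placed sp GP'; rewrite E0. Qed.

Lemma nodes_uniq Gm t s E : well_placed Gm t s E -> uniq (nodes Gm t s E).
Proof.
move=> sp; rewrite map_inj_uniq ?enum_uniq // => v w /(crd_inj sp (locus_pos v) (locus_pos w)).
exact: (pos_inj (ptg_embedding Gm)).
Qed.

Lemma nodesP Gm t s E z : z \in nodes Gm t s E <-> exists v : vertex (ptg_graph Gm), z = crd t s E (ptg_pos v).
Proof.
split=> [/mapP[v _ ->]|[v ->]]; first by exists v.
by apply: map_f; rewrite mem_enum.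
Qed.

Lemma arc_smooth2 Gm t s E e : well_placed Gm t s E ->
  smooth [set x : R | 0 < x < 1] (@arc1 Gm t s E e) /\ smooth [set x : R | 0 < x < 1] (@arc2 Gm t s E e).
Proof.
move=> sp; have [U [oU AU sm]] := arc_Ck e.
have cl (x : R) : 0 < x < 1 -> 0 <= x <= 1 by move=> /andP[x0 x1]; rewrite !ltW.
apply: (@crd_smooth R R [set x : R | 0 < x < 1] (ptg_arc e) t s E sp.1 (@open_itvoo R 0 1)).
- by move=> l; apply: Ck_sub (sm l) => x /cl /AU.
- by move=> x /cl; exact: arc_on_sphere.
- by move=> x /cl xi; exact: (well_placed_neg sp (locus_arc e xi)).
Qed.

(** The arc is [globe] along its coordinates: if both of these had derivative 0, so would the
    arc. *)
Lemma arc_regular2 Gm t s E e (x : R) : well_placed Gm t s E -> 0 < x < 1 -> 'D_1 (@arc1 Gm t s E e) x != 0 \/ 'D_1 (@arc2 Gm t s E e) x != 0.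
Proof.
move=> sp xi; have [s1 s2] := arc_smooth2 e sp.
have [e1|] := eqVneq ('D_1 (@arc1 Gm t s E e) x) 0; last by left.
right; apply/negP => /eqP e2.
have cl (y : R) : 0 < y < 1 -> 0 <= y <= 1 by move=> /andP[y0 y1]; rewrite !ltW.
have /negP := arc_regular (ptg_embedding Gm) e (cl x xi); apply.
have [U [oU AU sm]] := arc_Ck e; have Ux := AU x (cl x xi).
have dv : derivable (@ptg_arc R Gm e) x 1 by case: (sm 1%N) => _ d _; exact: d.
have D y : 0 < y < 1 -> globe t s E (arc1 t s E e y, arc2 t s E e y) = ptg_arc e y.
  by move=> yi; have [] := crd_well_placed sp (locus_arc e (cl y yi)).
have d1 : is_derive x (1 : R) (arc1 t s E e) 0 by rewrite -e1; apply: derivableP; exact: (smooth_derivable s1).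
have d2 : is_derive x (1 : R) (arc2 t s E e) 0 by rewrite -e2; apply: derivableP; exact: (smooth_derivable s2).
have c1 : {for x, continuous (arc1 t s E e)} by exact: (smooth_cont s1).
have c2 : {for x, continuous (arc2 t s E e)} by exact: (smooth_cont s2).
apply/eqP/rowP => j; rewrite derive_mx // !mxE.
have gj : smooth [set: R * R] (fun z => globe t s E z 0 j).
  by move=> l; apply: Ck_coord; [exact: openT|exact: globe_smooth sp.1 l].
have Dj := @derive_pair_comp _ _ setT (fun z => globe t s E z 0 j) (fun y => (arc1 t s E e y, arc2 t s E e y)) x 1 0 0 (@openT _) Logic.I gj c1 c2 d1 d2.
have z0 (a b : R) : a * 0 + b * 0 = 0 by rewrite !mulr0 addr0.
rewrite -(derive_val (is_derive := is_derive_eq Dj (z0 _ _))).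
by apply: (derive_eq_near (@open_itvoo R 0 1) xi) => y yi; rewrite D.
Qed.

Lemma arc_ends Gm t s E (e : edge (ptg_graph Gm)) (x r : R) : well_placed Gm t s E -> 0 <= x <= 1 -> 0 < r -> exists2 d : R, 0 < d &
  forall y, `|y - x| < d -> `|arc1 t s E e y - (crd t s E (ptg_arc e x)).1| < r /\ `|arc2 t s E e y - (crd t s E (ptg_arc e x)).2| < r.
Proof.
move=> sp xi r0; have GP := locus_arc e xi.
have [/cont1P/(_ r r0)[d1 d10 h1] /cont1P/(_ r r0)[d2 d20 h2]] :=
  crd_cont sp.1 (locus_sphere GP) (well_placed_neg sp GP) (arc_cont (e := e) xi).
have [d d0 [dd1 dd2]] := ex_min d10 d20; exists d => // y yd.
by split; [apply: h1|apply: h2]; exact: lt_le_trans yd _.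
Qed.

Lemma plane_arcs Gm t s E : well_placed Gm t s E -> arcs (@arc1 Gm t s E) (@arc2 Gm t s E) (nodes Gm t s E) (plane Gm t s E).
Proof.
move=> sp; have cl (y : R) : 0 < y < 1 -> 0 <= y <= 1 by move=> /andP[y0 y1]; rewrite !ltW.
have emb := ptg_embedding Gm.
split.
- by move=> z [].
- by move=> u c; exact: plane_free.
- by move=> e; have [] := arc_smooth2 e sp.
- by move=> e; have [] := arc_smooth2 e sp.
- by move=> e x; exact: arc_regular2.
- by move=> e x /cl xi; have [] := crd_well_placed sp (locus_arc e xi).
- move=> z Pz; rewrite -(plane_crd sp Pz); have [[v ->]|[e [x [xi ->]]]] := locusE Pz.2.
    by left; apply/nodesP; exists v.
  by right; exists e, x.
- move=> e e' x y xi yi E1 E2; apply: (@arc_disjoint _ _ _ _ emb e e' x y xi yi).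
  by apply: (crd_inj sp (locus_arc e (cl x xi)) (locus_arc e' (cl y yi))); congr (_, _).
- move=> e x xi; apply/negP => /nodesP[v E0].
  by apply: (@arc_avoid _ _ _ _ emb e x v xi); apply: (crd_inj sp (locus_arc e (cl x xi)) (locus_pos v)).
- move=> e x eta xi eta0; have [U [oU Ux HU]] := arc_isolated e xi eta0.
  have [gx _ _ _] := crd_well_placed sp (locus_arc e (cl x xi)).
  have [|r r0 Hr] := @globe_near t s E (crd t s E (ptg_arc e x)) U sp.1 oU; first by rewrite gx.
  exists r => // u v Puv ur vr; have [y [yi yx E0]] := HU _ Puv.2 (Hr u v ur vr).
  by exists y; have := plane_crd sp Puv; rewrite E0 => -[<- <-].
- move=> e; exists (crd t s E (ptg_arc e 0)).
    by apply/nodesP; exists (end_of e false); rewrite (arc_start emb e).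
  move=> r r0; have [d d0 Hd] := @arc_ends Gm t s E e 0 r sp ltac:(by rewrite lexx ler01) r0.
  by exists d => // y yi y1; apply: Hd; rewrite subr0 gtr0_norm //; case/andP: yi.
- move=> e; exists (crd t s E (ptg_arc e 1)).
    by apply/nodesP; exists (end_of e true); rewrite (arc_finish emb e).
  move=> r r0; have [d d0 Hd] := @arc_ends Gm t s E e 1 r sp ltac:(by rewrite lexx ler01) r0.
  exists d => // y yi y0; apply: Hd; rewrite ltr0_norm; clear -yi; lra.
Qed.

(** Composing the coordinates with [globe] gives back the chart of the sphere. Both [globe] and the
    chart have positive orientation determinants, and [det3_comp] makes the Jacobian their
    quotient. *)
Lemma plane_chart Gm t s E (v : vertex (ptg_graph Gm)) : well_placed Gm t s E -> chartat (plane Gm t s E) (crd t s E (ptg_pos v)).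
Proof.
move=> sp; have [psi [[[U [oU DU sm]] sph det] inj psi0 trip]] := vertex_chart (ptg_embedding Gm) v.
have d00 : open_disc R (0, 0) by rewrite /open_disc /= expr0n addr0.
have cpsi : {for ((0, 0) : R * R), continuous psi} by apply: (sm 0%N); exact: DU.
have neg0 : back1 t s E (psi (0, 0)) < 0 by rewrite psi0; exact: (well_placed_neg sp (locus_pos v)).
have [/cont2P/(_ (- back1 t s E (psi (0, 0)))) cb _ _] := back_cont sp.1 (sph _ d00) cpsi.
have [|r1 r10 H1] := cb; first by rewrite oppr_gt0.
have [r r0 [rr1 rr2]] := @ex_min R r1 (1 / 2) r10 ltac:(lra).
have inD z : box (0, 0) r z -> open_disc R z.
  move=> [/=]; rewrite !subr0 /open_disc /= => h1 h2.
  have q1 : z.1 ^+ 2 < 1 / 4 by rewrite -real_normK ?num_real //; move: h1; move: (normr_ge0 z.1); move: `|z.1| => a; clear -rr2; nra.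
  have q2 : z.2 ^+ 2 < 1 / 4 by rewrite -real_normK ?num_real //; move: h2; move: (normr_ge0 z.2); move: `|z.2| => a; clear -rr2; nra.
  by clear -q1 q2; lra.
have neg z : box (0, 0) r z -> back1 t s E (psi z) < 0.
  move=> [/= h1 h2]; have := H1 z.1 z.2 (lt_le_trans h1 rr1) (lt_le_trans h2 rr1).
  by rewrite pair_eta ltr_norml => /andP[_]; rewrite ltrBlDr addNr.
have oB := @open_box R (0, 0) r.
have smB : forall l : nat, is_Ck l (box (0, 0) r) psi by move=> l; apply: Ck_sub (sm l) => z /inD /DU.
have [s1 s2] := @crd_smooth R _ (box (0, 0) r) psi t s E sp.1 oB smB (fun z zB => sph z (inD z zB)) neg.
have gl z : box (0, 0) r z -> globe t s E (crd t s E (psi z)) = psi z.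
  by move=> zB; have [] := globe_crd sp.1 (sph z (inD z zB)) (neg z zB).
have b0 := @box_center R (0, 0) r r0.
exists (fun z => crd t s E (psi z)), r; split=> //.
- by rewrite psi0.
- have E1 := @det3_comp R (box (0, 0) r) setT (globe t s E) (fun z => crd t s E (psi z)) (0, 0) oB (@openT _) b0 Logic.I
    (fun _ _ => Logic.I) (globe_smooth sp.1) s1 s2.
  have ED w : 'D_w (fun z => globe t s E (crd t s E (psi z))) (0, 0) = 'D_w psi (0, 0).
    by apply: near_eq_derive; near=> z; apply: gl; near: z; exact: open_nbhs_nbhs.
  rewrite !ED gl // in E1.
  have [_ ci] := globe_crd sp.1 (sph _ d00) neg0.
  have p1 := det _ d00; have p2 := @globe_det3 R t s E (crd t s E (psi (0, 0))) sp.1 ci.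
  have g0 := gl _ b0; rewrite g0 in p2; by move: p1; rewrite E1 (pmulr_lgt0 _ p2).
- move=> z zB; rewrite -(trip z (inD z zB)); split=> [[_]|Gz]; first by rewrite gl.
  by have [_ ? _ _] := crd_well_placed sp (Gz : graph_locus Gm (psi z)).
Unshelve. all: by end_near.
Qed.

(** A chart at a vertex contains points off the tripod, such as (1/2, 0); without vertices there are
    no edges, and the graph is empty. *)
Lemma free_point Gm : exists2 q, sphere R q & ~ graph_locus Gm q.
Proof.
have [[v _]|nv] := pselect (exists v : vertex (ptg_graph Gm), True); last first.
  exists (vec 1 0 0); first by apply/sphere_vec; rewrite expr0n expr1n !addr0.
  by move=> /locusE[[v _]|[e _]]; apply: nv; [exists v|exists (end_of e true)].
have [psi [[_ sph _] _ _ trip]] := vertex_chart (ptg_embedding Gm) v.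
have d : open_disc R (1 / 2, 0) by rewrite /open_disc /= expr0n addr0; lra.
exists (psi (1 / 2, 0)); first exact: sph.
move/(trip _ d) => [[/= h _]|[_ /=]]; first by lra.
by rewrite gtr0_norm ?oppr0; lra.
Qed.

(** By compactness the first frame coordinate stays below [1 - d'] on the graph, the free point
    having coordinate 1; a strong enough boost then sends the graph close to -1. *)
Lemma well_placed_exists Gm : exists t s E, well_placed Gm t s E.
Proof.
have [q Sq Gq] := free_point Gm; have [E [EE dE Eq]] := frame Sq.
have lt1 P : graph_locus Gm P -> frame_coord E P 0 < 1.
  move=> GP; have S := frame_coord_sphere EE (locus_sphere GP).
  have /andP[_] := sphere_bound S; rewrite le_eqVlt => /orP[/eqP u1|//]; case: Gq.
  rewrite -Eq (_ : vec 1 0 0 *m E = P) // -[RHS](frame_coord_eta P EE) u1; congr (vec _ _ _ *m E).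
    by move: S; rewrite u1; move: (frame_coord E P 1) (frame_coord E P 2) => a b; clear => S; nra.
  by move: S; rewrite u1; move: (frame_coord E P 1) (frame_coord E P 2) => a b; clear => S; nra.
have [d1 d10 H1] : exists2 d : R, 0 < d & forall v : vertex (ptg_graph Gm), frame_coord E (ptg_pos v) 0 <= 1 - d.
  apply: fin_posT => [v|v d d' d0 dd]; last by move=> h; apply: le_trans h _; lra.
  by exists (1 - frame_coord E (ptg_pos v) 0); [rewrite subr_gt0; apply: lt1; exact: locus_pos|rewrite subKr].
have [d2 d20 H2] : exists2 d : R, 0 < d & forall (e : edge (ptg_graph Gm)) x, 0 <= x <= 1 -> frame_coord E (ptg_arc e x) 0 <= 1 - d.
  apply: fin_posT => [e|v d d' d0 dd]; last by move=> h x xi; apply: le_trans (h x xi) _; lra.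
  have [|c ci cmax] := @EVT_max R (fun x => frame_coord E (ptg_arc e x) 0) 0 1 ler01.
    apply: continuous_in_subspaceT => x; rewrite inE /= in_itv /= => xi.
    by apply: frame_coord_cont; exact: arc_cont.
  rewrite in_itv /= in ci; exists (1 - frame_coord E (ptg_arc e c) 0); first by rewrite subr_gt0; apply: lt1; exact: locus_arc.
  by move=> x xi; rewrite subKr; apply: cmax; rewrite in_itv.
have [d d0 [dd1 dd2]] := ex_min d10 d20.
have [d' d'0 [d'1 d'2]] := @ex_min R d 1 d0 ltr01.
(* For u = 1 - d' this t makes (u - t) / (1 - t u) equal to -8 / (10 - d'), which is at most -4/5;
   smaller u go further. *)
have [t tE] : exists t, t = 1 - d' / 9 by eexists.
have ti : 0 < t < 1 by lra.
have t2 : 0 < 1 - t ^+ 2 by nra.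
have pl : placement t (Num.sqrt (1 - t ^+ 2)) E.
  by split=> //; [rewrite sqrtr_gt0|rewrite sqr_sqrtr ?ltW // addrC subrK].
exists t, (Num.sqrt (1 - t ^+ 2)), E; split=> // P GP.
have b : frame_coord E P 0 <= 1 - d'.
  have [[v ->]|[e [x [xi ->]]]] := locusE GP; first by apply: le_trans (H1 v) _; lra.
  by apply: le_trans (H2 e x _) _; lra.
have /andP[b1 _] := sphere_bound (frame_coord_sphere EE (locus_sphere GP)).
rewrite /back1; move: (frame_coord E P 0) b b1 => u b b1.
have dn : 0 < 1 - t * u by clear -ti b b1 d'0; nra.
by rewrite ler_pdivrMr //; clear -b b1 d'0 d'2 tE; nra.
Qed.

Lemma plane_tame Gm t s E : well_placed Gm t s E -> exists H K F, diffeo H K /\ tame (pull H (plane Gm t s E)) F.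
Proof.
move=> sp; apply: (@drawing_tame R (edge (ptg_graph Gm)) (@arc1 Gm t s E) (@arc2 Gm t s E) (nodes Gm t s E) [::]); rewrite ?cats0 //.
- exact: plane_arcs.
- exact: nodes_uniq.
- by move=> z /nodesP[v ->]; exact: plane_chart.
Qed.

End Locus.

(** * Bands as cylinders in the sphere *)

Section Belts.
Context {R : realType}.
Implicit Types (Gm : planar_trivalent_graph R) (G : set (R * R)) (t s a b x y u : R) (E : 'M[R]_3) (P : pattern R) (H K F : R * R -> R).

Definition frac x : R := x - (Num.floor x)%:~R.

Lemma frac_shift x (n : int) : n%:~R <= x < n%:~R + 1 -> frac x = x - n%:~R.
Proof. by move=> xi; rewrite /frac (@floor_def _ x n) // intrD. Qed.

Lemma frac_itv x : 0 <= frac x < 1.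
Proof. by have := floor_itv x; rewrite intrD /frac; move: (_%:~R) => n; lra. Qed.

Lemma frac_id x : 0 <= x < 1 -> frac x = x.
Proof. by move=> xi; rewrite (@frac_shift x 0) ?subr0 // add0r. Qed.

Lemma frac_add1 x : frac (x + 1) = frac x.
Proof.
have := floor_itv x; rewrite intrD => h.
rewrite (@frac_shift (x + 1) (Num.floor x + 1)) intrD /frac; first by rewrite opprD addrACA subrr addr0.
by move: h; move: (_%:~R) => n; lra.
Qed.

Lemma globe_shift t s E x y (n : int) : globe t s E (x + n%:~R, y) = globe t s E (x, y).
Proof.
have nat_shift x' (k : nat) : globe t s E (x' + k%:R, y) = globe t s E (x', y).
  elim: k x' => [|k IH] x'; first by rewrite addr0.
  have -> : k.+1%:R = k%:R + 1 :> R by rewrite -addn1 natrD.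
  by rewrite addrA globe_period.
case: n => n; first exact: nat_shift.
by rewrite NegzE mulrNz -(nat_shift (x + - n.+1%:~R) n.+1) subrK.
Qed.

Lemma globe_frac t s E x y : globe t s E (frac x, y) = globe t s E (x, y).
Proof. by rewrite /frac -mulrNz globe_shift. Qed.

Lemma layer_lt G P F a b x y u : layer G P F a b -> 0 <= u <= 1 -> x < y -> F (x, u) < F (y, u).
Proof.
move=> ly ui xy; have ui' : - (1 / 4) < u < 5 / 4 by clear -ui; lra.
apply: (@incr_lt R (fun x => F (x, u)) x y _ _ x y) => // z _; last by rewrite -D10E; exact: ly_incr ly _ _ ui.
by rewrite -derivable10E; exact: (smooth_derivable (ly_smooth ly)).
Qed.

Lemma layer_le G P F a b x y u : layer G P F a b -> 0 <= u <= 1 -> x <= y -> F (x, u) <= F (y, u).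
Proof. by move=> ly ui; rewrite le_eqVlt => /orP[/eqP ->//|xy]; apply/ltW; exact: (layer_lt ly). Qed.

Lemma layer_01 G P F a b u : layer G P F a b -> F (0, u) = 0 /\ F (1, u) = 1.
Proof.
move=> ly; have [e e0 He] := ly_id ly; split; apply: He; first by rewrite ltW.
by apply/orP; right; lra.
Qed.

Lemma layer_range G P F a b x u : layer G P F a b -> 0 <= u <= 1 -> 0 <= x < 1 -> 0 <= F (x, u) < 1.
Proof.
move=> ly ui /andP[x0 x1]; have [F0 F1] := layer_01 u ly.
by rewrite -[X in X <= F _]F0 -[X in _ < X]F1 (layer_lt ly) ?(layer_le ly).
Qed.

Lemma layer_onto G P F a b c u : layer G P F a b -> 0 <= u <= 1 -> 0 <= c < 1 -> exists2 x, 0 <= x < 1 & F (x, u) = c.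
Proof.
move=> ly ui ci; have [F0 F1] := layer_01 u ly; have ui' : - (1 / 4) < u < 5 / 4 by clear -ui; lra.
have [|||x xi xc] := @IVT_incr R (fun x => F (x, u)) 0 1 c => //.
- move=> z _; have cF : {for (z, u), continuous F} by exact: (smooth_cont (ly_smooth ly)).
  apply/cont1P => e e0; have [d d0 Hd] := (cont2P _ _).1 cF e e0.
  by exists d => // y yd; apply: Hd => //=; rewrite subrr normr0.
- by rewrite F0 F1; clear -ci; lra.
exists x => //; move: xi => /andP[x0 x1]; rewrite x0 /= lt_neqAle x1 andbT; apply/eqP => x1E.
by move: ci; rewrite -xc x1E F1; lra.
Qed.

Lemma diffeo_Bo (H K : R * R -> R * R) z : diffeo H K -> Bo (H z) <-> Bo z.
Proof.
move=> D; have off := df_off D; have HI := can_inj (df_HK D).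
split=> B; apply: contrapT => nB; first by rewrite off in B.
by have E1 := HI _ _ (off _ nB); apply: nB; rewrite E1.
Qed.

(** A fundamental domain of the zone between the two polar caps. *)
Definition strip : set (R * R) := [set z | 0 <= z.1 < 1 /\ - (1 / 2) <= z.2 <= 1 / 2].

Lemma Bo_strip z : Bo z -> strip z /\ - (1 / 2) < z.2 < 1 / 2.
Proof. by rewrite /Bo /strip /=; lra. Qed.

Lemma diffeo_strip (H K : R * R -> R * R) z : diffeo H K -> strip z -> strip (H z).
Proof.
move=> D S; have [B|nB] := pselect (Bo z); last by rewrite (df_off D).
by case: (Bo_strip ((diffeo_Bo z D).2 B)).
Qed.

Lemma diffeo_half_open (H K : R * R -> R * R) z : diffeo H K -> - (1 / 2) < z.2 <= 1 / 2 -> - (1 / 2) < (H z).2 <= 1 / 2.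
Proof.
move=> D S; have [B|nB] := pselect (Bo z); last by rewrite (df_off D).
by case: (Bo_strip ((diffeo_Bo z D).2 B)) => _ /andP[-> /ltW ->].
Qed.

(** The map of a layer is the identity rather than periodic beyond [0, 1], hence the fractional
    part. *)
Definition belt t s E (H : R * R -> R * R) F a b (z : R * R) : 'rV[R]_3 := globe t s E (H (F (frac z.1, z.2), a + (b - a) * z.2)).

(** The fractional part jumps at integers, but near them both the layer and [H] are the identity and
    [globe] is periodic; elsewhere it is locally a translation. *)
Lemma belt_local t s E (H K : R * R -> R * R) G P F a b (z : R * R) : diffeo H K -> layer G P F a b -> - (1 / 4) < z.2 < 5 / 4 ->
  exists (W : set (R * R)) (L : R * R -> R * R), [/\ open W, W z, forall w, W w -> belt t s E H F a b w = globe t s E (L w),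
    smooth W (fun w => (L w).1) /\ smooth W (fun w => (L w).2) &
    0 <= z.2 <= 1 -> 0 < jac L z /\ -1 < (L z).2 < 1].
Proof.
case: z => x u /= D ly ui; have [e e0 He] := ly_id ly; have [la lab lb] := ly_level ly.
have lev (c : R) : 0 <= c <= 1 -> - (1 / 2) <= a + (b - a) * c <= 1 / 2.
  by move=> ci; clear -ci la lab lb; apply/andP; split; nra.
have slev (W : set (R * R)) : open W -> smooth W (fun w => a + (b - a) * w.2).
  by move=> oW; apply: smoothD => //; [exact: smooth_cst|apply: smoothM => //; [exact: smooth_cst|exact: smooth_snd]].
have Dlev (v w : R * R) : 'D_v (fun w : R * R => a + (b - a) * w.2) w = (b - a) * v.2.
  by rewrite (derive_val (is_derive := dD (dC w v a) (dZ (b - a) (is_derive_snd w v)))) add0r.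
have [n nE] : exists n, n = Num.floor x by eexists.
have := floor_itv x; rewrite -nE intrD => /andP[]; rewrite le_eqVlt => /orP[/eqP nx _|nx xn].
  have [d d0 [de d8]] := @ex_min R e (1 / 8) e0 ltac:(lra).
  have oW : open [set w : R * R | `|w.1 - x| < d].
    apply: openR2 => -[x' y'] /= h; exists (d - `|x' - x|); first by rewrite subr_gt0.
    move=> x2 y2 h2 _; rewrite (_ : x2 - x = (x2 - x') + (x' - x)); last by ring.
    by apply: le_lt_trans (ler_normD _ _) _; rewrite -ltrBrDr.
  exists [set w | `|w.1 - x| < d], (fun w => (w.1, a + (b - a) * w.2)); split=> //.
  - by rewrite /= subrr normr0.
  - move=> [x' y'] /= h; have fr : (frac x' <= d) || (1 - d <= frac x').
      have [xx|xx] := lerP x x'.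
        rewrite (@frac_shift x' n) nx; first by rewrite ger0_norm ?subr_ge0 // in h; rewrite ltW.
        by rewrite xx; move: h; rewrite ltr_norml; clear -d8; lra.
      rewrite (@frac_shift x' (n - 1)) intrB nx; last by rewrite ltr_norml in h; clear -h xx d8; lra.
      by rewrite ltr_norml in h; apply/orP; right; clear -h; lra.
    have nB c : ~ Bo (frac x', c) by rewrite /Bo /=; move: fr => /orP[]; clear -d8; lra.
    rewrite /belt /= He; last by move: fr => /orP[f|f]; apply/orP; [left|right]; clear -f de; lra.
    by rewrite (df_off D) // globe_frac.
  - by split; [exact: smooth_fst|exact: slev].
  - move=> ui'; split; last by have := lev u ui'; clear; rewrite /=; lra.
    rewrite /jac /= !Dlev /=.
    by rewrite !(derive_val (is_derive := is_derive_fst _ _)) /= mul1r mul0r subr0 mulr1 subr_gt0.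
pose W := [set w : R * R | n%:~R < w.1 < n%:~R + 1 /\ - (1 / 4) < w.2 < 5 / 4].
have oW : open W.
  apply: openR2 => -[x' y'] /= [/andP[h1 h2] /andP[h3 h4]]; rewrite /= in h1 h2 h3 h4.
  have [d1 d10 [d11 d12]] := @ex_min R (x' - n%:~R) (n%:~R + 1 - x') ltac:(by rewrite subr_gt0) ltac:(by rewrite subr_gt0).
  have [d2 d20 [d21 d22]] := @ex_min R (y' + 1 / 4) (5 / 4 - y') ltac:(clear -h3; lra) ltac:(clear -h4; lra).
  have [d d0 [dd1 dd2]] := ex_min d10 d20.
  exists d => // x2 y2; rewrite !ltr_norml /W /=; move: (n%:~R) h1 h2 d11 d12 => m h1 h2 d11 d12; clear -dd1 dd2 d11 d12 d21 d22; lra.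
have Wz : W (x, u) by rewrite /W /= nx xn.
pose Q (w : R * R) := (F (w.1 - n%:~R, w.2), a + (b - a) * w.2).
have sh1 : smooth W (fun w => w.1 - n%:~R) by apply: smoothB => //; [exact: smooth_fst|exact: smooth_cst].
have Sub w : W w -> [set z : R * R | - (1 / 4) < z.2 < 5 / 4] (w.1 - n%:~R, w.2) by move=> [].
have sQ1 : smooth W (fun w => (Q w).1).
  by apply: (@smooth_pair_comp R _ W _ F (fun w => (w.1 - n%:~R, w.2)) oW (@open_strip R _ _) Sub (ly_smooth ly)) => //; exact: smooth_snd.
have sQ2 : smooth W (fun w => (Q w).2) by exact: slev.
have oT := @openT (R * R)%type.
exists W, (fun w => H (Q w)); split=> //.
- move=> [x' y'] [/= /andP[h1 h2] _]; rewrite /belt /Q /= (@frac_shift x' n) //.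
  by rewrite ltW.
- by split; [apply: (@smooth_pair_comp R _ W setT (fun z => (H z).1) Q) => //; exact: df_1 D|apply: (@smooth_pair_comp R _ W setT (fun z => (H z).2) Q) => //; exact: df_2 D].
- move=> ui'; have fi : 0 <= x - n%:~R < 1 by move: nx xn; move: (n%:~R) => m; clear; lra.
  split.
    rewrite (jac_comp oW oT Wz Logic.I (df_1 D) (df_2 D) sQ1 sQ2); apply: mulr_gt0; first exact: df_jac D _.
    have jQ : jac Q (x, u) = 'D_(1, 0) (fun w : R * R => F (w.1 - n%:~R, w.2)) (x, u) * (b - a).
      have J (p q : R) : p * ((b - a) * 1) - q * ((b - a) * 0) = p * (b - a) by ring.
      by rewrite -(J _ ('D_(0, 1) (fun w : R * R => (Q w).1) (x, u))) /jac !Dlev.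
    rewrite jQ; apply: mulr_gt0; last by rewrite subr_gt0.
    have d1 : is_derive (x, u) ((1, 0) : R * R) (fun w : R * R => w.1 - n%:~R) 1.
      by have := dB (is_derive_fst (x, u) ((1, 0) : R * R)) (dC (x, u) ((1, 0) : R * R) (n%:~R)); rewrite subr0.
    have DD := @derive_pair_comp R _ _ F (fun w : R * R => ((w.1 - n%:~R, w.2) : R * R)) (x, u) ((1, 0) : R * R) 1 0 (@open_strip R _ _) (Sub _ Wz) (ly_smooth ly)
      (smooth_cont sh1 Wz) (smooth_cont (@smooth_snd R W) Wz) d1 (is_derive_snd (x, u) ((1, 0) : R * R)).
    by rewrite (derive_val (is_derive := DD)) mulr1 mulr0 addr0; exact: ly_incr ly _ _ ui'.
  have S : strip (Q (x, u)) by split; [exact: (layer_range ly)|exact: lev].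
  by have [_] := diffeo_strip D S; clear; move: (_.2) => c; lra.
Qed.

Lemma belt_cylinder t s E (H K : R * R -> R * R) G P F a b : placement t s E -> diffeo H K -> layer G P F a b -> cylinder (belt t s E H F a b).
Proof.
move=> pl D ly; have [la lab lb] := ly_level ly; split.
- split.
  + exists [set z : R * R | - (1 / 4) < z.2 < 5 / 4]; split; first exact: open_strip.
      by move=> z /=; lra.
    move=> l; apply: Ck_union => z zi; have [W [L [oW Wz bL [s1 s2] _]]] := @belt_local t s E H K G P F a b z D ly zi; exists W => //.
    apply: (Ck_ext oW (f := fun w => globe t s E (L w))) => [w /bL //|].
    by apply: (@Ck_vec_comp R _ W setT (globe t s E) L) => //; [exact: openT|exact: globe_smooth].
  + by move=> z _; exact: globe_sphere.
  + move=> z zi; have [|W [L [oW Wz bL [s1 s2] /(_ zi)[jL Li]]]] := @belt_local t s E H K G P F a b z D ly; first by clear -zi; move: zi => /=; lra.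
    have ED w : 'D_w (belt t s E H F a b) z = 'D_w (fun w => globe t s E (L w)) z.
      by apply: near_eq_derive; near=> y; apply: bL; near: y; exact: open_nbhs_nbhs.
    rewrite !ED bL // (@det3_comp R W setT (globe t s E) L z oW (@openT _) Wz Logic.I) //; last exact: globe_smooth.
    by rewrite mulr_gt0 // globe_det3.
- by move=> x u; rewrite /belt /= frac_add1.
- move=> [x u] [y v]; rewrite !inE /= => -[xi ui] [yi vi]; rewrite /belt /= !frac_id // => E0.
  have lev (c : R) : 0 <= c <= 1 -> - (1 / 2) <= a + (b - a) * c <= 1 / 2.
    by move=> ci; clear -ci la lab lb; apply/andP; split; nra.
  have S1 : strip (F (x, u), a + (b - a) * u) by split; [exact: (layer_range ly)|exact: lev].
  have S2 : strip (F (y, v), a + (b - a) * v) by split; [exact: (layer_range ly)|exact: lev].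
  have [h1 h2] := diffeo_strip D S1; have [h3 h4] := diffeo_strip D S2.
  have := globe_inj pl h1 ltac:(by clear -h2; lra) h3 ltac:(by clear -h4; lra) E0.
  move/(can_inj (df_HK D)) => -[E1 /addrI/(mulfI _) E2].
  have uv : u = v by apply: E2; rewrite subr_eq0 gt_eqF.
  rewrite uv in E1 *; congr (_, _); case: (ltgtP x y) => // xy.
    by have := layer_lt ly vi xy; rewrite E1 ltxx.
  by have := layer_lt ly vi xy; rewrite E1 ltxx.
Unshelve. all: by end_near.
Qed.

Lemma polar_disc t s E sg : sg ^+ 2 = 1 -> placement t s E -> parametrised_disc (polar t s E sg).
Proof.
move=> S pl; split; last by move=> z w _ _; exact: polar_inj.
split.
- by exists setT; split=> //; [exact: openT|move=> l; exact: polar_smooth].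
- by move=> z _; exact: polar_sphere.
- by move=> z _; exact: polar_det3.
Qed.

Definition stage : Type := pattern R * (R * R -> R) * R * R.
Definition stage0 : stage := (Pattern Strands [::], (fun z => z.1), 0, 0).
Definition st_ptn (q : stage) := q.1.1.1.
Definition st_fun (q : stage) := q.1.1.2.
Definition st_bot (q : stage) := q.1.2.
Definition st_top (q : stage) := q.2.

Lemma reach_stages G (l : seq stage) b g X : reach G l b g X -> let q := nth stage0 l in
  [/\ (l = [::] -> [/\ b = - (1 / 2), forall x, g x = x & X = [::]]) /\ (forall j, (j < size l)%N -> layer G (st_ptn (q j)) (st_fun (q j)) (st_bot (q j)) (st_top (q j))),
      forall j, (j.+1 < size l)%N -> [/\ source (st_ptn (q j)) = target (st_ptn (q j.+1)), st_bot (q j) = st_top (q j.+1) &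
        forall x, st_fun (q j) (x, 0) = st_fun (q j.+1) (x, 1)],
      l <> [::] -> [/\ st_top (q 0%N) = b, forall x, st_fun (q 0%N) (x, 1) = g x & target (st_ptn (q 0%N)) = X] &
      l <> [::] -> [/\ source (st_ptn (q (size l).-1)) = [::], st_bot (q (size l).-1) = - (1 / 2) & forall x, st_fun (q (size l).-1) (x, 0) = x]].
Proof.
elim=> {l b g X} [g gid|l P F a b g g' _ [[IH0 IHly] IHstep IHtop IHbot] ly F0 F1] q.
  by split=> //; split.
split=> //; first by split=> // -[|j] //=; exact: IHly.
- case=> [|j] /= jl; last exact: IHstep.
  have l0 : l <> [::] by case: (l) jl.
  have [tb Fg tg] := IHtop l0; rewrite /q /= /st_ptn /st_bot /st_fun /=; split=> // x.
  by rewrite F0 -Fg.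
- move=> _; case: l @q IH0 IHly IHstep IHtop IHbot => [|p l] q IH0 _ _ _ IHbot /=.
    have [ab gid sg] := IH0 erefl; split=> // x; rewrite -[RHS]gid; exact: F0.
  exact: IHbot.
Qed.

Lemma belt_image t s E (H K : R * R -> R * R) G P F a b (z : R * R) : diffeo H K -> layer G P F a b -> 0 < z.2 <= 1 ->
  exists w : R * R, [/\ strip w, a < w.2 <= b & belt t s E H F a b z = globe t s E (H w)].
Proof.
move=> D ly zi; have [la lab lb] := ly_level ly.
have lev : a < a + (b - a) * z.2 <= b by clear -zi lab; apply/andP; split; nra.
exists (F (frac z.1, z.2), a + (b - a) * z.2); split=> //.
have fi := frac_itv z.1; split=> /=; last by clear -lev la lb; lra.
by apply: (layer_range ly) => //; clear -zi; lra.
Qed.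

Lemma belt_onto t s E (H K : R * R -> R * R) G P F a b (w : R * R) : diffeo H K -> layer G P F a b -> strip w -> a < w.2 <= b ->
  exists2 z : R * R, 0 < z.2 <= 1 & belt t s E H F a b z = globe t s E (H w).
Proof.
move=> D ly [w1 _] wi; have [la lab lb] := ly_level ly; have ba : 0 < b - a by rewrite subr_gt0.
have [c cE] : exists c, c = (w.2 - a) / (b - a) by eexists.
have ci : 0 < c <= 1 by rewrite cE divr_gt0 ?ler_pdivrMr ?mul1r //; clear -wi; lra.
have [|x xi xw] := @layer_onto G P F a b w.1 c ly _ w1; first by clear -ci; lra.
exists (x, c) => //; rewrite /belt /= frac_id // xw cE mulrC divfK ?gt_eqF //.
by rewrite addrC subrK pair_eta.
Qed.

Lemma locus_strip Gm t s E z : well_placed Gm t s E -> strip z -> graph_locus Gm (globe t s E z) -> plane Gm t s E z.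
Proof.
move=> sp [z1 z2] Gz; have [gz pz r1 r2] := crd_well_placed sp Gz.
rewrite -(_ : crd t s E (globe t s E z) = z) //.
by apply: (globe_inj sp.1 _ _ _ _ gz); clear -z1 z2 r1 r2; lra.
Qed.

Lemma belt_locus Gm t s E (H K : R * R -> R * R) P F a b x u : well_placed Gm t s E -> diffeo H K ->
  layer (pull H (plane Gm t s E)) P F a b -> 0 <= x <= 1 -> 0 <= u <= 1 ->
  (graph_locus Gm (belt t s E H F a b (x, u)) <-> pattern_graph P x u).
Proof.
move=> sp D ly xi ui; rewrite -(ly_graph ly xi ui) /pull /=.
have [la lab lb] := ly_level ly; have [F0 F1] := layer_01 u ly.
have lev : - (1 / 2) <= a + (b - a) * u <= 1 / 2 by clear -ui la lab lb; apply/andP; split; nra.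
(* The strip is half-open: at [x = 1] the fractional part is 0, and the drawing meets neither
   side. *)
move: xi => /andP[x0]; rewrite le_eqVlt => /orP[/eqP ->|x1]; last first.
  have S : strip (F (x, u), a + (b - a) * u) by split=> //; apply: (layer_range ly) => //; rewrite x0.
  rewrite /belt /= frac_id ?x0 //; split=> [|[] //].
  exact: (locus_strip sp (diffeo_strip D S)).
have f1 : frac 1 = 0 by rewrite (@frac_shift 1 1) ?subrr //; lra.
have nB c (k : R) : c = 0 \/ c = 1 -> ~ Bo (c, k) by rewrite /Bo /=; lra.
rewrite /belt /= f1 F0 F1 !(df_off D); [|by apply: nB; right|by apply: nB; left].
split=> [/(locus_strip sp)[]|[/nB]].
- by split=> //=; lra.
- by move/nB; case; left.
- by case; right.
Qed.

(** On a cap the height is at least 4/5 in absolute value, on the graph [back1] is at most -4/5, and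
    a unit vector cannot have both. *)
Lemma polar_locus Gm t s E sg z : sg ^+ 2 = 1 -> well_placed Gm t s E -> disc R z -> ~ graph_locus Gm (polar t s E sg z).
Proof.
move=> S sp /(polar_height z S sp.1).1 h G; have far := sp.2 _ G.
have := back_sphere sp.1 (locus_sphere G); move: h far.
move: (back1 _ _ _ _) (back2 _ _ _ _) (back3 _ _ _ _) => q1 q2 q3 h far S1.
have : (sg * q3) ^+ 2 = q3 ^+ 2 by rewrite exprMn S mul1r.
by move: h; move: (sg * q3) => w h w2; clear -S1 far h w2; nra.
Qed.

(** Bands, open below and closed above, are told apart by the level before [H] is applied; caps are
    told apart from them by the height afterwards, [H] preserving the strip. *)
Lemma composite_of_reach Gm t s E (H K : R * R -> R * R) (l : seq stage) : well_placed Gm t s E -> diffeo H K -> l <> [::] ->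
  reach (pull H (plane Gm t s E)) l (1 / 2) (fun x => x) [::] -> is_composite (map st_ptn l) (graph_locus Gm).
Proof.
move=> sp D l0 /reach_stages[[_ ly] step /(_ l0)[top0 Ftop tgt] /(_ l0)[src bot0 Fbot]].
have pl := sp.1; have m0 : (0 < size l)%N by case: (l) l0.
have lastm : ((size l).-1 < size l)%N by rewrite prednK.
pose q := nth stage0 l.
have nthq j : (j < size l)%N -> nth (Pattern Strands [::]) (map st_ptn l) j = st_ptn (q j).
  by move=> jm; rewrite (nth_map stage0).
pose Phi j := belt t s E H (st_fun (q j)) (st_bot (q j)) (st_top (q j)).
have S1 : (1 : R) ^+ 2 = 1 by rewrite expr1n.
have S2 : (-1 : R) ^+ 2 = 1 by rewrite sqrrN expr1n.
have nBh (c : R) : ~ Bo (c, 1 / 2) /\ ~ Bo (c, - (1 / 2)) by rewrite /Bo /=; lra.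
(* The list starts at the top, so larger indices are lower bands. *)
have mono j k : (j < k)%N -> (k < size l)%N -> st_top (q k) <= st_bot (q j).
  elim: k => // k IH; rewrite ltnS leq_eqVlt => /orP[/eqP ->|jk] km.
    by have [_ -> _] := step k km.
  have [_ E1 _] := step k km; rewrite -/(q k) -/(q k.+1) in E1; rewrite -E1.
  by apply: le_trans (IH jk (ltnW km)); have [_ /ltW] := ly_level (ly k (ltnW km)).
have im j z : (j < size l)%N -> 0 < z.2 <= 1 -> exists w : R * R, [/\ strip w, - (1 / 2) < w.2 <= 1 / 2,
    st_bot (q j) < w.2 <= st_top (q j) & Phi j z = globe t s E (H w)].
  move=> jm zi; have [w [Sw wi E1]] := belt_image t s E D (ly j jm) zi.
  by have [la _ lb] := ly_level (ly j jm); exists w; split=> //; clear -wi la lb; lra.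
have hgtH w : strip w -> - (1 / 2) < w.2 <= 1 / 2 -> - (4 / 5) < back3 t s E (globe t s E (H w)) <= 4 / 5.
  move=> Sw wi; have [_ _ ->] := globe_back (H w) pl; have hi := diffeo_half_open D wi.
  have [e1 e2] := @hgt_half R; have h1 : -1 < (H w).2 < 1 by clear -hi; lra.
  have h2 : -1 < (- (1 / 2) : R) < 1 by lra. have h3 : -1 < (1 / 2 : R) < 1 by lra.
  by rewrite -e2 -e1 hgt_lt // leNgt hgt_lt // -leNgt.
have botP (p : 'rV[R]_3) : (polar t s E (-1) @` disc R) p -> back3 t s E p <= - (4 / 5).
  by move=> [z /(polar_height z S2 pl).1 h <-]; move: h; rewrite mulN1r lerNr.
have topP (p : 'rV[R]_3) : (polar t s E 1 @` open_disc R) p -> 4 / 5 < back3 t s E p.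
  by move=> [z /(polar_height z S1 pl).2 h <-]; move: h; rewrite mul1r.
rewrite /is_composite size_map; split=> //.
- by move=> j jm; rewrite nthq //; exact: ly_wf (ly j jm).
- move=> j; rewrite size_map => jm; rewrite !nthq //; last exact: ltnW.
  by have [] := step j jm.
- by rewrite !nthq.
exists Phi, (polar t s E (-1)), (polar t s E 1); split; split.
- by move=> j jm; exact: (belt_cylinder pl D (ly j jm)).
- exact: polar_disc.
- exact: polar_disc.
- move=> j x jm; have [_ E1 E2] := step j jm.
  by rewrite /Phi /belt /= E2 -/(q j) -/(q j.+1) in E1 *; rewrite mulr0 addr0 mulr1 -E1 [_ + (_ - _)]addrC subrK.
- move=> x; have := polar_circle t s E x S2; rewrite !mulN1r => ->.
  by rewrite /Phi /belt /= mulr0 addr0 Fbot bot0 (df_off D) ?globe_frac //; case: (nBh (frac x)).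
- move=> x; have := polar_circle t s E x S1; rewrite (mul1r (sin _)) (mul1r (1 / 2)) => ->.
  rewrite /Phi /belt /= mulr1 [_ + (_ - _)]addrC subrK Ftop top0 (df_off D) ?globe_frac //; by case: (nBh (frac x)).
- move=> p SP; have [h|h] := lerP (back3 t s E p) (- (4 / 5)).
    constructor 1; have [|z zP] := @polar_ex R t s E (-1) p S2 pl SP; first by clear -h; lra.
    by exists z => //; apply/(polar_height z S2 pl).1; rewrite zP; clear -h; lra.
  have [h'|h'] := ltrP (4 / 5) (back3 t s E p).
    constructor 2; have [|z zP] := @polar_ex R t s E 1 p S1 pl SP; first by clear -h'; lra.
    by exists z => //; apply/(polar_height z S1 pl).2; rewrite zP mul1r.
  have [|x [y [xi yi gP hy]]] := globe_ex pl SP; first by clear -h h'; lra.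
  have [e1 e2] := @hgt_half R.
  have yi' : - (1 / 2) < y <= 1 / 2.
    rewrite -hy in h h'; rewrite -(@hgt_lt R) //; last by lra.
    by rewrite e2 h leNgt -hgt_lt ?e1 -?leNgt //; lra.
  have Dk := diffeo_sym D; have Sk : strip (K (x, y)) by apply: (diffeo_strip Dk); split=> //=; clear -yi'; lra.
  have ki := @diffeo_half_open K H (x, y) Dk yi'.
  (* The least index whose bottom is below the point gives the band containing it, since the top of
     a band is the bottom of the preceding index. *)
  have exj : exists j, (j < size l)%N && (st_bot (q j) < (K (x, y)).2).
    by exists (size l).-1; rewrite lastm /= /q bot0; case/andP: ki.
  case: (ex_minnP exj) => j /andP[jm hj] jmin; constructor 3; exists j => //.
  have hj' : (K (x, y)).2 <= st_top (q j).
    case: j jm hj jmin => [|j] jm hj jmin; first by rewrite /q top0; case/andP: ki.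
    have [_ E1 _] := step j jm; rewrite -/(q j) -/(q j.+1) in E1; rewrite -E1 leNgt; apply/negP => c.
    by have := jmin j; rewrite (ltnW jm) c ltnn => /(_ isT).
  have [|z zi zE] := belt_onto t s E D (ly j jm) Sk; first by rewrite hj.
  by exists z => //; rewrite /Phi zE (df_KH D) gP.
- by apply/seteqP; split=> // p [/botP h1 /topP h2] /=; clear -h1 h2; lra.
- move=> j jm; apply/seteqP; split=> // p [bt [z zi zP]].
  have [w [Sw wi _ E1]] := im j z jm zi; have hw := hgtH w Sw wi; rewrite -E1 zP in hw.
  by case: bt => [/botP|/topP] h /=; clear -h hw; lra.
- move=> j k /andP[jk km]; have jm := ltn_trans jk km; apply/seteqP; split=> // p [[z zi zP] [z' zi' zP']] /=.
  have [w [Sw wi wl E1]] := im j z jm zi; have [w' [Sw' wi' wl' E2]] := im k z' km zi'.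
  have [h1 h2] := diffeo_strip D Sw; have [h3 h4] := diffeo_strip D Sw'.
  have ww : H w = H w' by apply: (globe_inj pl) => //; [clear -h2; lra|clear -h4; lra|rewrite -E1 -E2 zP zP'].
  have := mono j k jk km; rewrite (can_inj (df_HK D) ww) in wl; clear -wl wl'; lra.
- by move=> j x u jm xi ui; rewrite nthq //; exact: (belt_locus sp D (ly j jm) xi ui).
- by apply/seteqP; split=> // p [GP [z zd zP]]; apply: (polar_locus S2 sp zd); rewrite zP.
- by apply/seteqP; split=> // p [GP [z zd zP]]; apply: (polar_locus S1 sp zd); rewrite zP.
Qed.

End Belts.

Theorem theorem5p19 (R : realType) (Gamma : planar_trivalent_graph R) :
  exists s : seq (pattern R), is_composite s (graph_locus Gamma).
Proof.
have [t [s [E sp]]] := well_placed_exists Gamma; have [H [K [F [D tm]]]] := plane_tame sp.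
have [l [l0 rl]] := tame_sweep tm.
by exists (map (@st_ptn R) l); exact: composite_of_reach sp D l0 rl.
Qed.
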